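(* Let $\Omega=B_1$, fix $\lambda>0$, let $\{Q_{\rm b}^j\}\subset C^{1,1}(\partial B_1;\mathbb{S}^4)$ be the $\mathbb{S}^1$-equivariant boundary data defined by $Q^j_{\rm b}=Q_{1,\nu_j}$ for a sequence $\nu_j\downarrow0$ (with $Q_{\mu_1,\mu_2}$ as defined in the context), and let $\bar Q^j$ be a sequence of minimizers of $\mathcal{E}_\lambda$ over $\mathcal{A}_{Q_{\rm b}^j}(\Omega)$. Then, for every $j$ large enough, $\bar Q^j$ is not $\mathbb{S}^1$-equivariant (i.e., $\bar Q^j\in\mathcal{A}_{Q_{\rm b}^j}(\Omega)\setminus\mathcal{A}^{\rm sym}_{Q_{\rm b}^j}(\Omega)$). In particular $x\mapsto R\,\bar Q^j(R^tx)\,R^t$ is a minimizer for each $R\in\mathbb{S}^1$, hence nonuniqueness of minimizers occurs.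
   Context: $B_1$ is the open unit ball of $\mathbb{R}^3$. $\mathcal{S}_0$ is the 5-dimensional space of real symmetric traceless $3\times3$ matrices with norm $|Q|^2=\mathrm{tr}(Q^2)$; $\mathbb{S}^4=\{Q\in\mathcal{S}_0:|Q|=1\}$. $\mathbb{S}^1$ is identified with the group of rotations $R$ about the $x_3$-axis; it acts on $\mathcal{S}_0$ by $R\cdot A=RAR^t$, and a map $Q$ is $\mathbb{S}^1$-equivariant if $Q(Rx)=RQ(x)R^t$ for (a.e.) $x$ and all $R\in\mathbb{S}^1$. $\mathcal{A}_{Q_{\rm b}}(\Omega)=\{Q\in W^{1,2}(\Omega;\mathbb{S}^4):Q|_{\partial\Omega}=Q_{\rm b}\}$ and $\mathcal{A}^{\rm sym}_{Q_{\rm b}}(\Omega)$ is its subset of $\mathbb{S}^1$-equivariant maps. For $Q\in\mathbb{S}^4$, $\widetilde\beta(Q)=\sqrt6\,\mathrm{tr}(Q^3)$, $W(Q)=\frac1{3\sqrt6}(1-\widetilde\beta(Q))$, $\mathcal{E}_\lambda(Q)=\int_\Omega\frac12|\nabla Q|^2+\lambda W(Q)\,dx$. Identification $\mathcal{S}_0\simeq\mathbb{R}\oplus\mathbb{C}\oplus\mathbb{C}$: $(t,\zeta_1,\zeta_2)$ corresponds to $t\,\mathbf{e}_0+\mathrm{Re}\zeta_1\,\mathbf{e}^{(1)}_1+\mathrm{Im}\zeta_1\,\mathbf{e}^{(1)}_2+\mathrm{Re}\zeta_2\,\mathbf{e}^{(2)}_1+\mathrm{Im}\zeta_2\,\mathbf{e}^{(2)}_2$,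 where $\mathbf{e}_0=\frac1{\sqrt6}\mathrm{diag}(-1,-1,2)$, $\mathbf{e}^{(1)}_1=\frac1{\sqrt2}(E_{13}+E_{31})$, $\mathbf{e}^{(1)}_2=\frac1{\sqrt2}(E_{23}+E_{32})$, $\mathbf{e}^{(2)}_1=\frac1{\sqrt2}(E_{11}-E_{22})$, $\mathbf{e}^{(2)}_2=\frac1{\sqrt2}(E_{12}+E_{21})$, $E_{kl}$ being the matrix units. For $\mu_1,\mu_2\in\mathbb{C}$, $Q_{\mu_1,\mu_2}:\partial B_1=\mathbb{S}^2\to\mathbb{S}^4$ is the real-analytic $\mathbb{S}^1$-equivariant map given, under this identification and with $x\in\mathbb{S}^2$ corresponding to $[z_0,z_1]\in\mathbb{C}P^1$ via $z_1/z_0=\frac{x_1+ix_2}{1+x_3}$ (the south pole $(0,0,-1)$ corresponding to $[0,1]$), by $$\frac1D\Big(|z_0|^6-|\mu_1|^2|z_0|^4|z_1|^2-|\mu_2|^2|z_0|^2|z_1|^4+\tfrac{|\mu_1|^2|\mu_2|^2}{9}|z_1|^6,\ 2\mu_1\overline{z_0}z_1\big(|z_0|^4-\tfrac{|\mu_2|^2}{3}|z_1|^4\big),\ 2\mu_2\overline{z_0}^2z_1^2\big(|z_0|^2+\tfrac{|\mu_1|^2}{3}|z_1|^2\big)\Big),$$ $D=|z_0|^6+|\mu_1|^2|z_0|^4|z_1|^2+|\mu_2|^2|z_0|^2|z_1|^4+\frac{|\mu_1|^2|\mu_2|^2}{9}|z_1|^6$. *)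

(* Defs.v *)
From HB Require Import structures.
From mathcomp Require Import all_boot all_order all_algebra.
From mathcomp Require Import all_classical all_reals all_analysis.
From mathcomp Require Import complex.
Set Implicit Arguments.
Unset Strict Implicit.
Unset Printing Implicit Defensive.
Import Order.TTheory GRing.Theory Num.Theory.
Import numFieldNormedType.Exports.
Local Open Scope classical_set_scope.
Local Open Scope complex_scope.
Local Open Scope ring_scope.

(* R^3 is an iterated product because the library puts a topology, a Borel
   sigma-algebra and a product measure on products, but no sigma-algebra on
   'cV[R]_3. The library norm of a product is the sup norm, hence [enorm]. *)
Notation R3 R :=
  (measurableTypeR R * measurableTypeR R * measurableTypeR R)%type.

Notation vol R :=
  (@lebesgue_measure R \x @lebesgue_measure R \x @lebesgue_measure R)%E.

Section Space.
Variable R : realType.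
Implicit Types (x y : R3 R) (A : 'M[R]_3) (D : set (R3 R)).
Implicit Types (u g phi : R3 R -> R).

Definition to_col x : 'cV[R]_3 := \col_i [:: x.1.1; x.1.2; x.2]`_i.

Definition of_col (v : 'cV[R]_3) : R3 R := (v 0 0, v 1 0, v 2 0).

Definition act A x : R3 R := of_col (A *m to_col x).

Definition enorm x : R := Num.sqrt (x.1.1 ^+ 2 + x.1.2 ^+ 2 + x.2 ^+ 2).

Definition B1 : set (R3 R) := [set x | enorm x < 1].

Definition basis_vec (i : 'I_3) : R3 R := of_col (delta_mx i 0).

Definition partial (i : 'I_3) u : R3 R -> R := fun x => 'D_(basis_vec i) u x.

(* [foldr partial u s] is the iterated partial derivative of [u] along [s]. *)
Definition smooth u := forall s : seq 'I_3,
  continuous (foldr partial u s) /\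
  forall i x, derivable (foldr partial u s) x (basis_vec i).

Definition test_function D phi := smooth phi /\
  exists K : set (R3 R),
    [/\ compact K, K `<=` D & forall x, ~ K x -> phi x = 0].

Definition L2 D u := measurable_fun D u /\
  (\int[vol R]_(x in D) ((u x) ^+ 2)%:E < +oo)%E.

Definition is_weak_partial D (i : 'I_3) u g := forall phi,
  test_function D phi ->
  \int[vol R]_(x in D) (u x * partial i phi x) =
  - \int[vol R]_(x in D) (g x * phi x).

Definition W12 D u := L2 D u /\
  forall i : 'I_3, exists2 g, L2 D g & is_weak_partial D i u g.

(* A chosen representative; it is unique up to a null set for u in W^{1,2}. *)
Definition weak_partial D (i : 'I_3) u : R3 R -> R :=
  get [set g | L2 D g /\ is_weak_partial D i u g].

(* Integration of nonnegative functions against the surface measure of S^2.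
   In polar coordinates, the integral over B_1 of f(x/|x|) is
   (\int_0^1 r^2 dr) = 1/3 times the integral of f over S^2. *)
Definition sphere_integral (f : R3 R -> R) : \bar R :=
  (3%:E * \int[vol R]_(x in B1) (f ((enorm x)^-1 *: x))%:E)%E.

(* [b] is the trace on S^2 of u in W^{1,2}(B_1): the trace operator is the
   continuous extension to W^{1,2}(B_1) of the restriction map
   C^oo(closure of B_1) -> L^2(S^2). *)
Definition has_trace u (b : R3 R -> R) :=
  exists f : nat -> R3 R -> R,
  [/\ forall n, smooth (f n),
      (\int[vol R]_(x in B1) ((f n x - u x) ^+ 2)%:E)%E
        @[n --> \oo] --> 0%E,
      forall i : 'I_3,
        (\int[vol R]_(x in B1)
           ((partial i (f n) x - weak_partial B1 i u x) ^+ 2)%:E)%E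
        @[n --> \oo] --> 0%E &
      sphere_integral (fun x => (f n x - b x) ^+ 2) @[n --> \oo] --> 0%E].

Definition sqnormQ A : R := \tr (A ^+ 2).

Definition S0 : set 'M[R]_3 := [set A | A^T = A /\ \tr A = 0].

Definition S4 : set 'M[R]_3 := [set A | S0 A /\ sqnormQ A = 1].

Definition betat A : R := Num.sqrt 6 * \tr (A ^+ 3).

Definition W A : R := (3 * Num.sqrt 6)^-1 * (1 - betat A).

Implicit Types (Q : R3 R -> 'M[R]_3) (b : R3 R -> 'M[R]_3).

Definition weak_partialQ (k : 'I_3) Q x : 'M[R]_3 :=
  \matrix_(i, j) weak_partial B1 k (fun y => Q y i j) x.

Definition energy (lambda : R) Q : \bar R :=
  (\int[vol R]_(x in B1)
    (2^-1 * (\sum_k sqnormQ (weak_partialQ k Q x)) + lambda * W (Q x))%:E)%E.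

(* Maps are functions on R^3 of which only the values a.e. in B_1 (and, for the
   boundary datum [b], on S^2) matter. *)
Definition admissible b : set (R3 R -> 'M[R]_3) :=
  [set Q : R3 R -> 'M[R]_3 |
    [/\ forall i j, W12 B1 (fun x => Q x i j),
        {ae vol R, forall x, B1 x -> S4 (Q x)} &
        forall i j, has_trace (fun x => Q x i j) (fun x => b x i j)]].

Definition minimizer (lambda : R) b Q := admissible b Q /\
  forall Q', admissible b Q' -> (energy lambda Q <= energy lambda Q')%E.

Definition rotz (t : R) : 'M[R]_3 := \matrix_(i, j)
  (nth [::] [:: [:: cos t; - sin t; 0];
                [:: sin t; cos t;   0];
                [:: 0;     0;       1]] i)`_j.

Definition S1 : set 'M[R]_3 := range rotz.

Definition equivariant Q := forall A, S1 A ->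
  {ae vol R, forall x, B1 x -> Q (act A x) = A *m Q x *m A^T}.

Definition admissible_sym b : set (R3 R -> 'M[R]_3) :=
  admissible b `&` [set Q | equivariant Q].

Definition e0 : 'M[R]_3 := (Num.sqrt 6)^-1 *:
  (2 *: delta_mx 2 2 - delta_mx 0 0 - delta_mx 1 1).
Definition e11 : 'M[R]_3 := (Num.sqrt 2)^-1 *: (delta_mx 0 2 + delta_mx 2 0).
Definition e12 : 'M[R]_3 := (Num.sqrt 2)^-1 *: (delta_mx 1 2 + delta_mx 2 1).
Definition e21 : 'M[R]_3 := (Num.sqrt 2)^-1 *: (delta_mx 0 0 - delta_mx 1 1).
Definition e22 : 'M[R]_3 := (Num.sqrt 2)^-1 *: (delta_mx 0 1 + delta_mx 1 0).

Definition of_coords (t : R) (z1 z2 : R[i]) : 'M[R]_3 :=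
  t *: e0 + complex.Re z1 *: e11 + complex.Im z1 *: e12
          + complex.Re z2 *: e21 + complex.Im z2 *: e22.

(* Homogeneous coordinates of the point of CP^1 corresponding to x in S^2;
   x_3 = -1 only at the south pole. *)
Definition proj_coords x : R[i] * R[i] :=
  if x.2 == -1 then (0, 1) else ((1 + x.2)%:C, x.1.1 +i* x.1.2).

Definition sqmod (z : R[i]) : R := complex.Re z ^+ 2 + complex.Im z ^+ 2.

(* Invariant under (z0, z1) |-> (c z0, c z1), c != 0, so that the choice of
   representative in [proj_coords] does not matter. *)
Definition Qmu (mu1 mu2 : R[i]) x : 'M[R]_3 :=
  let z0 := (proj_coords x).1 in let z1 := (proj_coords x).2 in
  let a0 := sqmod z0 in let a1 := sqmod z1 in
  let m1 := sqmod mu1 in let m2 := sqmod mu2 in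
  let D := a0 ^+ 3 + m1 * a0 ^+ 2 * a1 + m2 * a0 * a1 ^+ 2
           + m1 * m2 / 9 * a1 ^+ 3 in
  D^-1 *: of_coords
    (a0 ^+ 3 - m1 * a0 ^+ 2 * a1 - m2 * a0 * a1 ^+ 2 + m1 * m2 / 9 * a1 ^+ 3)
    (2 * mu1 * conjc z0 * z1 * (a0 ^+ 2 - m2 / 3 * a1 ^+ 2)%:C)
    (2 * mu2 * conjc z0 ^+ 2 * z1 ^+ 2 * (a0 + m1 / 3 * a1)%:C).

End Space.

(* Main.v *)
(* Write a minimizer as a unit vector field u in R^5 with e_0-coordinate t, put y = |x - c e_3|^2 for an axis
point c in [-1, 1], and suppose that u is equivariant. Summing the second variation over an orthonormal frame
bounds the integral of phi(y)^2 |Du|^2 by that of phi'(y)^2 up to lower order terms. By equivariance, |Du|^2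
without its radial part dominates the derivative of t along the meridian circles {y const}, t^2 being 1 at their
ends on the axis. A logarithmic cut-off phi then leaves a set of y > 0 of positive measure on whose circles the
variation of t is too small for a change of sign. By Q_{1,nu} this sign is - around the south pole and + around
the north pole, on circles which for small nu reach a fixed distance from the poles. Circles that cross carry the
same sign (Fubini), and the circles around all the c in [-1, 1] form a crossing chain from pole to pole:
contradiction. *)
Require Import Defs.
From HB Require Import structures.
From mathcomp Require Import all_boot all_order all_algebra.
From mathcomp Require Import all_classical all_reals all_analysis.
From mathcomp Require Import measurable_realfun complex ring lra.
Set Implicit Arguments.
Unset Strict Implicit.
Unset Printing Implicit Defensive.
Import Order.TTheory GRing.Theory Num.Theory.
Import numFieldNormedType.Exports.
Local Open Scope classical_set_scope.
Local Open Scope ring_scope.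

Local Notation mTR := measurableTypeR.
Local Notation sqrt := Num.sqrt.
Local Notation mfun := (measurable_fun setT).

(** A minimizer is only a W^{1,2} map, so each fact about it is read off from smooth approximations
    that converge almost everywhere with dominated gradients, on the ball and along almost every
    circle. The constants come from a weighted Hardy inequality. In the coordinates slope, y,
    height, the volume element depends on the slope alone; for phi = Phi(y), stability thus compares
    y^(3/2) Phi'^2, the length of the arcs included, with y^(-1/2) Phi^2 times the variation of t.
    The sharp Hardy constant is 1/16, approached by y^(-1/4), and a circle with a change of sign has
    variation at least 2 (at a pole 15/8); the contradiction rests on 66/16 < 13/2. Inside the ball
    Phi'^2 has the coefficient 2 (16 + 1) = 34, at a pole 65 + 1 = 66 with arcs half as long. At a
    pole the cut-off does not vanish on the sphere, so the frame fields are bent to vanish where u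
    equals an extension beta of the datum. The datum is +e_0 at both poles: its sign - near the
    south pole shows only at some distance from it, so nu is chosen after the inner radius of the
    cut-off. *)

Lemma sgn_sqr (R : pzRingType) (s : R) : s = 1 \/ s = - 1 -> s^+2 = 1.
Proof. by case=> ->; rewrite ?sqrrN expr1n. Qed.

(** * Borel sets and measurable functions on R^3 *)

Section Space.
Variable R : realType.
Local Notation mR := (mTR R).
Local Notation leb := (@lebesgue_measure R).

(** The sigma-algebra is the product one, so an open set has to be exhibited as a countable union of
    boxes; those with rational centres and radii are enough. *)
Lemma open_measurable_R3 (U : set (R3 R)) : open U -> measurable U.
Proof.
move=> oU.
pose I := (rat*rat*rat*rat)%type.
pose bx (i : I) : set (R3 R) :=
 (ball (ratr i.1.1.1 : R) (ratr i.2) `*` ball (ratr i.1.1.2 : R) (ratr i.2))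
  `*` ball (ratr i.1.2 : R) (ratr i.2).
have mbx i : measurable (bx i).
 by apply: measurableX; [apply: measurableX|]; rewrite ball_itv; exact: measurable_itv.
have -> : U = \bigcup_(i : I) (if `[< bx i `<=` U >] then bx i else set0).
 apply/seteqP; split=> [[[x y] z] Ux|x [i _]]; last first.
  by case: asboolP=> // sub /sub.
 have /nbhs_ballP[e /= e0 be] : nbhs ((x, y), z) U by exact: open_nbhs_nbhs.
 have e4 : 0 < e/4 by rewrite divr_gt0.
 (* A radius q between e/4 and e/2 and a centre closer than e/4 put the point into the box, and the
    box into the ball because e/4 + q < e. *)
 have [q] : exists q : rat, ratr q \in `]e/4, (e/2)[.
  by apply: rat_in_itvoo; rewrite ltr_pM2l// ltf_pV2// ?posrE// ltr_nat.
 rewrite in_itv/= => /andP[q1 q2].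
 have H (u : R) : exists r : rat, `|ratr r - u| < e/4.
  have [r] : exists q : rat, ratr q \in `]u - e/4, (u + e/4)[.
   by apply: rat_in_itvoo; lra.
  by rewrite in_itv/= => /andP[? ?]; exists r; rewrite ltr_norml; lra.
 have [a Ha] := H x; have [b Hb] := H y; have [c Hc] := H z.
 exists (((a, b), c), q)=> //; case: asboolP=> [_|].
  by rewrite /bx/= /ball/=; split => /=; [split => /=|]; exact: lt_trans q1.
 case; move=> [[x' y'] z'] /= [[/=]]; rewrite /ball/= => H1 H2 H3.
 have tri (p v v' : R) : `|p - v| < e/4 -> `|p - v'| < ratr q -> `|v - v'| < e.
  move=> h1 h2; have -> : v - v' = (p - v') - (p - v) by ring.
  by apply: (le_lt_trans (ler_normB _ _)); lra.
 apply: be; split => /=; [split => /=|]; apply: tri; eauto.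
by apply: countable_bigcupT_measurable=> [|i]; [exact: countableP|case: asboolP].
Qed.

Lemma continuous_measurable_R3 (f : R3 R -> R) :
 continuous f -> mfun f.
Proof.
move=> cf; apply: (measurability _ (measurable_realfun.RGenOpens.measurableE R)) => /=.
move=> _ [_ [a [b ->] <-]]; rewrite setTI; apply: open_measurable_R3.
by move/continuousP: cf; apply; exact: interval_open.
Qed.

Lemma measurable_inv : mfun (@GRing.inv R).
Proof.
rewrite -(setUv [set (0 : R)]); apply/measurable_funU=> //; first exact: measurableC.
split; first exact: measurable_fun_set1.
apply: open_continuous_measurable_fun.
 by apply: closed_openC; exact: accessible_closed_set1 (hausdorff_accessible (@Rhausdorff R)) _.
by move=> x; rewrite inE => /= x0; apply: inv_continuous; exact/eqP.
Qed.

Lemma measurable_sqrt : mfun (@sqrt R).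
Proof. by apply: continuous_measurable_fun; exact: sqrt_continuous. Qed.

End Space.

(** * Restrictions and products of measures *)

Section sigma_finite_product.
Context d1 d2 (T1 : measurableType d1) (T2 : measurableType d2) (R : realType).
Variable m1 : {sigma_finite_measure set T1 -> \bar R}.
Variable m2 : {sigma_finite_measure set T2 -> \bar R}.
Local Open Scope ereal_scope.

Lemma sigma_finite_product : sigma_finite setT (product_measure1 m1 m2).
Proof.
have /sigma_finiteP[F [TF ndF Foo]] := sigma_finiteT m1.
have /sigma_finiteP[G [TG ndG Goo]] := sigma_finiteT m2.
exists (fun n => F n `*` G n).
 rewrite -setXTT TF TG predeqE => -[x y]; split.
  move=> [/= [n _ Fnx] [k _ Gky]]; exists (maxn n k)=> //; split.
  - by move: x Fnx; exact/subsetPset/ndF/leq_maxl.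
  - by move: y Gky; exact/subsetPset/ndG/leq_maxr.
 by move=> [n _ []/= ? ?]; split; exists n.
move=> k; have [? ?] := Foo k; have [? ?] := Goo k.
split; first exact: measurableX.
by rewrite product_measure1E// lte_mul_pinfty// ge0_fin_numE.
Qed.

End sigma_finite_product.

Lemma integral_mrestr d (T : measurableType d) (R : realType)
  (mu : {measure set T -> \bar R}) (E : set T) (mE : measurable E)
  (G : T -> \bar R) : mfun G -> (forall x, (0 <= G x)%E) ->
 (\int[mrestr mu mE]_x G x = \int[mu]_(x in E) G x)%E.
Proof.
move=> mG G0; rewrite -(setUv E) ge0_integral_setU//; last 3 first.
- exact: measurableC.
- by rewrite setUv.
- by rewrite disj_set2E setICr.
rewrite [X in (_ + X)%E]null_set_integral//; last 3 first.
- exact: measurableC.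
- exact: measurable_funTS.
- by transitivity (mu (~` E `&` E))=> //; rewrite setICl measure0.
rewrite adde0; apply: eq_measure_integral => A mA AE.
by rewrite /= /mrestr setIidl.
Qed.

Lemma measurable_restr d (T : measurableType d) (R : realType) (D : set T)
  (f : T -> \bar R) : measurable D -> mfun f ->
 mfun (f \_ D).
Proof.
by move=> mD mf; apply/(measurable_restrictT f mD); exact: measurable_funTS.
Qed.

Section Leb2.
Variable R : realType.
(** A named copy of the product measure, so that it can carry the sigma-finite structure that
    Tonelli's theorem asks for when a further product is formed. *)
Definition leb2 : set (mTR R * mTR R) -> \bar R :=
 product_measure1 (@lebesgue_measure R) (@lebesgue_measure R).
HB.instance Definition _ := Measure.on leb2.
HB.instance Definition _ := Measure_isSigmaFinite.Build _ _ _ leb2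
 (sigma_finite_product (@lebesgue_measure R) (@lebesgue_measure R)).

Definition leb3 : set (R3 R) -> \bar R :=
 product_measure1 leb2 (@lebesgue_measure R).
HB.instance Definition _ := Measure.on leb3.
HB.instance Definition _ := Measure_isSigmaFinite.Build _ _ _ leb3
 (sigma_finite_product leb2 (@lebesgue_measure R)).
End Leb2.
Arguments leb2 R : clear implicits.
Arguments leb3 R : clear implicits.

(** * One-dimensional substitutions and slope coordinates in the plane *)

Section Iterated.
Variable R : realType.
Local Notation leb := (@lebesgue_measure R).
Local Open Scope ereal_scope.
Implicit Types (F : R3 R -> \bar R) (G : mTR R * mTR R -> \bar R).

Lemma leb2_iter G : mfun G -> (forall x, 0 <= G x) ->
 \int[leb2 R]_x G x = \int[leb]_x \int[leb]_y G (x, y).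
Proof. by move=> mG G0; rewrite (fubini_tonelli1 (m1 := leb) (m2 := leb)). Qed.

Lemma leb2_iter2 G : mfun G -> (forall x, 0 <= G x) ->
 \int[leb2 R]_x G x = \int[leb]_y \int[leb]_x G (x, y).
Proof. by move=> mG G0; rewrite (fubini_tonelli2 (m1 := leb) (m2 := leb)). Qed.

Lemma vol_iter_z F : mfun F -> (forall x, 0 <= F x) ->
 \int[vol R]_x F x = \int[leb]_z \int[leb2 R]_x F (x, z).
Proof. by move=> mF F0; rewrite (fubini_tonelli2 (m1 := leb2 R) (m2 := leb)). Qed.

Lemma vol_iter_h F : mfun F -> (forall x, 0 <= F x) ->
 \int[vol R]_x F x = \int[leb2 R]_x \int[leb]_z F (x, z).
Proof. by move=> mF F0; rewrite (fubini_tonelli1 (m1 := leb2 R) (m2 := leb)). Qed.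

(** The pushforward of Lebesgue measure by a shift gives half-open intervals their length, and this
    determines the measure. [leb_scale] argues in the same way. *)
Lemma leb_shift (a : R) (F : mTR R -> \bar R) :
 mfun F -> (forall x, 0 <= F x) ->
 \int[leb]_x F (x + a)%R = \int[leb]_x F x.
Proof.
move=> mF F0; pose f := (fun x : mTR R => (x + a)%R : mTR R).
have mf : mfun f by exact: measurable_funD.
transitivity (\int[pushforward leb f]_x F x).
 by rewrite ge0_integral_pushforward.
apply: eq_measure_integral => A mA _; apply/esym.
apply: (lebesgue_measure_unique (mu := pushforward leb f))=> //.
move=> _ [[p q] _ <-]; transitivity (leb (f @^-1` `]p, q]%classic))=> //.
have -> : f @^-1` `]p, q]%classic = `](p - a)%R, (q - a)%R]%classic.
 apply/seteqP; split=> x /=; rewrite /f !in_itv/= => /andP[? ?]; apply/andP; split; lra.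
rewrite !lebesgue_measure_itv/= !lte_fin.
by case: ltP => h1; case: ltP => h2 //; first (congr (_%:E); ring); exfalso; lra.
Qed.

Lemma leb_scale (k : R) (F : mTR R -> \bar R) : (0 < k)%R ->
 mfun F -> (forall x, 0 <= F x) ->
 \int[leb]_x F x = k%:E * \int[leb]_x F (k*x)%R.
Proof.
move=> k0 mF F0; pose f := (fun x : mTR R => (k*x)%R : mTR R).
have mf : mfun f by exact: measurable_funM.
transitivity (k%:E * \int[pushforward leb f]_x F x); last first.
 by rewrite ge0_integral_pushforward.
have kn : (0 <= k)%R by exact: ltW.
rewrite -(ge0_integral_mscale (pushforward leb f) measurableT (NngNum kn))//.
apply: eq_measure_integral => A mA _.
apply: (lebesgue_measure_unique (mu := mscale (NngNum kn) (pushforward leb f)))=> //.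
move=> _ [[p q] _ <-]; transitivity (k%:E * leb (f @^-1` `]p, q]%classic))=> //.
have -> : f @^-1` `]p, q]%classic = `](p / k)%R, (q / k)%R]%classic.
 apply/seteqP; split=> x /=; rewrite /f !in_itv/= => /andP[];
 by rewrite ?ltr_pdivrMr ?ler_pdivlMr// ?(mulrC x) => ? ?; apply/andP; split.
rewrite !lebesgue_measure_itv/= !lte_fin ltr_pM2r ?invr_gt0//.
case: ltP => h1; last by rewrite mule0.
by rewrite -EFinB -EFinM; congr (_%:E); field; rewrite gt_eqF.
Qed.

Lemma leb_opp (F : mTR R -> \bar R) :
 mfun F -> (forall x, 0 <= F x) ->
 \int[leb]_x F (- x)%R = \int[leb]_x F x.
Proof.
move=> mF F0; pose f := (fun x : mTR R => (- x)%R : mTR R).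
have mf : mfun f by exact: measurableT_comp.
transitivity (\int[pushforward leb f]_x F x).
 by rewrite ge0_integral_pushforward.
by apply: eq_measure_integral => A mA _; exact: lebesgue_measureN.
Qed.

(* [2 x] is the length of the section at [x] of [0 < y < 2 x], so the density
   can be realized by a restriction of the planar measure. *)
Lemma leb_sqr (F : mTR R -> \bar R) :
 mfun F -> (forall x, 0 <= F x) ->
 \int[leb]_(x in `]0%R, +oo[) ((2*x)%:E*F (x^+2)%R) =
 \int[leb]_(x in `]0%R, +oo[) F x.
Proof.
move=> mF F0.
pose E := [set p : mTR R * mTR R | (0 < p.2 < 2 * p.1)%R].
have mE : measurable E.
 have -> : E = [set p | (0 < p.2)%R] `&` [set p | (p.2 < 2 * p.1)%R].
  by apply/seteqP; split => p; rewrite /E/=; [move=> /andP[]|move=> [? ?]; apply/andP].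
 apply: measurableI.
  by rewrite -[X in measurable X]setTI; exact: measurable_fun_ltr.
 rewrite -[X in measurable X]setTI; apply: measurable_fun_ltr=> //.
 by apply: measurable_funM=> //; exact: measurable_fst.
pose f := (fun p : mTR R * mTR R => (p.1^+2)%R : mTR R).
have mf : mfun f by apply: measurable_funX; exact: measurable_fst.
pose mu' := pushforward (mrestr (leb2 R) mE) f.
have mFf : mfun (F \o f) by exact: measurableT_comp.
have secE (G : mTR R -> \bar R) : mfun G ->
  (forall x, 0 <= G x) ->
  \int[mu']_x G x = \int[leb]_(x in `]0%R, +oo[) ((2*x)%:E*G (x^+2)%R).
 move=> mG G0; have mGf : mfun (G \o f) by exact: measurableT_comp.
 rewrite ge0_integral_pushforward// preimage_setT.
 rewrite (integral_mrestr _ mE)//; last by move=> x; exact: G0.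
 rewrite integral_mkcond leb2_iter//; last 2 first.
 - by apply/(measurable_restrictT _ mE); exact: measurable_funTS.
 - by move=> p; rewrite patchE; case: ifP=> // _; exact: G0.
 rewrite [RHS]integral_mkcond; apply: eq_integral => x _.
 rewrite !patchE mem_setE in_itv/= andbT; case: ltP => x0; last first.
  apply: integral0_eq => y _; rewrite patchE ifF//; apply/negbTE/negP.
  by rewrite inE /E/= => /andP[? ?]; lra.
 transitivity (\int[leb]_y (G (x^+2)%R*(\1_(`]0%R, (2*x)%R[%classic) y)%:E)).
  apply: eq_integral => y _; rewrite patchE indicE.
  have -> : ((x, y) \in E) = (0 < y < 2*x)%R by apply/idP/idP; rewrite inE.
  have -> : (y \in `]0%R, (2*x)%R[%classic) = (0 < y < 2*x)%R.
   by apply/idP/idP; rewrite inE/= in_itv.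
  by case: ifP; rewrite ?mule1 ?mule0.
 rewrite ge0_integralZl//; last first.
  by apply/measurable_EFinP; exact: measurable_indic.
 have -> : \int[leb]_y (\1_(`]0%R, (2*x)%R[%classic) y)%:E = (2*x)%:E.
  rewrite integral_indic// setIT; apply: etrans (lebesgue_measure_itv _) _.
  by rewrite /= lte_fin ifT ?sube0//; lra.
 by rewrite muleC.
(* [mu'] charges the positive half-line only. Lebesgue measure on the nonpositive one is added,
   since uniqueness of Lebesgue measure concerns measures on the whole line. *)
have mN : measurable (`]-oo, 0%R]%classic : set (mTR R)) by exact: measurable_itv.
pose mu3 := measure_add mu' (mrestr leb mN).
pose mu'' := mu3 mf.
have lebE A : measurable A -> leb A = mu'' A.
 move=> mA; apply: lebesgue_measure_unique=> //.
 move=> _ [[p q] _ <-].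
 have mpq : measurable (`]p, q]%classic : set (mTR R)) by exact: measurable_itv.
 transitivity (mu' `]p, q]%classic + leb (`]p, q]%classic `&` `]-oo, 0%R]%classic)); last first.
  exact/esym/measure_addE.
 have -> : mu' `]p, q]%classic = \int[leb]_(x in `]sqrt p, sqrt q]) (2*x)%:E.
  transitivity (\int[mu']_x (\1_(`]p, q]%classic) x)%:E).
   by rewrite integral_indic// setIT.
  rewrite secE//; last by apply/measurable_EFinP; exact: measurable_indic.
  rewrite integral_mkcond [RHS]integral_mkcond; apply: eq_integral => x _.
  rewrite !patchE indicE !mem_setE !in_itv/= andbT.
  case: (ltP 0%R x) => x0; last first.
   by rewrite ifF//; apply/negbTE/negP => /andP[h _]; move: (sqrtr_ge0 p); lra.
  have -> : (p < x^+2 <= q)%R = (sqrt p < x <= sqrt q)%R; last first.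
   by case: ifP; rewrite ?mule1 ?mule0.
  apply/idP/idP => /andP[h1 h2]; apply/andP; split.
  - by rewrite -(ger0_norm (ltW x0)) -sqrtr_sqr ltr_sqrt// exprn_gt0.
  - by rewrite -(ger0_norm (ltW x0)) -sqrtr_sqr ler_sqrt// (le_trans _ h2)// sqr_ge0.
  - by move: h1; rewrite -{1}(ger0_norm (ltW x0)) -sqrtr_sqr ltr_sqrt// exprn_gt0.
  - have q0 : (0 <= q)%R.
    by rewrite leNgt; apply/negP => /ltW /ler0_sqrtr q0; move: h2 x0; rewrite q0; lra.
   by rewrite -(sqr_sqrtr q0) ler_pXn2r// nnegrE ?sqrtr_ge0// ltW.
 have sqrtE (a : R) : (sqrt a^+2 = Num.max a 0)%R.
  case: (leP a 0%R) => a0; last by rewrite sqr_sqrtr// ltW.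
  by rewrite ler0_sqrtr// expr0n.
 have [pq|qp] := ltP (sqrt p) (sqrt q); last first.
  rewrite [X in X + _](_ : _ = 0) ?add0e; last first.
   by rewrite set_itv_ge ?integral_set0// -leNgt bnd_simp.
  case: (leP q p) => qp'; first by rewrite set_itv_ge -?leNgt ?bnd_simp// set0I.
  have q0 : (q <= 0)%R.
   by rewrite leNgt; apply/negP => q0; move: qp; rewrite leNgt ltr_sqrt// qp'.
  congr (leb _); apply/seteqP; split => x /=; last by case.
  by rewrite !in_itv/= => /andP[? ?]; split; [apply/andP; split|lra].
 rewrite integral_itv_obnd_cbnd; last first.
  by apply/measurable_EFinP; exact: measurable_funM.
 rewrite (@continuous_FTC2 _ (fun x => 2*x)%R (fun x => x^+2)%R _ _ pq); last 3 first.
 - by apply: continuous_subspaceT => x; apply: cvgM; [exact: cvg_cst|exact: cvg_id].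
 - split; first by move=> x _; exact: exprn_derivable.
   by apply: cvg_at_right_filter; exact: exprn_continuous.
  by apply: cvg_at_left_filter; exact: exprn_continuous.
 - by move=> x _; rewrite exp_derive1 /= expr1.
 have q0 : (0 < q)%R by rewrite -sqrtr_gt0; exact: le_lt_trans pq.
 rewrite !sqrtE (max_idPl (ltW q0)).
 have -> : `]p, q]%classic `&` `]-oo, 0%R]%classic = `]p, 0%R]%classic.
  apply/seteqP; split => x /=; rewrite !in_itv/=; first by move=> [/andP[-> _] ->].
  by move=> /andP[? ?]; split=> //; apply/andP; split=> //; lra.
 rewrite !lebesgue_measure_itv/= !lte_fin.
 move: pq; rewrite ltr_sqrt// => pq; rewrite pq.
 by case: (ltP p 0%R) => p0; rewrite -?EFinB -?EFinD ?adde0; congr (_%:E); ring.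
have mH : measurable (`]0%R, +oo[%classic : set (mTR R)) by exact: measurable_itv.
rewrite [RHS]integral_mkcond.
have mF' : mfun (F \_ `]0%R, +oo[%classic).
 by apply/(measurable_restrictT _ mH); exact: measurable_funTS.
have F'0 x : 0 <= (F \_ `]0%R, +oo[%classic) x by rewrite patchE; case: ifP.
rewrite (eq_measure_integral mu'')=> [|A mA _]; last exact/lebE.
transitivity (\int[mu']_x (F \_ `]0%R, +oo[%classic) x +
 \int[mrestr leb mN]_x (F \_ `]0%R, +oo[%classic) x); last first.
 by apply/esym; apply: ge0_integral_measure_add.
rewrite secE//.
rewrite [X in _ = _ + X](_ : _ = 0) ?adde0.
 apply: eq_integral => x; rewrite inE/= in_itv/= andbT => x0.
 by rewrite patchE mem_setE in_itv/= exprn_gt0.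
rewrite (integral_mrestr _ mN)//; apply: integral0_eq => x /=; rewrite in_itv/= => x0.
by rewrite patchE mem_setE in_itv/= andbT ltNge x0.
Qed.

Lemma leb_half (F : mTR R -> \bar R) :
 mfun F -> (forall x, 0 <= F x) ->
 \int[leb]_x F x =
 \int[leb]_(x in `]0%R, +oo[) F x + \int[leb]_(x in `]0%R, +oo[) F (- x)%R.
Proof.
move=> mF F0; pose P : set (mTR R) := `]0%R, +oo[%classic.
have mP : measurable P by exact: measurable_itv.
pose N : set (mTR R) := `]-oo, 0%R[%classic.
have mN : measurable N by exact: measurable_itv.
have mFN : mfun (fun x : mTR R => F (- x)%R).
 by apply: measurableT_comp=> //; exact: measurableT_comp.
transitivity (\int[leb]_x ((F \_ P) x + (F \_ N) x)).
 apply: ae_eq_integral=> //.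
 - by apply: emeasurable_funD; exact: measurable_restr.
 exists [set 0%R]; split=> //; first exact: lebesgue_measure_set1.
 move=> x /= /not_implyP[_]; apply: contra_notP => x0; rewrite !patchE.
 rewrite [x \in P](_ : _ = (0 < x)%R); last by apply/idP/idP; rewrite inE /P/= in_itv/= andbT.
 rewrite [x \in N](_ : _ = (x < 0)%R); last by apply/idP/idP; rewrite inE /N/= in_itv.
 by case: (ltgtP x 0%R) x0=> //; rewrite ?adde0 ?add0e.
rewrite ge0_integralD//; last 4 first.
- by move=> x _; rewrite patchE; case: ifP.
- exact: measurable_restr.
- by move=> x _; rewrite patchE; case: ifP.
- exact: measurable_restr.
congr (_ + _); first by rewrite [RHS]integral_mkcond.
rewrite [RHS]integral_mkcond -leb_opp; last 2 first.
- exact: measurable_restr.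
- by move=> x; rewrite patchE; case: ifP.
apply: eq_integral => x _; rewrite !patchE.
rewrite [(- x)%R \in N](_ : _ = (0 < x)%R); last by apply/idP/idP; rewrite inE /N/= in_itv/= oppr_lt0.
by rewrite [x \in _](_ : _ = (0 < x)%R)//; apply/idP/idP; rewrite inE /= in_itv/= andbT.
Qed.

(* Polar coordinates with the slope [m] in place of the angle and the squared
   radius [w] in place of the radius. *)
Definition slope_pt (m w : R) : mTR R * mTR R :=
 let r := sqrt (w/(1 + m^+2)) in (r, m*r)%R.

Lemma measurable_slope_pt :
 mfun (fun p : mTR R * mTR R => slope_pt p.1 p.2).
Proof.
have H : mfun (fun p : mTR R * mTR R =>
  sqrt (p.2/(1 + p.1^+2)) : mTR R).
 apply: (measurableT_comp (@measurable_sqrt R)).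
 apply: measurable_funM; first exact: measurable_snd.
 apply: (measurableT_comp (@measurable_inv R)).
 apply: measurable_funD; first exact: measurable_cst.
 by apply: measurable_funX; exact: measurable_fst.
by apply: measurable_fun_pair=> //; apply: measurable_funM=> //; exact: measurable_fst.
Qed.

Lemma measurable_scale_pt :
 mfun (fun p : mTR R * mTR R => (p.1, p.1 * p.2)%R
  : mTR R * mTR R).
Proof.
apply: measurable_fun_pair; first exact: measurable_fst.
by apply: measurable_funM; [exact: measurable_fst|exact: measurable_snd].
Qed.

(** Three substitutions: y = x m, then x^2 in place of x, then x^2 = w / (1 + m^2). The resulting
    density 1 / (2 (1 + m^2)) depends on m alone, which later makes circles of all radii
    comparable. *)
Lemma leb2_slope_half (F : mTR R * mTR R -> \bar R) :
 mfun F -> (forall x, 0 <= F x) ->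
 \int[leb]_(x in `]0%R, +oo[) \int[leb]_y F (x, y) =
 \int[leb]_m \int[leb]_(w in `]0%R, +oo[) ((2*(1 + m^+2))^-1%:E*F (slope_pt m w)).
Proof.
move=> mF F0; pose P : set (mTR R) := `]0%R, +oo[%classic.
have mP : measurable P by exact: measurable_itv.
have PE x : (x \in P) = (0 < x)%R by apply/idP/idP; rewrite inE /P/= in_itv/= andbT.
have mF2 : mfun (fun p : mTR R * mTR R => (p.1%:E*F (p.1, p.1 * p.2)%R)).
 apply: emeasurable_funM; first by apply/measurable_EFinP; exact: measurable_fst.
 apply: measurableT_comp=> //; apply: measurable_fun_pair; first exact: measurable_fst.
 by apply: measurable_funM; [exact: measurable_fst|exact: measurable_snd].
pose G (p : mTR R * mTR R) : \bar R :=
 if p.1 \in P then p.1%:E*F (p.1, p.1 * p.2)%R else 0.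
have mG : mfun G.
 rewrite (_ : G = (fun p => p.1%:E*F (p.1, p.1 * p.2)%R) \_ (fst @^-1` P)).
  apply: measurable_restr=> //.
  by rewrite -[X in measurable X]setTI; exact: measurable_fst.
 by apply/funext => p; rewrite patchE /G; congr (if _ then _ else _); apply/idP/idP; rewrite !inE.
have G0 p : 0 <= G p.
 by rewrite /G; case: ifP=> // p1; apply: mule_ge0=> //; rewrite lee_fin; move: p1; rewrite PE => /ltW.
transitivity (\int[leb]_x \int[leb]_m G (x, m)).
 rewrite integral_mkcond; apply: eq_integral => x _; rewrite patchE /G/=.
 case: ifP => xP; last by rewrite integral0_eq.
 rewrite (leb_scale (k := x))//.
 - rewrite -ge0_integralZl//; first by apply: measurableT_comp=> //; exact: (measurable_fun_pair2 x measurable_scale_pt).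
  by rewrite lee_fin; move: xP; rewrite PE => /ltW.
 - by rewrite -PE.
 - exact: (measurable_fun_pair2 x mF).
rewrite -(leb2_iter mG G0) (leb2_iter2 mG G0); apply: eq_integral => m _.
have m0 : (0 < 1 + m^+2)%R by rewrite ltr_pwDl// sqr_ge0.
have mFm : mfun (fun w : mTR R => F (slope_pt m w)).
 apply: measurableT_comp=> //.
 exact: (measurable_fun_pair2 m measurable_slope_pt).
transitivity (2^-1%:E * \int[leb]_(x in P) ((2*x)%:E*F (x, m*x)%R)).
 rewrite -ge0_integralZl//; last 2 first.
 - apply: measurable_funTS; apply: emeasurable_funM; first by apply/measurable_EFinP; exact: measurable_funM.
  by apply: measurableT_comp=> //; apply: measurable_fun_pair=> //; exact: measurable_funM.
 - by move=> x; rewrite /P/= in_itv/= andbT => x0; rewrite mule_ge0// lee_fin mulr_ge0// ltW.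
 rewrite [RHS]integral_mkcond; apply: eq_integral => x _; rewrite patchE /G/=.
 case: ifP=> // _; rewrite muleA -EFinM mulrA mulVf ?mul1r ?(mulrC m)//.
transitivity (2^-1%:E * \int[leb]_(w in P) F (sqrt w, m*sqrt w)%R).
 congr (_ * _).
 rewrite -(leb_sqr (F := fun w => F (sqrt w, m*sqrt w)%R))//.
  apply: eq_integral => x; rewrite PE => x0.
  by rewrite sqrtr_sqr ger0_norm// ltW.
 apply: measurableT_comp=> //; apply: measurable_fun_pair; first exact: measurable_sqrt.
 by apply: measurable_funM=> //; exact: measurable_sqrt.
rewrite [X in _*X](_ : _ = (1 + m^+2)^-1%:E * \int[leb]_(w in P) F (slope_pt m w)).
 rewrite muleA -EFinM -invfM ge0_integralZl//.
 - exact: measurable_funTS.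
 - by rewrite lee_fin invr_ge0 mulr_ge0// ltW.
rewrite integral_mkcond (leb_scale (k := (1 + m^+2)^-1%R)) ?invr_gt0//.
- congr (_ * _); rewrite [RHS]integral_mkcond; apply: eq_integral => w _.
 by rewrite !patchE !PE pmulr_rgt0 ?invr_gt0// /slope_pt mulrC.
- apply: measurable_restr=> //; apply: measurableT_comp=> //; apply: measurable_fun_pair; first exact: measurable_sqrt.
 by apply: measurable_funM=> //; exact: measurable_sqrt.
- by move=> x; rewrite patchE; case: ifP.
Qed.

End Iterated.

(** * Smooth functions on R^3 and a class closed under differentiation *)

Section Smooth.
Variable R : realType.
Implicit Types (f g : R3 R -> R) (x h : R3 R) (i j : 'I_3).

Lemma basis_vecE i :
 basis_vec R i = (((i == 0)%:R, (i == 1)%:R), (i == 2)%:R) :> R3 R.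
Proof.
by rewrite /basis_vec /of_col !mxE /= !andbT ![_ == i]eq_sym.
Qed.

Definition coord (i : 'I_3) (x : R3 R) : R := [:: x.1.1; x.1.2; x.2]`_i.

Lemma big_I3 (V : nmodType) (F : 'I_3 -> V) : \sum_i F i = F 0 + F 1 + F 2.
Proof.
rewrite !big_ord_recr big_ord0 /= add0r; congr (F _ + F _ + F _); exact: val_inj.
Qed.

Lemma I3_case (P : 'I_3 -> Prop) : P 0 -> P 1 -> P 2 -> forall i, P i.
Proof.
move=> p0 p1 p2 [[|[|[|//]]] ii]; [move: p0|move: p1|move: p2];
 by congr P; exact: val_inj.
Qed.

Lemma coord_continuous i : continuous (coord i).
Proof.
move=> x; move: i; apply: I3_case; rewrite /coord /=.
- by apply: (cvg_comp _ _ (cvg_fst (F := nbhs x.1) (G := nbhs x.2))); exact: cvg_fst.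
- by apply: (cvg_comp _ _ (cvg_fst (F := nbhs x.1) (G := nbhs x.2))); exact: cvg_snd.
- exact: cvg_snd.
Qed.

Definition lin_form (a : 'I_3 -> R) (h : R3 R) : R := \sum_i coord i h*a i.

Lemma lin_form_is_linear a : linear (lin_form a).
Proof.
move=> k u v; rewrite /lin_form scaler_sumr -big_split /=.
apply: eq_bigr => i _; rewrite /GRing.scale/= mulrA -mulrDl; congr (_ * _).
by move: i; apply: I3_case.
Qed.
HB.instance Definition _ a := GRing.isLinear.Build R (R3 R) R *:%R (lin_form a) (lin_form_is_linear a).

Lemma lin_form_continuous a : continuous (lin_form a).
Proof.
move=> x; rewrite /lin_form.
rewrite (_ : (fun h => _) = (fun h => coord 0 h*a 0 + coord 1 h*a 1 + coord 2 h*a 2)); last first.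
 by apply/funext => h; rewrite big_I3.
by apply: cvgD; [apply: cvgD|]; (apply: cvgM; [exact: coord_continuous|exact: cvg_cst]).
Qed.

Lemma norm_R3_lt x (r : R) : (`|x| < r) = [forall i, `|coord i x| < r].
Proof.
rewrite !prod_normE !gt_max; apply/idP/forallP=> [/andP[/andP[h0 h1] h2]|h].
 by apply: I3_case.
by rewrite (h 0) (h 1) (h 2).
Qed.

Lemma coord_le_norm i x : `|coord i x| <= `|x|.
Proof.
by rewrite leNgt; apply/negP; rewrite norm_R3_lt => /forallP/(_ i); rewrite ltxx.
Qed.

Lemma coordD i x h : coord i (x + h) = coord i x + coord i h.
Proof. by move: i; apply: I3_case. Qed.

Lemma coordZ i (k : R) x : coord i (k *: x) = k*coord i x.
Proof. by move: i; apply: I3_case. Qed.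

Lemma R3_eq x h : (forall i, coord i x = coord i h) -> x = h.
Proof.
case: x=> [[a b] c]; case: h=> [[a' b'] c'] E.
by congr ((_, _), _); [exact: (E 0)|exact: (E 1)|exact: (E 2)].
Qed.

Lemma coord_basis i j : coord i (basis_vec R j) = (i == j)%:R.
Proof.
rewrite basis_vecE; move: i; apply: I3_case; rewrite /coord/=; congr (_%:R); by rewrite eq_sym.
Qed.

Lemma is_derive_line f x i (s : R) : derivable f (x + s *: basis_vec R i) (basis_vec R i) ->
 is_derive s (1 : R) (fun t => f (x + t *: basis_vec R i)) (partial i f (x + s *: basis_vec R i)).
Proof.
move=> df; have E : (fun h : R => h^-1 *: ((fun t => f (x + t *: basis_vec R i)) (h *: 1 + s) - f (x + s *: basis_vec R i))) =
 (fun h : R => h^-1 *: ((f \o shift (x + s *: basis_vec R i)) (h *: basis_vec R i) - f (x + s *: basis_vec R i))).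
 apply/funext => h /=; congr (_ *: (f _ - _)).
 by rewrite [h *: 1]mulr1 scalerDl addrCA.
split; first by rewrite /derivable /= E.
by rewrite /derive /= E.
Qed.

Lemma MVT_line f x i (d : R) :
 (forall y, derivable f y (basis_vec R i)) ->
 exists2 s : R, (0 <= s <= 1) &
  f (x + d *: basis_vec R i) - f x = d * partial i f (x + (s*d) *: basis_vec R i).
Proof.
move=> df; pose k (t : R) := f (x + t *: basis_vec R i).
have dk (t : R) : is_derive t (1 : R) k (partial i f (x + t *: basis_vec R i)).
 exact: is_derive_line.
pose g (s : R) : R := k (d*s).
have dg (s : R) : is_derive s (1 : R) g (partial i f (x + (d*s) *: basis_vec R i)*d).
 apply: (is_derive1_comp (f := k) (g := fun s => d*s)).
 by apply: is_derive_eq; rewrite [LHS]mulr1.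
have gc : {within `[0, 1], continuous g}.
 apply: derivable_within_continuous => s _; exact: ex_derive.
have [s sI] := @MVT R g _ 0 1 ltr01 (fun s _ => dg s) gc.
rewrite subr0 mulr1 /g /k mulr1 mulr0 scale0r addr0=> ->.
exists s; last by rewrite mulrC (mulrC d s).
by move: sI; rewrite in_itv/= => /andP[/ltW-> /ltW->].
Qed.

Lemma C1_differentiable f x :
 (forall i y, derivable f y (basis_vec R i)) ->
 (forall i, {for x, continuous (partial i f)}) ->
 differentiable f x /\ 'd f x = lin_form (fun i => partial i f x) :> (R3 R -> R).
Proof.
move=> df cf.
have E : f \o shift x = cst (f x) + lin_form (fun i => partial i f x) +o_ (0 : R3 R) id.
 apply/eqaddoP => e e0.
 have e3 : 0 < e/3 by rewrite divr_gt0.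
 have H i : \forall y \near x, `|partial i f x - partial i f y| < e/3.
  by have /cvgr_dist_lt := cf i; apply.
 have [r r0 Hr] : exists2 r : R, 0 < r & forall y, `|y - x| < r -> forall i, `|partial i f x - partial i f y| < e/3.
  have : nbhs x [set y | forall i, `|partial i f x - partial i f y| < e/3].
   by apply: filterS3 (H 0) (H 1) (H 2) => y h0 h1 h2; exact: I3_case.
  move=> /nbhs_ballP; case=> r /= r0 Hr.
  exists r=> // y yx; apply: Hr.
  by rewrite ball_prod_normE /ball_/= distrC.
 have : \forall h \near (0 : R3 R), `|h| < r by exact: nbhs0_lt.
 apply: filterS => h hr.
 pose y1 := x + h.1.1 *: basis_vec R 0; pose y2 := y1 + h.1.2 *: basis_vec R 1.
 have [s0 s0I E0] := MVT_line x h.1.1 (df 0).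
 have [s1 s1I E1] := MVT_line y1 h.1.2 (df 1).
 have [s2 s2I E2] := MVT_line y2 h.2 (df 2).
 have hx : h + x = y2 + h.2 *: basis_vec R 2.
  apply: R3_eq; apply: I3_case; rewrite !coordD !coordZ !coord_basis /= ?mulr1 ?mulr0 ?addr0; exact: addrC.
 have M (s u : R) : 0 <= s <= 1 -> `|u| < r -> `|s*u| < r.
  move=> /andP[s0' s1'] ur; rewrite normrM ger0_norm// (le_lt_trans _ ur)//.
  by rewrite ler_piMl.
 have := hr; rewrite norm_R3_lt => /forallP hr3.
 have hr0 := hr3 0; have hr1 := hr3 1; have hr2 := hr3 2; rewrite /coord/= in hr0 hr1 hr2.
 have B0 : `|partial 0 f x - partial 0 f (x + (s0*h.1.1) *: basis_vec R 0)| < e/3.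
  apply: Hr; rewrite addrC addKr norm_R3_lt; apply/forallP; apply: I3_case; rewrite coordZ coord_basis /= ?mulr1 ?mulr0 ?normr0 //; exact: M.
 have B1 : `|partial 1 f x - partial 1 f (y1 + (s1*h.1.2) *: basis_vec R 1)| < e/3.
  apply: Hr; rewrite /y1 -!addrA addrC !addrA subrK norm_R3_lt; apply/forallP; apply: I3_case; rewrite ?coordD !coordZ !coord_basis /= ?mulr1 ?mulr0 ?addr0 ?add0r ?normr0 //; exact: M.
 have B2 : `|partial 2 f x - partial 2 f (y2 + (s2*h.2) *: basis_vec R 2)| < e/3.
  apply: Hr; rewrite /y2 /y1 -!addrA addrC !addrA subrK norm_R3_lt; apply/forallP; apply: I3_case; rewrite ?coordD !coordZ !coord_basis /= ?mulr1 ?mulr0 ?addr0 ?add0r ?normr0 //; exact: M.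
 set D0 := partial 0 f (x + _) in E0 B0; set D1 := partial 1 f (y1 + _) in E1 B1; set D2 := partial 2 f (y2 + _) in E2 B2.
 have -> : (f \o shift x - (cst (f x) + lin_form (fun i => partial i f x))) h =
  - (h.1.1*(partial 0 f x - D0) + h.1.2*(partial 1 f x - D1) + h.2*(partial 2 f x - D2)).
  rewrite /= !fctE /= hx /lin_form big_I3 /coord /=.
  have -> : f (y2 + h.2 *: basis_vec R 2) = f x + h.1.1*D0 + h.1.2*D1 + h.2*D2.
   by rewrite -E0 -E1 -E2 -/y1 -/y2; ring.
  have RR (a b0 b1 b2 d0 d1 d2 p q t : R) : a + p*d0 + q*d1 + t*d2 - (a + (p*b0 + q*b1 + t*b2)) =
    - (p*(b0 - d0) + q*(b1 - d1) + t*(b2 - d2)) by ring.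
  exact: RR.
 rewrite normrN.
 have T (u v : R) : `|u| <= `|h| -> `|v| < e/3 -> `|u * v| <= `|h|*(e/3).
  by move=> uh ve; rewrite normrM ler_pM// ltW.
 have -> : e * `|h| = `|h|*(e/3) + `|h|*(e/3) + `|h|*(e/3) by field.
 apply: le_trans (ler_normD _ _) _; apply: lerD; last by apply: T=> //; exact: (coord_le_norm 2).
 apply: le_trans (ler_normD _ _) _; apply: lerD; apply: T=> //.
  exact: (coord_le_norm 0).
 exact: (coord_le_norm 1).
have lc : continuous (lin_form (fun i => partial i f x)) by exact: lin_form_continuous.
have dE := diff_unique lc E.
by split=> //; apply/diff_locallyP; rewrite dE.
Qed.

(* Closed under [partial i]: the constructors list what is needed to express
   the derivatives of the competitors built later. *)
Definition flat (k : nat) (t : R) : R := if 0 < t then expR (- t^-1)*t^-1^+k else 0.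

Inductive gsm : (R3 R -> R) -> Prop :=
| Gsmooth f : smooth f -> gsm f
| Gcst c : gsm (fun=> c)
| Gcoord i : gsm (coord i)
| Gadd f g : gsm f -> gsm g -> gsm (fun x => f x + g x)
| Gmul f g : gsm f -> gsm g -> gsm (fun x => f x*g x)
| Ginv f : gsm f -> (forall x, 0 < f x) -> gsm (fun x => (f x)^-1)
| Gsqrt f : gsm f -> (forall x, 0 < f x) -> gsm (fun x => sqrt (f x))
| Gflat k f : gsm f -> gsm (fun x => flat k (f x))
| Glin A f : gsm f -> gsm (fun x => f (act A x)).

Lemma smooth_partial f i : smooth f -> smooth (partial i f).
Proof.
move=> sf s; have := sf (rcons s i).
by rewrite -cats1 foldr_cat /=.
Qed.

Lemma smooth_continuous f : smooth f -> continuous f.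
Proof. by move=> /(_ [::])[]. Qed.

Lemma smooth_derivable f i x : smooth f -> derivable f x (basis_vec R i).
Proof. by move=> /(_ [::])[_]. Qed.

Lemma smooth_differentiable f x : smooth f ->
 differentiable f x /\ 'd f x = lin_form (fun i => partial i f x) :> (R3 R -> R).
Proof.
move=> sf; apply: C1_differentiable=> [i y|i]; first exact: smooth_derivable.
by apply: smooth_continuous; exact: smooth_partial.
Qed.

(** Smoothness by coinduction: derivatives of members of the class are members again, so every
    iterated derivative inherits continuity and differentiability. *)
Lemma smooth_coind (P : (R3 R -> R) -> Prop) :
 (forall f, P f -> continuous f) ->
 (forall f x, P f -> differentiable f x) ->
 (forall f i, P f -> P (partial i f)) -> forall f, P f -> smooth f.
Proof.
move=> Pc Pd Pp f Pf s; have Ps : P (foldr (@partial R) f s).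
 by elim: s=> //= i s; exact: Pp.
by split=> [|i x]; [exact: Pc|apply: diff_derivable; exact: Pd].
Qed.

Lemma d_lin f x v : differentiable f x ->
 'd f x v = \sum_i coord i v * partial i f x.
Proof.
move=> df; have -> : v = \sum_i coord i v *: basis_vec R i.
 rewrite big_I3 !basis_vecE; case: v=> [[a b] c] /=.
 by congr ((_, _), _); rewrite /coord/= /GRing.scale/= ?mulr1 ?mulr0 ?addr0 ?add0r.
rewrite linear_sum /=; apply: eq_bigr => i _.
rewrite linearZ /= /partial deriveE// [LHS]/GRing.scale/=; congr (_ * _).
by rewrite big_I3 !coordD !coordZ !coord_basis; move: i; apply: I3_case;
 rewrite /= ?mulr1 ?mulr0 ?addr0 ?add0r.
Qed.

Lemma comp1_diff (h : R -> R) f x : differentiable f x -> derivable h (f x) 1 ->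
 differentiable (h \o f) x /\ forall v, 'D_v (h \o f) x = (h^`())%classic (f x) * 'D_v f x.
Proof.
move=> df dh; have dh' : differentiable h (f x) by exact/derivable1_diffP.
have dc : differentiable (h \o f) x by exact: differentiable_comp.
split=> // v; rewrite deriveE// diff_comp//= deriveE// deriv1E// mulrC.
by rewrite [LHS]/GRing.scale/=.
Qed.

Lemma flat_ge0 k (t : R) : 0 <= flat k t.
Proof.
rewrite /flat; case: ifP=> // t0.
by rewrite mulr_ge0 ?expR_ge0// exprn_ge0// invr_ge0 ltW.
Qed.

(** With v = 1/t one has exp v >= (1 + v/(k+1))^(k+1) >= (v/(k+1))^(k+1), which beats v^k by one
    factor v. Applied to k + 1 the bound gives the derivative 0 at the origin. *)
Lemma flat_le k (t : R) : 0 < t -> flat k t <= k.+1%:R^+k.+1*t.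
Proof.
move=> t0; rewrite /flat t0; have k0 : 0 < k.+1%:R :> R by rewrite ltr0n.
have u0 : 0 < t^-1 by rewrite invr_gt0.
have H : (t^-1 / k.+1%:R)^+k.+1 <= expR t^-1.
 have -> : expR t^-1 = expR (t^-1 / k.+1%:R)^+k.+1.
  by rewrite -expRM_natl; congr expR; rewrite mulrC divfK// gt_eqF.
 have d0 : 0 <= t^-1 / k.+1%:R by rewrite divr_ge0// ltW.
 rewrite ler_pXn2r ?nnegrE ?expR_ge0//.
 by apply: le_trans (expR_ge1Dx _); rewrite lerDr.
rewrite expRN ler_pdivrMl ?expR_gt0//.
apply: le_trans (ler_wpM2r _ H); last by rewrite mulr_ge0 ?exprn_ge0 ?ltW.
rewrite expr_div_n mulrA divfK ?gt_eqF ?exprn_gt0//.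
by rewrite exprSr -mulrA mulVf ?mulr1// gt_eqF.
Qed.

(** The functions exp(-1/t) t^(-k) are stable under differentiation up to linear combinations; this
    is why [flat] carries an exponent. *)
Lemma flat_derive k (t : R) :
 is_derive t (1 : R) (flat k) (- k%:R*flat k.+1 t + flat k.+2 t).
Proof.
have [t0|t0|->] := ltgtP t 0.
- have -> : - k%:R*flat k.+1 t + flat k.+2 t = 0.
  by rewrite /flat !ltNge !(ltW t0)/= mulr0 addr0.
 have N : \near t, (fun=> 0 : R) t = flat k t.
  by near=> s; rewrite /flat ltNge (_ : s <= 0)//; apply: ltW; near: s; exact: lt_nbhsl.
 exact: (near_eq_is_derive N (is_derive_cst (0:R) t 1)).
- have N : \near t, expR (- t^-1)*t^-1^+k = flat k t.
  by near=> s; rewrite /flat ifT//; near: s; exact: lt_nbhsr.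
 apply: (near_eq_is_derive N).
 have tn0 : t != 0 by rewrite gt_eqF.
 have dV : is_derive t (1 : R) (fun s : R => s^-1) (- t ^- 2).
  by have := is_deriveV (f := id) (v := 1) tn0 (is_derive_id t 1); rewrite /GRing.scale/= mulr1.
 have dE : is_derive t (1 : R) (fun s : R => expR (- s^-1)) (expR (- t^-1)*t ^- 2).
  have := is_derive1_comp (f := expR) (g := fun s : R => - s^-1) (x := t) (is_derive_expR _) (is_deriveN dV).
  by rewrite opprK.
 have dX : is_derive t (1 : R) (fun s : R => s^-1^+k) (k%:R*t^-1^+k.-1*(- t ^- 2)).
  have := is_deriveX (f := fun s : R => s^-1) k dV.
  by rewrite exprfctE.
 have := is_deriveM dE dX; rewrite mulrfctE /GRing.scale/= => D.
 suff <- : expR (- t^-1)*(k%:R*t^-1^+k.-1 * - t ^- 2) + t^-1^+k*(expR (- t^-1) / t^+2) = - k%:R*flat k.+1 t + flat k.+2 t by exact: D.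
 rewrite /flat t0 -!exprVn; move: (expR _) => E; move: (t^-1) => T; case: k {N D dX}=> [|k] /=.
  by rewrite !mul0r !mulr0 add0r expr0 mul1r oppr0 mul0r add0r.
 by rewrite !exprS expr0; ring.
- have -> : - k%:R*flat k.+1 0 + flat k.+2 0 = 0 :> R by rewrite /flat ltxx mulr0 addr0.
 have H : h^-1 *: (flat k (h *: 1 + 0) - flat k 0) @[h --> (0:R)^'] --> (0 : R).
  have f0 : flat k 0 = 0 :> R by rewrite /flat ltxx.
  pose C : R := k.+2%:R^+k.+2.
  have C0 : 0 < C by rewrite exprn_gt0.
  apply/cvgr0Pnorm_le => e e0; have eC : 0 < e / C by rewrite divr_gt0.
  near=> h.
  have hn0 : h != 0 by near: h; exact: nbhs_dnbhs_neq.
  rewrite f0 subr0 addr0 /GRing.scale/= mulr1.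
  have [h0|h0] := ltP 0 h; last by rewrite /flat ltNge h0/= mulr0 normr0 ltW.
  have -> : h^-1*flat k h = flat k.+1 h by rewrite /flat h0 exprS; ring.
  rewrite ger0_norm ?flat_ge0//; apply: le_trans (flat_le _ h0) _; rewrite -/C.
  rewrite -ler_pdivlMl// mulrC; apply: le_trans (ler_norm _) _.
  near: h; exact: dnbhs0_le.
 split; first by apply/cvg_ex; exists 0; exact: H.
 by rewrite /derive; apply: cvg_lim H.
Unshelve. all: end_near. Qed.

Lemma flat_continuous k : continuous (flat k).
Proof.
move=> t; apply: differentiable_continuous; apply/derivable1_diffP.
by have [] := flat_derive k t.
Qed.

Lemma coord_act i (A : 'M[R]_3) x : coord i (act A x) = \sum_j A i j*coord j x.
Proof.
rewrite !big_I3; move: i; apply: I3_case; rewrite /coord/act/of_col/= !mxE big_I3 !mxE.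
all: by [].
Qed.

Lemma act_differentiable A x : differentiable (@act R A) x /\ forall v, 'd (@act R A) x v = act A v.
Proof.
have H : act A = (fun y => ((lin_form (A 0) y, lin_form (A 1) y), lin_form (A 2) y)).
 apply/funext => y; rewrite [LHS]surjective_pairing [in LHS](surjective_pairing (act A y).1).
 have E i := coord_act i A y.
 by congr ((_, _), _); [have := E 0|have := E 1|have := E 2]; rewrite /coord/==> ->;
  apply: eq_bigr => j _; rewrite mulrC.
have dl a : differentiable (lin_form a) x by apply: linear_differentiable; exact: lin_form_continuous.
have dla a v : 'd (lin_form a) x v = lin_form a v by rewrite diff_lin//; exact: lin_form_continuous.
split; first by rewrite H; apply: differentiable_pair=> //; exact: differentiable_pair.
move=> v; rewrite H diff_pair ?diff_pair//=; last exact: differentiable_pair.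
by congr ((_, _), _); apply: dla.
Qed.

(** One induction for both claims: the rule of differentiation for each constructor presupposes
    differentiability of its arguments and expresses the derivative by constructors again. *)
Lemma gsmP f : gsm f -> (forall x, differentiable f x) /\ forall i, gsm (partial i f).
Proof.
elim=> {f}.
- move=> f sf; split=> [x|i]; first by case: (smooth_differentiable x sf).
 by apply: Gsmooth; exact: smooth_partial.
- move=> c; split=> [x|i]; first exact: differentiable_cst.
 rewrite (_ : partial i _ = fun=> 0); first exact: Gcst.
 by apply/funext => x; exact: derive_cst.
- move=> i; have E : coord i = lin_form (fun j => (i == j)%:R).
  by apply/funext => x; rewrite /lin_form big_I3; move: i; apply: I3_case; rewrite /= ?mulr1 ?mulr0 ?addr0 ?add0r.
 have dc x : differentiable (coord i) x by rewrite E; apply: linear_differentiable; exact: lin_form_continuous.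
 split=> [//|j]; rewrite (_ : partial j _ = fun=> (i == j)%:R); first exact: Gcst.
 apply/funext => x; rewrite /partial deriveE// E diff_lin; last exact: lin_form_continuous.
 exact: (etrans (esym (congr1 (fun F => F (basis_vec R j)) E)) (coord_basis i j)).
- move=> f g _ [df gf] _ [dg gg]; split=> [x|i]; first exact: differentiableD.
 rewrite (_ : partial i _ = fun x => partial i f x + partial i g x); first exact: Gadd.
 by apply/funext => x; apply: deriveD; exact: diff_derivable.
- move=> f g ff [df gf] fg [dg gg]; split=> [x|i]; first exact: differentiableM.
 rewrite (_ : partial i _ = fun x => f x * partial i g x + g x * partial i f x).
  by apply: Gadd; exact: Gmul.
 by apply/funext => x; apply: deriveM; exact: diff_derivable.
- move=> f ff [df gf] f0; split=> [x|i]; first by apply: differentiableV; rewrite // gt_eqF.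
 rewrite (_ : partial i _ = fun x => -1*((f x)^-1*(f x)^-1) * partial i f x).
  by apply: Gmul=> //; apply: Gmul; [exact: Gcst|apply: Gmul; exact: Ginv].
 apply/funext => x; rewrite /partial (deriveV (f := f)) ?gt_eqF//; last exact: diff_derivable.
 by rewrite [LHS]/GRing.scale/= mulN1r -invfM -expr2.
- move=> f ff [df gf] f0.
 have ds (y : R) : 0 < y -> is_derive y (1 : R) sqrt (2*sqrt y)^-1.
  by move=> y0; exact: is_derive1_sqrt.
 have H x : differentiable (sqrt \o f) x /\ forall v, 'D_v (sqrt \o f) x = (sqrt^`())%classic (f x) * 'D_v f x.
  by apply: comp1_diff=> //; have dd := ds _ (f0 x); exact: ex_derive.
 split=> [x|i]; first by case: (H x).
 rewrite (_ : partial i _ = fun x => (2*sqrt (f x))^-1 * partial i f x).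
  apply: Gmul=> //; apply: Ginv; last by move=> x; rewrite mulr_gt0 ?sqrtr_gt0.
  by apply: Gmul; [exact: Gcst|exact: Gsqrt].
 apply/funext => x; have [_ E] := H x; rewrite [LHS]E; congr (_ * _).
 by rewrite derive1E; have := ds _ (f0 x) => dd; rewrite derive_val.
- move=> k f ff [df gf].
 have H x : differentiable (flat k \o f) x /\ forall v, 'D_v (flat k \o f) x = ((flat k)^`())%classic (f x) * 'D_v f x.
  by apply: comp1_diff=> //; have dd := flat_derive k (f x); exact: ex_derive.
 split=> [x|i]; first by case: (H x).
 rewrite (_ : partial i _ = fun x => (- k%:R*flat k.+1 (f x) + flat k.+2 (f x)) * partial i f x).
  apply: Gmul=> //; apply: Gadd; last exact: Gflat.
  by apply: Gmul; [exact: Gcst|exact: Gflat].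
 apply/funext => x; have [_ E] := H x; rewrite [LHS]E; congr (_ * _).
 by rewrite derive1E; have := flat_derive k (f x) => dd; rewrite derive_val.
- move=> A f ff [df gf]; split=> [x|i].
  by apply: differentiable_comp=> //; case: (act_differentiable A x).
 rewrite (_ : partial i _ = fun x => A 0 i * partial 0 f (act A x) + A 1 i * partial 1 f (act A x) + A 2 i * partial 2 f (act A x)).
  by apply: Gadd; [apply: Gadd|]; (apply: Gmul; [exact: Gcst|exact: (Glin A (gf _))]).
 apply/funext => x; have [da dav] := act_differentiable A x.
 rewrite /partial deriveE; last by exact: differentiable_comp.
 rewrite (diff_comp da)//= dav d_lin// big_I3 !coord_act !big_I3 !coord_basis.
 by move: i; apply: I3_case; rewrite /= ?mulr1 ?mulr0 ?addr0 ?add0r.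
Qed.

Lemma gsm_smooth f : gsm f -> smooth f.
Proof.
apply: smooth_coind f=> [f gf x|f x gf|f i gf].
- by apply: differentiable_continuous; case: (gsmP gf).
- by case: (gsmP gf).
- by case: (gsmP gf).
Qed.

Lemma smooth_act A f : smooth f -> smooth (fun x => f (act A x)).
Proof. by move=> sf; apply: gsm_smooth; apply: Glin; exact: Gsmooth. Qed.

End Smooth.

(** * Almost everywhere statements, integrability and dominated convergence on the ball *)

Section BallIntegrals.
Variable R : realType.
Local Notation B := (@B1 R).
Local Notation mu := (vol R).
Implicit Types (f g h : R3 R -> R) (P Q : R3 R -> Prop).

Lemma enorm_continuous : continuous (@enorm R).
Proof.
move=> x; apply: (cvg_comp _ sqrt); last exact: sqrt_continuous.
have c i := @coord_continuous R i x.
have c2 i : (coord i y)^+2 @[y --> x] --> (coord i x)^+2.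
 by apply: (cvg_comp _ (fun t : R => t^+2) (c i)); exact: exprn_continuous.
by apply: cvgD; [apply: cvgD|]; [exact: (c2 0)|exact: (c2 1)|exact: (c2 2)].
Qed.

Lemma enorm_ge0 (x : R3 R) : 0 <= enorm x. Proof. exact: sqrtr_ge0. Qed.

Lemma sqr_enorm (x : R3 R) : enorm x^+2 = x.1.1^+2 + x.1.2^+2 + x.2^+2.
Proof. by rewrite sqr_sqrtr// !addr_ge0// sqr_ge0. Qed.

Lemma open_B1 : open B.
Proof.
rewrite (_ : B = (@enorm R) @^-1` [set y : R | y < 1])//.
by move/continuousP: enorm_continuous; apply; exact: open_lt.
Qed.

Lemma measurable_B1 : measurable B.
Proof. by apply: open_measurable_R3; exact: open_B1. Qed.
Hint Resolve measurable_B1 : core.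

Lemma coord_le_enorm i (x : R3 R) : `|coord i x| <= enorm x.
Proof.
rewrite -(@ler_pXn2r R 2)// ?nnegrE ?enorm_ge0// sqr_enorm.
rewrite (real_normK (num_real _)); move: i; apply: I3_case; rewrite /coord/=; have := sqr_ge0 x.1.1; have := sqr_ge0 x.1.2; have := sqr_ge0 x.2; lra.
Qed.

Definition cl_ball : set (R3 R) := [set x | enorm x <= 1].

Definition box : set (R3 R) := (`[-1, 1]%classic `*` `[-1, 1]%classic) `*` `[-1, 1]%classic.

Lemma compact_cl_ball : compact cl_ball.
Proof.
apply: (@subclosed_compact _ _ box).
- rewrite (_ : cl_ball = (@enorm R) @^-1` [set y : R | y <= 1])//.
 by move/continuous_closedP: enorm_continuous; apply; exact: closed_le.
- by apply: compact_setX; [apply: compact_setX|]; exact: segment_compact.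
- move=> x xB; have H i : `|coord i x| <= 1 by rewrite (le_trans (coord_le_enorm i x)).
 by split; [split|]; rewrite /= in_itv/= -ler_norml; [exact: (H 0)|exact: (H 1)|exact: (H 2)].
Qed.

Lemma B1_cl_ball : B `<=` cl_ball. Proof. by move=> x /ltW. Qed.

Lemma continuous_bounded_cl f : continuous f -> exists2 M, 0 <= M & forall x, cl_ball x -> `|f x| <= M.
Proof.
move=> cf; have /compact_bounded : compact (f @` cl_ball).
 by apply: continuous_compact compact_cl_ball; exact: continuous_subspaceT.
move=> [M [_ HM]]; exists (`|M| + 1); first by rewrite addr_ge0.
move=> x xB; apply: (HM (`|M| + 1)); last by exists x.
by rewrite (le_lt_trans (ler_norm _))// ltrDl.
Qed.

Lemma measurable_box : measurable box.
Proof. by apply: measurableX=> //; exact: measurableX. Qed.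

Lemma vol_box : (mu box < +oo)%E.
Proof.
rewrite /box product_measure1E//; last exact: measurableX.
set A := (X in (X * _)%E).
have -> : A = (@lebesgue_measure R `[(-1)%R, 1%R]%classic * @lebesgue_measure R `[(-1)%R, 1%R]%classic)%E.
 by rewrite -product_measure1E.
have F : (@lebesgue_measure R `[(-1)%R, 1%R]%classic) = 2%:E.
 by rewrite lebesgue_measure_itv/= lte_fin (_ : (-1 < 1 :> R) = true) ?gtrN// -EFinD; congr EFin; ring.
set C := (X in (_*X)%E); have -> : C = 2%:E by exact: F.
by rewrite F -!EFinM ltry.
Qed.

Lemma B1_box : B `<=` box.
Proof.
move=> x xB; have H i : `|coord i x| <= 1 by rewrite (le_trans (coord_le_enorm i x))// ltW.
by split; [split|]; rewrite /= in_itv/= -ler_norml; [exact: (H 0)|exact: (H 1)|exact: (H 2)].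
Qed.

Lemma vol_B1 : (mu B < +oo)%E.
Proof. by apply: le_lt_trans vol_box; apply: le_measure; rewrite ?inE//; [exact: measurable_box|exact: B1_box]. Qed.

Definition aeB P := {ae mu, forall x, B x -> P x}.

Lemma aeB_and P Q : aeB P -> aeB Q -> aeB (fun x => P x /\ Q x).
Proof. by rewrite /aeB; apply: filterS2 => x p q Bx; split; [exact: p|exact: q]. Qed.

Lemma aeB_mono P Q : (forall x, B x -> P x -> Q x) -> aeB P -> aeB Q.
Proof. by move=> H; rewrite /aeB; apply: filterS => x p Bx; apply: H=> //; exact: p. Qed.

Lemma aeB_mono2 P Q P' : (forall x, B x -> P x -> Q x -> P' x) -> aeB P -> aeB Q -> aeB P'.
Proof. by move=> H; rewrite /aeB; apply: filterS2 => x p q Bx; apply: H=> //; [exact: p|exact: q]. Qed.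

Lemma aeB_all P : (forall x, B x -> P x) -> aeB P.
Proof. by move=> H; exact: aeW. Qed.

Lemma aeB_forall (I : finType) (P : I -> R3 R -> Prop) :
 (forall i, aeB (P i)) -> aeB (fun x => forall i, P i x).
Proof.
move=> H; have /ae_foralln : forall n : nat, {ae mu, forall x, forall i, enum_rank i = n :> nat -> B x -> P i x}.
 move=> n; case: (pselect (exists i : I, enum_rank i = n :> nat))=> [[i iE]|Nn].
  move: (H i); rewrite /aeB; apply: filterS => x p j jE; suff -> : j = i by [].
  by apply: enum_rank_inj; apply: val_inj; rewrite /= jE iE.
 by apply: aeW => x i iE; case: Nn; exists i.
by apply: filterS => x p Bx i; exact: (p (enum_rank i)).
Qed.

Definition mB f := measurable_fun B f.
Definition L1B f := mu.-integrable B (EFin \o f).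
Definition IB f : R := \int[mu]_(x in B) f x.

Lemma mB_EFin f : mB f -> measurable_fun B (EFin \o f).
Proof. by move=> mf; exact/measurable_EFinP. Qed.

Lemma L1B_m f : L1B f -> mB f.
Proof. by move=> /integrableP[/measurable_EFinP]. Qed.

Lemma L1B_le f g : mB f -> L1B g -> aeB (fun x => `|f x| <= g x) -> L1B f.
Proof.
move=> mf ig fg; apply/integrableP; split; first exact: mB_EFin.
have /integrableP[mg] := ig; apply: le_lt_trans.
apply: ae_ge0_le_integral=> //.
- by apply: measurableT_comp=> //; exact: mB_EFin.
- exact: measurableT_comp.
- by move: fg; rewrite /aeB; apply: filterS => x H Bx; rewrite /= lee_fin (le_trans (H Bx))// ler_norm.
Qed.

Lemma L1B_cst c : L1B (fun=> c).
Proof.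
apply/integrableP; split; first exact: measurable_cst.
by rewrite /= integral_cst// lte_mul_pinfty ?vol_B1.
Qed.

Lemma L1B_add f g : L1B f -> L1B g -> L1B (fun x => f x + g x).
Proof. by move=> fi gi; exact: (integrableD measurable_B1 fi gi). Qed.

Lemma L1B_scale k f : L1B f -> L1B (fun x => k*f x).
Proof. by move=> fi; exact: (integrableZl measurable_B1 k fi). Qed.

Lemma L1B_opp f : L1B f -> L1B (fun x => - f x).
Proof. by move=> fi; have := L1B_scale (-1) fi; congr L1B; apply/funext => x; rewrite mulN1r. Qed.

Lemma L1B_sub f g : L1B f -> L1B g -> L1B (fun x => f x - g x).
Proof. by move=> fi gi; exact: (L1B_add fi (L1B_opp gi)). Qed.

Lemma L1B_norm f : L1B f -> L1B (fun x => `|f x|).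
Proof. by move=> fi; exact: (integrable_abse fi). Qed.

Lemma L1B_sum (I : Type) (s : seq I) (F : I -> R3 R -> R) :
 (forall i, L1B (F i)) -> L1B (fun x => \sum_(i <- s) F i x).
Proof.
move=> H; elim: s=> [|i s IH].
 by rewrite (_ : (fun x => _) = fun=> 0); [exact: L1B_cst|apply/funext => x; rewrite big_nil].
rewrite (_ : (fun x => _) = fun x => F i x + \sum_(i <- s) F i x); first exact: L1B_add.
by apply/funext => x; rewrite big_cons.
Qed.

Lemma IBD f g : L1B f -> L1B g -> IB (fun x => f x + g x) = IB f + IB g.
Proof. by move=> fi gi; rewrite /IB RintegralD. Qed.

Lemma IBB f g : L1B f -> L1B g -> IB (fun x => f x - g x) = IB f - IB g.
Proof. by move=> fi gi; rewrite /IB RintegralB. Qed.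

Lemma IBZ k f : L1B f -> IB (fun x => k*f x) = k*IB f.
Proof. by move=> fi; rewrite /IB RintegralZl. Qed.

Lemma IBN f : L1B f -> IB (fun x => - f x) = - IB f.
Proof. by move=> fi; rewrite -mulN1r -IBZ//; congr IB; apply/funext => x; rewrite mulN1r. Qed.

Lemma IB_sum (I : Type) (s : seq I) (F : I -> R3 R -> R) :
 (forall i, L1B (F i)) -> IB (fun x => \sum_(i <- s) F i x) = \sum_(i <- s) IB (F i).
Proof.
move=> H; elim: s=> [|i s IH].
 rewrite big_nil (_ : (fun x => _) = fun=> 0*0).
  by rewrite IBZ ?mul0r//; exact: L1B_cst.
 by apply/funext => x; rewrite big_nil mulr0.
rewrite big_cons -IH -IBD//; last exact: L1B_sum.
by congr IB; apply/funext => x; rewrite big_cons.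
Qed.

Lemma IB_EFin f : L1B f -> (\int[mu]_(x in B) (f x)%:E)%E = (IB f)%:E.
Proof. by move=> fi; rewrite /IB /Rintegral fineK//; exact: integrable_fin_num. Qed.

Lemma IB_ae_eq f g : mB f -> mB g -> aeB (fun x => f x = g x) -> IB f = IB g.
Proof.
move=> mf mg fg; rewrite /IB /Rintegral; congr fine; apply: ae_eq_integral=> //; try exact: mB_EFin.
by move: fg; rewrite /aeB; apply: filterS => x H Bx; rewrite H.
Qed.

Lemma L1B_ae_eq f g : mB g -> L1B f -> aeB (fun x => f x = g x) -> L1B g.
Proof.
move=> mg fi fg; apply: (L1B_le mg (L1B_norm fi)).
by apply: aeB_mono fg => x _ ->.
Qed.

Lemma IB_ge0 f : mB f -> aeB (fun x => 0 <= f x) -> 0 <= IB f.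
Proof.
move=> mf f0; rewrite (IB_ae_eq (g := fun x => `|f x|)) //.
- by apply: Rintegral_ge0.
- exact: measurableT_comp.
- by apply: aeB_mono f0 => x _ ?; rewrite ger0_norm.
Qed.

Lemma IB_le f g : L1B f -> L1B g -> aeB (fun x => f x <= g x) -> IB f <= IB g.
Proof.
move=> fi gi fg; rewrite -subr_ge0 -IBB//; apply: IB_ge0.
 by apply: L1B_m; exact: L1B_sub.
by apply: aeB_mono fg => x _ ?; rewrite subr_ge0.
Qed.

Lemma dct_B (fn : nat -> R3 R -> R) f g : (forall n, mB (fn n)) -> mB f -> L1B g ->
 aeB (fun x => fn n x @[n --> \oo] --> f x) ->
 aeB (fun x => forall n, `|fn n x| <= g x) ->
 [/\ L1B f, (\int[mu]_(x in B) (`|fn n x - f x|)%:E)%E @[n --> \oo] --> 0%E &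
   IB (fn n) @[n --> \oo] --> IB f].
Proof.
move=> mfn mf gi cf dom.
have H := dominated_convergence measurable_B1 (f_ := fun n x => (fn n x)%:E) (f := fun x => (f x)%:E)
 (g := fun x => (g x)%:E).
have {H}[fi I0 I1] : [/\ mu.-integrable B (EFin \o f),
  [sequence (\int[mu]_(x in B) (`|(fn n x)%:E - (f x)%:E|))%E]_n @ \oo --> 0%E &
  [sequence (\int[mu]_(x in B) ((fn n x)%:E))%E]_n @ \oo --> (\int[mu]_(x in B) ((f x)%:E))%E].
 apply: H=> //.
 - by move=> n; exact: mB_EFin.
 - exact: mB_EFin.
 - by move: cf; rewrite /aeB; apply: filterS => x H Bx; apply: cvg_EFin; [exact: nearW|exact: H].
 - by move: dom; rewrite /aeB; apply: filterS => x H n Bx; rewrite /= lee_fin; exact: H.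
split=> //.
have fni n : L1B (fn n).
 by apply: (L1B_le (mfn n) gi); apply: aeB_mono dom => x _; exact.
move: I1; rewrite (IB_EFin fi) => /fine_cvg; rewrite /= => H1.
by apply: cvg_trans H1; apply: near_eq_cvg; near=> n; rewrite /= IB_EFin.
Unshelve. all: end_near. Qed.

Definition Linf f := mB f /\ exists M, aeB (fun x => `|f x| <= M).
Definition L2B f := mB f /\ L1B (fun x => f x^+2).

Lemma mB_mul f g : mB f -> mB g -> mB (fun x => f x*g x).
Proof. exact: measurable_funM. Qed.
Lemma mB_add f g : mB f -> mB g -> mB (fun x => f x + g x).
Proof. exact: measurable_funD. Qed.
Lemma mB_sum (I : Type) (s : seq I) (F : I -> R3 R -> R) :
 (forall i, mB (F i)) -> mB (fun x => \sum_(i <- s) F i x).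
Proof. by move=> H; exact: measurable_sum. Qed.
Lemma mB_continuous f : continuous f -> mB f.
Proof. by move=> cf; apply: measurable_funTS; exact: continuous_measurable_R3. Qed.

Lemma Linf_cst c : Linf (fun=> c).
Proof. by split; [exact: measurable_cst|exists `|c|; exact: aeB_all]. Qed.
Lemma Linf_mul f g : Linf f -> Linf g -> Linf (fun x => f x*g x).
Proof.
move=> [mf [M HM]] [mg [N HN]]; split; first exact: mB_mul.
exists (M*N); apply: aeB_mono2 HM HN => x _ fM gN.
by rewrite normrM ler_pM.
Qed.
Lemma Linf_add f g : Linf f -> Linf g -> Linf (fun x => f x + g x).
Proof.
move=> [mf [M HM]] [mg [N HN]]; split; first exact: mB_add.
exists (M + N); apply: aeB_mono2 HM HN => x _ fM gN.
by rewrite (le_trans (ler_normD _ _)) ?lerD.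
Qed.
Lemma Linf_opp f : Linf f -> Linf (fun x => - f x).
Proof.
by move=> /(Linf_mul (Linf_cst (-1))); congr Linf; apply/funext => x; rewrite mulN1r.
Qed.
Lemma Linf_continuous f : continuous f -> Linf f.
Proof.
move=> cf; split; first exact: mB_continuous.
by have [M _ HM] := continuous_bounded_cl cf; exists M; apply: aeB_all => x /B1_cl_ball; exact: HM.
Qed.
Lemma Linf_sum (I : Type) (s : seq I) (F : I -> R3 R -> R) :
 (forall i, Linf (F i)) -> Linf (fun x => \sum_(i <- s) F i x).
Proof.
move=> H; elim: s=> [|i s IH].
 by rewrite (_ : (fun x => _) = fun=> 0); [exact: Linf_cst|apply/funext => x; rewrite big_nil].
rewrite (_ : (fun x => _) = fun x => F i x + \sum_(i <- s) F i x); first exact: Linf_add.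
by apply/funext => x; rewrite big_cons.
Qed.

Lemma L1B_Linf f g : Linf f -> L1B g -> L1B (fun x => f x*g x).
Proof.
move=> [mf [M HM]] ig; apply: (L1B_le _ (L1B_scale `|M| (L1B_norm ig))).
 by apply: mB_mul=> //; exact: L1B_m.
apply: aeB_mono HM => x _ H; rewrite normrM ler_wpM2r//.
by rewrite (le_trans H)// ler_norm.
Qed.
Lemma Linf_L1 f : Linf f -> L1B f.
Proof.
by move=> H; have := L1B_Linf H (L1B_cst 1); congr L1B; apply/funext => x; rewrite mulr1.
Qed.
Lemma L2B_mul f g : L2B f -> L2B g -> L1B (fun x => f x*g x).
Proof.
move=> [mf f2] [mg g2]; apply: (L1B_le _ (L1B_add f2 g2)); first exact: mB_mul.
apply: aeB_all => x _; rewrite ler_norml; have := sqr_ge0 (f x + g x); have := sqr_ge0 (f x - g x).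
have := sqr_ge0 (f x); have := sqr_ge0 (g x); rewrite sqrrB sqrrD; move: (f x^+2) (g x^+2) (f x*g x) => a b c.
by rewrite !mulr2n => h1 h2 h3 h4; apply/andP; split; lra.
Qed.
Lemma L2B_le f g : mB f -> L2B g -> aeB (fun x => `|f x| <= g x) -> L2B f.
Proof.
move=> mf [mg g2] H; split=> //; apply: (L1B_le _ g2).
 by rewrite (_ : (fun x => f x^+2) = fun x => f x*f x); [exact: mB_mul|apply/funext].
apply: aeB_mono H => x _ h; rewrite normrX ler_pXn2r// nnegrE ?normr_ge0//.
exact: le_trans h.
Qed.
Lemma L2B_Linf f g : Linf f -> L2B g -> L2B (fun x => f x*g x).
Proof.
move=> [mf HM] [mg g2]; split; first exact: mB_mul.
have f2 : Linf (fun x => f x*f x) by exact: Linf_mul.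
have := L1B_Linf f2 g2; congr L1B; apply/funext => x.
by rewrite -expr2 exprMn.
Qed.
Lemma Linf_L2 f : Linf f -> L2B f.
Proof.
move=> H; split; first by case: H.
have : Linf (fun x => f x*f x) by exact: Linf_mul.
exact: Linf_L1.
Qed.
Lemma L2B_L1 f : L2B f -> L1B f.
Proof.
by move=> H; have := L2B_mul (Linf_L2 (Linf_cst 1)) H; congr L1B; apply/funext => x; rewrite mul1r.
Qed.
Lemma L2B_add f g : L2B f -> L2B g -> L2B (fun x => f x + g x).
Proof.
move=> Hf Hg; have fg := L2B_mul Hf Hg; case: Hf Hg=> [mf f2] [mg g2]; split; first exact: mB_add.
have := L1B_add (L1B_add f2 (L1B_scale 2 fg)) g2; congr L1B; apply/funext => x; ring.
Qed.
Lemma L2B_scale k f : L2B f -> L2B (fun x => k*f x).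
Proof. exact: L2B_Linf (Linf_cst k). Qed.
Lemma L2B_sum (I : Type) (s : seq I) (F : I -> R3 R -> R) :
 (forall i, L2B (F i)) -> L2B (fun x => \sum_(i <- s) F i x).
Proof.
move=> H; elim: s=> [|i s IH].
 by rewrite (_ : (fun x => _) = fun=> 0); [exact: (Linf_L2 (Linf_cst 0))|apply/funext => x; rewrite big_nil].
rewrite (_ : (fun x => _) = fun x => F i x + \sum_(i <- s) F i x); first exact: L2B_add.
by apply/funext => x; rewrite big_cons.
Qed.
Lemma L2B_norm f : L2B f -> L2B (fun x => `|f x|).
Proof.
move=> [mf f2]; split; first exact: measurableT_comp.
by move: f2; congr L1B; apply/funext => x; rewrite real_normK ?num_real.
Qed.

Lemma L2_L2B f : L2 B f <-> L2B f.
Proof.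
split=> -[mf f2]; split=> //.
 apply/integrableP; split; first by apply: mB_EFin; exact: measurable_funX.
 by under eq_integral do rewrite gee0_abs ?lee_fin ?sqr_ge0//.
have /integrableP[_] := f2; apply: le_lt_trans; rewrite le_eqVlt; apply/orP; left; apply/eqP.
by apply: eq_integral => x _; rewrite gee0_abs ?lee_fin ?sqr_ge0.
Qed.

End BallIntegrals.
#[global] Hint Resolve measurable_B1 : core.

(** * Integration by parts and the fundamental lemma of the calculus of variations *)

Section WeakDerivatives.
Variable R : realType.
Local Notation B := (@B1 R).
Local Notation mu := (vol R).
Local Notation box := (@box R).
Local Notation leb := (@lebesgue_measure R).
Implicit Types (f g h phi : R3 R -> R).

Definition upd (i : 'I_3) (x : R3 R) (s : R) : R3 R :=
 x + (s - coord i x) *: basis_vec R i.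

Lemma upd0E x s : upd 0 x s = ((s, x.1.2), x.2).
Proof.
by apply: R3_eq; apply: I3_case; rewrite /upd coordD coordZ coord_basis /= /coord/= ?mulr1 ?mulr0 ?addr0// addrC subrK.
Qed.
Lemma upd1E x s : upd 1 x s = ((x.1.1, s), x.2).
Proof.
by apply: R3_eq; apply: I3_case; rewrite /upd coordD coordZ coord_basis /= /coord/= ?mulr1 ?mulr0 ?addr0// addrC subrK.
Qed.
Lemma upd2E x s : upd 2 x s = (x.1, s).
Proof.
by apply: R3_eq; apply: I3_case; rewrite /upd coordD coordZ coord_basis /= /coord/= ?mulr1 ?mulr0 ?addr0// addrC subrK.
Qed.

(** Tonelli's theorem with the lines along axis [i] innermost. It reduces integration by parts and
    invariance of volume under shears to statements about single lines. *)
Lemma vol_eq_lines (i : 'I_3) (F G : R3 R -> \bar R) :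
 mfun F -> mfun G ->
 (forall x, 0 <= F x)%E -> (forall x, 0 <= G x)%E ->
 (forall x, \int[leb]_s F (upd i x s) = \int[leb]_s G (upd i x s))%E ->
 (\int[mu]_x F x = \int[mu]_x G x)%E.
Proof.
move=> mF mG F0 G0; move: i.
have mz (H : R3 R -> \bar R) z : mfun H -> mfun (fun p => H (p, z)).
 by move=> mH; exact: (measurable_fun_pair1 (f := H) z mH).
apply: I3_case => H.
- rewrite (vol_iter_z mF F0) (vol_iter_z mG G0); apply: eq_integral => z _.
 rewrite (leb2_iter2 (mz _ z mF) (fun p => F0 (p, z))) (leb2_iter2 (mz _ z mG) (fun p => G0 (p, z))).
 apply: eq_integral => y _.
 transitivity (\int[leb]_s F (upd 0%R ((0, y), z)%R s))%E; first by apply: eq_integral => s _; rewrite upd0E.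
 by rewrite H; apply: eq_integral => s _; rewrite upd0E.
- rewrite (vol_iter_z mF F0) (vol_iter_z mG G0); apply: eq_integral => z _.
 rewrite (leb2_iter (mz _ z mF) (fun p => F0 (p, z))) (leb2_iter (mz _ z mG) (fun p => G0 (p, z))).
 apply: eq_integral => y _.
 transitivity (\int[leb]_s F (upd 1%R ((y, 0), z)%R s))%E; first by apply: eq_integral => s _; rewrite upd1E.
 by rewrite H; apply: eq_integral => s _; rewrite upd1E.
- rewrite (vol_iter_h mF F0) (vol_iter_h mG G0); apply: eq_integral => p _.
 transitivity (\int[leb]_s F (upd 2%R (p, 0)%R s))%E; first by apply: eq_integral => s _; rewrite upd2E.
 by rewrite H; apply: eq_integral => s _; rewrite upd2E.
Qed.

Lemma smooth_line f i x : smooth f ->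
 let k := fun s => f (upd i x s) in
 (forall s, is_derive s (1 : R) k (partial i f (upd i x s))) /\
 continuous (fun s => partial i f (upd i x s)).
Proof.
move=> sf k.
have E s : upd i x s = x + (- coord i x) *: basis_vec R i + s *: basis_vec R i.
 by rewrite /upd addrC -addrA -scalerDl addrC [- _ + _]addrC.
split=> s.
 have -> : k = fun s => f (x + (- coord i x) *: basis_vec R i + s *: basis_vec R i).
  by apply/funext => t; rewrite /k E.
 by rewrite E; apply: is_derive_line; exact: smooth_derivable.
apply: (continuous_comp (f := upd i x)); last exact: (smooth_continuous (smooth_partial i sf)).
rewrite /upd; apply: cvgD; first exact: cvg_cst.
by apply: cvgZl; apply: cvgB; [exact: cvg_id|exact: cvg_cst].
Qed.

Lemma coord_upd i j x s : coord j (upd i x s) = if j == i then s else coord j x.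
Proof.
rewrite /upd coordD coordZ coord_basis; case: eqP=> [->|_]; last by rewrite mulr0 addr0.
by rewrite mulr1 addrC subrK.
Qed.

Lemma box_coord (x : R3 R) : box x <-> forall i, -1 <= coord i x <= 1.
Proof.
split=> [[[H0 H1] H2]|H]; first by move: H0 H1 H2; rewrite /= !in_itv/= => H0 H1 H2; exact: I3_case.
by split; [split|]; rewrite /= in_itv/=; [exact: (H 0)|exact: (H 1)|exact: (H 2)].
Qed.

Lemma partial_near0 i f x : (\forall y \near x, f y = 0) -> partial i f x = 0.
Proof.
move=> H; by rewrite /partial (near_eq_derive (g := cst 0)) ?derive_cst.
Qed.

Lemma FTC_all (q K : R -> R) (a b : R) : a < b -> continuous q ->
 (forall s : R, is_derive s (1 : R) K (q s)) ->
 (\int[leb]_(s in `[a, b]) (q s)%:E = (K b)%:E - (K a)%:E)%E.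
Proof.
move=> ab cq dq; apply: continuous_FTC2=> //.
- exact: continuous_subspaceT.
- have cK : continuous K by move=> s; apply: differentiable_continuous; apply/derivable1_diffP; have [] := dq s.
 by split=> [s _||]; [have [] := dq s|apply: cvg_at_right_filter; exact: cK|apply: cvg_at_left_filter; exact: cK].
- by move=> s _; rewrite derive1E; have d := dq s; rewrite derive_val.
Qed.

(** By the fundamental theorem of calculus the integral vanishes on every line along axis [i]. As
    [vol_eq_lines] is about nonnegative functions, a multiple of the indicator of the cube, large
    enough to make the integrand nonnegative, is added on both sides. *)
Lemma integral_partial_cmpct i f (K : set (R3 R)) : smooth f -> compact K -> K `<=` B ->
 (forall x, ~ K x -> f x = 0) -> IB (partial i f) = 0.
Proof.
move=> sf cK KB f0.
have oK : open (~` K) by apply: closed_openC; apply: compact_closed=> //; exact: norm_hausdorff.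
have p0 x : ~ K x -> partial i f x = 0.
 by move=> Kx; apply: partial_near0; exact: filterS f0 (open_nbhs_nbhs (conj oK Kx)).
have [C C0 HC] := continuous_bounded_cl (smooth_continuous (smooth_partial i sf)).
have {}HC x : `|partial i f x| <= C.
 have [/KB/B1_cl_ball|/p0 ->] := pselect (K x); [exact: HC|by rewrite normr0].
have mp : mfun (partial i f) by apply: continuous_measurable_R3; exact/smooth_continuous/smooth_partial.
have mbox : mfun (fun x => \1_box x : R) by apply: measurable_indic; exact: measurable_box.
pose F x := partial i f x + C * \1_box x; pose G x : R := C * \1_box x.
have KBox x : K x -> box x by move=> /KB /B1_box.
have F0 x : 0 <= F x.
 rewrite /F indicE; case: (boolP (x \in box))=> [_|]; first by rewrite mulr1; have := HC x; rewrite ler_norml; lra.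
 by rewrite notin_setE => nb; rewrite p0 ?mulr0 ?addr0// => /KBox.
have G0 x : 0 <= G x by rewrite /G mulr_ge0.
have mG : mfun G by exact: measurable_funM.
have mF : mfun F by exact: measurable_funD.
have FG : (\int[mu]_x (F x)%:E = \int[mu]_x (G x)%:E)%E.
 apply: (vol_eq_lines (i := i)); try exact/measurable_EFinP; try by move=> x; rewrite lee_fin.
 move=> x; have [dk ck] := smooth_line i x sf.
 have [nb|bx] := pselect (forall j, j != i -> -1 <= coord j x <= 1); last first.
  have nbox s : ~ box (upd i x s).
   move/box_coord => H; apply: bx => j ji; have := H j; by rewrite coord_upd (negbTE ji).
  by apply: eq_integral => s _; rewrite /F /G p0 ?add0r// => /KBox; exact: nbox.
 have bE s : \1_box (upd i x s) = \1_`[-1, 1]%classic s :> R.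
  rewrite !indicE; congr (nat_of_bool _)%:R; apply/idP/idP; rewrite !inE.
   by move/box_coord/(_ i); rewrite coord_upd eqxx /= in_itv.
  rewrite /= in_itv/= => H; apply/box_coord => j; rewrite coord_upd; case: eqP=> // /eqP; exact: nb.
 have LHS : (\int[leb]_s (F (upd i x s))%:E = \int[leb]_(s in `[(-1)%R, 1%R]) (partial i f (upd i x s) + C)%:E)%E.
  rewrite [RHS]integral_mkcond; apply: eq_integral => s _; rewrite /F bE patchE indicE.
  case: ifPn=> [_|]; first by rewrite mulr1.
  rewrite notin_setE => ns; rewrite p0 ?mulr0 ?addr0// => /KBox /box_coord/(_ i).
  by rewrite coord_upd eqxx => H; apply: ns; rewrite /= in_itv.
 have RHS' : (\int[leb]_s (G (upd i x s))%:E = \int[leb]_(s in `[(-1)%R, 1%R]) C%:E)%E.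
  rewrite [RHS]integral_mkcond; apply: eq_integral => s _; rewrite /G bE patchE indicE.
  by case: ifPn=> [_|_]; rewrite ?mulr1 ?mulr0.
 rewrite LHS RHS'.
 have kE (s : R) : (s <= -1) || (1 <= s) -> f (upd i x s) = 0.
  move=> H; apply: f0 => /KB Bx; have := coord_le_enorm i (upd i x s); rewrite coord_upd eqxx => le.
  have : `|s| < 1 := le_lt_trans le Bx; rewrite ltr_norml => /andP[a b]; case/orP: H; lra.
 pose k s := f (upd i x s) + C*s.
 have dk' (s : R) : is_derive s (1 : R) k (partial i f (upd i x s) + C).
  apply: is_deriveD; apply: is_derive_eq; by rewrite /GRing.scale/= mulr1.
 rewrite (FTC_all _ _ dk') ; last 2 first.
 - by lra.
 - by move=> s; apply: cvgD; [exact: ck|exact: cvg_cst].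
 have dC (s : R) : is_derive s (1 : R) (fun s => C*s) C.
  by apply: is_derive_eq; rewrite /GRing.scale/= mulr1.
 rewrite (FTC_all _ _ dC); last 2 first.
 - by lra.
 - by move=> s; exact: cvg_cst.
 by rewrite /k !kE ?lexx ?orbT// !add0r.
have GE : (\int[mu]_x (G x)%:E)%E \is a fin_num.
 rewrite ge0_fin_numE; last by apply: integral_ge0 => x _; rewrite lee_fin.
 rewrite /G; under eq_integral do rewrite EFinM.
 rewrite ge0_integralZl//; last by exact/measurable_EFinP.
 rewrite integral_indic//; last exact: measurable_box.
 by rewrite setIT lte_mul_pinfty ?lee_fin// vol_box.
have Gi : mu.-integrable setT (EFin \o G).
 apply/integrableP; split; first exact/measurable_EFinP.
 under eq_integral do rewrite gee0_abs ?lee_fin//.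
 by rewrite -ge0_fin_numE// integral_ge0// => x _; rewrite lee_fin.
have Fi : mu.-integrable setT (EFin \o F).
 apply/integrableP; split; first exact/measurable_EFinP.
 under eq_integral do rewrite gee0_abs ?lee_fin//.
 by rewrite FG -ge0_fin_numE// integral_ge0// => x _; rewrite lee_fin.
have -> : IB (partial i f) = \int[mu]_x (F x - G x).
 rewrite /IB Rintegral_mkcond; apply: eq_Rintegral => x _; rewrite patchE /F /G addrK.
 by case: ifPn=> //; rewrite notin_setE => nB; rewrite p0// => /KB.
by rewrite RintegralB// /Rintegral FG subrr.
Qed.

Definition obox (a b : 'I_3 -> R) : set (R3 R) := [set x | forall i, a i < coord i x < b i].

Lemma smallest_preimage T U (S : set (set T)) (f : T -> U) (G : set (set U)) :
 sigma_algebra setT S -> (forall A, G A -> S (f @^-1` A)) ->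
 forall A, <<s G >> A -> S (f @^-1` A).
Proof.
move=> [S0 SC SU] H A; apply: (smallest_sub (X := [set A | S (f @^-1` A)]))=> //=.
split=> /=; first by rewrite preimage_set0.
- by move=> X SX; rewrite setTD preimage_setC -setTD; exact: SC.
- by move=> F SF; rewrite preimage_bigcup; exact: SU.
Qed.

Lemma coord_sigma i (A : set R) : measurable A ->
 <<s [set X | exists a b, X = obox a b] >> (coord i @^-1` A).
Proof.
move=> mA; have {mA} : (measurable_realfun.RGenOpens.G (R:=R)).-sigma.-measurable A.
 by rewrite -measurable_realfun.RGenOpens.measurableE.
apply: smallest_preimage; first exact: smallest_sigma_algebra.
move=> _ [p [q ->]].
have -> : coord i @^-1` `]p, q[%classic = \bigcup_n obox (fun j => if j == i then p else - n%:R) (fun j => if j == i then q else n%:R).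
 apply/seteqP; split=> [x /= Hx|x [n _ /(_ i)]]; last by rewrite eqxx /= in_itv.
 have [n Hn] : exists n : nat, `|x| < n%:R by exists (Num.bound `|x|); exact: archi_boundP.
 exists n=> // j; case: eqP=> [->|_]; first by move: Hx; rewrite in_itv.
 by rewrite -ltr_norml (le_lt_trans (coord_le_norm _ _)).
have [_ _ SU] := @smallest_sigma_algebra _ setT [set X | exists a b, X = obox a b].
apply: SU => n; apply: sub_gen_smallest; by do 2 eexists.
Qed.

(** Open boxes generate the Borel sets and are stable under intersection: they are the pi-system
    from which [fund_lemma] starts. *)
Lemma measurable_obox_gen (E : set (R3 R)) : measurable E ->
 <<s [set X | exists a b, X = obox a b] >> E.
Proof.
have SA := @smallest_sigma_algebra _ setT [set X | exists a b, X = obox a b].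
apply: smallest_sub=> // A [] [X mX <-]; rewrite setTI; last exact: (@coord_sigma 2).
move: X mX; apply: smallest_sub; last first.
 by move=> X' [] [Y mY <-]; rewrite setTI /=; [exact: (@coord_sigma 0)|exact: (@coord_sigma 1)].
case: SA => S0 SC SU; split=> /=; first by rewrite preimage_set0.
- by move=> X SX; rewrite setTD preimage_setC -setTD; exact: SC.
- by move=> F SF; rewrite preimage_bigcup; exact: SU.
Qed.

(** Each factor tends to the indicator of a half-space as [k] grows, so the product tends on the
    ball to the indicator of a box. The last factor, through its shift by -1, has support in 1 -
    |x|^2 >= 1/k, a compact subset of the ball. *)
Definition bump (k : nat) (a b : 'I_3 -> R) (x : R3 R) : R :=
 \prod_(i < 3) (flat 0 (k%:R*(coord i x - a i))*flat 0 (k%:R*(b i - coord i x)))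
 * flat 0 (k%:R*(1 - (x.1.1^+2 + x.1.2^+2 + x.2^+2)) - 1).

Lemma gsm_poly_sub c i (a : R) : gsm (fun x => c*(coord i x - a)).
Proof. by apply: Gmul; [exact: Gcst|apply: Gadd; [exact: Gcoord|exact: Gcst]]. Qed.

Lemma gsm_sub f g : gsm f -> gsm g -> gsm (fun x => f x - g x).
Proof.
move=> sf sg; rewrite (_ : (fun x => _) = fun x => f x + (-1)*g x).
 by apply: Gadd=> //; apply: Gmul=> //; exact: Gcst.
by apply/funext => x; rewrite mulN1r.
Qed.

Lemma gsm_sqr f : gsm f -> gsm (fun x => f x^+2).
Proof. by move=> sf; rewrite (_ : (fun x => _) = fun x => f x*f x); [exact: Gmul|apply/funext]. Qed.

Lemma gsm_sqnorm : gsm (fun x : R3 R => x.1.1^+2 + x.1.2^+2 + x.2^+2).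
Proof.
by apply: Gadd; [apply: Gadd|]; apply: gsm_sqr; [exact: (Gcoord _ 0)|exact: (Gcoord _ 1)|exact: (Gcoord _ 2)].
Qed.

Lemma prod_I3 (F : 'I_3 -> R) : \prod_i F i = F 0*F 1*F 2.
Proof.
rewrite !big_ord_recr big_ord0 /= mul1r; congr (F _*F _*F _); exact: val_inj.
Qed.

Lemma gsm_bump k a b : gsm (bump k a b).
Proof.
apply: Gmul.
 rewrite (_ : (fun x => _) = fun x =>
  flat 0 (k%:R*(coord 0 x - a 0))*flat 0 (k%:R*(b 0 - coord 0 x)) *
  (flat 0 (k%:R*(coord 1 x - a 1))*flat 0 (k%:R*(b 1 - coord 1 x))) *
  (flat 0 (k%:R*(coord 2 x - a 2))*flat 0 (k%:R*(b 2 - coord 2 x)))); last first.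
  by apply/funext => x; rewrite prod_I3.
 have G i : gsm (fun x => flat 0 (k%:R*(coord i x - a i))*flat 0 (k%:R*(b i - coord i x))).
  apply: Gmul; apply: Gflat; first exact: gsm_poly_sub.
  by apply: Gmul; [exact: Gcst|apply: gsm_sub; [exact: Gcst|exact: Gcoord]].
 by apply: Gmul; [apply: Gmul|]; exact: G.
apply: Gflat; apply: gsm_sub; last exact: Gcst.
by apply: Gmul; [exact: Gcst|apply: gsm_sub; [exact: Gcst|exact: gsm_sqnorm]].
Qed.

Lemma flat0_01 (t : R) : 0 <= flat 0 t <= 1.
Proof.
rewrite flat_ge0/= /flat; case: ifP=> // t0; rewrite expr0 mulr1 -expR0 ler_expR.
by rewrite oppr_le0 invr_ge0 ltW.
Qed.

Lemma flat0_cvg (s c : R) : 0 < s -> flat 0 (k%:R*s - c) @[k --> \oo] --> (1 : R).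
Proof.
move=> s0.
have T : (k%:R*s - c : R) @[k --> \oo] --> +oo.
 apply/cvgryPge => A; near=> k.
 rewrite lerBrDr -ler_pdivrMr//; near: k; exact: nbhs_infty_ger.
have V : ((k%:R*s - c)^-1 : R) @[k --> \oo] --> (0 : R).
 by apply/gtr0_cvgV0=> //; near=> k; near: k; move/cvgryPgt : T; exact.
have E : expR (- (k%:R*s - c)^-1) @[k --> \oo] --> (1 : R).
 have : expR (- (k%:R*s - c)^-1) @[k --> \oo] --> expR (- 0 : R).
  by apply: (cvg_comp _ (@expR R) (cvgN V)); exact: continuous_expR.
 by rewrite oppr0 expR0.
apply: cvg_trans E; apply: near_eq_cvg; near=> k; rewrite /flat expr0 mulr1 ifT//.
by near: k; move/cvgryPgt : T; exact.
Unshelve. all: end_near. Qed.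

Lemma cutoff_lt1 (k : nat) (s : R) : 0 <= k%:R*(1 - s) - 1 -> s < 1.
Proof.
case: k=> [|k]; first by rewrite mul0r; lra.
move=> H; rewrite ltNge; apply/negP => s1.
have : k.+1%:R*(1 - s) <= 0 by rewrite mulr_ge0_le0// subr_le0.
lra.
Qed.

Lemma bump_test k a b : test_function B (bump k a b).
Proof.
split; first exact/gsm_smooth/gsm_bump.
exists [set x | 0 <= k%:R*(1 - (x.1.1^+2 + x.1.2^+2 + x.2^+2)) - 1]; split.
- apply: (@subclosed_compact _ _ (@cl_ball R)); last 2 first.
 + exact: compact_cl_ball.
 + by move=> x /= /cutoff_lt1 H; rewrite /cl_ball/= -[1]sqrtr1 ler_sqrt// ltW.
 rewrite (_ : mkset _ = (fun x : R3 R => k%:R*(1 - (x.1.1^+2 + x.1.2^+2 + x.2^+2)) - 1) @^-1` [set y | 0 <= y])//.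
 apply: closed_comp; last exact: closed_ge.
 move=> x _; apply: smooth_continuous; apply: gsm_smooth; apply: gsm_sub; last exact: Gcst.
 by apply: Gmul; [exact: Gcst|apply: gsm_sub; [exact: Gcst|exact: gsm_sqnorm]].
- by move=> x /= /cutoff_lt1 H; rewrite /B1/= -[ltRHS]sqrtr1 ltr_sqrt.
- move=> x /= /negP; rewrite -ltNge => H; rewrite /bump [X in _*X](_ : _ = 0) ?mulr0//.
 by rewrite /flat ltNge (ltW H).
Qed.

Lemma bump_cvg a b x : B x -> bump k a b x @[k --> \oo] --> (\1_(obox a b) x : R).
Proof.
move=> Bx.
pose pos (t : R) : R := if 0 < t then 1 else 0.
have C (t : R) : flat 0 (k%:R*t) @[k --> \oo] --> pos t.
 rewrite /pos; case: ltP => t0; first by have := flat0_cvg 0 t0; under eq_fun do rewrite subr0.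
 apply: cvg_near_cst; near=> k; rewrite /flat ltNge ifF//; apply/negbTE; rewrite negbK.
 by rewrite mulr_ge0_le0.
have -> : \1_(obox a b) x = \prod_(i < 3) (pos (coord i x - a i) * pos (b i - coord i x))*1 :> R.
 rewrite mulr1 indicE; case: (boolP (x \in obox a b)); rewrite ?inE ?notin_setE.
  by move=> H; rewrite big1// => i _; have /andP[a1 b1] := H i; rewrite /pos !subr_gt0 a1 b1 mulr1.
 move=> /existsNP[i /negP]; rewrite negb_and => H; rewrite (bigD1 i)//= /pos !subr_gt0.
 by case/orP: H => /negbTE ->; rewrite ?(mulr0, mul0r).
apply: cvgM; last first.
 by apply: flat0_cvg; rewrite subr_gt0 -sqr_enorm expr_lt1// enorm_ge0.
rewrite prod_I3; under eq_fun do rewrite prod_I3.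
by apply: cvgM; [apply: cvgM|]; apply: cvgM; exact: C.
Unshelve. all: end_near. Qed.

Lemma bump_01 k a b x : `|bump k a b x| <= 1.
Proof.
have P (I : finType) (F : I -> R) : (forall i, 0 <= F i <= 1) -> 0 <= \prod_i F i <= 1.
 by move=> H; rewrite prodr_ge0 ?prodr_ile1// => i _; have /andP[] := H i.
have M (s t : R) : 0 <= s <= 1 -> 0 <= t <= 1 -> 0 <= s*t <= 1.
 by move=> /andP[s0 s1] /andP[t0 t1]; rewrite mulr_ge0// mulr_ile1.
have /andP[b0 b1] : 0 <= bump k a b x <= 1.
 by apply: (M _ _); [apply: (P _ _) => i; apply: (M _ _); exact: flat0_01|exact: flat0_01].
by rewrite ger0_norm.
Qed.

Lemma cvg_seq_cst (u : nat -> R) (c l : R) : (forall n, u n = c) -> u n @[n --> \oo] --> l -> l = c.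
Proof.
move=> E; rewrite (_ : u = fun=> c); last exact/funext.
by move=> /cvg_lim <- //; rewrite lim_cst.
Qed.

Lemma measurable_obox a b : measurable (obox a b).
Proof.
have -> : obox a b = \bigcap_(i in [set: 'I_3]) (coord i @^-1` `]a i, b i[%classic).
 by apply/seteqP; split=> [x Hx i _|x Hx i]; [rewrite /= in_itv; exact: Hx|have := Hx i I; rewrite /= in_itv].
apply: fin_bigcap_measurable=> // i _; rewrite -[X in measurable X]setTI.
by apply: continuous_measurable_R3=> //; exact: coord_continuous.
Qed.

(** Orthogonality passes from test functions to indicators of boxes by dominated convergence, and to
    those of all Borel sets by the monotone class theorem. The set where g > 0 then yields the
    integral of |g|. *)
Lemma fund_lemma g : L1B g ->
 (forall phi, test_function B phi -> IB (fun x => g x * phi x) = 0) ->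
 aeB (fun x => g x = 0).
Proof.
move=> gi H.
have L1 (E : set (R3 R)) : measurable E -> L1B (fun x => g x * \1_E x).
 move=> mE; have LE : Linf (fun x => \1_E x : R).
  split; first by apply: measurable_funTS; exact: measurable_indic.
  by exists 1; apply: aeB_all => x _; rewrite indicE ger0_norm// lern1 leq_b1.
 by have := L1B_Linf LE gi; congr L1B; apply/funext => x; rewrite mulrC.
have Hbox a b : IB (fun x => g x * \1_(obox a b) x) = 0.
 have mo := measurable_obox a b.
 have [|||||_ _ C] := @dct_B R (fun k x => g x*bump k a b x) (fun x => g x * \1_(obox a b) x) (fun x => `|g x|).
 - by move=> n; apply: mB_mul; [exact: L1B_m|apply: mB_continuous; apply: smooth_continuous; case: (bump_test n a b)].
 - by apply: L1B_m; exact: L1.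
 - exact: L1B_norm.
 - by apply: aeB_all => x Bx; apply: cvgM; [exact: cvg_cst|exact: bump_cvg].
 - by apply: aeB_all => x _ n; rewrite normrM ler_piMr// bump_01.
 by apply: cvg_seq_cst C => n; rewrite H//; exact: bump_test.
have Hset (E : set (R3 R)) : measurable E -> IB (fun x => g x * \1_E x) = 0.
 move=> mE; have /measurable_obox_gen := mE.
 pose HH := [set E : set (R3 R) | measurable E /\ IB (fun x => g x * \1_E x) = 0].
 suff : <<s [set X | exists a b, X = obox a b] >> `<=` HH by move=> S /S[].
 have HT : IB g = 0.
  rewrite -(Hbox (fun=> -2) (fun=> 2)); apply: IB_ae_eq.
  - exact: L1B_m.
  - by apply: L1B_m; apply: L1; exact: measurable_obox.
  - apply: aeB_all => x Bx; rewrite indicE mem_set ?mulr1// => i.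
   rewrite -ltr_norml (le_lt_trans (coord_le_enorm _ _))// (lt_trans Bx)//; lra.
 apply: lambda_system_subset=> //.
 - move=> _ _ [a [b ->]] [a' [b' ->]]; exists (fun i => Num.max (a i) (a' i)), (fun i => Num.min (b i) (b' i)).
  apply/seteqP; split=> [x [H1 H2] i|x H1]; first by rewrite gt_max lt_min; have /andP[-> ->] := H1 i; have /andP[-> ->] := H2 i.
  by split=> i; have := H1 i; rewrite gt_max lt_min => /andP[/andP[h1 h2] /andP[h3 h4]]; apply/andP.
 - split=> //.
  + split; first exact: measurableT.
   by rewrite -HT; congr IB; apply/funext => x; rewrite indicT mulr1.
  + move=> E1 E2 E21 [m1 I1] [m2 I2]; split; first exact: measurableD.
   rewrite (_ : (fun x => _) = fun x => g x * \1_E1 x - g x * \1_E2 x); last first.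
    apply/funext => x; rewrite -mulrBr; congr (_ * _); rewrite !indicE in_setD.
    case: (boolP (x \in E2)) => x2; last by rewrite subr0 andbT.
    by rewrite andbF (_ : x \in E1) ?subrr//; move: x2; rewrite !inE; exact: E21.
   by rewrite IBB ?I1 ?I2 ?subrr//; exact: L1.
  + move=> F ndF HF; have mU : measurable (\bigcup_n F n) by apply: bigcup_measurable => n _; case: (HF n).
   split=> //.
   have [|||||_ _ C] := @dct_B R (fun k x => g x * \1_(F k) x) (fun x => g x * \1_(\bigcup_n F n) x) (fun x => `|g x|).
   * by move=> n; apply: L1B_m; apply: L1; case: (HF n).
   * by apply: L1B_m; exact: L1.
   * exact: L1B_norm.
   * apply: aeB_all => x _; apply: cvgM; first exact: cvg_cst.
    apply: cvg_near_cst; rewrite !indicE; have [[n _ Fn]|nF] := pselect ((\bigcup_n F n) x).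
     exists n=> // k /= nk; have Fk : F k x by have /subsetPset := ndF n k nk; exact.
     by rewrite indicE (mem_set Fk) mem_set//; exists n.
    by apply: nearW => k; rewrite indicE !memNset// => Fk; apply: nF; exists k.
   * by apply: aeB_all => x _ n; rewrite normrM ler_piMr// indicE ger0_norm// lern1 leq_b1.
   by apply: cvg_seq_cst C => n; case: (HF n).
 - by move=> _ [a [b ->]]; split; [exact: measurable_obox|exact: Hbox].
have mg : mB g by exact: L1B_m.
pose E := B `&` g @^-1` `]0, +oo[%classic.
have mE : measurable E by apply: mg=> //; exact: measurable_itv.
have IT : IB g = 0.
 by rewrite -(Hset _ measurableT); congr IB; apply/funext => x; rewrite indicT mulr1.
have I0 : IB (fun x => `|g x|) = 0.
 have -> : IB (fun x => `|g x|) = IB (fun x => 2*(g x * \1_E x) - g x).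
  apply: IB_ae_eq; first by apply: L1B_m; exact: L1B_norm.
   by apply: L1B_m; apply: L1B_sub=> //; apply: L1B_scale; exact: L1.
  apply: aeB_all => x Bx; rewrite indicE; case: (boolP (x \in E)); rewrite ?inE ?notin_setE.
   by move=> [_]; rewrite /= in_itv/= andbT => g0; rewrite gtr0_norm//; ring.
  move=> nE; rewrite mulr0 mulr0 sub0r ler0_norm// leNgt; apply/negP => g0; apply: nE.
  by split=> //; rewrite /= in_itv/= andbT.
 by rewrite IBB ?IBZ ?Hset ?IT ?mulr0 ?subrr//; [exact: L1|apply: L1B_scale; exact: L1].
have := ae_eq_integral_abs mu (@measurable_B1 R) (mB_EFin mg).
have -> : (\int[mu]_(x in B) `|(EFin \o g) x| = 0)%E.
 by have := IB_EFin (L1B_norm gi); rewrite I0.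
move=> [/(_ erefl) H0 _]; move: H0; rewrite /aeB/ae_eq; apply: filterS => x h Bx.
by have := h Bx => -[].
Unshelve. all: end_near. Qed.

End WeakDerivatives.

(** * Smooth approximations with dominated gradients and their calculus *)

Section Approximation.
Variable R : realType.
Local Notation B := (@B1 R).
Local Notation mu := (vol R).
Implicit Types (f g : nat -> R3 R -> R) (u v : R3 R -> R) (c b : R3 R -> R) (w : 'I_3 -> R3 R -> R).

Lemma partialD i (u v : R3 R -> R) x : smooth u -> smooth v ->
 partial i (fun x => u x + v x) x = partial i u x + partial i v x.
Proof. by move=> su sv; apply: deriveD; exact: smooth_derivable. Qed.

Lemma partialM i (u v : R3 R -> R) x : smooth u -> smooth v ->
 partial i (fun x => u x * v x) x = u x * partial i v x + v x * partial i u x.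
Proof. by move=> su sv; apply: deriveM; exact: smooth_derivable. Qed.

Lemma partial_cst i (k : R) x : partial i (fun=> k) x = 0.
Proof. exact: derive_cst. Qed.

Lemma partialV i (u : R3 R -> R) x : smooth u -> (forall x, 0 < u x) ->
 partial i (fun x => (u x)^-1) x = - (u x)^-2 * partial i u x.
Proof. by move=> su u0; rewrite /partial (deriveV (f := u)) ?gt_eqF//; exact: smooth_derivable. Qed.

Lemma partial_sqrt i (u : R3 R -> R) x : smooth u -> (forall x, 0 < u x) ->
 partial i (fun x => sqrt (u x)) x = (2*sqrt (u x))^-1 * partial i u x.
Proof.
move=> su u0; have [du _] := smooth_differentiable x su.
have dd : is_derive (u x) (1 : R) sqrt (2*sqrt (u x))^-1 by exact: is_derive1_sqrt.
have [_ E] : differentiable (sqrt \o u) x /\ forall h, 'D_h (sqrt \o u) x = (sqrt^`())%classic (u x) * 'D_h u x.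
 by apply: comp1_diff=> //; exact: ex_derive.
by rewrite [LHS]E; congr (_ * _); rewrite derive1E derive_val.
Qed.

Lemma smooth_add (u v : R3 R -> R) : smooth u -> smooth v -> smooth (fun x => u x + v x).
Proof. by move=> su sv; apply: gsm_smooth; apply: Gadd; exact: Gsmooth. Qed.
Lemma smooth_mul (u v : R3 R -> R) : smooth u -> smooth v -> smooth (fun x => u x * v x).
Proof. by move=> su sv; apply: gsm_smooth; apply: Gmul; exact: Gsmooth. Qed.
Lemma smooth_cst (k : R) : smooth (fun=> k : R).
Proof. by apply: gsm_smooth; exact: Gcst. Qed.
Lemma smooth_inv (u : R3 R -> R) : smooth u -> (forall x, 0 < u x) -> smooth (fun x => (u x)^-1).
Proof. by move=> su u0; apply: gsm_smooth; apply: Ginv=> //; exact: Gsmooth. Qed.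
Lemma smooth_sqrt (u : R3 R -> R) : smooth u -> (forall x, 0 < u x) -> smooth (fun x => sqrt (u x)).
Proof. by move=> su u0; apply: gsm_smooth; apply: Gsqrt=> //; exact: Gsmooth. Qed.
Lemma smooth_sum (I : Type) (s : seq I) (F : I -> R3 R -> R) :
 (forall k, smooth (F k)) -> smooth (fun x => \sum_(k <- s) F k x).
Proof.
move=> sF; elim: s=> [|k s IH].
 by rewrite (_ : (fun x => _) = fun=> 0); [exact: smooth_cst|apply/funext => x; rewrite big_nil].
rewrite (_ : (fun x => _) = fun x => F k x + \sum_(k <- s) F k x); first exact: smooth_add.
by apply/funext => x; rewrite big_cons.
Qed.
Lemma partial_sum (I : Type) (s : seq I) (F : I -> R3 R -> R) i x :
 (forall k, smooth (F k)) -> partial i (fun x => \sum_(k <- s) F k x) x = \sum_(k <- s) partial i (F k) x.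
Proof.
move=> sF; elim: s=> [|k s IH].
 rewrite big_nil (_ : (fun x => _) = fun=> 0); first exact: partial_cst.
 by apply/funext => y; rewrite big_nil.
rewrite big_cons -IH -partialD//; last exact: smooth_sum.
by congr (partial i _ x); apply/funext => y; rewrite big_cons.
Qed.

Definition nrm (x : R3 R) : R3 R := (enorm x)^-1 *: x.

Lemma enorm_scale k (x : R3 R) : enorm (k *: x) = `|k|*enorm x.
Proof.
rewrite /enorm /= /GRing.scale/= !exprMn -!mulrDr sqrtrM ?sqr_ge0//.
by rewrite sqrtr_sqr.
Qed.

Lemma enorm_nrm (x : R3 R) : enorm x != 0 -> enorm (nrm x) = 1.
Proof. by move=> x0; rewrite /nrm enorm_scale ger0_norm ?invr_ge0 ?enorm_ge0// mulVf. Qed.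

Lemma nrm_cl x : @cl_ball R (nrm x).
Proof.
rewrite /cl_ball/=; have [x0|x0] := eqVneq (enorm x) 0; last by rewrite enorm_nrm.
by rewrite /nrm enorm_scale x0 mulr0.
Qed.

(** The [f n] tend to [v], their gradients to [w] and their values on the sphere to [c], with the
    bounds that dominated convergence asks for. Such data are stable under sums, products, inverses
    and square roots, so the chain rule, weak derivatives and traces of competitors are limits of
    smooth identities; the same sequences are later restricted to curves. Boundary values are taken
    at [nrm x] for x in the ball, in accordance with [sphere_integral]. *)
Record AppF f v w c : Prop := MkAppF {
 af_s : forall n, smooth (f n);
 af_b : exists M, forall n x, cl_ball x -> `|f n x| <= M;
 af_m : mB v;
 af_mw : forall i, mB (w i);
 af_mc : mB (fun x => c (nrm x));
 af_c : aeB (fun x => f n x @[n --> \oo] --> v x);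
 af_cw : aeB (fun x => forall i, partial i (f n) x @[n --> \oo] --> w i x);
 af_d : exists2 G, L2B G & aeB (fun x => forall n i, `|partial i (f n) x| <= G x);
 af_t : aeB (fun x => f n (nrm x) @[n --> \oo] --> c (nrm x)) }.

Lemma mB_partial i u : smooth u -> mB (partial i u).
Proof. by move=> su; apply: mB_continuous; apply: smooth_continuous; exact: smooth_partial. Qed.

Lemma cvg_le_norm (a : nat -> R) l M : (forall n, `|a n| <= M) -> a n @[n --> \oo] --> l -> `|l| <= M.
Proof. by move=> H /cvg_norm C; apply: (cvgr_to_le C); exact: nearW. Qed.

Lemma af_Linf f v w c : AppF f v w c -> Linf v.
Proof.
move=> A; split; first exact: (af_m A).
have [M HM] := af_b A; exists M; apply: aeB_mono (af_c A) => x Bx; apply: cvg_le_norm => n.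
by apply: HM; exact: B1_cl_ball.
Qed.

Lemma af_L2 f v w c i : AppF f v w c -> L2B (w i).
Proof.
move=> A; have [G G2 HG] := af_d A; apply: (L2B_le (af_mw A i) G2).
by apply: aeB_mono2 (af_cw A) HG => x _ C D; apply: cvg_le_norm (C i) => n.
Qed.

Lemma af_cst (k : R) : AppF (fun _ _ => k) (fun=> k) (fun _ _ => 0) (fun=> k).
Proof.
split; try (by apply: aeB_all => x _; exact: cvg_cst); try (by move=> *; exact: measurable_cst); try exact: measurable_cst.
- by move=> _; exact: smooth_cst.
- by exists `|k|.
- by apply: aeB_all => x _ i; under eq_fun do rewrite partial_cst; exact: cvg_cst.
- exists (fun=> 0); first exact: (Linf_L2 (Linf_cst 0)).
 by apply: aeB_all => x _ n i; rewrite partial_cst normr0.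
Qed.

Lemma measurable_nrm : mfun nrm.
Proof.
have mi : mfun (fun x : R3 R => (enorm x)^-1).
 by apply: (measurableT_comp (@measurable_inv R)); apply: continuous_measurable_R3; exact: enorm_continuous.
have mc i : mfun (@coord R i) by apply: continuous_measurable_R3; exact: coord_continuous.
apply: measurable_fun_pair; first (apply: measurable_fun_pair).
- by apply: measurable_funM=> //; exact: (mc 0).
- by apply: measurable_funM=> //; exact: (mc 1).
- by apply: measurable_funM=> //; exact: (mc 2).
Qed.

Lemma mB_nrm u : mfun u -> mB (fun x => u (nrm x)).
Proof.
by move=> mu_; apply: measurable_funTS; apply: (measurableT_comp mu_); exact: measurable_nrm.
Qed.

Lemma af_smooth u : smooth u -> AppF (fun _ => u) u (fun i => partial i u) u.
Proof.
move=> su; split=> //.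
- have [M _ HM] := continuous_bounded_cl (smooth_continuous su); exists M => n x; exact: HM.
- by apply: mB_continuous; exact: smooth_continuous.
- by move=> i; exact: mB_partial.
- by apply: mB_nrm; apply: continuous_measurable_R3; exact: smooth_continuous.
- by apply: aeB_all => x _; exact: cvg_cst.
- by apply: aeB_all => x _ i; exact: cvg_cst.
- exists (fun x => \sum_i `|partial i u x|).
  by apply: L2B_sum => i; apply: L2B_norm; apply: Linf_L2; apply: Linf_continuous; exact/smooth_continuous/smooth_partial.
 by apply: aeB_all => x _ _ i; rewrite (bigD1 i)//= lerDl sumr_ge0.
- by apply: aeB_all => x _; exact: cvg_cst.
Qed.

Lemma af_add f v w c g v' w' c' : AppF f v w c -> AppF g v' w' c' ->
 AppF (fun n x => f n x + g n x) (fun x => v x + v' x) (fun i x => w i x + w' i x) (fun x => c x + c' x).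
Proof.
move=> F G; split.
- by move=> n; apply: smooth_add; [exact: (af_s F)|exact: (af_s G)].
- have [M HM] := af_b F; have [N HN] := af_b G; exists (M + N) => n x Bx.
 by apply: le_trans (ler_normD _ _) _; apply: lerD; [exact: HM|exact: HN].
- by apply: mB_add; [exact: (af_m F)|exact: (af_m G)].
- by move=> i; apply: mB_add; [exact: (af_mw F)|exact: (af_mw G)].
- by apply: mB_add; [exact: (af_mc F)|exact: (af_mc G)].
- by apply: aeB_mono2 (af_c F) (af_c G) => x _; exact: cvgD.
- apply: aeB_mono2 (af_cw F) (af_cw G) => x _ C D i.
 under eq_fun do rewrite (partialD _ _ (af_s F _) (af_s G _)).
 by apply: cvgD; [exact: C|exact: D].
- have [M M2 HM] := af_d F; have [N N2 HN] := af_d G; exists (fun x => M x + N x); first exact: L2B_add.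
 apply: aeB_mono2 HM HN => x _ C D n i; rewrite (partialD _ _ (af_s F _) (af_s G _)).
 by apply: le_trans (ler_normD _ _) _; apply: lerD.
- by apply: aeB_mono2 (af_t F) (af_t G) => x _; exact: cvgD.
Qed.

Lemma af_mul f v w c g v' w' c' : AppF f v w c -> AppF g v' w' c' ->
 AppF (fun n x => f n x*g n x) (fun x => v x * v' x) (fun i x => v x*w' i x + v' x*w i x) (fun x => c x*c' x).
Proof.
move=> F G; split.
- by move=> n; apply: smooth_mul; [exact: (af_s F)|exact: (af_s G)].
- have [M HM] := af_b F; have [N HN] := af_b G; exists (M*N) => n x Bx.
 by rewrite normrM ler_pM//; [exact: HM|exact: HN].
- by apply: mB_mul; [exact: (af_m F)|exact: (af_m G)].
- by move=> i; apply: mB_add; apply: mB_mul; [exact: (af_m F)|exact: (af_mw G)|exact: (af_m G)|exact: (af_mw F)].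
- by apply: mB_mul; [exact: (af_mc F)|exact: (af_mc G)].
- by apply: aeB_mono2 (af_c F) (af_c G) => x _; exact: cvgM.
- apply: aeB_mono2 (aeB_and (af_c F) (af_c G)) (aeB_and (af_cw F) (af_cw G)) => x _ [c1 c2] [C D] i.
 under eq_fun do rewrite (partialM _ _ (af_s F _) (af_s G _)).
 by apply: cvgD; apply: cvgM=> //; (exact: D || exact: C).
- have [M M2 HM] := af_d F; have [N N2 HN] := af_d G.
 have [K HK] := af_b F; have [L HL] := af_b G.
 exists (fun x => K*N x + L*M x); first by apply: L2B_add; exact: L2B_scale.
 apply: aeB_mono2 HM HN => x Bx C D n i; rewrite (partialM _ _ (af_s F _) (af_s G _)).
 apply: le_trans (ler_normD _ _) _; rewrite !normrM; apply: lerD; apply: ler_pM=> //.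
  by apply: HK; exact: B1_cl_ball.
 by apply: HL; exact: B1_cl_ball.
- by apply: aeB_mono2 (af_t F) (af_t G) => x _; exact: cvgM.
Qed.

Lemma af_scale k f v w c : AppF f v w c ->
 AppF (fun n x => k*f n x) (fun x => k * v x) (fun i x => k*w i x) (fun x => k*c x).
Proof.
move=> /(af_mul (af_cst k)); congr AppF; apply/funext => i; apply/funext => x.
by rewrite mulr0 addr0.
Qed.

Lemma af_sum (I : Type) (s : seq I) (f : I -> nat -> R3 R -> R)
 (v : I -> R3 R -> R) (w : I -> 'I_3 -> R3 R -> R) (c : I -> R3 R -> R) :
 (forall k : I, AppF (f k) (v k) (w k) (c k)) ->
 AppF (fun n x => \sum_(k <- s) f k n x) (fun x => \sum_(k <- s) v k x)
  (fun i x => \sum_(k <- s) w k i x) (fun x => \sum_(k <- s) c k x).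
Proof.
move=> H; elim: s=> [|k s IH].
 have := af_cst 0; congr AppF; [apply/funext => n| |apply/funext => i|];
  by apply/funext => x; rewrite big_nil.
have := af_add (H k) IH; congr AppF; [apply/funext => n| |apply/funext => i|];
 by apply/funext => x; rewrite big_cons.
Qed.

(** The lower bound 1 for [f n] makes the derivative of the inverse at most that of [f n], so the
    old majorant serves again. The same holds for the square root below. *)
Lemma af_inv f v w c : (forall n x, 1 <= f n x) -> AppF f v w c ->
 AppF (fun n x => (f n x)^-1) (fun x => (v x)^-1) (fun i x => - (v x)^-2*w i x) (fun x => (c x)^-1).
Proof.
move=> f1 F; have f0 n x : 0 < f n x by exact: lt_le_trans (f1 n x).
have l1 (a : nat -> R) (l : R) : (forall n, 1 <= a n) -> a n @[n --> \oo] --> l -> 1 <= l.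
 by move=> H C; apply: (cvgr_to_ge C); exact: nearW.
have i1 (t : R) : 1 <= t -> `|t^-1| <= 1 by move=> t1; rewrite ger0_norm ?invr_ge0 ?(le_trans _ t1)// invf_le1// (lt_le_trans _ t1).
have mV (u : R3 R -> R) : mB u -> mB (fun x => (u x)^-1).
 by move=> mu_; apply: (measurableT_comp (@measurable_inv R)).
split.
- by move=> n; apply: smooth_inv=> //; exact: (af_s F).
- by exists 1 => n x _; exact: i1.
- exact: mV (af_m F).
- move=> i; apply: mB_mul (af_mw F i); apply: measurableT_comp=> //.
 by rewrite (_ : (fun x => (v x)^-2) = fun x => (v x * v x)^-1); [apply: mV; apply: mB_mul; exact: (af_m F)|apply/funext => x; rewrite -expr2].
- exact: mV (af_mc F).
- apply: aeB_mono (af_c F) => x _ C; apply: cvgV=> //; have := l1 _ _ (fun n => f1 n x) C.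
 by move=> l0; rewrite gt_eqF// (lt_le_trans _ l0).
- apply: aeB_mono2 (af_c F) (af_cw F) => x _ C D i.
 under eq_fun do rewrite (partialV _ _ (af_s F _) (f0 _)).
 apply: cvgM; last exact: D; apply: cvgN; apply: cvgV.
  have l0 := l1 _ _ (fun n => f1 n x) C.
  by rewrite expf_neq0// gt_eqF// (lt_le_trans _ l0).
 by apply: (cvg_comp _ (fun t : R => t^+2) C); exact: exprn_continuous.
- have [G G2 HG] := af_d F; exists G=> //; apply: aeB_mono HG => x Bx C n i.
 rewrite (partialV _ _ (af_s F _) (f0 _)) mulNr normrN normrM.
 apply: le_trans (C n i); rewrite ler_piMl// -exprVn normrX exprn_ile1//; exact: i1.
- apply: aeB_mono (af_t F) => x _ C; apply: cvgV=> //; have l0 := l1 _ _ (fun n => f1 n _) C.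
 by rewrite gt_eqF// (lt_le_trans _ l0).
Qed.

Lemma af_sqrt f v w c : (forall n x, 1 <= f n x) -> AppF f v w c ->
 AppF (fun n x => sqrt (f n x)) (fun x => sqrt (v x)) (fun i x => (2*sqrt (v x))^-1*w i x)
  (fun x => sqrt (c x)).
Proof.
move=> f1 F; have f0 n x : 0 < f n x by exact: lt_le_trans (f1 n x).
have l1 (a : nat -> R) (l : R) : (forall n, 1 <= a n) -> a n @[n --> \oo] --> l -> 1 <= l.
 by move=> H C; apply: (cvgr_to_ge C); exact: nearW.
have s1 (t : R) : 1 <= t -> 1 <= sqrt t by move=> t1; rewrite -[1]sqrtr1 ler_sqrt// (le_trans ler01).
have i1 (t : R) : 1 <= t -> `|(2*sqrt t)^-1| <= 1.
 move=> t1; have := s1 _ t1; move: (sqrt t) => s h; rewrite ger0_norm ?invr_ge0; last lra.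
 by rewrite invf_le1; lra.
have mV (u : R3 R -> R) : mB u -> mB (fun x => sqrt (u x)).
 by move=> mu_; apply: (measurableT_comp (@measurable_sqrt R)).
have cS (a : nat -> R) l : a n @[n --> \oo] --> l -> sqrt (a n) @[n --> \oo] --> sqrt l.
 by move=> C; apply: (cvg_comp _ (@sqrt R) C); exact: sqrt_continuous.
split.
- by move=> n; apply: smooth_sqrt=> //; exact: (af_s F).
- have [M HM] := af_b F; exists (1 + M) => n x Bx; have := HM n x Bx; have := s1 _ (f1 n x); have := sqr_sqrtr (ltW (f0 n x)).
 move=> sa s1' aM; rewrite ger0_norm ?sqrtr_ge0//; move: aM; rewrite ger0_norm ?(ltW (f0 _ _))// => aM.
 by move: (f n x) (sqrt _) sa s1' aM => a t sa s1' aM; nra.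
- exact: mV (af_m F).
- move=> i; apply: mB_mul (af_mw F i); apply: (measurableT_comp (@measurable_inv R)).
 by apply: mB_mul; [exact: measurable_cst|exact: mV (af_m F)].
- exact: mV (af_mc F).
- by apply: aeB_mono (af_c F) => x _; exact: cS.
- apply: aeB_mono2 (af_c F) (af_cw F) => x _ C D i.
 under eq_fun do rewrite (partial_sqrt _ _ (af_s F _) (f0 _)).
 apply: cvgM; last exact: D; apply: cvgV.
  have l0 := s1 _ (l1 _ _ (fun n => f1 n x) C).
  by rewrite mulf_neq0// gt_eqF// (lt_le_trans _ l0).
 by apply: cvgM; [exact: cvg_cst|exact: cS].
- have [G G2 HG] := af_d F; exists G=> //; apply: aeB_mono HG => x Bx C n i.
 rewrite (partial_sqrt _ _ (af_s F _) (f0 _)) normrM.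
 by apply: le_trans (C n i); rewrite ler_piMl//; exact: i1.
- by apply: aeB_mono (af_t F) => x _; exact: cS.
Qed.

(** The product of [f n] with a test function is smooth with compact support, so its derivative has
    integral 0; the identity then passes to the limit. *)
Lemma af_weak f v w c i : AppF f v w c -> is_weak_partial B i v (w i).
Proof.
move=> F phi [sp [K [cK KB p0]]]; have [M HM] := af_b F; have [G G2 HG] := af_d F.
have lp : Linf phi by apply: Linf_continuous; exact: smooth_continuous.
have ldp : Linf (partial i phi) by apply: Linf_continuous; exact/smooth_continuous/smooth_partial.
have L1 : L1B (fun x => v x * partial i phi x) by apply: L1B_Linf; [exact: af_Linf F|exact: Linf_L1].
have L2 : L1B (fun x => w i x * phi x) by apply: L2B_mul; [exact: af_L2 F|exact: Linf_L2].
suff : IB (fun x => v x * partial i phi x + w i x * phi x) = 0.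
 by rewrite IBD// => /eqP; rewrite addr_eq0 => /eqP.
have [|||||_ _ C] := @dct_B R (fun n x => f n x * partial i phi x + partial i (f n) x * phi x)
 (fun x => v x * partial i phi x + w i x * phi x)
 (fun x => M * `|partial i phi x| + G x * `|phi x|).
- move=> n; apply: mB_add; apply: mB_mul; try (by apply: mB_partial=> //; exact: (af_s F));
  by apply: mB_continuous; apply: smooth_continuous=> //; exact: (af_s F).
- by apply: L1B_m; exact: L1B_add.
- apply: L1B_add; first by apply: L1B_scale; apply: L1B_norm; exact: Linf_L1.
 by apply: L2B_mul=> //; apply: L2B_norm; exact: Linf_L2.
- apply: aeB_mono2 (af_c F) (af_cw F) => x _ c1 c2; apply: cvgD; apply: cvgM=> //; exact: cvg_cst.
- apply: aeB_mono HG => x Bx H n; apply: le_trans (ler_normD _ _) _; rewrite !normrM.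
 apply: lerD; apply: ler_wpM2r=> //; by apply: HM; exact: B1_cl_ball.
apply: cvg_seq_cst C => n.
rewrite (_ : (fun x => _) = partial i (fun x => f n x * phi x)); last first.
 by apply/funext => x; rewrite partialM//; [rewrite [X in _ + X]mulrC|exact: (af_s F)].
apply: (integral_partial_cmpct _ _ cK KB); first by apply: smooth_mul=> //; exact: (af_s F).
by move=> x /p0 ->; rewrite mulr0.
Qed.

Lemma weak_unique i u v (g g' : R3 R -> R) : mB u -> mB v -> aeB (fun x => u x = v x) -> L2B g -> L2B g' ->
 is_weak_partial B i u g -> is_weak_partial B i v g' -> aeB (fun x => g x = g' x).
Proof.
move=> mu_ mv uv g2 g2' wu wv.
have : aeB (fun x => g x - g' x = 0).
 apply: fund_lemma; first by apply: L1B_sub; exact: L2B_L1.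
 move=> phi tp; have [sp _] := tp.
 have lp : Linf phi by apply: Linf_continuous; exact: smooth_continuous.
 rewrite (_ : (fun x => _) = fun x => g x * phi x - g' x * phi x); last by apply/funext => x; rewrite mulrBl.
 rewrite IBB; try (by apply: L2B_mul=> //; exact: Linf_L2).
 have E : IB (fun x => u x * partial i phi x) = IB (fun x => v x * partial i phi x).
  apply: IB_ae_eq; try (by apply: mB_mul=> //; exact: mB_partial).
  by apply: aeB_mono uv => x _ ->.
 have := wu _ tp; have := wv _ tp; rewrite -!/(IB _) E=> -> /oppr_inj ->; exact: subrr.
by apply: aeB_mono => x _ /eqP; rewrite subr_eq0 => /eqP.
Qed.

Lemma weak_partialP i u : W12 B u -> L2B (weak_partial B i u) /\ is_weak_partial B i u (weak_partial B i u).
Proof.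
move=> [_ /(_ i) [g g2 wg]].
have [] : [set g | L2 B g /\ is_weak_partial B i u g] (weak_partial B i u).
 by apply: getPex; exists g.
by move=> /L2_L2B.
Qed.

Lemma af_W12 f v w c u : AppF f v w c -> mB u -> aeB (fun x => u x = v x) -> W12 B u.
Proof.
move=> F mu_ uv; split.
 apply/L2_L2B; apply: (L2B_le mu_ (L2B_norm (Linf_L2 (af_Linf F)))).
 by apply: aeB_mono uv => x _ ->.
move=> i; exists (w i); first by apply/L2_L2B; exact: af_L2 F.
move=> phi tp; rewrite -(af_weak i F tp); apply: IB_ae_eq.
- by apply: mB_mul=> //; apply: mB_partial; case: tp.
- by apply: mB_mul; [exact: (af_m F)|apply: mB_partial; case: tp].
- by apply: aeB_mono uv => x _ ->.
Qed.

(** Two weak derivatives of almost everywhere equal functions agree almost everywhere, by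
    [fund_lemma]; this identifies the chosen representative [weak_partial]. *)
Lemma af_weak_partial f v w c u i : AppF f v w c -> mB u -> aeB (fun x => u x = v x) ->
 aeB (fun x => weak_partial B i u x = w i x).
Proof.
move=> F mu_ uv; have [g2 wg] := weak_partialP i (af_W12 F mu_ uv).
exact: (weak_unique mu_ (af_m F) uv g2 (af_L2 i F) wg (af_weak i F)).
Qed.

Lemma dct_sq (h : nat -> R3 R -> R) (g : R3 R -> R) : (forall n, mB (h n)) -> L2B g ->
 aeB (fun x => h n x @[n --> \oo] --> (0 : R)) -> aeB (fun x => forall n, `|h n x| <= g x) ->
 (\int[mu]_(x in B) ((h n x)^+2)%:E)%E @[n --> \oo] --> 0%E.
Proof.
move=> mh [mg g2] ch dh.
have [|||||_ C _] := @dct_B R (fun n x => h n x^+2) (fun=> 0) (fun x => g x^+2)=> //.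
- by move=> n; apply: measurable_funX; exact: mh.
- exact: measurable_cst.
- apply: aeB_mono ch => x _ c; rewrite [X in _ --> X](_ : 0 = 0^+2 :> R); last by rewrite expr0n.
 by apply: (cvg_comp _ (fun t : R => t^+2) c); exact: exprn_continuous.
- apply: aeB_mono dh => x _ H n; rewrite normrX ler_pXn2r// nnegrE ?normr_ge0//.
 exact: le_trans (H n).
move: C; under eq_cvg do under eq_integral do rewrite subr0 ger0_norm ?sqr_ge0//.
by [].
Qed.

(** The approximating sequence itself is the one that [has_trace] asks for; its three limits are
    instances of dominated convergence. *)
Lemma af_trace f v w c u b : AppF f v w c -> mB u -> aeB (fun x => u x = v x) ->
 (forall x, enorm x != 0 -> b (nrm x) = c (nrm x)) -> mB (fun x => b (nrm x)) ->
 aeB (fun x : R3 R => enorm x != 0) -> has_trace u b.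
Proof.
move=> F mu_ uv bc mb x0; have [M HM] := af_b F; have [G G2 HG] := af_d F.
have M2 : L2B (fun=> M + M) := Linf_L2 (Linf_cst (M + M)).
have mf n : mB (f n) by apply: mB_continuous; apply: smooth_continuous; exact: (af_s F).
exists f; split.
- exact: (af_s F).
- apply: (dct_sq _ M2).
 + by move=> n; apply: measurable_funB; [exact: mf|exact: mu_].
 + by apply: aeB_mono2 (af_c F) uv => x _ C ->; rewrite -(subrr (v x)); apply: cvgB=> //; exact: cvg_cst.
 + apply: aeB_mono2 (af_c F) uv => x Bx C -> n; apply: le_trans (ler_normB _ _) _.
  have H k : `|f k x| <= M by apply: HM; exact: B1_cl_ball.
  by apply: lerD=> //; exact: cvg_le_norm H C.
- move=> i; have wE := af_weak_partial i F mu_ uv; have [wp2 _] := weak_partialP i (af_W12 F mu_ uv).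
 apply: (dct_sq _ (L2B_add G2 G2)).
 + by move=> n; apply: measurable_funB; [apply: mB_partial; exact: (af_s F)|case: wp2].
 + apply: aeB_mono2 (af_cw F) wE => x _ /(_ i) C ->.
  by rewrite -(subrr (w i x)); apply: cvgB=> //; exact: cvg_cst.
 + apply: aeB_mono2 (aeB_and (af_cw F) HG) wE => x _ [/(_ i) C H] -> n.
  apply: le_trans (ler_normB _ _) _; apply: lerD=> //.
  by apply: cvg_le_norm C => k.
- rewrite /sphere_integral -[X in _ --> X](mule0 3%:E).
 apply: cvgeZl=> //; apply: (dct_sq (h := fun n x => f n (nrm x) - b (nrm x)) _ M2).
 + move=> n; apply: measurable_funB=> //; apply: mB_nrm; apply: continuous_measurable_R3.
  by apply: smooth_continuous; exact: (af_s F).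
 + apply: aeB_mono2 (af_t F) x0 => x _ C /bc ->.
  by rewrite -(subrr (c (nrm x))); apply: cvgB=> //; exact: cvg_cst.
 + apply: aeB_mono2 (af_t F) x0 => x Bx C /bc -> n; apply: le_trans (ler_normB _ _) _.
  have H k : `|f k (nrm x)| <= M by apply: HM; exact: nrm_cl.
  by apply: lerD=> //; exact: cvg_le_norm H C.
Qed.

End Approximation.

(** * Orthonormal coordinates on symmetric traceless matrices *)

Section Coordinates.
Variable R : realType.
Implicit Types (v : 'I_5 -> R) (A : 'M[R]_3).

Definition ebasis (k : 'I_5) : 'M[R]_3 := [:: e0 R; e11 R; e12 R; e21 R; e22 R]`_k.

Definition Mv v : 'M[R]_3 := \sum_k v k *: ebasis k.

Definition coords A (k : 'I_5) : R := \sum_i \sum_j ebasis k i j*A i j.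

Lemma big_I5 (V : nmodType) (F : 'I_5 -> V) : \sum_k F k = F 0 + F 1 + F 2 + F 3 + F 4.
Proof.
rewrite !big_ord_recr big_ord0 /= add0r; congr (F _ + F _ + F _ + F _ + F _); exact: val_inj.
Qed.

Lemma I5_case (P : 'I_5 -> Prop) : P 0 -> P 1 -> P 2 -> P 3 -> P 4 -> forall i, P i.
Proof.
move=> p0 p1 p2 p3 p4 [[|[|[|[|[|//]]]]] ii]; [move: p0|move: p1|move: p2|move: p3|move: p4];
 by congr P; exact: val_inj.
Qed.

Definition row3 (a b c : R) (j : 'I_3) : R := [:: a; b; c]`_j.
Definition mat33 (a b c d e f g h k : R) : 'M[R]_3 :=
 \matrix_(i, j) (nth (fun=> 0) [:: row3 a b c; row3 d e f; row3 g h k] i) j.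

Lemma matrix3P A (B : 'M[R]_3) : (forall i j, A i j = B i j) -> A = B.
Proof. by move=> H; apply/matrixP. Qed.

Lemma mat33E a b c d e f g h k : let M := mat33 a b c d e f g h k in
 (M 0 0 = a)*(M 0 1 = b)*(M 0 2 = c)*(M 1 0 = d)*(M 1 1 = e)*(M 1 2 = f)
 * (M 2 0 = g)*(M 2 1 = h)*(M 2 2 = k).
Proof. by move=> M; rewrite /M /mat33 !mxE. Qed.

Lemma mat3_eta A : A = mat33 (A 0 0) (A 0 1) (A 0 2) (A 1 0) (A 1 1) (A 1 2) (A 2 0) (A 2 1) (A 2 2).
Proof. by apply/matrixP; apply: I3_case; apply: I3_case; rewrite mat33E. Qed.

Local Notation a6 := ((sqrt 6)^-1 : R).
Local Notation b2 := ((sqrt 2)^-1 : R).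

Lemma a6sq : a6*a6 = 6^-1.
Proof. by rewrite -invfM -expr2 sqr_sqrtr. Qed.
Lemma b2sq : b2*b2 = 2^-1.
Proof. by rewrite -invfM -expr2 sqr_sqrtr. Qed.

Lemma ebasisE k : ebasis k =
 [:: mat33 (- a6) 0 0 0 (- a6) 0 0 0 (2*a6); mat33 0 0 b2 0 0 0 b2 0 0; mat33 0 0 0 0 0 b2 0 b2 0;
   mat33 b2 0 0 0 (- b2) 0 0 0 0; mat33 0 b2 0 b2 0 0 0 0 0]`_k.
Proof.
move: k; apply: I5_case; apply/matrixP; apply: I3_case; apply: I3_case; rewrite /ebasis /= mat33E
/e0 /e11 /e12 /e21 /e22 !mxE /= ?(mulr0, mulr1, subr0, add0r, addr0, sub0r, mulrN) //; exact: mulrC.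
Qed.

Lemma MvE v : Mv v = mat33
 (- a6 * v 0 + b2 * v 3) (b2 * v 4) (b2 * v 1)
 (b2 * v 4) (- a6 * v 0 - b2 * v 3) (b2 * v 2)
 (b2 * v 1) (b2 * v 2) (2*a6 * v 0).
Proof.
apply/matrixP; apply: I3_case; apply: I3_case;
rewrite mat33E /Mv big_I5 !ebasisE !mxE /=; rewrite /row3 /=; ring.
Qed.

Lemma sqnormQE A : sqnormQ A = \sum_i \sum_j A i j*A j i.
Proof. by rewrite /sqnormQ /mxtrace; apply: eq_bigr => i _; rewrite expr2 mxE. Qed.

Lemma sqnormQ_Mv v : sqnormQ (Mv v) = \sum_k v k^+2.
Proof.
rewrite sqnormQE !big_I3 MvE !mat33E !big_I5.
have A := a6sq; have B := b2sq; set a := a6 in A *; set b := b2 in B *.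
transitivity (6*(a*a) * v 0^+2 + 2*(b*b)*(v 1^+2 + v 2^+2 + v 3^+2 + v 4^+2)); first by ring.
by rewrite A B; field.
Qed.

Lemma coordsE A : (coords A 0 = a6*(2*A 2 2 - A 0 0 - A 1 1))*(coords A 1 = b2*(A 0 2 + A 2 0))
 * (coords A 2 = b2*(A 1 2 + A 2 1))*(coords A 3 = b2*(A 0 0 - A 1 1))*(coords A 4 = b2*(A 0 1 + A 1 0)).
Proof. by do !split; rewrite /coords !big_I3 ebasisE /= !mat33E; ring. Qed.

Lemma coordsK A : S0 A -> Mv (coords A) = A.
Proof.
move=> [symA trA]; rewrite [RHS]mat3_eta MvE !coordsE.
have S i j : A j i = A i j by rewrite -[in LHS]symA mxE.
have T : A 2 2 = - A 0 0 - A 1 1.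
 by move: trA; rewrite /mxtrace big_I3 => E; rewrite -[RHS]addr0 -E; ring.
rewrite (S 0 1) (S 0 2) (S 1 2) T.
have Aq := a6sq; have B := b2sq; set a := a6 in Aq *; set b := b2 in B *.
move: (A 0 0) (A 0 1) (A 0 2) (A 1 1) (A 1 2) => p q r s t.
have bb (y : R) : b*(b*y) = y/2 by rewrite mulrA B; field.
have aa (y : R) : a*(a*y) = y/6 by rewrite mulrA Aq; field.
congr (mat33 _ _ _ _ _ _ _ _ _).
- transitivity (- (a*(a*(2*(- p - s) - p - s))) + b*(b*(p - s))); first by ring.
 by rewrite aa bb; field.
- by transitivity (b*(b*(2*q))); [ring|rewrite bb; field].
- by transitivity (b*(b*(2*r))); [ring|rewrite bb; field].
- by transitivity (b*(b*(2*q))); [ring|rewrite bb; field].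
- transitivity (- (a*(a*(2*(- p - s) - p - s))) - b*(b*(p - s))); first by ring.
 by rewrite aa bb; field.
- by transitivity (b*(b*(2*t))); [ring|rewrite bb; field].
- by transitivity (b*(b*(2*r))); [ring|rewrite bb; field].
- by transitivity (b*(b*(2*t))); [ring|rewrite bb; field].
- transitivity (2*(a*(a*(2*(- p - s) - p - s)))); first by ring.
 by rewrite aa; field.
Qed.

Lemma coords_Mv v k : coords (Mv v) k = v k.
Proof.
have Aq := a6sq; have B := b2sq; set a := a6 in Aq *; set b := b2 in B *.
have bb (y : R) : b*(b*y) = y/2 by rewrite mulrA B; field.
have aa (y : R) : a*(a*y) = y/6 by rewrite mulrA Aq; field.
move: k; apply: I5_case; rewrite coordsE MvE !mat33E -/a -/b.
- by transitivity (a*(a*(6 * v 0))); [ring|rewrite aa; field].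
- by transitivity (b*(b*(2 * v 1))); [ring|rewrite bb; field].
- by transitivity (b*(b*(2 * v 2))); [ring|rewrite bb; field].
- by transitivity (b*(b*(2 * v 3))); [ring|rewrite bb; field].
- by transitivity (b*(b*(2 * v 4))); [ring|rewrite bb; field].
Qed.

Lemma Mv_S0 v : S0 (Mv v).
Proof.
split; first by apply/matrixP; apply: I3_case; apply: I3_case; rewrite mxE MvE !mat33E.
by rewrite /mxtrace big_I3 MvE !mat33E; ring.
Qed.

Lemma Mv_S4 v : \sum_k v k^+2 = 1 -> S4 (Mv v).
Proof. by move=> E; split; [exact: Mv_S0|rewrite sqnormQ_Mv]. Qed.

Lemma Mv_ij v i j : Mv v i j = \sum_k ebasis k i j * v k.
Proof. by rewrite /Mv summxE; apply: eq_bigr => k _; rewrite mxE mulrC. Qed.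

Definition tau (k l m : 'I_5) : R := \tr (ebasis k *m ebasis l *m ebasis m).
(** The trilinear form whose restriction to the diagonal is tr(Q^3). It turns the potential along u
    + s xi into an explicit cubic polynomial in s. *)
Definition tri (u v w : 'I_5 -> R) : R := \sum_k \sum_l \sum_m tau k l m*(u k * v l*w m).

Lemma tr3_Mv v : \tr (Mv v^+3) = tri v v v.
Proof.
rewrite exprS expr2 mulrA /tri {1 2 3}/Mv.
rewrite -[_ * _ * _]/(_ *m _ *m _) mulmx_suml mulmx_suml raddf_sum /=; apply: eq_bigr => k _.
rewrite [X in X *m _]mulmx_sumr mulmx_suml raddf_sum /=; apply: eq_bigr => l _.
rewrite mulmx_sumr raddf_sum /=; apply: eq_bigr => m _.
rewrite -!scalemxAl -!scalemxAr -!scalemxAl !mxtraceZ /tau; ring.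
Qed.

Definition nrm5 (v : 'I_5 -> R) : R := sqrt (\sum_k v k^+2).

Lemma nrm5_ge0 v : 0 <= nrm5 v. Proof. exact: sqrtr_ge0. Qed.
Lemma sqr_nrm5 v : nrm5 v^+2 = \sum_k v k^+2.
Proof. by rewrite sqr_sqrtr// sumr_ge0// => k _; exact: sqr_ge0. Qed.
Lemma le_nrm5 v k : `|v k| <= nrm5 v.
Proof.
rewrite -(@ler_pXn2r R 2)// ?nnegrE ?nrm5_ge0// sqr_nrm5 real_normK ?num_real//.
by rewrite (bigD1 k)//= lerDl sumr_ge0// => l _; exact: sqr_ge0.
Qed.

(** A crude bound for the norm of [tri]. It enters the coefficient of the lower order terms, to
    which the cut-off is adapted. *)
Definition Ktau : R := \sum_k \sum_l \sum_m `|tau k l m|.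

Lemma Ktau_ge0 : 0 <= Ktau.
Proof. by rewrite /Ktau; do 3 (apply: sumr_ge0 => ? _). Qed.

Lemma tri_le (u v w : 'I_5 -> R) : `|tri u v w| <= Ktau*(nrm5 u * nrm5 v * nrm5 w).
Proof.
rewrite /tri /Ktau mulr_suml; apply: le_trans (ler_norm_sum _ _ _) _; apply: ler_sum => k _.
rewrite mulr_suml; apply: le_trans (ler_norm_sum _ _ _) _; apply: ler_sum => l _.
rewrite mulr_suml; apply: le_trans (ler_norm_sum _ _ _) _; apply: ler_sum => m _.
rewrite !normrM; apply: ler_wpM2l=> //.
by apply: ler_pM; rewrite ?mulr_ge0 ?nrm5_ge0 ?le_nrm5//; apply: ler_pM; rewrite ?le_nrm5.
Qed.

Definition Wv v : R := (3*sqrt 6)^-1*(1 - sqrt 6*tri v v v).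

Lemma W_Mv v : W (Mv v) = Wv v.
Proof. by rewrite /W /betat tr3_Mv. Qed.

End Coordinates.

(** * Extraction of dominated subsequences *)

Section RieszFischer.
Variable R : realType.
Local Notation B := (@B1 R).
Local Notation mu := (vol R).

(** H is the sum of the 2^n E_n, whose integral is at most the sum of the 2^(-n); each single term
    of the sum gives E_n <= 2^(-n) H. *)
Lemma RF_series (E : nat -> R3 R -> R) : (forall n, mB (E n)) -> (forall n x, 0 <= E n x) ->
 (forall n, (\int[mu]_(x in B) (E n x)%:E <= ((4^-1)^+n)%:E)%E) ->
 exists2 H : R3 R -> R, L1B H & aeB (fun x => forall n, E n x <= (2^-1)^+n*H x).
Proof.
move=> mE E0 EI; pose a n x : R := 2^+n*E n x.
pose S x : \bar R := (\sum_(0 <= n <oo) (a n x)%:E)%E.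
have ma n : measurable_fun B (fun x => (a n x)%:E).
 by apply: mB_EFin; apply: mB_mul; [exact: measurable_cst|exact: mE].
have a0 n x : (0 <= (a n x)%:E)%E by rewrite lee_fin mulr_ge0.
have mS : measurable_fun B S.
 exact: ge0_emeasurable_sum.
have S0 x : (0 <= S x)%E by apply: nneseries_ge0.
have IS : (\int[mu]_(x in B) S x < +oo)%E.
 rewrite /S (integral_nneseries mu (@measurable_B1 R)) //.
 have le n : (\int[mu]_(x in B) (a n x)%:E <= ((2^-1)^+n)%:E)%E.
  rewrite /a; under eq_integral do rewrite EFinM.
  rewrite ge0_integralZl//; try (by apply: mB_EFin; exact: mE); try (by move=> x _; rewrite lee_fin).
  apply: le_trans (lee_pmul _ _ (lexx _) (EI n)) _; rewrite ?lee_fin//.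
   by apply: integral_ge0 => x _; rewrite lee_fin.
  by rewrite -exprMn (_ : 2*4^-1 = 2^-1)//; field.
 apply: le_lt_trans (lee_nneseries _ (fun n _ => le n)) _=> //.
  by move=> n _ _; apply: integral_ge0 => x _.
 have -> : (\sum_(0 <= n <oo) ((2^-1 : R)^+n)%:E = (2/2^+0)%:E)%E.
  have EE n : ((2^-1 : R)^+n)%:E = (2/(2 ^ (n + 1))%:R)%:E.
   by congr EFin; rewrite natrX exprVn exprD expr1 invfM mulrCA divff ?mulr1.
  under eq_eseriesr do rewrite EE.
  by apply/cvg_lim=> //; exact: (@cvg_geometric_eseries_half R 2 0).
 by rewrite ltry.
have SF : aeB (fun x => S x \is a fin_num).
 have Si : mu.-integrable B S.
  apply/integrableP; split=> //; under eq_integral do rewrite gee0_abs//.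
  exact: IS.
 by have := integrable_ae (@measurable_B1 R) Si.
exists (fun x => fine (S x)).
 have : mu.-integrable B (EFin \o (fine \o S)).
  apply/integrableP; split.
   by apply: mB_EFin; apply: measurableT_comp=> //.
  apply: le_lt_trans IS; apply: ge0_le_integral=> //.
  - by apply: measurableT_comp=> //; apply: mB_EFin; apply: measurableT_comp.
  - move=> x _ /=; case: (S x) (S0 x)=> [r||] //=; rewrite ?lee_fin => r0; first by rewrite ger0_norm.
   by rewrite normr0.
 by [].
apply: aeB_mono SF => x _ Sf n.
have : ((a n x)%:E <= S x)%E.
 rewrite /S (@nneseriesD1 _ _ n)//.
 by rewrite leeDl// nneseries_ge0.
rewrite -(fineK Sf) lee_fin /a => h.
by rewrite exprVn ler_pdivlMl ?exprn_gt0.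
Qed.

(** Convergence to 0 in L^1 of finitely many sequences gives a common subsequence with an integrable
    majorant and a geometric rate, hence both pointwise convergence and domination at once. *)
Lemma RF (I : finType) (E : I -> nat -> R3 R -> R) : (forall i n, mB (E i n)) -> (forall i n x, 0 <= E i n x) ->
 (forall i, (\int[mu]_(x in B) (E i n x)%:E)%E @[n --> \oo] --> 0%E) ->
 exists (k : nat -> nat) (H : R3 R -> R), [/\ L1B H, aeB (fun x => 0 <= H x) &
  aeB (fun x => forall i n, E i (k n) x <= (2^-1)^+n*H x)].
Proof.
move=> mE E0 EI.
have /choice[k Hk] : forall n, exists k : nat, forall i, (\int[mu]_(x in B) (E i k x)%:E <= ((4^-1)^+n)%:E)%E.
 move=> n.
 have : \forall m \near \oo, forall i, (\int[mu]_(x in B) (E i m x)%:E <= ((4^-1)^+n)%:E)%E.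
  apply: filter_forall => i; move: (EI i) => /fine_cvgP[Fi Ci].
  have : \forall m \near \oo, fine (\int[mu]_(x in B) (E i m x)%:E)%E <= (4^-1)^+n.
   by apply: (cvgr_le _ Ci); rewrite exprn_gt0.
  by apply: filterS2 Fi => m f le; rewrite -(fineK f) lee_fin.
 by move=> [N _ HN]; exists N; apply: HN => /=.
have /choice[H HH] : forall i, exists H : R3 R -> R, L1B H /\ aeB (fun x => forall n, E i (k n) x <= (2^-1)^+n*H x).
 move=> i.
 have [||n|h h1 h2] := @RF_series (fun n => E i (k n)); first (by move=> n; exact: mE); first (by move=> n x; exact: E0); first exact: Hk.
 by exists h.
have H0 i : aeB (fun x => 0 <= H i x).
 have [_] := HH i; apply: aeB_mono => x _ /(_ 0%N); rewrite expr0 mul1r; exact: le_trans.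
exists k, (fun x => \sum_i H i x); split.
- by apply: L1B_sum => i; case: (HH i).
- by have := aeB_forall H0; apply: aeB_mono => x _ h; exact: sumr_ge0.
- have := aeB_and (aeB_forall H0) (aeB_forall (fun i => (HH i).2)); apply: aeB_mono => x _ [h0 h] i n.
 apply: le_trans (h i n) _; rewrite ler_wpM2l ?exprn_ge0 ?invr_ge0//.
 by rewrite (bigD1 i)//= lerDl sumr_ge0.
Qed.

End RieszFischer.

(** * From admissible maps to smooth approximations and back *)

Section Admissible.
Variable R : realType.
Local Notation B := (@B1 R).
Local Notation mu := (vol R).
Implicit Types (Q b : R3 R -> 'M[R]_3).

Definition dens (lam : R) (v : 'I_5 -> R3 R -> R) (w : 'I_5 -> 'I_3 -> R3 R -> R) (x : R3 R) : R :=
 2^-1*(\sum_i \sum_k w k i x^+2) + lam*Wv (fun k => v k x).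

Definition AppV (f : 'I_5 -> nat -> R3 R -> R) v w (c : 'I_5 -> R3 R -> R) :=
 forall k, AppF (f k) (v k) (w k) (c k).

Lemma Linf_tri (u v w : 'I_5 -> R3 R -> R) : (forall k, Linf (u k)) -> (forall k, Linf (v k)) -> (forall k, Linf (w k)) ->
 Linf (fun x => tri (fun k => u k x) (fun k => v k x) (fun k => w k x)).
Proof.
move=> hu hv hw; apply: Linf_sum => k; apply: Linf_sum => l; apply: Linf_sum => m.
by apply: Linf_mul; [exact: Linf_cst|apply: Linf_mul=> //; exact: Linf_mul].
Qed.

Lemma Linf_Wv (v : 'I_5 -> R3 R -> R) : (forall k, Linf (v k)) -> Linf (fun x => Wv (fun k => v k x)).
Proof.
move=> hv; apply: Linf_mul; first exact: Linf_cst.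
apply: Linf_add; first exact: Linf_cst.
by apply: Linf_opp; apply: Linf_mul; [exact: Linf_cst|exact: Linf_tri].
Qed.

Lemma L1_dens lam f v w c : AppV f v w c -> L1B (dens lam v w).
Proof.
move=> A; apply: L1B_add; last first.
 by apply: L1B_scale; apply: Linf_L1; apply: Linf_Wv => k; exact: af_Linf (A k).
apply: L1B_scale; apply: L1B_sum => i; apply: L1B_sum => k.
by have [] := af_L2 i (A k).
Qed.

Lemma ae_enorm_neq0 : aeB (fun x : R3 R => enorm x != 0).
Proof.
exists (([set 0] `*` [set 0]) `*` [set (0 : R)]); split.
- by apply: measurableX; [apply: measurableX|]; exact: measurable_set1.
- rewrite product_measure1E//; last exact: measurableX.
 by set m := (X in (_*X)%E); have -> : m = 0%E; [exact: lebesgue_measure_set1|rewrite mule0].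
move=> x /= /not_implyP [Bx /negP/negPn/eqP e0].
have H i : coord i x = 0 by have := coord_le_enorm i x; rewrite e0 normr_le0 => /eqP.
by split; [split|]; [exact: (H 0)|exact: (H 1)|exact: (H 2)].
Qed.

Lemma energy_app lam f v w c Q : AppV f v w c -> (forall i j, mB (fun x => Q x i j)) ->
 aeB (fun x => Q x = Mv (fun k => v k x)) -> energy lam Q = (IB (dens lam v w))%:E.
Proof.
move=> A mQ QE; rewrite -IB_EFin; last exact: L1_dens A.
have AQ i j := af_sum (index_enum 'I_5) (fun k => af_scale (ebasis R k i j) (A k)).
have wE i j l : aeB (fun x => weak_partial B l (fun y => Q y i j) x = \sum_k ebasis R k i j*w k l x).
 apply: (af_weak_partial l (AQ i j)); first exact: mQ.
 by apply: aeB_mono QE => x _ ->; rewrite Mv_ij.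
have E : aeB (fun x => forall l, weak_partialQ l Q x = Mv (fun k => w k l x)).
 have := aeB_forall (fun i => aeB_forall (fun j => aeB_forall (wE i j))).
 by apply: aeB_mono => x _ H l; apply/matrixP => i j; rewrite mxE Mv_ij H.
rewrite /energy.
have mw i j l : mB (weak_partial B l (fun y => Q y i j)).
 have W : W12 B (fun y => Q y i j).
  by apply: (af_W12 (AQ i j)); [exact: mQ|apply: aeB_mono QE => x _ ->; rewrite Mv_ij].
 by have [[]] := weak_partialP l W.
apply: ae_eq_integral=> //.
- apply: mB_EFin; apply: mB_add.
  apply: mB_mul; first exact: measurable_cst.
  rewrite (_ : (fun x => _) = fun x => \sum_k \sum_i \sum_j weak_partial B k (fun y => Q y i j) x*weak_partial B k (fun y => Q y j i) x).
   by do 3 (apply: mB_sum => ?); apply: mB_mul; exact: mw.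
  apply/funext => x; apply: eq_bigr => k _; rewrite sqnormQE; apply: eq_bigr => i _; apply: eq_bigr => j _.
  by rewrite !mxE.
 apply: mB_mul; first exact: measurable_cst.
 apply: mB_mul; first exact: measurable_cst.
 apply: mB_add; first exact: measurable_cst.
 apply: measurableT_comp=> //; apply: mB_mul; first exact: measurable_cst.
 rewrite (_ : (fun x => _) = fun x => \sum_i \sum_j Q x i j * \sum_k Q x j k*Q x k i).
  by apply: mB_sum => i; apply: mB_sum => j; apply: mB_mul; [exact: mQ|]; apply: mB_sum => k; apply: mB_mul; exact: mQ.
 apply/funext => x; rewrite /mxtrace; apply: eq_bigr => i _; rewrite exprS expr2 mxE.
 by apply: eq_bigr => j _; rewrite mxE.
- by apply: mB_EFin; apply: L1B_m; exact: L1_dens A.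
- move: (aeB_and E QE); rewrite /aeB /ae_eq; apply: filterS => x H Bx; have [{}E {}QE] := H Bx.
 congr EFin; rewrite /dens QE W_Mv; congr (_ * _ + _).
 by apply: eq_bigr => l _; rewrite E sqnormQ_Mv.
Qed.

Lemma adm_of_app f v w c b : AppV f v w c -> aeB (fun x => \sum_k v k x^+2 = 1) ->
 (forall x, enorm x != 0 -> b (nrm x) = Mv (fun k => c k (nrm x))) ->
 (forall i j, mB (fun x => b (nrm x) i j)) ->
 admissible b (fun x => Mv (fun k => v k x)).
Proof.
move=> A v1 bc mb.
have AQ i j := af_sum (index_enum 'I_5) (fun k => af_scale (ebasis R k i j) (A k)).
have mQ i j : mB (fun x => Mv (fun k => v k x) i j).
 rewrite (_ : (fun x => _) = fun x => \sum_k ebasis R k i j * v k x); last by apply/funext => x; rewrite Mv_ij.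
 exact: (af_m (AQ i j)).
have vE i j : aeB (fun x => Mv (fun k => v k x) i j = \sum_k ebasis R k i j * v k x).
 by apply: aeB_all => x _; rewrite Mv_ij.
split.
- move=> i j; exact: (af_W12 (AQ i j) (mQ i j) (vE i j)).
- by move: v1; rewrite /aeB; apply: filterS => x H /H; exact: Mv_S4.
- move=> i j; apply: (af_trace (AQ i j) (mQ i j) (vE i j))=> //; last exact: ae_enorm_neq0.
 by move=> x x0; rewrite bc// Mv_ij.
Qed.

Lemma cvg_sumr (J : Type) (s : seq J) (a : J -> nat -> R) (l : J -> R) :
 (forall j, a j n @[n --> \oo] --> l j) ->
 \sum_(j <- s) a j n @[n --> \oo] --> \sum_(j <- s) l j.
Proof.
move=> C; elim: s=> [|j s IH].
 by rewrite big_nil; under eq_fun do rewrite big_nil; exact: cvg_cst.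
by rewrite big_cons; under eq_fun do rewrite big_cons; exact: cvgD.
Qed.

Lemma cvg_sqrr (a : nat -> R) (l : R) : a n @[n --> \oo] --> l -> a n^+2 @[n --> \oo] --> l^+2.
Proof. by move=> C; apply: (cvg_comp _ (fun t : R => t^+2) C); exact: exprn_continuous. Qed.

Lemma sqr_le_le (p q : R) : 0 <= p -> 0 <= q -> p^+2 <= q^+2 -> p <= q.
Proof. by move=> p0 q0; rewrite ler_pXn2r. Qed.

(** The expression is the derivative of 2 y_k / (1 + |y|^2) in the direction d, so the estimate says
    that this map of R^5 is globally Lipschitz. Here 22 = 2 + 5 * 4, from the quotient and from the
    five terms of the inner product. *)
Lemma bounded_rational (y d : 'I_5 -> R) (G : R) k : (forall l, `|d l| <= G) ->
 forall S, S = \sum_l y l^+2 ->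
 `|2*d k/(1 + S) - 2*y k*(\sum_l 2*(y l*d l))/(1 + S)^+2| <= 22*G.
Proof.
move=> dG S SE; have G0 : 0 <= G := le_trans (normr_ge0 _) (dG 0).
have S0 : 0 <= S by rewrite SE; apply: sumr_ge0 => l _; exact: sqr_ge0.
have P l m : `|y l| * `|y m| <= S.
 have yS p : y p^+2 <= S by rewrite SE (bigD1 p)//= lerDl sumr_ge0// => q _; exact: sqr_ge0.
 have := yS l; have := yS m; rewrite -(real_normK (num_real (y l))) -(real_normK (num_real (y m))).
 by move: (`|y l|) (`|y m|) => p q h1 h2; have := sqr_ge0 (p - q); nra.
have i1 : `|(1 + S)^-1| <= 1 by rewrite ger0_norm ?invr_ge0 ?invf_le1; lra.
apply: le_trans (ler_normB _ _) _.
have A1 : `|2*d k/(1 + S)| <= 2*G.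
 rewrite normrM -[leRHS]mulr1; apply: ler_pM=> //; rewrite normrM ger0_norm//; exact: ler_wpM2l.
have A2 : `|2*y k*(\sum_l 2*(y l*d l))/(1 + S)^+2| <= 20*G.
 rewrite mulr_sumr normrM; apply: (@le_trans _ _ ((20*S*G) * `|(1 + S) ^- 2|)).
  apply: ler_wpM2r=> //; apply: le_trans (ler_norm_sum _ _ _) _.
  have -> : 20*S*G = \sum_(l < 5) (4*S*G) by rewrite sumr_const card_ord -mulr_natl; ring.
  apply: ler_sum => l _; rewrite (_ : 2*y k * _ = 4*((y k*y l)*d l)); last by ring.
  by rewrite !normrM ger0_norm// -!mulrA; apply: ler_wpM2l=> //; rewrite mulrA; apply: ler_pM=> //; rewrite mulr_ge0.
 rewrite ger0_norm ?invr_ge0 ?exprn_ge0; try lra.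
 rewrite ler_pdivrMr ?exprn_gt0; try lra.
 rewrite -subr_ge0 (_ : _ - _ = 20*(G + G*S + G*S^+2)); last by ring.
 by rewrite mulr_ge0// !addr_ge0// mulr_ge0// exprn_ge0.
lra.
Qed.

(** The smooth functions provided by [has_trace] come without a uniform bound. They are composed
    with y -> 2 y / (1 + |y|^2), which is bounded by 1, globally Lipschitz and the identity on the
    unit sphere. At a unit vector v its differential is the projection d - (v . d) v, so the limit
    gradient [w] is tangent by construction. *)
Lemma app_of_adm lam b Q (c : 'I_5 -> R3 R -> R) : admissible b Q ->
 (forall x, enorm x != 0 -> b (nrm x) = Mv (fun k => c k (nrm x))) ->
 (forall x, enorm x != 0 -> \sum_k c k (nrm x)^+2 = 1) ->
 (forall k, mB (fun x => c k (nrm x))) -> (forall i j, mB (fun x => b (nrm x) i j)) ->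
 exists f v w, [/\ AppV f v w c, aeB (fun x => Q x = Mv (fun k => v k x)),
  aeB (fun x => \sum_k v k x^+2 = 1),
  aeB (fun x => forall i, \sum_k v k x*w k i x = 0) &
  energy lam Q = (IB (dens lam v w))%:E].
Proof.
move=> [WQ SQ TQ] bc c1 mc mb.
have mQ i j : mB (fun x => Q x i j) by have [[]] := WQ i j.
pose wp l i j := weak_partial B l (fun y => Q y i j).
have wpP l i j := weak_partialP l (WQ i j).
have /choice[F HF] : forall ij : 'I_3 * 'I_3, exists f : nat -> R3 R -> R,
 [/\ forall n, smooth (f n), (\int[mu]_(x in B) ((f n x - Q x ij.1 ij.2)^+2)%:E)%E @[n --> \oo] --> 0%E,
   forall l, (\int[mu]_(x in B) ((partial l (f n) x - wp l ij.1 ij.2 x)^+2)%:E)%E @[n --> \oo] --> 0%E &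
   sphere_integral (fun x => (f n x - b x ij.1 ij.2)^+2) @[n --> \oo] --> 0%E].
 by move=> [i j]; exact: TQ.
(* One index set for all three convergences of all entries: [None] for values in the ball,
   [Some None] for the trace, [Some (Some l)] for the l-th derivative. *)
pose I := ('I_3 * 'I_3 * option (option 'I_3))%type.
pose E (a : I) (n : nat) (x : R3 R) : R := match a.2 with
 | None => (F a.1 n x - Q x a.1.1 a.1.2)^+2
 | Some None => (F a.1 n (nrm x) - b (nrm x) a.1.1 a.1.2)^+2
 | Some (Some l) => (partial l (F a.1 n) x - wp l a.1.1 a.1.2 x)^+2 end.
have sF a n : smooth (F a n) by case: (HF a).
have [||[[i j] [[l|]|]]|k [H [H1 H0 HE]]] := @RF R I E.
- move=> [[i j] [[l|]|]] n; apply: measurable_funX; apply: measurable_funB.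
 + exact: mB_partial.
 + by have [[]] := wpP l i j.
 + by apply: mB_nrm; apply: continuous_measurable_R3; exact: smooth_continuous.
 + exact: mb.
 + by apply: mB_continuous; exact: smooth_continuous.
 + exact: mQ.
- by move=> [[i j] [[l|]|]] n x; exact: sqr_ge0.
- by case: (HF (i, j)) => _ _ /(_ l).
- case: (HF (i, j)) => _ _ _; rewrite /sphere_integral => C.
 have := cvgeZl (y := (3^-1 : R)%:E) isT C; rewrite mule0.
 by under eq_fun do rewrite muleA -EFinM mulVf// mul1e.
- by case: (HF (i, j)).
have cvgsq (a : nat -> R) (l h : R) : (forall n, (a n - l)^+2 <= (2^-1)^+n*h) -> a n @[n --> \oo] --> l.
 move=> le; apply/cvgrPdist_le => e e0.
 have Ch : (2^-1 : R)^+n*h @[n --> \oo] --> (0 : R).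
  rewrite -[X in _ --> X](mul0r h); apply: cvgM; last exact: cvg_cst.
  by apply: cvg_expr; rewrite ger0_norm ?invr_ge0//; lra.
 near=> n.
 have A1 : `|l - a n|^+2 <= (2^-1)^+n*h by rewrite real_normK ?num_real// -opprB sqrrN.
 have A2 : (2^-1)^+n*h <= e^+2 by near: n; apply: (cvgr_le _ Ch); rewrite exprn_gt0.
 exact: (sqr_le_le (normr_ge0 _) (ltW e0) (le_trans A1 A2)).
pose y (n : nat) (m : 'I_5) x := \sum_i \sum_j ebasis R m i j*F (i, j) (k n) x.
pose S n x := \sum_m y n m x^+2.
have sy n m : smooth (y n m).
 by apply: smooth_sum => i; apply: smooth_sum => j; apply: smooth_mul=> //; exact: smooth_cst.
have sS n : smooth (fun x => 1 + S n x).
 apply: smooth_add; first exact: smooth_cst.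
 apply: smooth_sum => m; rewrite (_ : (fun x => _) = fun x => y n m x*y n m x); first exact: smooth_mul.
 by apply/funext => x.
have S0 n x : 0 <= S n x by apply: sumr_ge0 => m _; exact: sqr_ge0.
have S1 n x : 0 < 1 + S n x by rewrite ltr_wpDr.
pose f m n x := 2*y n m x*(1 + S n x)^-1.
pose v m x := coords (Q x) m.
pose d m l x := \sum_i \sum_j ebasis R m i j*wp l i j x.
pose w m l x := d m l x - v m x * \sum_p v p x*d p l x.
have mv m : mB (v m) by apply: mB_sum => i; apply: mB_sum => j; apply: mB_mul=> //; exact: measurable_cst.
have md m l : L2B (d m l).
 by apply: L2B_sum => i; apply: L2B_sum => j; apply: L2B_scale; case: (wpP l i j).
have QE : aeB (fun x => Q x = Mv (fun k => v k x)).
 by move: SQ; rewrite /aeB; apply: filterS => x Hx Bx; have [s0 _] := Hx Bx; rewrite coordsK.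
have v1 : aeB (fun x => \sum_k v k x^+2 = 1).
 move: SQ; rewrite /aeB; apply: filterS => x Hx Bx; have [s0 s1] := Hx Bx.
 by rewrite -sqnormQ_Mv coordsK.
have vw : aeB (fun x => forall i, \sum_k v k x*w k i x = 0).
 apply: aeB_mono v1 => x _ v1 i; rewrite /w.
 under eq_bigr do rewrite mulrBr mulrA -expr2.
 by rewrite sumrB -mulr_suml v1 mul1r subrr.
have dyE n m l x : partial l (y n m) x = \sum_i \sum_j ebasis R m i j * partial l (F (i, j) (k n)) x.
 rewrite partial_sum; last by move=> i; apply: smooth_sum => j; apply: smooth_mul=> //; exact: smooth_cst.
 apply: eq_bigr => i _; rewrite partial_sum; last by move=> j; apply: smooth_mul=> //; exact: smooth_cst.
 by apply: eq_bigr => j _; rewrite partialM ?partial_cst ?mulr0 ?addr0//; exact: smooth_cst.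
have cvgs (a : 'I_5 -> nat -> R) (l : 'I_5 -> R) : (forall m, a m n @[n --> \oo] --> l m) ->
  (1 + \sum_m a m n^+2)^-1 @[n --> \oo] --> (1 + \sum_m l m^+2)^-1.
 move=> C; apply: cvgV; first by rewrite gt_eqF// ltr_wpDr// sumr_ge0// => m _; exact: sqr_ge0.
 apply: cvgD; first exact: cvg_cst.
 by apply: cvg_sumr => m; exact: cvg_sqrr.
have cvg_lin (a : nat -> 'I_3 * 'I_3 -> R) (l : 'I_3 -> 'I_3 -> R) m : (forall i j, a n (i, j) @[n --> \oo] --> l i j) ->
  \sum_i \sum_j ebasis R m i j*a n (i, j) @[n --> \oo] --> \sum_i \sum_j ebasis R m i j * l i j.
 by move=> C; apply: cvg_sumr => i; apply: cvg_sumr => j; apply: cvgM; [exact: cvg_cst|exact: C].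
have yv : aeB (fun x => forall m, y n m x @[n --> \oo] --> v m x).
 apply: aeB_mono HE => x _ Hx m; apply: (cvg_lin (fun n ij => F ij (k n) x) (fun i j => Q x i j)) => i j.
 by apply: cvgsq => n; exact: (Hx ((i, j), None) n).
have yd : aeB (fun x => forall m l, partial l (y n m) x @[n --> \oo] --> d m l x).
 apply: aeB_mono HE => x _ Hx m l; under eq_fun do rewrite dyE.
 apply: (cvg_lin (fun n ij => partial l (F ij (k n)) x) (fun i j => wp l i j x)) => i j.
 by apply: cvgsq => n; exact: (Hx ((i, j), Some (Some l)) n).
have yt : aeB (fun x => forall m, y n m (nrm x) @[n --> \oo] --> c m (nrm x)).
 apply: aeB_mono2 HE ae_enorm_neq0 => x _ Hx x0 m; rewrite -[c m _](coords_Mv (fun m => c m (nrm x))) -bc//.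
 apply: (cvg_lin (fun n ij => F ij (k n) (nrm x)) (fun i j => b (nrm x) i j)) => i j.
 by apply: cvgsq => n; exact: (Hx ((i, j), Some None) n).
have df n m l x : partial l (f m n) x =
  2 * partial l (y n m) x/(1 + S n x) - 2*y n m x*(\sum_p 2*(y n p x * partial l (y n p) x))/(1 + S n x)^+2.
 rewrite /f partialM; last 2 first.
 - by apply: smooth_mul=> //; exact: smooth_cst.
 - exact: smooth_inv.
 rewrite partialV// partialM ?partial_cst ?mulr0 ?addr0//; last exact: smooth_cst.
 rewrite partialD ?partial_cst ?add0r; last 2 first.
 - exact: smooth_cst.
 - apply: smooth_sum => p; rewrite (_ : (fun x => _) = fun x => y n p x*y n p x); first exact: smooth_mul.
  by apply/funext.
 rewrite /S partial_sum; last first.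
  move=> p; rewrite (_ : (fun x => _) = fun x => y n p x*y n p x); first exact: smooth_mul.
  by apply/funext.
 have -> : \sum_p partial l (fun x0 => y n p x0^+2) x = \sum_p 2*(y n p x * partial l (y n p) x).
  apply: eq_bigr => p _; rewrite (_ : (fun x => _) = fun x => y n p x*y n p x); last by apply/funext.
  by rewrite partialM//; ring.
 ring.
(* The squared distance of the l-th derivative of an entry to its limit is at most H, so sqrt H,
   which is square integrable, bounds the distance itself. *)
have [G G2 HG] : exists2 G, L2B G & aeB (fun x => forall n m l, `|partial l (y n m) x| <= G x).
 have sH2 : L2B (fun x => sqrt (H x)).
  have mH : mB (fun x => sqrt (H x)) by apply: (measurableT_comp (@measurable_sqrt R)); exact: L1B_m.
  split=> //; apply: (L1B_le _ (L1B_norm H1)); first exact: measurable_funX.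
  by apply: aeB_mono H0 => x _ h0; rewrite sqr_sqrtr.
 pose g m l i j x := `|ebasis R m i j|*(`|wp l i j x| + sqrt (H x)).
 have g0 m l i j x : 0 <= g m l i j x by rewrite mulr_ge0// addr_ge0// sqrtr_ge0.
 exists (fun x => \sum_m \sum_l \sum_i \sum_j g m l i j x).

  apply: L2B_sum => m; apply: L2B_sum => l; apply: L2B_sum => i; apply: L2B_sum => j.
  apply: L2B_scale; apply: L2B_add=> //; apply: L2B_norm.
  by case: (wpP l i j).
 apply: aeB_mono2 HE H0 => x _ Hx h0 n m l; rewrite dyE.
 have P m' l' : 0 <= \sum_i \sum_j g m' l' i j x by apply: sumr_ge0 => i _; apply: sumr_ge0 => j _.
 apply: (@le_trans _ _ (\sum_i \sum_j g m l i j x)); last first.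
  apply: (@le_trans _ _ (\sum_l' \sum_i \sum_j g m l' i j x)).
   by rewrite [leRHS](bigD1 l)//= lerDl; apply: sumr_ge0 => l' _.
  by rewrite [leRHS](bigD1 m)//= lerDl; apply: sumr_ge0 => m' _; apply: sumr_ge0 => l' _.
 apply: le_trans (ler_norm_sum _ _ _) _; apply: ler_sum => i _.
 apply: le_trans (ler_norm_sum _ _ _) _; apply: ler_sum => j _.
 rewrite normrM; apply: ler_wpM2l=> //; rewrite -lerBlDl.
 apply: le_trans (lerB_dist _ _) _.
 rewrite -(@ler_pXn2r R 2)// ?nnegrE ?sqrtr_ge0// sqr_sqrtr// real_normK ?num_real//.
 apply: le_trans (Hx ((i, j), Some (Some l)) n) _.
 by rewrite ler_piMl// exprn_ile1//; lra.
have A : AppV f v w c.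
 move=> m; split.
 - by move=> n; apply: smooth_mul; [apply: smooth_mul=> //; exact: smooth_cst|exact: smooth_inv].
 - exists 1 => n x _; rewrite /f normrM [X in _*X]ger0_norm ?invr_ge0 ?(ltW (S1 n x))// ler_pdivrMr// mul1r.
  have : y n m x^+2 <= S n x by rewrite /S (bigD1 m)//= lerDl sumr_ge0// => q _; exact: sqr_ge0.
  rewrite normrM ger0_norm// -(real_normK (num_real (y n m x))).
  by move: (`|y n m x|) => q; have := sqr_ge0 (q - 1); nra.
 - exact: mv.
 - move=> i; apply: measurable_funB; first by case: (md m i).
  by apply: mB_mul=> //; apply: mB_sum => p; apply: mB_mul=> //; case: (md p i).
 - exact: mc.
 - apply: aeB_mono2 yv v1 => x _ C v1.
  have -> : v m x = 2 * v m x*(1 + \sum_p v p x^+2)^-1 by rewrite v1; field.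
  by apply: cvgM; [apply: cvgM; [exact: cvg_cst|exact: C]|exact: (cvgs (fun p n => y n p x) (fun p => v p x))].
 - apply: aeB_mono2 (aeB_and yv v1) yd => x _ [C v1'] D i.
  under eq_fun do rewrite df.
  have -> : w m i x = 2*d m i x*(1 + \sum_p v p x^+2)^-1 -
   2 * v m x*(\sum_p 2*(v p x*d p i x))*((1 + \sum_p v p x^+2)^-1)^+2.
   by rewrite v1' -mulr_sumr /w; field.
  have CS := cvgs (fun p n => y n p x) (fun p => v p x) C.
  apply: cvgB; first by apply: cvgM=> //; apply: cvgM; [exact: cvg_cst|exact: D].
  under eq_fun do rewrite -exprVn.
  apply: cvgM; last exact: cvg_sqrr.
  apply: cvgM; first by apply: cvgM; [exact: cvg_cst|exact: C].
  apply: cvg_sumr => p; apply: cvgM; [exact: cvg_cst|apply: cvgM; [exact: C|exact: D]].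
 - exists (fun x => 22*G x); first exact: L2B_scale.
  by apply: aeB_mono HG => x _ Hx n i; rewrite df; apply: bounded_rational=> // l.
 - apply: aeB_mono2 yt ae_enorm_neq0 => x _ C /c1 c1'.
  have -> : c m (nrm x) = 2*c m (nrm x)*(1 + \sum_p c p (nrm x)^+2)^-1 by rewrite c1'; field.
  by apply: cvgM; [apply: cvgM; [exact: cvg_cst|exact: C]|exact: (cvgs (fun p n => y n p (nrm x)) (fun p => c p (nrm x)))].
exists f, v, w; split=> //.
exact: energy_app A mQ QE.
Unshelve. all: end_near. Qed.

End Admissible.

(** * Pointwise estimates for normalized variations *)

Section Variation.
Variable R : realType.
Local Notation B := (@B1 R).
Implicit Types (a b u v : 'I_5 -> R).

Definition dot a b : R := \sum_k a k*b k.

Lemma dotC a b : dot a b = dot b a.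
Proof. by apply: eq_bigr => k _; rewrite mulrC. Qed.

Lemma dot_lin (s t : R) a b v : dot v (fun k => s*a k + t*b k) = s*dot v a + t*dot v b.
Proof.
rewrite /dot !mulr_sumr -big_split /=; apply: eq_bigr => k _; ring.
Qed.

Lemma dot_sqr a : \sum_k a k^+2 = dot a a.
Proof. by apply: eq_bigr => k _; rewrite expr2. Qed.

Lemma dot_ge0 a : 0 <= dot a a.
Proof. by rewrite -dot_sqr sumr_ge0// => k _; exact: sqr_ge0. Qed.

Lemma dot_CS a b : dot a b^+2 <= dot a a*dot b b.
Proof.
have [b0|b0] := eqVneq (dot b b) 0.
 have bz k : b k = 0.
  apply/eqP; rewrite -sqrf_eq0; apply/eqP; move/eqP: b0; rewrite -dot_sqr psumr_eq0; last by move=> l _; exact: sqr_ge0.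
  by move/allP/(_ k); rewrite mem_index_enum => /(_ isT)/eqP.
 have -> : dot a b = 0 by rewrite /dot big1// => k _; rewrite bz mulr0.
 by rewrite b0 mulr0 expr0n.
have bp : 0 < dot b b by rewrite lt_neqAle eq_sym b0 dot_ge0.
have := dot_ge0 (fun k => dot b b*a k + (- dot a b)*b k).
rewrite !(dot_lin, dotC (fun k => _ + _)) (dotC b a).
set x := dot a a; set y := dot a b; set z := dot b b in bp *.
have -> : z*(z*x + - y*y) + - y*(z*y + - y*z) = z*(x*z - y^+2) by ring.
by rewrite pmulr_rge0// subr_ge0.
Qed.

Lemma tri_lin1 (s : R) a b v w : tri (fun k => a k + s*b k) v w = tri a v w + s*tri b v w.
Proof.
rewrite /tri mulr_sumr -big_split; apply: eq_bigr => k _.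
rewrite mulr_sumr -big_split; apply: eq_bigr => l _.
rewrite mulr_sumr -big_split; apply: eq_bigr => m _ /=; ring.
Qed.
Lemma tri_lin2 (s : R) a b v w : tri v (fun k => a k + s*b k) w = tri v a w + s*tri v b w.
Proof.
rewrite /tri mulr_sumr -big_split; apply: eq_bigr => k _.
rewrite mulr_sumr -big_split; apply: eq_bigr => l _.
rewrite mulr_sumr -big_split; apply: eq_bigr => m _ /=; ring.
Qed.
Lemma tri_lin3 (s : R) a b v w : tri v w (fun k => a k + s*b k) = tri v w a + s*tri v w b.
Proof.
rewrite /tri mulr_sumr -big_split; apply: eq_bigr => k _.
rewrite mulr_sumr -big_split; apply: eq_bigr => l _.
rewrite mulr_sumr -big_split; apply: eq_bigr => m _ /=; ring.
Qed.
Lemma tri_hom (r : R) a : tri (fun k => a k*r) (fun k => a k*r) (fun k => a k*r) = r^+3*tri a a a.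
Proof.
rewrite /tri mulr_sumr; apply: eq_bigr => k _.
rewrite mulr_sumr; apply: eq_bigr => l _.
rewrite mulr_sumr; apply: eq_bigr => m _ /=; ring.
Qed.

Lemma WvB u v : Wv v - Wv u = 3^-1*(tri u u u - tri v v v).
Proof.
rewrite /Wv; have s0 : sqrt 6 != 0 :> R by rewrite gt_eqF// sqrtr_gt0.
by field.
Qed.

(** Here r = (1 + a)^(-1/2), to be used with a = s^2 |xi|^2: the potential is cubic, so the
    normalizing factor enters through its cube. *)
Lemma rcube (r a : R) : 0 < r -> 0 <= a -> r^+2*(1 + a) = 1 -> 0 <= 1 - r^+3 <= 2*a.
Proof.
move=> r0 a0 E; have r1 : r <= 1.
 rewrite leNgt; apply/negP => r1; have : 1 < r^+2 by rewrite expr_gt1// ltW.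
 by nra.
have r2 : 0 <= r^+2 by exact: sqr_ge0.
have r3 : r^+3 <= 1 by rewrite exprn_ile1// ltW.
apply/andP; split; first lra.
have h1 : 1 - a <= r^+2 by nra.
have h2 : r^+2 <= 1 by rewrite exprn_ile1// ltW.
have h3 : r^+4 <= r^+3 by rewrite [r^+4]exprS ler_piMl// exprn_ge0// ltW.
have h4 : 1 - 2*a <= r^+4.
 have -> : r^+4 = r^+2*r^+2 by rewrite -exprD.
 move: h1 h2 r2 E; move: (r^+2) => t h1 h2 r2 E; nra.
lra.
Qed.

Section pointwise.
Variables (u xi : 'I_5 -> R) (s r : R).
Hypothesis u1 : dot u u = 1.
Let n := nrm5 xi.
Let K := Ktau R.
Hypothesis r0 : 0 < r.
Hypothesis rN : r^+2*(1 + s^+2*dot xi xi) = 1.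
Let v t k := (u k + t*xi k)*r.

Let n2 : n^+2 = dot xi xi. Proof. by rewrite sqr_nrm5 dot_sqr. Qed.
Let nu1 : nrm5 u = 1. Proof. by rewrite /nrm5 dot_sqr u1 sqrtr1. Qed.

Let P (t : R) : tri (v t) (v t) (v t) = r^+3*(tri u u u + t*(tri xi u u + tri u xi u + tri u u xi)
 + t^+2*(tri xi xi u + tri xi u xi + tri u xi xi) + t^+3*tri xi xi xi).
Proof. rewrite /v tri_hom !tri_lin1 !tri_lin2 !tri_lin3; congr (_ * _); ring. Qed.

Let r3 : 0 <= 1 - r^+3 <= 2*(s^+2 * n^+2).
Proof. by apply: rcube=> //; rewrite ?n2 // mulr_ge0 ?sqr_ge0 ?dot_ge0. Qed.

Let bT (a b c : 'I_5 -> R) (p : R) : nrm5 a * nrm5 b * nrm5 c = p -> - (K * p) <= tri a b c <= K * p.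
Proof. by move=> <-; rewrite -ler_norml; exact: tri_le. Qed.

Let hT0 : tri u u u*(1 - r^+3) <= K*(2*(s^+2 * n^+2)).
Proof.
have /andP[_ a2] := bT (a := u) (b := u) (c := u) (p := 1) ltac:(by rewrite nu1; ring).
have /andP[c0 c1] := r3; apply: le_trans (ler_wpM2r c0 a2) _; rewrite mulr1; apply: ler_wpM2l=> //; exact: Ktau_ge0.
Qed.

Let hT2 : - (tri xi xi u + tri xi u xi + tri u xi xi) <= 3*K * n^+2.
Proof.
have b (x y z : 'I_5 -> R) : nrm5 x * nrm5 y * nrm5 z = n^+2 -> - (K * n^+2) <= tri x y z by move=> /bT /andP[].
have := b xi xi u; have := b xi u xi; have := b u xi xi; rewrite nu1 -/n !mul1r !mulr1 => /(_ erefl) h1 /(_ erefl) h2 /(_ erefl) h3; lra.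
Qed.

(** Odd powers of s cancel between s and -s; what is left is of second order and is bounded through
    [Ktau]. *)
Lemma W2 : Wv (v s) + Wv (v (- s)) - 2*Wv u <= 4*K*(s^+2*dot xi xi).
Proof.
have -> : Wv (v s) + Wv (v (- s)) - 2*Wv u = (Wv (v s) - Wv u) + (Wv (v (- s)) - Wv u) by ring.
rewrite !WvB !P -n2.
have /andP[c0 c1] := r3.
have K0 : 0 <= K := Ktau_ge0 R.
have h1 := hT0; have h2 := hT2; set T0 := tri u u u in h1 *; set T2 := tri xi xi u + _ + _ in h2 *.
have -> : 3^-1*(T0 - r^+3*(T0 + s*(tri xi u u + tri u xi u + tri u u xi) + s^+2*T2 + s^+3*tri xi xi xi)) +
 3^-1*(T0 - r^+3*(T0 + - s*(tri xi u u + tri u xi u + tri u u xi) + (- s)^+2*T2 + (- s)^+3*tri xi xi xi))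
 = 3^-1*(2*(T0*(1 - r^+3)) + 2*(r^+3*(s^+2 * - T2))) by field.
have {}h2 : s^+2 * - T2 <= s^+2*(3*K * n^+2) by apply: ler_wpM2l=> //; exact: sqr_ge0.
have h3 : r^+3*(s^+2 * - T2) <= s^+2*(3*K * n^+2).
 have r30 : 0 <= r^+3 by rewrite exprn_ge0// ltW.
 apply: le_trans (ler_wpM2l r30 h2) _; rewrite ler_piMl//; last lra.
 by apply: mulr_ge0; [exact: sqr_ge0|apply: mulr_ge0; [exact: mulr_ge0|exact: sqr_ge0]].
have h4 : 0 <= K*(s^+2 * n^+2) by apply: mulr_ge0=> //; apply: mulr_ge0; exact: sqr_ge0.
lra.
Qed.

(** The term linear in s is estimated instead of computed, so the Euler-Lagrange equation will take
    the form of an inequality. *)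
Lemma W1 : 0 <= s -> Wv (v s) - Wv u <= K*(s * n + s^+2*(2 * n^+2) + s^+3 * n^+3).
Proof.
move=> s0; rewrite !WvB !P.
have n0 : 0 <= n := nrm5_ge0 xi.
have /andP[d1 d1'] := bT (a := xi) (b := u) (c := u) (p := n) ltac:(by rewrite nu1 -/n; ring).
have /andP[d2 d2'] := bT (a := u) (b := xi) (c := u) (p := n) ltac:(by rewrite nu1 -/n; ring).
have /andP[d3 d3'] := bT (a := u) (b := u) (c := xi) (p := n) ltac:(by rewrite nu1 -/n; ring).
have /andP[e1 e1'] := bT (a := xi) (b := xi) (c := xi) (p := n^+3) ltac:(by rewrite -/n; ring).
have /andP[c0 c1] := r3.
have K0 : 0 <= K := Ktau_ge0 R.
have h1 := hT0; have g2 := hT2; set T0 := tri u u u in h1 *; set T1 := tri xi u u + _ + _; set T2 := tri xi xi u + _ + _ in g2 *; set T3 := tri xi xi xi.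
have -> : 3^-1*(T0 - r^+3*(T0 + s*T1 + s^+2*T2 + s^+3*T3))
 = 3^-1*(T0*(1 - r^+3) + r^+3*(s * - T1 + s^+2 * - T2 + s^+3 * - T3)) by field.
have h2 : s * - T1 + s^+2 * - T2 + s^+3 * - T3 <= s*(3*K * n) + s^+2*(3*K * n^+2) + s^+3*(K * n^+3).
 apply: lerD; first apply: lerD; apply: ler_wpM2l; rewrite ?exprn_ge0//; rewrite ?/T1 ?/T3; lra.
have r30 : 0 <= r^+3 by rewrite exprn_ge0// ltW.
have h4 : 0 <= s*(3*K * n) + s^+2*(3*K * n^+2) + s^+3*(K * n^+3).
 by rewrite !addr_ge0// !mulr_ge0// ?exprn_ge0.
have h3 : r^+3*(s * - T1 + s^+2 * - T2 + s^+3 * - T3) <= s*(3*K * n) + s^+2*(3*K * n^+2) + s^+3*(K * n^+3).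
 by apply: le_trans (ler_wpM2l r30 h2) _; rewrite ler_piMl//; lra.
have h5 : 0 <= K*(s^+2 * n^+2) by rewrite !mulr_ge0 ?exprn_ge0.
have h6 : 0 <= K*(s^+3 * n^+3) by rewrite !mulr_ge0 ?exprn_ge0.
have -> : K*(s * n + s^+2*(2 * n^+2) + s^+3 * n^+3) = K*(s * n) + 2*(K*(s^+2 * n^+2)) + K*(s^+3 * n^+3) by ring.
have E3 : s*(3*K * n) + s^+2*(3*K * n^+2) + s^+3*(K * n^+3) = 3*(K*(s * n)) + 3*(K*(s^+2 * n^+2)) + K*(s^+3 * n^+3) by ring.
rewrite E3 in h3.
lra.
Qed.

(* Normalizing [p = u + s xi] divides [|q|^2] by [|p|^2] up to a nonnegative defect. *)
Lemma grad_normalized (q : 'I_5 -> R) e : dot u xi = 0 -> dot (fun k => u k + s*xi k) q = s^+2*e ->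
 \sum_k ((u k + s*xi k)*(- r^+2*(r/2*(s^+2*(e + e)))) + r*q k)^+2
 <= r^+2 * \sum_k q k^+2.
Proof.
move=> uxi pq; set p := fun k => u k + s*xi k.
have pp : r^+2*dot p p = 1.
 rewrite -rN /p; congr (_ * _).
 have -> : (fun k => u k + s*xi k) = (fun k => 1*u k + s*xi k) by apply/funext => k; rewrite mul1r.
 by rewrite !(dot_lin, dotC (fun k => _ + _)) u1 (dotC xi u) uxi; ring.
rewrite (eq_bigr (fun k => (((- r^+3*(s^+2*e)) * p k + r*q k)^+2))); last by move=> k _; congr (_^+2); rewrite /p; field.
rewrite !dot_sqr !(dot_lin, dotC (fun k => _ + _)) (dotC q p) pq.
have -> : - r^+3*(s^+2*e)*(- r^+3*(s^+2*e)*dot p p + r*(s^+2*e)) +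
  r*(- r^+3*(s^+2*e)*(s^+2*e) + r*dot q q)
 = r^+4*(s^+2*e)^+2*(r^+2*dot p p - 2) + r^+2*dot q q by ring.
rewrite pp gerDr; have -> : r^+4*(s^+2*e)^+2*(1 - 2) = - ((r^+2*(s^+2*e))^+2) by ring.
by rewrite oppr_le0 sqr_ge0.
Qed.

End pointwise.
End Variation.

(** * Competitors, first and second variation of the energy *)

Section Competitors.
Variable R : realType.
Local Notation B := (@B1 R).

Lemma eq_af f (v v' : R3 R -> R) w w' c c' : (forall x, v x = v' x) -> (forall i x, w i x = w' i x) ->
 (forall x, c x = c' x) -> @AppF R f v w c -> AppF f v' w' c'.
Proof.
move=> /funext -> H /funext ->; suff -> : w = w' by [].
by apply/funext => i; apply/funext => x.
Qed.

(** Minimality in coordinates, against all competitors that come with smooth approximations and have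
    the same values on the sphere; every competitor built below is of this kind. *)
Record Min (lam : R) f (u : 'I_5 -> R3 R -> R) w (c : 'I_5 -> R3 R -> R) : Prop := MkMin {
 mn_app : AppV f u w c;
 mn_1 : aeB (fun x => dot (u^~ x) (u^~ x) = 1);
 mn_w : aeB (fun x => forall i, dot (u^~ x) (fun k => w k i x) = 0);
 mn_c : forall x, enorm x != 0 -> dot (fun k => c k (nrm x)) (fun k => c k (nrm x)) = 1;
 mn_min : forall f' (v : 'I_5 -> R3 R -> R) w' c', AppV f' v w' c' -> aeB (fun x => dot (v^~ x) (v^~ x) = 1) ->
  (forall k x, enorm x != 0 -> c' k (nrm x) = c k (nrm x)) ->
  IB (dens lam u w) <= IB (dens lam v w') }.

(** Infinitesimal variations of [u] with fixed boundary values. [tg_du] is the differentiated form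
    of u . xi = 0, recorded on its own because the gradients are almost everywhere limits. *)
Record Tang (u : 'I_5 -> R3 R -> R) (w : 'I_5 -> 'I_3 -> R3 R -> R) g xi eta d : Prop := MkTang {
 tg_app : AppV g xi eta d;
 tg_0 : forall k x, enorm x != 0 -> d k (nrm x) = 0;
 tg_u : aeB (fun x => dot (u^~ x) (xi^~ x) = 0);
 tg_du : aeB (fun x => forall i, dot (u^~ x) (fun k => eta k i x) + dot (xi^~ x) (fun k => w k i x) = 0) }.

Definition sq2 (w : 'I_5 -> 'I_3 -> R3 R -> R) x := \sum_i \sum_k w k i x^+2.
Definition pair2 (w e : 'I_5 -> 'I_3 -> R3 R -> R) x := \sum_i \sum_k w k i x*e k i x.
Definition sq1 (xi : 'I_5 -> R3 R -> R) x := \sum_k xi k x^+2.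

Lemma L1_pair2 f u w c g xi eta d : AppV f u w c -> AppV g xi eta d -> L1B (pair2 w eta).
Proof.
by move=> A X; apply: L1B_sum => i; apply: L1B_sum => k; apply: L2B_mul; [exact: af_L2 (A k)|exact: af_L2 (X k)].
Qed.

Lemma sq1_ge0 xi x : 0 <= sq1 xi x.
Proof. by apply: sumr_ge0 => k _; exact: sqr_ge0. Qed.

Lemma normalizer_ge1 (s : R) xi x : 1 <= 1 + s^+2*sq1 xi x.
Proof. by rewrite lerDl mulr_ge0 ?sqr_ge0// sq1_ge0. Qed.

Lemma Linf_normalizer (s : R) g xi eta d : AppV g xi eta d -> Linf (fun x => (1 + s^+2*sq1 xi x)^-1).
Proof.
move=> X; have N1 := normalizer_ge1 s xi; split.
 apply: (measurableT_comp (@measurable_inv R)); apply: mB_add; first exact: measurable_cst.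
 apply: mB_mul; first exact: measurable_cst.
 by apply: mB_sum => k; apply: measurable_funX; exact: (af_m (X k)).
exists 1; apply: aeB_all => x _; rewrite ger0_norm ?invr_ge0 ?(le_trans _ (N1 x))//.
by rewrite invf_le1// (lt_le_trans _ (N1 x)).
Qed.

Lemma normalizerE (s : R) xi x : let r := (sqrt (1 + s^+2*sq1 xi x))^-1 in
 0 < r /\ r^+2*(1 + s^+2*dot (xi^~ x) (xi^~ x)) = 1.
Proof.
have N0 := lt_le_trans ltr01 (normalizer_ge1 s xi x); split; first by rewrite invr_gt0 sqrtr_gt0.
by rewrite -dot_sqr exprVn sqr_sqrtr ?(ltW N0)// mulVf// gt_eqF.
Qed.

(** If I were negative, s = min(1, -I / (2 (1 + |J|))) would give s J <= -I/2 and so I + s J < 0. *)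
Lemma nonneg_first_order (I J : R) : (forall s, 0 < s -> s <= 1 -> 0 <= I + s*J) -> 0 <= I.
Proof.
move=> H; rewrite leNgt; apply/negP => I0.
have J0 : 0 <= `|J| by [].
pose t := Num.min 1 (- I/(2*(1 + `|J|))).
have t0 : 0 < t by rewrite lt_min ltr01/= divr_gt0 ?oppr_gt0// mulr_gt0// ltr_wpDr.
have := H t t0; rewrite ge_min lexx => /(_ isT).
apply/negP; rewrite -ltNge; have : t*J <= t * `|J| by rewrite ler_wpM2l ?ler_norm// ltW.
have : t * `|J| <= - I/2; last lra.
apply: (@le_trans _ _ ((- I/(2*(1 + `|J|))) * `|J|)); first by apply: ler_wpM2r=> //; rewrite ge_min lexx orbT.
have -> : (- I/(2*(1 + `|J|))) * `|J| = (- I/2)*(`|J|/(1 + `|J|)) by field; rewrite gt_eqF// ltr_wpDr.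
rewrite ler_piMr//; first lra.
by rewrite ler_pdivrMr ?ltr_wpDr// mul1r lerDr.
Qed.

(** The comparison map is (u + s xi) / |u + s xi|, where |u + s xi|^2 = 1 + s^2 |xi|^2 by
    orthogonality. [grad_normalized] discards the derivative of the normalizing factor, which would
    only lower the gradient term. *)
Lemma competitor lam f u w c g xi eta d (s : R) : 0 < lam -> Min lam f u w c -> Tang u w g xi eta d ->
 exists v : 'I_5 -> R3 R -> R, [/\ (forall k, Linf (v k)),
  forall x, v^~ x = fun k => (u k x + s*xi k x)*(sqrt (1 + s^+2*sq1 xi x))^-1 &
  0 <= IB (fun x => 2^-1*((1 + s^+2*sq1 xi x)^-1*(sq2 w x + 2*s * pair2 w eta x + s^+2*sq2 eta x) - sq2 w x)
   + lam*(Wv (v^~ x) - Wv (u^~ x)))].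
Proof.
move=> l0 M T; have A := mn_app M; have X := tg_app T.
pose N x := 1 + s^+2*sq1 xi x.
pose v k x := (u k x + s*xi k x)*(sqrt (N x))^-1.
pose e i x := \sum_k xi k x*eta k i x.
pose wv k i x := (u k x + s*xi k x)*(- (sqrt (N x)) ^- 2*((2*sqrt (N x))^-1*(0 + s^+2 * \sum_k (xi k x*eta k i x + xi k x*eta k i x))))
 + (sqrt (N x))^-1*(w k i x + s*eta k i x).
have N1 : forall x, 1 <= N x := normalizer_ge1 s xi.
have [f' [c' [AV cE]]] : exists f' c', AppV f' v wv c' /\ (forall k x, enorm x != 0 -> c' k (nrm x) = c k (nrm x)).
 pose gN n x := 1 + s^+2 * \sum_k g k n x*g k n x.
 have gN1 n x : 1 <= gN n x by rewrite /gN lerDl mulr_ge0 ?sqr_ge0// sumr_ge0// => k _; rewrite -expr2 sqr_ge0.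
 have sN1 n x : 1 <= sqrt (gN n x) by rewrite -[1]sqrtr1 ler_sqrt// (le_trans ler01).
 have AN := af_add (af_cst 1) (af_scale (s^+2) (af_sum (index_enum 'I_5) (fun k => af_mul (X k) (X k)))).
 have AI := af_inv sN1 (af_sqrt gN1 AN).
 exists (fun k n x => (f k n x + s*g k n x)*(sqrt (gN n x))^-1).
 exists (fun k x => (c k x + s*d k x)*(sqrt (1 + s^+2 * \sum_k d k x*d k x))^-1); split.
  move=> k; have := af_mul (af_add (A k) (af_scale s (X k))) AI; apply: eq_af=> //.
 move=> k x x0; rewrite (tg_0 T)// mulr0 addr0 big1 ?mulr0 ?addr0 ?sqrtr1 ?invr1 ?mulr1//.
 by move=> l _; rewrite (tg_0 T)// mulr0.
have r0 x := (normalizerE s xi x).1; have rN x := (normalizerE s xi x).2.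
have v1 : aeB (fun x => dot (v^~ x) (v^~ x) = 1).
 apply: aeB_mono2 (mn_1 M) (tg_u T) => x _ u1 ux.
 rewrite -(rN x) -dot_sqr /v; under eq_bigr do rewrite exprMn mulrC; rewrite -mulr_sumr; congr (_ * _).
 rewrite dot_sqr (_ : (fun k => u k x + s*xi k x) = fun k => 1*u k x + s*xi k x); last by apply/funext => k; rewrite mul1r.
 by rewrite !(dot_lin, dotC (fun k => _ + _)) u1 (dotC (xi^~ x)) ux; ring.
have mu_ k := af_Linf (A k).
have vL k : Linf (v k) := af_Linf (AV k).
have wL k i : L2B (w k i) := af_L2 i (A k).
have eL k i : L2B (eta k i) := af_L2 i (X k).
have L1sq2 (z : 'I_5 -> 'I_3 -> R3 R -> R) : (forall k i, L2B (z k i)) -> L1B (sq2 z).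
 by move=> H; apply: L1B_sum => i; apply: L1B_sum => k; case: (H k i).
have LN := Linf_normalizer s X.
exists v; split=> //.
have L1g : L1B (fun x => 2^-1*((1 + s^+2*sq1 xi x)^-1*(sq2 w x + 2*s * pair2 w eta x + s^+2*sq2 eta x) - sq2 w x)).
 apply: L1B_scale; apply: L1B_sub; last exact: L1sq2.
 apply: L1B_Linf=> //; apply: L1B_add; last by apply: L1B_scale; exact: L1sq2.
 apply: L1B_add; first exact: L1sq2.
 by apply: L1B_scale; apply: L1B_sum => i; apply: L1B_sum => k; exact: L2B_mul.
have L1W : L1B (fun x => lam*(Wv (v^~ x) - Wv (u^~ x))).
 apply: L1B_scale; apply: L1B_sub; apply: Linf_L1; exact: Linf_Wv.
have := mn_min M AV v1 cE; rewrite -subr_ge0 -IBB; last 2 first.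
- exact: L1_dens AV.
- exact: L1_dens A.
move=> h; apply: (le_trans h); apply: IB_le.
- by apply: L1B_sub; [exact: L1_dens AV|exact: L1_dens A].
- exact: L1B_add.
have := aeB_and (aeB_and (mn_1 M) (mn_w M)) (aeB_and (tg_u T) (tg_du T)); apply: aeB_mono => x _ [[u1 uw] [ux ud]].
rewrite /dens -/(sq2 wv x) -/(sq2 w x).
suff H : sq2 wv x <= (1 + s^+2*sq1 xi x)^-1*(sq2 w x + 2*s * pair2 w eta x + s^+2*sq2 eta x) by lra.
have -> : (1 + s^+2*sq1 xi x)^-1 = (sqrt (N x))^-1^+2 by rewrite exprVn sqr_sqrtr// (le_trans ler01).
have -> : sq2 w x + 2*s * pair2 w eta x + s^+2*sq2 eta x = \sum_i \sum_k (w k i x + s*eta k i x)^+2.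
 rewrite /sq2 /pair2 !mulr_sumr -!big_split /=; apply: eq_bigr => i _.
 rewrite !mulr_sumr -!big_split /=; apply: eq_bigr => k _; ring.
rewrite mulr_sumr; apply: ler_sum => i _.
have pq : dot (fun k => u k x + s*xi k x) (fun k => w k i x + s*eta k i x) = s^+2*e i x.
 rewrite (_ : (fun k => u k x + s*xi k x) = fun k => 1*u k x + s*xi k x); last by apply/funext => k; rewrite mul1r.
 rewrite (_ : (fun k => w k i x + s*eta k i x) = fun k => 1*w k i x + s*eta k i x); last by apply/funext => k; rewrite mul1r.
 rewrite dot_lin !(dotC (fun k => 1*u k x + _)) !dot_lin.
 have := ud i; have := uw i; rewrite (dotC (fun k => w k i x) (u^~ x)) (dotC (fun k => w k i x) (xi^~ x)) (dotC (fun k => eta k i x) (u^~ x)) (dotC (fun k => eta k i x) (xi^~ x))=> -> h2.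
 rewrite /e -/(dot (xi^~ x) (fun k => eta k i x)).
 set D := dot (u^~ x) _ in h2 *; set D' := dot (xi^~ x) (fun k => w k i x) in h2 *.
 have -> : D = - D' by move/eqP: h2; rewrite addr_eq0 => /eqP.
 by ring.
have := grad_normalized u1 (rN x) ux pq; apply: le_trans; rewrite le_eqVlt; apply/orP; left; apply/eqP.
apply: eq_bigr => k _; congr (_^+2); rewrite /wv big_split /= -/(e i x) add0r; congr (_*(_*(_ * _)) + _).
 by rewrite exprVn.
by rewrite invfM mulrC.
Qed.

Lemma Linf_sq1 g xi eta d : AppV g xi eta d -> Linf (sq1 xi).
Proof.
move=> X; apply: Linf_sum => k; rewrite (_ : (fun x => _) = fun x => xi k x*xi k x); last by apply/funext.
by apply: Linf_mul; exact: af_Linf (X k).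
Qed.

Lemma L1_sq2 g xi eta d : AppV g xi eta d -> L1B (sq2 eta).
Proof. by move=> X; apply: L1B_sum => i; apply: L1B_sum => k; case: (af_L2 i (X k)). Qed.

(** The inequalities for s and -s are added, which removes the terms of odd order, and 1 / (1 + z)
    <= 1 - z + z^2 with z = s^2 |xi|^2 leaves the remainder s^4 |xi|^4 |D u|^2. After division by
    s^2 the small parameter of [nonneg_first_order] is s^2. *)
Lemma V_ineq lam f u w c g xi eta d : 0 < lam -> Min lam f u w c -> Tang u w g xi eta d ->
 0 <= IB (fun x => sq2 eta x - sq1 xi x*sq2 w x + 4*Ktau R * lam*sq1 xi x).
Proof.
move=> l0 M T; have A := mn_app M; have X := tg_app T.
have LX := Linf_sq1 X; have Lw := L1_sq2 A; have Le := L1_sq2 X.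
have L1 : L1B (fun x => sq2 eta x - sq1 xi x*sq2 w x + 4*Ktau R * lam*sq1 xi x).
 apply: L1B_add; last by apply: L1B_scale; exact: Linf_L1.
 by apply: L1B_sub=> //; exact: L1B_Linf.
have L2 : L1B (fun x => sq1 xi x*sq1 xi x*sq2 w x) by apply: L1B_Linf=> //; exact: Linf_mul.
set I := IB _; pose J := IB (fun x => sq1 xi x*sq1 xi x*sq2 w x).
apply: (@nonneg_first_order _ J) => s' s'0 _; pose s := sqrt s'.
have s0 : 0 < s by rewrite sqrtr_gt0.
have s20 : 0 < s^+2 by rewrite exprn_gt0.
rewrite -[s'](sqr_sqrtr (ltW s'0)) -/s.
have [v [Lv vE Iv]] := competitor s l0 M T; have [v' [Lv' vE' Iv']] := competitor (- s) l0 M T.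
rewrite -(pmulr_rge0 _ s20) /I /J -IBZ// -IBD//; last exact: L1B_scale.
rewrite -IBZ; last by apply: L1B_add=> //; exact: L1B_scale.
have LW (z : 'I_5 -> R3 R -> R) : (forall k, Linf (z k)) -> L1B (fun x => lam*(Wv (z^~ x) - Wv (u^~ x))).
 move=> Lz; apply: L1B_scale; apply: L1B_sub; apply: Linf_L1; apply: Linf_Wv=> // k; exact: af_Linf (A k).
have LN := Linf_normalizer s X; have Lp := L1_pair2 A X.
have LG (t : R) : t^+2 = s^+2 -> L1B (fun x => 2^-1*((1 + t^+2*sq1 xi x)^-1*(sq2 w x + 2*t * pair2 w eta x + t^+2*sq2 eta x) - sq2 w x)).
 move=> ->; apply: L1B_scale; apply: L1B_sub=> //; apply: L1B_Linf=> //.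
 by apply: L1B_add; [apply: L1B_add=> //|]; exact: L1B_scale.
have G1 := LG s erefl; have G2 := LG (- s) (sqrrN s).
have := addr_ge0 Iv Iv'; rewrite -IBD; try (by apply: L1B_add=> //; exact: LW).
move=> h; apply: le_trans h _; apply: IB_le.
- by apply: L1B_add; apply: L1B_add=> //; exact: LW.
- by apply: L1B_scale; apply: L1B_add=> //; exact: L1B_scale.
apply: aeB_mono (mn_1 M) => x _ u1.
have X0 := sq1_ge0 xi x.
have G0 : 0 <= sq2 w x by apply: sumr_ge0 => i _; apply: sumr_ge0 => k _; exact: sqr_ge0.
have E0 : 0 <= sq2 eta x by apply: sumr_ge0 => i _; apply: sumr_ge0 => k _; exact: sqr_ge0.
rewrite sqrrN.
have N0 : 0 < 1 + s^+2*sq1 xi x by rewrite ltr_wpDr// mulr_ge0// ltW.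
have [r0 rN] := normalizerE s xi x; set r := (sqrt _)^-1 in r0 rN *.
have := W2 u1 r0 rN; rewrite vE vE' sqrrN -/r -dot_sqr -/(sq1 xi x) => HW.
have {}HW := ler_wpM2l (ltW l0) HW.
have HN : (1 + s^+2*sq1 xi x)^-1 <= 1 - s^+2*sq1 xi x + (s^+2*sq1 xi x)^+2.
 rewrite -[_^-1]mul1r ler_pdivrMr//; have : 0 <= (s^+2*sq1 xi x)^+3 by rewrite exprn_ge0// mulr_ge0// ltW.
 move: (s^+2*sq1 xi x) => z z3; have -> : (1 - z + z^+2)*(1 + z) = 1 + z^+3 by ring.
 by rewrite lerDl.
have HN1 : (1 + s^+2*sq1 xi x)^-1 <= 1 by rewrite invf_le1// lerDl mulr_ge0// ltW.
have h1 := ler_wpM2r G0 HN.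
have h2 : (1 + s^+2*sq1 xi x)^-1*(s^+2*sq2 eta x) <= s^+2*sq2 eta x.
 by rewrite ler_piMl// mulr_ge0// ltW.
set i := (1 + s^+2*sq1 xi x)^-1 in h1 h2 *.
set a := sq1 xi x in h1 h2 HW *; set p := sq2 w x in h1 *; set q := sq2 eta x in h2 *; set m := pair2 w eta x.
have -> : 2^-1*(i*(p + 2*s * m + s^+2*q) - p) + lam*(Wv (fun k => (u k x + s*xi k x)*r) - Wv (u^~ x)) +
 (2^-1*(i*(p + 2 * - s * m + s^+2*q) - p) + lam*(Wv (fun k => (u k x + - s*xi k x)*r) - Wv (u^~ x)))
 = i * p + i*(s^+2*q) - p + lam*(Wv (fun k => (u k x + s*xi k x)*r) + Wv (fun k => (u k x + - s*xi k x)*r) - 2*Wv (u^~ x)) by field.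
have -> : s^+2*(q - a * p + 4*Ktau R * lam*a + s^+2*(a*a * p)) =
 (1 - s^+2*a + (s^+2*a)^+2) * p - p + s^+2*q + lam*(4*Ktau R*(s^+2*a)) by ring.
lra.
Qed.

(** The first variation for s > 0, with the derivative of the potential replaced by its bound in
    terms of |xi|. *)
Lemma EL_ineq lam f u w c g xi eta d : 0 < lam -> Min lam f u w c -> Tang u w g xi eta d ->
 0 <= IB (fun x => pair2 w eta x + Ktau R * lam * nrm5 (xi^~ x)).
Proof.
move=> l0 M T; have A := mn_app M; have X := tg_app T.
have LX := Linf_sq1 X; have Lw := L1_sq2 A; have Le := L1_sq2 X.
have Lp := L1_pair2 A X.
have Ln : Linf (fun x => nrm5 (xi^~ x)).
 case: LX => mX [K HK]; split; first by apply: (measurableT_comp (@measurable_sqrt R)).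
 exists (1 + K); apply: aeB_mono HK => x _; rewrite ger0_norm; last by apply: sumr_ge0 => k _; exact: sqr_ge0.
 rewrite ger0_norm ?nrm5_ge0// -[sq1 xi x](sqr_nrm5 (xi^~ x)); move: (nrm5 _) => z; have := sqr_ge0 (z - 1); nra.
have L1 : L1B (fun x => pair2 w eta x + Ktau R * lam * nrm5 (xi^~ x)).
 by apply: L1B_add=> //; apply: L1B_scale; exact: Linf_L1.
pose rest x := 2^-1*sq2 eta x + Ktau R * lam*(2 * nrm5 (xi^~ x)^+2 + nrm5 (xi^~ x)^+3).
have L2 : L1B rest.
 apply: L1B_add; first exact: L1B_scale.
 apply: L1B_scale; apply: Linf_L1; apply: Linf_add.
  apply: Linf_mul; first exact: Linf_cst.
  by rewrite (_ : (fun x => _) = fun x => nrm5 (xi^~ x) * nrm5 (xi^~ x)); [exact: Linf_mul|apply/funext].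
 rewrite (_ : (fun x => _) = fun x => nrm5 (xi^~ x)*(nrm5 (xi^~ x) * nrm5 (xi^~ x))); last by apply/funext.
 by apply: Linf_mul=> //; exact: Linf_mul.
set I := IB _; pose J := IB rest.
apply: (@nonneg_first_order _ J) => s s0 s1.
have [v [Lv vE Iv]] := competitor s l0 M T.
rewrite -(pmulr_rge0 _ s0) /I /J -IBZ// -IBD//; last exact: L1B_scale.
rewrite -IBZ; last by apply: L1B_add=> //; exact: L1B_scale.
apply: le_trans Iv _; apply: IB_le.
- have LN := Linf_normalizer s X.
 apply: L1B_add.
  apply: L1B_scale; apply: L1B_sub=> //; apply: L1B_Linf=> //.
  by apply: L1B_add; [apply: L1B_add=> //|]; exact: L1B_scale.
 apply: L1B_scale; apply: L1B_sub; apply: Linf_L1; apply: Linf_Wv=> // k; exact: af_Linf (A k).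
- by apply: L1B_scale; apply: L1B_add=> //; exact: L1B_scale.
apply: aeB_mono (mn_1 M) => x _ u1.
have X0 := sq1_ge0 xi x.
have s20 : 0 < s^+2 by rewrite exprn_gt0.
have N0 : 0 < 1 + s^+2*sq1 xi x by rewrite ltr_wpDr// mulr_ge0// ltW.
have [r0 rN] := normalizerE s xi x; set r := (sqrt _)^-1 in r0 rN *.
have := W1 u1 r0 rN (ltW s0); rewrite vE -/r => HW.
have {}HW := ler_wpM2l (ltW l0) HW.
have HN1 : (1 + s^+2*sq1 xi x)^-1 <= 1 by rewrite invf_le1// lerDl mulr_ge0// ltW.
have Sq : sq2 w x + 2*s * pair2 w eta x + s^+2*sq2 eta x = \sum_i \sum_k (w k i x + s*eta k i x)^+2.
 rewrite /sq2 /pair2 !mulr_sumr -!big_split /=; apply: eq_bigr => i _.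
 rewrite !mulr_sumr -!big_split /=; apply: eq_bigr => k _; ring.
have S0 : 0 <= sq2 w x + 2*s * pair2 w eta x + s^+2*sq2 eta x.
 by rewrite Sq; apply: sumr_ge0 => i _; apply: sumr_ge0 => k _; exact: sqr_ge0.
have h1 := ler_wpM2r S0 HN1; rewrite mul1r in h1.
rewrite /rest; set n := nrm5 _ in HW *.
have n0 : 0 <= n := nrm5_ge0 _.
have K0 := Ktau_ge0 R.
have h2 : lam*(Ktau R*(s^+3 * n^+3)) <= lam*(Ktau R*(s^+2 * n^+3)).
 apply: ler_wpM2l; first exact: ltW.
 apply: ler_wpM2l=> //; apply: ler_wpM2r; first exact: exprn_ge0.
 by rewrite [s^+3]exprS ler_piMl// ltW.
have E1 : lam*(Ktau R*(s * n + s^+2*(2 * n^+2) + s^+3 * n^+3)) =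
 s*(Ktau R * lam * n) + s^+2*(Ktau R * lam*(2 * n^+2)) + lam*(Ktau R*(s^+3 * n^+3)) by ring.
have -> : s*(pair2 w eta x + Ktau R * lam * n + s*(2^-1*sq2 eta x + Ktau R * lam*(2 * n^+2 + n^+3))) =
 2^-1*(2*s * pair2 w eta x + s^+2*sq2 eta x) + (s*(Ktau R * lam * n) + s^+2*(Ktau R * lam*(2 * n^+2)) + lam*(Ktau R*(s^+2 * n^+3))) by field.
rewrite E1 in HW; lra.
Qed.

End Competitors.

(** * The second variation summed over a bent frame *)

Section Stability.
Variable R : realType.
Local Notation B := (@B1 R).

(** The squared norm of the 5 x 5 matrix A Id + u r^T + m p^T; both the fields [Xf] and their
    derivatives, indexed by the frame, have this form. *)
Lemma sum_sq_frame (A : R) (u r m p : 'I_5 -> R) :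
 \sum_a \sum_k (A*(a == k)%:R + u a*r k + m a * p k)^+2 =
 5*A^+2 + dot u u*dot r r + dot m m*dot p p + 2*A*dot u r + 2*A*dot m p
 + 2*dot u m*dot r p.
Proof.
have S (F : 'I_5 -> R) a : \sum_k (a == k)%:R*F k = F a.
 by rewrite (bigD1 a)//= eqxx mul1r big1 ?addr0// => k /negbTE; rewrite eq_sym=> ->; rewrite mul0r.
transitivity (\sum_a (\sum_k (a == k)%:R*(A^+2 + 2*A*(u a*r k + m a * p k))
 + (u a*u a*dot r r + m a * m a*dot p p + 2*(u a * m a)*dot r p))).
 apply: eq_bigr => a _; rewrite /dot !mulr_sumr -!big_split /=; apply: eq_bigr => k _.
 by case: (a == k) => /=; ring.
under eq_bigr do rewrite S.
move: (dot r r) (dot p p) (dot r p) => rr pp rp.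
by rewrite /dot !big_I5; ring.
Qed.

Variables (lam : R) (f : 'I_5 -> nat -> R3 R -> R) (u : 'I_5 -> R3 R -> R)
 (w : 'I_5 -> 'I_3 -> R3 R -> R) (c : 'I_5 -> R3 R -> R).
Variables (phi : R3 R -> R) (beta : 'I_5 -> R3 R -> R).
Hypothesis l0 : 0 < lam.
Hypothesis M : Min lam f u w c.
Hypothesis sphi : smooth phi.
Hypothesis sbeta : forall k, smooth (beta k).
Hypothesis bdry : forall x, enorm x != 0 -> phi (nrm x) = 0 \/ forall k, beta k (nrm x) = c k (nrm x).

Let A := mn_app M.
Let kap k i := partial i (beta k).
(** It is 0 where u = beta is a unit vector, and 1 for beta = 0; in the latter case the fields [Xf]
    below are the tangential projections of a constant frame, multiplied by phi. Its derivative is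
    -[th]. *)
Definition qq x := 1 - dot (u^~ x) (beta^~ x).
Definition th i x := dot (u^~ x) (fun k => kap k i x) + dot (beta^~ x) (fun k => w k i x).

Let Aq : AppF (fun n x => 1 + (-1) * \sum_k f k n x*beta k x) qq (fun i x => - th i x)
 (fun x => 1 - dot (c^~ x) (beta^~ x)).
Proof.
have := af_add (af_cst 1) (af_scale (-1) (af_sum (index_enum 'I_5) (fun k => af_mul (A k) (af_smooth (sbeta k))))).
apply: eq_af=> [x|i x|x]; rewrite ?mulN1r// add0r big_split.
by congr (- (_ + _)).
Qed.

(* For constant a these fields are tangent to S^4 at u, and they vanish where u = beta. *)
Definition Xf a k x := phi x*(qq x*(a == k)%:R + u a x*(beta k x - u k x)).
Definition dXf (a k : 'I_5) i x :=
 (partial i phi x*qq x - phi x*th i x)*(a == k)%:R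
 + u a x*(partial i phi x*(beta k x - u k x) + phi x*(kap k i x - w k i x))
 + w a i x*(phi x*(beta k x - u k x)).

Let Xtang a : exists g d, Tang u w g (Xf a) (dXf a) d.
Proof.
pose g k n x := phi x*((a == k)%:R*(1 + (-1) * \sum_k f k n x*beta k x) + f a n x*(beta k x + (-1)*f k n x)).
pose d k x := phi x*((a == k)%:R*(1 - dot (c^~ x) (beta^~ x)) + c a x*(beta k x + (-1)*c k x)).
exists g, d; split.
- move=> k.
 have := af_mul (af_smooth sphi) (af_add (af_scale ((a == k)%:R : R) Aq) (af_mul (A a) (af_add (af_smooth (sbeta k)) (af_scale (-1) (A k))))).
 by apply: eq_af=> [x|i x|x]; rewrite /Xf /dXf /kap /d; ring.
- move=> k x x0; rewrite /d; have [->|E] := bdry x0; first by rewrite mul0r.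
 have -> : dot (c^~ (nrm x)) (beta^~ (nrm x)) = 1 by rewrite -(mn_c M x0); apply: eq_bigr => l _; rewrite E.
 by rewrite E subrr mulr0 add0r mulN1r subrr !mulr0.
- apply: aeB_mono (mn_1 M) => x _ u1.
 have -> : dot (u^~ x) (Xf a ^~ x) = phi x*(qq x*u a x + u a x*(dot (u^~ x) (beta^~ x) - dot (u^~ x) (u^~ x))).
  have D (F : 'I_5 -> R) : \sum_k F k*(a == k)%:R = F a.
   by rewrite (bigD1 a)//= eqxx mulr1 big1 ?addr0// => k /negbTE; rewrite eq_sym=> ->; rewrite mulr0.
  transitivity (\sum_k (phi x*qq x*(u k x*(a == k)%:R) + phi x*u a x*(u k x*beta k x) + (- (phi x*u a x))*(u k x*u k x))).
   by apply: eq_bigr => k _; rewrite /Xf; ring.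
  by rewrite !big_split /= -!mulr_sumr (D (u^~ x)) -/(dot (u^~ x) (beta^~ x)) -/(dot (u^~ x) (u^~ x)); ring.
 by rewrite u1 /qq; ring.
- apply: aeB_mono2 (mn_1 M) (mn_w M) => x _ u1 uw i.
 have D (F : 'I_5 -> R) : \sum_k F k*(a == k)%:R = F a.
  by rewrite (bigD1 a)//= eqxx mulr1 big1 ?addr0// => k /negbTE; rewrite eq_sym=> ->; rewrite mulr0.
 have := uw i; set m := fun k => w k i x => um.
 transitivity ((partial i phi x*qq x - phi x*th i x)*u a x
  + u a x*(partial i phi x*(dot (u^~ x) (beta^~ x) - dot (u^~ x) (u^~ x)) + phi x*(dot (u^~ x) (fun k => kap k i x) - dot (u^~ x) m))
  + m a*(phi x*(dot (u^~ x) (beta^~ x) - dot (u^~ x) (u^~ x)))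
  + (phi x*qq x * m a + phi x*u a x*(dot (beta^~ x) m - dot (u^~ x) m))).
  have -> : dot (u^~ x) (fun k => dXf a k i x) = (partial i phi x*qq x - phi x*th i x)*u a x
    + (u a x * partial i phi x + m a * phi x)*dot (u^~ x) (beta^~ x) + (- (u a x * partial i phi x + m a * phi x))*dot (u^~ x) (u^~ x)
    + (u a x * phi x)*dot (u^~ x) (fun k => kap k i x) + (- (u a x * phi x))*dot (u^~ x) m.
   rewrite -(D (u^~ x)) /dot !mulr_sumr -!big_split /=; apply: eq_bigr => k _.
   by rewrite (D (u^~ x)) /dXf /m; ring.
  have -> : dot (Xf a ^~ x) m = phi x*qq x * m a + (phi x*u a x)*dot (beta^~ x) m + (- (phi x*u a x))*dot (u^~ x) m.
   rewrite -[m a]D /dot !mulr_sumr -!big_split /=; apply: eq_bigr => k _.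
   by rewrite /Xf /m; ring.
  by ring.
 by rewrite u1 um /th -/m /qq; ring.
Qed.

(** |beta - u|^2 for a unit vector u. *)
Definition Bu x := dot (beta^~ x) (beta^~ x) - 2*dot (u^~ x) (beta^~ x) + 1.

(** The sum over the frame of |D_i X|^2 - |X|^2 |D_i u|^2, plus the first variation in the direction
    [ef]. For beta = 0 it reduces to 4 (D_i phi)^2 - 2 phi^2 |D_i u|^2, the classical stability
    integrand for maps into S^4. *)
Definition stab_term i x :=
 let m k := w k i x in let ka k := kap k i x in let g := partial i phi x in
 let ph := phi x in let q := qq x in
 - 2 * ph^+2*dot m m + g^+2*(3*q^+2 + Bu x) + 4 * ph*g*dot (beta^~ x) m
 + 2 * ph*g*(dot (beta^~ x) ka - (1 + 3*q)*dot (u^~ x) ka)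
 + ph^+2*(dot ka ka - 2*dot m ka + 3*th i x*dot (u^~ x) ka + 3*(1 + q)*dot m ka).

Let bT k x := beta k x - dot (u^~ x) (beta^~ x)*u k x.
(** A multiple of the tangential part of beta. Its first variation cancels the term 3 phi^2 (beta .
    D u)^2 of the summed second variation and turns the coefficient 1 - 3 q^2 of phi^2 |D u|^2 into
    -2, whatever q is. *)
Definition ef k x := phi x^+2*(3 + 3*qq x)*bT k x.
Definition def (k : 'I_5) i x := (2 * phi x * partial i phi x*(3 + 3*qq x) - 3 * phi x^+2*th i x)*bT k x
 + phi x^+2*(3 + 3*qq x)*(kap k i x - th i x*u k x - dot (u^~ x) (beta^~ x)*w k i x).

Let etang : exists g d, Tang u w g ef def d.
Proof.
pose h n x := 1 + (-1) * \sum_k f k n x*beta k x.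
pose g k n x := phi x * phi x*(3 + 3*h n x)*(beta k x + (-1)*((1 + (-1)*h n x)*f k n x)).
pose hc x := 1 - dot (c^~ x) (beta^~ x).
pose d k x := phi x * phi x*(3 + 3*hc x)*(beta k x + (-1)*((1 + (-1)*hc x)*c k x)).
exists g, d; split.
- move=> k.
 have := af_mul (af_mul (af_mul (af_smooth sphi) (af_smooth sphi)) (af_add (af_cst 3) (af_scale 3 Aq)))
  (af_add (af_smooth (sbeta k)) (af_scale (-1) (af_mul (af_add (af_cst 1) (af_scale (-1) Aq)) (A k)))).
 by apply: eq_af=> [x|i x|x]; rewrite /ef /def /bT /kap /d /hc /qq; ring.
- move=> k x x0; rewrite /d; have [->|E] := bdry x0; first by rewrite !mul0r.
 have h0 : hc (nrm x) = 0 by rewrite /hc -(mn_c M x0) -sumrB big1// => l _; rewrite E subrr.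
 by rewrite h0 E; ring.
- apply: aeB_mono (mn_1 M) => x _ u1.
 have -> : dot (u^~ x) (ef^~ x) = phi x^+2*(3 + 3*qq x)*(dot (u^~ x) (beta^~ x) - dot (u^~ x) (beta^~ x)*dot (u^~ x) (u^~ x)).
  have [be beE] : exists be, be = dot (u^~ x) (beta^~ x) by eexists.
  have -> : dot (u^~ x) (ef^~ x) = phi x^+2*(3 + 3*qq x)*dot (u^~ x) (beta^~ x) + (- (phi x^+2*(3 + 3*qq x)*be))*dot (u^~ x) (u^~ x).
   by rewrite /dot !mulr_sumr -big_split /=; apply: eq_bigr => k _; rewrite /ef /bT -beE; ring.
  by rewrite beE; ring.
 by rewrite u1 mulr1 subrr mulr0.
- apply: aeB_mono2 (mn_1 M) (mn_w M) => x _ u1 uw i.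
 have := uw i; set m := fun k => w k i x => um.
 have [be beE] : exists be, be = dot (u^~ x) (beta^~ x) by eexists.
 transitivity ((2 * phi x * partial i phi x*(3 + 3*qq x) - 3 * phi x^+2*th i x)*(be - be*dot (u^~ x) (u^~ x))
  + phi x^+2*(3 + 3*qq x)*(dot (u^~ x) (fun k => kap k i x) - th i x*dot (u^~ x) (u^~ x) - be*dot (u^~ x) m)
  + phi x^+2*(3 + 3*qq x)*(dot (beta^~ x) m - be*dot (u^~ x) m)).
  rewrite (_ : dot (u^~ x) (fun k => def k i x) = (2 * phi x * partial i phi x*(3 + 3*qq x) - 3 * phi x^+2*th i x)*dot (u^~ x) (beta^~ x)
   + (- (2 * phi x * partial i phi x*(3 + 3*qq x) - 3 * phi x^+2*th i x)*be)*dot (u^~ x) (u^~ x)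
   + phi x^+2*(3 + 3*qq x)*dot (u^~ x) (fun k => kap k i x)
   + (- phi x^+2*(3 + 3*qq x)*th i x)*dot (u^~ x) (u^~ x)
   + (- phi x^+2*(3 + 3*qq x)*be)*dot (u^~ x) m); last first.
   by rewrite /dot !mulr_sumr -!big_split /=; apply: eq_bigr => k _; rewrite /def /bT -beE /m; ring.
  rewrite (_ : dot (ef^~ x) m = phi x^+2*(3 + 3*qq x)*dot (beta^~ x) m + (- phi x^+2*(3 + 3*qq x)*be)*dot (u^~ x) m); last first.
   by rewrite /dot !mulr_sumr -!big_split /=; apply: eq_bigr => k _; rewrite /ef /bT -beE /m; ring.
  by rewrite -beE; ring.
 by rewrite u1 um /th -/m; ring.
Qed.

(** The five inequalities [V_ineq] for [Xf] and the inequality [EL_ineq] for [ef] are added; the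
    integrand is then simplified by |u| = 1 and u . D u = 0. *)
Lemma stability : L1B (fun x => \sum_i stab_term i x
 + Ktau R * lam*(4*(phi x^+2*(3*qq x^+2 + Bu x)) + nrm5 (ef^~ x))) /\
 0 <= IB (fun x => \sum_i stab_term i x
 + Ktau R * lam*(4*(phi x^+2*(3*qq x^+2 + Bu x)) + nrm5 (ef^~ x))).
Proof.
have Lu k := af_Linf (A k).
have Lb k : Linf (beta k) by apply: Linf_continuous; exact: smooth_continuous.
have Lka k i : Linf (kap k i) by apply: Linf_continuous; exact/smooth_continuous/smooth_partial.
pose F a x := sq2 (dXf a) x - sq1 (Xf a) x*sq2 w x + 4*Ktau R * lam*sq1 (Xf a) x.
have LF a : L1B (F a).
 have [g [d T]] := Xtang a; have X := tg_app T.
 apply: L1B_add; last by apply: L1B_scale; apply: Linf_L1; exact: Linf_sq1 X.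
 apply: L1B_sub; first exact: L1_sq2 X.
 by apply: L1B_Linf; [exact: Linf_sq1 X|exact: L1_sq2 A].
have [ge [de Te]] := etang; have Xe := tg_app Te.
have H1 : 0 <= IB (fun x => \sum_a F a x).
 by rewrite IB_sum//; apply: sumr_ge0 => a _; have [g [d T]] := Xtang a; exact: V_ineq l0 M T.
have H2 := EL_ineq l0 M Te.
have LG : L1B (fun x => pair2 w def x + Ktau R * lam * nrm5 (ef^~ x)).
 apply: L1B_add.
  by apply: L1B_sum => i; apply: L1B_sum => k; apply: L2B_mul; [exact: af_L2 (A k)|exact: af_L2 (Xe k)].
 apply: L1B_scale; have [mX [K HK]] := Linf_sq1 Xe; apply: Linf_L1.
 split; first by apply: (measurableT_comp (@measurable_sqrt R)).
 exists (1 + K); apply: aeB_mono HK => x _; rewrite ger0_norm; last by apply: sumr_ge0 => k _; exact: sqr_ge0.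
 rewrite ger0_norm ?nrm5_ge0// -[sq1 ef x](sqr_nrm5 (ef^~ x)); move: (nrm5 _) => z; have := sqr_ge0 (z - 1); nra.
have := addr_ge0 H1 H2; rewrite -IBD//; last exact: L1B_sum.
have AE : aeB (fun x => \sum_a F a x + (pair2 w def x + Ktau R * lam * nrm5 (ef^~ x)) =
 \sum_i stab_term i x + Ktau R * lam*(4*(phi x^+2*(3*qq x^+2 + Bu x)) + nrm5 (ef^~ x))).
 apply: aeB_mono2 (mn_1 M) (mn_w M) => x _ u1 uw.
 have S1 : \sum_a sq1 (Xf a) x = phi x^+2*(3*qq x^+2 + Bu x).
  pose r k := 1*(phi x*beta k x) + (- phi x)*u k x.
  transitivity (\sum_a \sum_k ((phi x*qq x)*(a == k)%:R + u a x*r k + (fun=> 0) a*(fun=> 0) k)^+2).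
   by apply: eq_bigr => a _; apply: eq_bigr => k _; rewrite /Xf /r; ring.
  have Z (v : 'I_5 -> R) : dot v (fun=> 0) = 0 by rewrite /dot big1// => k _; rewrite mulr0.
  rewrite (sum_sq_frame _ (u^~ x) r (fun=> 0) (fun=> 0)) u1 !Z.
  have rE : r = fun k => phi x*beta k x + (- phi x)*u k x by apply/funext => k; rewrite /r mul1r.
  have ex v : dot v r = phi x*dot v (beta^~ x) + (- phi x)*dot v (u^~ x) by rewrite rE dot_lin.
  by rewrite (ex r) !(dotC r) !ex u1 (dotC (beta^~ x) (u^~ x)) /Bu /qq; ring.
 have S2 i : \sum_a \sum_k (dXf a k i x)^+2 - phi x^+2*(3*qq x^+2 + Bu x)*dot (fun k => w k i x) (fun k => w k i x)
   + \sum_k w k i x*def k i x = stab_term i x.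
  have := uw i; set m := fun k => w k i x => um; pose ka k := kap k i x.
  pose g := partial i phi x; pose p := phi x; pose q := qq x.
  pose bu := dot (u^~ x) (beta^~ x).
  pose r k := g*(beta k x + (-1)*u k x) + p*(ka k + (-1) * m k).
  pose pp k := p*beta k x + (- p)*u k x.
  have -> : \sum_a \sum_k (dXf a k i x)^+2 = \sum_a \sum_k ((g*q - p*th i x)*(a == k)%:R + u a x*r k + m a * pp k)^+2.
   by apply: eq_bigr => a _; apply: eq_bigr => k _; rewrite /dXf /r /pp /m /ka /g /p /q; ring.
  rewrite sum_sq_frame.
  have dl (v b1 b2 : 'I_5 -> R) (t : R) : dot v (fun k => b1 k + t*b2 k) = dot v b1 + t*dot v b2.
   by rewrite /dot mulr_sumr -big_split /=; apply: eq_bigr => k _; ring.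
  have -> : \sum_k w k i x*def k i x = (2 * p*g*(3 + 3*q) - 3 * p^+2*th i x)*(dot (beta^~ x) m - bu*dot (u^~ x) m)
   + p^+2*(3 + 3*q)*(dot m ka - th i x*dot (u^~ x) m - bu*dot m m).
   rewrite /dot !mulr_sumr -!sumrB !mulr_sumr -!big_split /=; apply: eq_bigr => k _.
   by rewrite /def /bT -/bu /m /ka /p /q /g; ring.
  have ur : dot (u^~ x) r = g*(bu - 1) + p*(dot (u^~ x) ka).
   by rewrite /r dot_lin !dl u1 um -/bu; ring.
  have rr : dot r r = g^+2*Bu x + 2*g * p*(dot (beta^~ x) ka - dot (beta^~ x) m - dot (u^~ x) ka)
    + p^+2*(dot ka ka - 2*dot m ka + dot m m).
   have ex v : dot v r = g*(dot v (beta^~ x) + -1*dot v (u^~ x)) + p*(dot v ka + -1*dot v m) by rewrite /r dot_lin !dl.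
   rewrite (ex r) !(dotC r) !ex u1 um (dotC (beta^~ x) (u^~ x)) (dotC ka (beta^~ x)) (dotC m (beta^~ x)) (dotC ka (u^~ x)) (dotC m (u^~ x)) (dotC ka m) um /Bu; ring.
  have pe : dot pp pp = p^+2*Bu x.
   have ex v : dot v pp = p*dot v (beta^~ x) + (- p)*dot v (u^~ x) by rewrite /pp dot_lin.
   by rewrite (ex pp) !(dotC pp) !ex u1 (dotC (beta^~ x) (u^~ x)) /Bu; ring.
  have mp : dot m pp = p*dot (beta^~ x) m.
   by rewrite /pp dot_lin (dotC m (u^~ x)) um (dotC m); ring.
  rewrite u1 ur rr pe mp um /stab_term -/ka -/m -/g -/p -/q /th -/ka -/m.
  have -> : bu = 1 - q by rewrite /q /qq -/bu; ring.
  ring.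
 rewrite /F big_split /= -mulr_sumr S1 sumrB -mulr_suml S1.
 rewrite [\sum_a sq2 (dXf a) x]exchange_big /=.
 under [X in X - _ + _ + _]eq_bigr do idtac.
 have -> : sq2 w x = \sum_i dot (fun k => w k i x) (fun k => w k i x) by apply: eq_bigr => i _; rewrite dot_sqr.
 rewrite /pair2 mulr_sumr -sumrB.
 set P1 := \sum_(i < 3) (_ - _); set P2 := \sum_(i < 3) \sum_(k < 5) _.
 have -> : \sum_(i < 3) stab_term i x = P1 + P2 by rewrite /P1 /P2 -big_split /=; apply: eq_bigr => i _; rewrite -S2.
 by ring.
suff mS : mB (fun x => \sum_i stab_term i x
 + Ktau R * lam*(4*(phi x^+2*(3*qq x^+2 + Bu x)) + nrm5 (ef^~ x))).
 have L1 : L1B (fun x => \sum_a F a x + (pair2 w def x + Ktau R * lam * nrm5 (ef^~ x))).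
  by apply: L1B_add=> //; exact: L1B_sum.
 by rewrite (IB_ae_eq (L1B_m L1) mS AE); split=> //; exact: L1B_ae_eq mS L1 AE.
have mb k : mB (beta k) by case: (Lb k).
have mu_ k : mB (u k) by exact: (af_m (A k)).
have mw k i : mB (w k i) by exact: (af_mw (A k)).
have mk k i : mB (kap k i) by case: (Lka k i).
have mp : mB phi by apply: mB_continuous; exact: smooth_continuous.
have mdp i : mB (partial i phi) by exact: mB_partial.
have md (a b : 'I_5 -> R3 R -> R) : (forall k, mB (a k)) -> (forall k, mB (b k)) -> mB (fun x => dot (a^~ x) (b^~ x)).
 by move=> ha hb; apply: mB_sum => k; exact: mB_mul.
have mc (t : R) : mB (fun=> t) by exact: measurable_cst.
have mB_sq g : mB g -> mB (fun x => g x^+2) by move=> mg; exact: measurable_funX.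
have mB_opp g : mB g -> mB (fun x => - g x) by move=> mg; exact: measurableT_comp.
have mq : mB qq by apply: mB_add=> //; apply: mB_opp; exact: md.
have mBu : mB Bu.
 by apply: mB_add=> //; apply: mB_add; [exact: md|apply: mB_opp; apply: mB_mul=> //; exact: md].
have mth i : mB (th i) by apply: mB_add; [exact: (md u (fun k => kap k i))|exact: (md beta (fun k => w k i))].
apply: mB_add; last first.
 apply: mB_mul=> //; apply: mB_add.
  apply: mB_mul=> //; apply: mB_mul; first exact: mB_sq.
  by apply: mB_add=> //; apply: mB_mul=> //; exact: mB_sq.
 apply: (measurableT_comp (@measurable_sqrt R)); apply: mB_sum => k; apply: mB_sq; exact: (af_m (Xe k)).
apply: mB_sum => i; rewrite /stab_term.
have m1 := md (fun k => w k i) (fun k => w k i) (mw^~ i) (mw^~ i).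
have m2 := md beta (fun k => w k i) mb (mw^~ i).
have m3 := md beta (fun k => kap k i) mb (mk^~ i).
have m4 := md u (fun k => kap k i) mu_ (mk^~ i).
have m5 := md (fun k => kap k i) (fun k => kap k i) (mk^~ i) (mk^~ i).
have m6 := md (fun k => w k i) (fun k => kap k i) (mw^~ i) (mk^~ i).
have mp2 := mB_sq _ _ mp; have mq2 := mB_sq _ _ mq.
apply: mB_add; first (apply: mB_add; first (apply: mB_add; first apply: mB_add)).
- by apply: mB_mul=> //; apply: mB_mul.
- by apply: mB_mul; [exact: mB_sq|apply: mB_add=> //; exact: mB_mul].
- by apply: mB_mul=> //; apply: mB_mul=> //; exact: mB_mul.
- apply: mB_mul; first by apply: mB_mul=> //; exact: mB_mul.
 apply: mB_add=> //; apply: mB_opp; apply: mB_mul=> //; apply: mB_add=> //; exact: mB_mul.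
- apply: mB_mul=> //; apply: mB_add; first (apply: mB_add; first apply: mB_add=> //).
 + by apply: mB_opp; apply: mB_mul.
 + by apply: mB_mul=> //; apply: mB_mul.
 + by apply: mB_mul=> //; apply: mB_mul=> //; apply: mB_add.
Qed.

End Stability.

(** * Algebraic inequalities for the stability integrand *)

Section Pointwise.
Variable R : realType.
Implicit Types (a b u m : 'I_5 -> R).

Definition n5 a : R := sqrt (dot a a).
Lemma n5_ge0 a : 0 <= n5 a. Proof. exact: sqrtr_ge0. Qed.
Lemma n5_sqr a : n5 a^+2 = dot a a. Proof. by rewrite sqr_sqrtr// dot_ge0. Qed.

Lemma dot_le a b : `|dot a b| <= n5 a * n5 b.
Proof.
apply: sqr_le_le=> //; first by rewrite mulr_ge0 ?n5_ge0.
by rewrite real_normK ?num_real// exprMn !n5_sqr dot_CS.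
Qed.

Lemma young (A B e : R) : 0 < e -> A*B <= e/2*A^+2 + (2*e)^-1*B^+2.
Proof.
move=> e0; rewrite -subr_ge0.
have -> : e/2*A^+2 + (2*e)^-1*B^+2 - A*B = (2*e)^-1*(e*A - B)^+2 by field; rewrite gt_eqF.
by rewrite mulr_ge0 ?sqr_ge0// invr_ge0 mulr_ge0// ltW.
Qed.

(** All terms with the derivative of beta are absorbed at the price of 1/4 of (D phi)^2 and 1/4 of
    phi^2 |D u|^2. Here 980 = 576 + 404, from Young's inequality with |1 + 3 q| <= 10 and 3 (1 + q)
    <= 12. *)
Lemma lower_terms (beta u m ka : 'I_5 -> R) (ph g q th : R) :
 dot u u = 1 -> n5 beta <= 2 -> -1 <= q <= 3 -> th = dot u ka + dot beta m ->
 2 * ph*g*(dot beta ka - (1 + 3*q)*dot u ka)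
 + ph^+2*(dot ka ka - 2*dot m ka + 3*th*dot u ka + 3*(1 + q)*dot m ka)
 <= 4^-1*g^+2 + 4^-1 * ph^+2*dot m m + 980 * ph^+2*dot ka ka.
Proof.
move=> u1 b2 /andP[q1 q2] thE.
have u1' : n5 u = 1 by rewrite /n5 u1 sqrtr1.
have := dot_le beta ka; have := dot_le u ka; have := dot_le m ka; have := dot_le beta m.
rewrite u1' mul1r; have kE := n5_sqr ka; have mE := n5_sqr m.
have k0 := n5_ge0 ka; have m0 := n5_ge0 m; have be0 := n5_ge0 beta.
move: (n5 ka) (n5 m) (n5 beta) k0 m0 be0 b2 kE mE => k M be k0 M0 be0 be2 kE mE.
move=> hbm hmk huk hbk.
have bm2 : `|dot beta m| <= 2*M by apply: le_trans hbm _; exact: ler_wpM2r.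
have bk2 : `|dot beta ka| <= 2 * k by apply: le_trans hbk _; exact: ler_wpM2r.
have q10 : `|1 + 3*q| <= 10 by rewrite ler_norml; lra.
have q12 : `|3*(1 + q)| <= 12 by rewrite ler_norml; lra.
have h1 : `|dot beta ka - (1 + 3*q)*dot u ka| <= 12 * k.
 apply: le_trans (ler_normB _ _) _; rewrite normrM.
 have : `|1 + 3*q| * `|dot u ka| <= 10 * k by apply: ler_pM.
 lra.
have h2 : 2 * ph*g*(dot beta ka - (1 + 3*q)*dot u ka) <= 4^-1*g^+2 + 576 * ph^+2 * k^+2.
 apply: le_trans (ler_norm _) _; rewrite 3!normrM ger0_norm//.
 apply: (@le_trans _ _ (`|g|*(24 * `|ph| * k))).
  rewrite (_ : `|g|*(24 * `|ph| * k) = 2 * `|ph| * `|g|*(12 * k)); last by ring.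
  by apply: ler_wpM2l=> //; rewrite !mulr_ge0.
 have := @young `|g| (24 * `|ph| * k) (2^-1) ltac:(lra).
 rewrite !exprMn !real_normK ?num_real// => h; apply: le_trans h _.
 by rewrite le_eqVlt; apply/orP; left; apply/eqP; field.
have thB : `|th| <= k + 2*M by rewrite thE; apply: le_trans (ler_normD _ _) _; exact: lerD.
have h3 : dot ka ka - 2*dot m ka + 3*th*dot u ka + 3*(1 + q)*dot m ka <= 4 * k^+2 + 20*(M * k).
 have a1 : - (M * k) <= dot m ka by move: hmk; rewrite ler_norml => /andP[].
 have a2 : th*dot u ka <= (k + 2*M) * k.
  by apply: le_trans (ler_norm _) _; rewrite normrM ler_pM.
 have a3 : 3*(1 + q)*dot m ka <= 12*(M * k).
  by apply: le_trans (ler_norm _) _; rewrite normrM; apply: ler_pM.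
 rewrite -kE; lra.
have h4 := @young M (20 * k) (2^-1) ltac:(lra).
have p2 : 0 <= ph^+2 := sqr_ge0 ph.
have h5 : ph^+2*(dot ka ka - 2*dot m ka + 3*th*dot u ka + 3*(1 + q)*dot m ka)
 <= ph^+2*(4^-1*M^+2 + 404 * k^+2).
 apply: ler_wpM2l=> //; apply: le_trans h3 _.
 have -> : 4^-1*M^+2 + 404 * k^+2 = 4 * k^+2 + (2^-1/2*M^+2 + (2*2^-1)^-1*(20 * k)^+2) by field.
 by rewrite lerD2l; apply: le_trans h4; lra.
by move: h5; rewrite -kE -mE; move=> h5; lra.
Qed.

(** As u . a = 0, the number -u_0 a_0 is the inner product of the four other components, to which
    the Cauchy-Schwarz inequality is applied. *)
Lemma tangent_first (u a : 'I_5 -> R) : dot u u = 1 -> dot u a = 0 ->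
 a 0^+2 <= (1 - u 0^+2)*dot a a.
Proof.
rewrite /dot !big_I5 => u1 ua.
pose u' k : R := if k == 0 :> 'I_5 then 0 else u k; pose a' k : R := if k == 0 :> 'I_5 then 0 else a k.
have := dot_CS u' a'; rewrite /dot !big_I5 /u' /a' /= !(mul0r, add0r).
have -> : u 1*a 1 + u 2*a 2 + u 3*a 3 + u 4*a 4 = - (u 0*a 0) by lra.
have -> : u 1*u 1 + u 2*u 2 + u 3*u 3 + u 4*u 4 = 1 - u 0^+2 by rewrite expr2; lra.
have -> : a 0*a 0 + a 1*a 1 + a 2*a 2 + a 3*a 3 + a 4*a 4 = a 0^+2 + (a 1*a 1 + a 2*a 2 + a 3*a 3 + a 4*a 4) by ring.
move: (a 1*a 1 + a 2*a 2 + a 3*a 3 + a 4*a 4) => aa h.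
rewrite mulrDr; have := h; rewrite sqrrN exprMn => h'.
have -> : (1 - u 0^+2)*a 0^+2 = a 0^+2 - u 0^+2*a 0^+2 by ring.
lra.
Qed.

End Pointwise.

(** * The stability inequality for cut-offs around a point of the axis *)

Section Radial.
Variable R : realType.
Local Notation B := (@B1 R).
Variables (lam : R) (f : 'I_5 -> nat -> R3 R -> R) (u : 'I_5 -> R3 R -> R)
 (w : 'I_5 -> 'I_3 -> R3 R -> R) (c : 'I_5 -> R3 R -> R).
Variables (c0 : R) (Phi dPhi : R -> R) (beta : 'I_5 -> R3 R -> R).
Hypothesis l0 : 0 < lam.
Hypothesis M : Min lam f u w c.

Definition yc (x : R3 R) := x.1.1^+2 + x.1.2^+2 + (x.2 - c0)^+2.
Definition rho2 (x : R3 R) := x.1.1^+2 + x.1.2^+2.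
Definition xc (i : 'I_3) (x : R3 R) := coord i x - (if i == 2 then c0 else 0).
(* [rho2 * Lam] is the derivative of u along V_tau = (-(z-c)x1, -(z-c)x2, rho2). *)
Definition vtau (k : 'I_5) x := - (x.2 - c0)*x.1.1*w k 0 x - (x.2 - c0)*x.1.2*w k 1 x + rho2 x*w k 2 x.
Definition vphi (k : 'I_5) x := x.1.1*w k 1 x - x.1.2*w k 0 x.
Definition Lam x := vtau 0 x / rho2 x.

Let phi x := Phi (yc x).
Hypothesis sphi : smooth phi.
Hypothesis dP : forall y : R, is_derive y (1 : R) Phi (dPhi y).
Hypothesis cdP : continuous dPhi.
Hypothesis sbeta : forall k, smooth (beta k).
Hypothesis bdry : forall x, enorm x != 0 -> phi (nrm x) = 0 \/ forall k, beta k (nrm x) = c k (nrm x).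
Hypothesis ang : aeB (fun x => 1 - u 0 x^+2 <= dot (vphi^~ x) (vphi^~ x)).

Lemma gsm_yc : gsm yc.
Proof.
apply: Gadd; first (apply: Gadd; apply: gsm_sqr; [exact: (Gcoord _ 0)|exact: (Gcoord _ 1)]).
by apply: gsm_sqr; apply: gsm_sub; [exact: (Gcoord _ 2)|exact: Gcst].
Qed.

Lemma partial_sqr3 i x (a b d : R3 R -> R) : smooth a -> smooth b -> smooth d ->
 partial i (fun x => a x^+2 + b x^+2 + d x^+2) x =
 2*(a x * partial i a x + b x * partial i b x + d x * partial i d x).
Proof.
move=> sa sb sd; rewrite (partialD i x (smooth_add (smooth_mul sa sa) (smooth_mul sb sb)) (smooth_mul sd sd)).
by rewrite (partialD i x (smooth_mul sa sa) (smooth_mul sb sb)) (partialM i x sa sa) (partialM i x sb sb) (partialM i x sd sd); ring.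
Qed.

Lemma partial_yc i x : partial i yc x = 2*xc i x.
Proof.
have cE j : (fun x : R3 R => coord j x) = coord j by [].
have sc j : smooth (@coord R j) by apply: gsm_smooth; exact: Gcoord.
have pc j : partial i (coord j) x = (j == i)%:R.
 have [_ E] := smooth_differentiable x (sc j).
 have lE : coord j = lin_form (fun l => (j == l)%:R) :> (R3 R -> R).
  by apply/funext => y; rewrite /lin_form big_I3; move: j {E cE sc};  apply: I3_case; rewrite /= ?mulr1 ?mulr0 ?addr0 ?add0r.
 have dc : differentiable (coord j) x by case: (smooth_differentiable x (sc j)).
 rewrite /partial deriveE// [in 'd _ _]lE diff_lin; last exact: lin_form_continuous.
 by rewrite -[LHS]/(lin_form _ _) -lE coord_basis.
have s2 : smooth (fun x => coord 2 x + - c0) := smooth_add (sc 2) (smooth_cst (- c0)).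
rewrite (partial_sqr3 i x (sc 0) (sc 1) s2) (partialD i x (sc 2) (smooth_cst (- c0))) partial_cst !pc /xc /coord.
by move: i {pc}; apply: I3_case; rewrite /=; ring.
Qed.

Lemma partial_phi i x : partial i phi x = 2*dPhi (yc x)*xc i x.
Proof.
have [dy _] := smooth_differentiable x (gsm_smooth gsm_yc).
have [_ E] : differentiable (Phi \o yc) x /\ forall h, 'D_h (Phi \o yc) x = (Phi^`())%classic (yc x) * 'D_h yc x.
 by apply: comp1_diff=> //; have d := dP (yc x); exact: ex_derive.
rewrite [LHS]E; have d := dP (yc x); rewrite derive1E derive_val.
by rewrite -/(partial i yc x) partial_yc; ring.
Qed.

Lemma sum_xc2 x : \sum_i xc i x^+2 = yc x.
Proof. by rewrite big_I3 /xc /= !subr0. Qed.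

Lemma yc_ge0 x : 0 <= yc x. Proof. by rewrite -sum_xc2 sumr_ge0// => i _; exact: sqr_ge0. Qed.

(** The radial, meridian and angular directions are orthogonal, hence rho2 y |D u|^2 = rho2 |P|^2 +
    |V_tau u|^2 + y |V_phi u|^2. The last two terms are at least 2 sqrt(y) |V_tau u| |V_phi u|, and
    [tangent_first] together with 1 - u_0^2 <= |V_phi u|^2 gives |V_tau u_0| <= |V_tau u| |V_phi u|.
    Where y or rho2 is 0, the quotients are 0 by convention. *)
Lemma defect x : dot (u^~ x) (u^~ x) = 1 -> (forall i, dot (u^~ x) (fun k => w k i x) = 0) ->
 1 - u 0 x^+2 <= dot (vphi^~ x) (vphi^~ x) ->
 forall P, (forall k, P k = \sum_i xc i x*w k i x) ->
 2 * `|Lam x| / sqrt (yc x) + dot P P / yc x <= \sum_i dot (fun k => w k i x) (fun k => w k i x).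
Proof.
move=> u1 uw an P PE; set SM := \sum_i _.
have y0 := yc_ge0 x.
have r0 : 0 <= rho2 x by rewrite addr_ge0// sqr_ge0.
have FI : rho2 x*yc x*SM = rho2 x*dot P P + dot (vtau^~ x) (vtau^~ x) + yc x*dot (vphi^~ x) (vphi^~ x).
 rewrite /SM big_I3 /dot -!big_split /= !mulr_sumr -!big_split /=; apply: eq_bigr => k _.
 rewrite PE big_I3 /xc /= !subr0 /vtau /vphi /rho2 /yc /coord /=; ring.
have ut : dot (u^~ x) (vtau^~ x) = 0.
 have -> : dot (u^~ x) (vtau^~ x) = - (x.2 - c0)*x.1.1*dot (u^~ x) (fun k => w k 0 x) + - (x.2 - c0)*x.1.2*dot (u^~ x) (fun k => w k 1 x)
  + rho2 x*dot (u^~ x) (fun k => w k 2 x).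
  by rewrite /dot !mulr_sumr -!big_split /=; apply: eq_bigr => k _; rewrite /vtau; ring.
 by rewrite !uw !mulr0 !addr0.
have tf := tangent_first u1 ut.
have SM0 : 0 <= SM by apply: sumr_ge0 => i _; exact: dot_ge0.
have PS : dot P P <= yc x*SM.
 have e k : (P k)^+2 <= yc x * \sum_i w k i x^+2.
  rewrite -sum_xc2 PE !big_I3; move: (xc 0 x) (xc 1 x) (xc 2 x) (w k 0 x) (w k 1 x) (w k 2 x) => p q r a b d.
  rewrite -subr_ge0 (_ : _ - _ = (p*b - q*a)^+2 + (p*d - r*a)^+2 + (q*d - r*b)^+2); last by ring.
  by rewrite !addr_ge0// sqr_ge0.
 rewrite -dot_sqr; apply: le_trans (ler_sum _ (fun k _ => e k)) _.
 rewrite -mulr_sumr exchange_big /=; apply: ler_wpM2l=> //; rewrite /SM; apply: ler_sum => i _.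
have [yy|yn] := eqVneq (yc x) 0; first by rewrite yy sqrtr0 invr0 !mulr0 addr0.
have yp : 0 < yc x by rewrite lt_neqAle eq_sym yn.
have PS' : dot P P / yc x <= SM by rewrite ler_pdivrMr// mulrC.
have [rr|rn] := eqVneq (rho2 x) 0; first by rewrite /Lam rr invr0 mulr0 normr0 mulr0 mul0r add0r.
have rp : 0 < rho2 x by rewrite lt_neqAle eq_sym rn.
set s := sqrt (yc x); have sE : s^+2 = yc x by rewrite sqr_sqrtr.
have sp : 0 < s by rewrite sqrtr_gt0.
have aa : 2*s * `|vtau 0 x| <= dot (vtau^~ x) (vtau^~ x) + yc x*dot (vphi^~ x) (vphi^~ x).
 have A0 := dot_ge0 (vtau^~ x).
 set a := dot (vtau^~ x) _ in A0 tf *; set b := dot (vphi^~ x) _ in an *.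
 have b0 : 0 <= b := dot_ge0 _.
 have h1 : `|vtau 0 x|^+2 <= b*a by rewrite real_normK ?num_real//; apply: le_trans tf _; exact: ler_wpM2r.
 apply: sqr_le_le; rewrite ?mulr_ge0 ?addr_ge0 ?mulr_ge0 ?(ltW sp)//.
 apply: (@le_trans _ _ (4*yc x*(b*a))).
  rewrite !exprMn sE (_ : 2^+2 = 4); last by ring.
  by apply: ler_wpM2l=> //; exact: mulr_ge0.
 rewrite -subr_ge0 (_ : _ - _ = (a - yc x*b)^+2); last by ring.
 exact: sqr_ge0.
rewrite -(ler_pM2l rp) -(ler_pM2l yp).
have -> : yc x*(rho2 x*SM) = rho2 x*dot P P + dot (vtau^~ x) (vtau^~ x) + yc x*dot (vphi^~ x) (vphi^~ x) by rewrite -FI; ring.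
have -> : yc x*(rho2 x*(2 * `|Lam x| / s + dot P P / yc x)) = rho2 x*dot P P + 2*s * `|vtau 0 x|.
 rewrite /Lam normrM normfV (ger0_norm r0) -sE; field.
 have sn : s != 0 by rewrite gt_eqF.
 by rewrite ?rn ?sn.
lra.
Qed.

Variables (K0 kap0 : R).
Hypothesis K00 : 0 <= K0.
Hypothesis supp : forall x, B x -> (Phi (yc x) = 0 /\ dPhi (yc x) = 0) \/
 [/\ n5 (beta^~ x) <= 2, \sum_i dot (fun k => partial i (beta k) x) (fun k => partial i (beta k) x) <= kap0 &
 dot (u^~ x) (u^~ x) = 1 -> 4*(3*qq u beta x^+2 + Bu u beta x) +
  64/7*(dot (beta^~ x) (beta^~ x) - (1 - qq u beta x)^+2) <= K0].

Let Cc := 980 * kap0 + 168*Ktau R * lam.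

(** [lower_terms] leaves the coefficient -7/4 in front of phi^2 |D u|^2, which is split by [defect]:
    the radial part pays for the cross term 8 phi Phi' beta . P, whence the 64/7 in the bound for
    [K0], and the meridian part gives 7/2 |Lam|. The 1 in K0 + 1 is 4 times the 1/4 lost in
    [lower_terms]; 168 = 4 * 36 + 24 collects the potential terms. *)
Lemma radial_pointwise x : B x -> dot (u^~ x) (u^~ x) = 1 -> (forall i, dot (u^~ x) (fun k => w k i x) = 0) ->
 1 - u 0 x^+2 <= dot (vphi^~ x) (vphi^~ x) ->
 \sum_i stab_term u w phi beta i x
 + Ktau R * lam*(4*(phi x^+2*(3*qq u beta x^+2 + Bu u beta x)) + nrm5 (ef u phi beta ^~ x))
 <= (K0 + 1)*(yc x*dPhi (yc x)^+2) + Cc*Phi (yc x)^+2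
  - 7/2*(Phi (yc x)^+2 * `|Lam x| / sqrt (yc x)).
Proof.
move=> Bx u1 uw an.
have y0 := yc_ge0 x.
have KL : 0 <= Ktau R * lam by rewrite mulr_ge0 ?Ktau_ge0// ltW.
have [[P0 D0]|[b2 kk KK]] := supp Bx.
 have g0 i : partial i phi x = 0 by rewrite partial_phi D0 mulr0 mul0r.
 have p0 : phi x = 0 by [].
 rewrite big1; last first.
  by move=> i _; rewrite /stab_term g0 p0 expr0n /= !(mulr0, mul0r, addr0).
 have -> : nrm5 (ef u phi beta ^~ x) = 0.
  rewrite /nrm5 big1 ?sqrtr0// => k _; by rewrite /ef p0 expr0n /= !mul0r expr0n.
 by rewrite p0 P0 D0 expr0n /= !(mulr0, mul0r, addr0, add0r, oppr0).
have {}KK := KK u1.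
set q := qq u beta x in KK *.
have u1' : n5 (u^~ x) = 1 by rewrite /n5 u1 sqrtr1.
have ub : `|dot (u^~ x) (beta^~ x)| <= 2 by apply: le_trans (dot_le _ _) _; rewrite u1' mul1r.
have qE : dot (u^~ x) (beta^~ x) = 1 - q by rewrite /q /qq; ring.
have q13 : -1 <= q <= 3 by move: ub; rewrite qE ler_norml => /andP[]; lra.
set ph := Phi (yc x); set g' := dPhi (yc x).
pose m i k := w k i x; pose ka i k := partial i (beta k) x.
pose P k := \sum_i xc i x*w k i x.
have T i : stab_term u w phi beta i x <= - (7/4) * ph^+2*dot (m i) (m i)
  + (2*g'*xc i x)^+2*(3*q^+2 + Bu u beta x + 4^-1) + 8 * ph*g'*(xc i x*dot (beta^~ x) (m i)) + 980 * ph^+2*dot (ka i) (ka i).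
 rewrite /stab_term partial_phi -/g' -/(phi x) -[phi x]/ph -/q -/(m i) -/(ka i).
 have := @lower_terms R (beta^~ x) (u^~ x) (m i) (ka i) ph (2*g'*xc i x) q (th u w beta i x) u1 b2 q13 erefl.
 lra.
have S : \sum_i stab_term u w phi beta i x <= - (7/4) * ph^+2*(\sum_i dot (m i) (m i))
 + 4*(yc x*g'^+2)*(3*q^+2 + Bu u beta x + 4^-1) + 8 * ph*g'*dot (beta^~ x) P + 980 * ph^+2 * kap0.
 apply: le_trans (ler_sum _ (fun i _ => T i)) _; rewrite !big_split /=.
 have -> : dot (beta^~ x) P = \sum_i xc i x*dot (beta^~ x) (m i).
  under [RHS]eq_bigr do rewrite /dot mulr_sumr; rewrite exchange_big /=; apply: eq_bigr => k _.
  by rewrite /P mulr_sumr; apply: eq_bigr => i _; rewrite /m; ring.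
 have -> : \sum_i (2*g'*xc i x)^+2*(3*q^+2 + Bu u beta x + 4^-1) = 4*(yc x*g'^+2)*(3*q^+2 + Bu u beta x + 4^-1).
  by rewrite -mulr_suml -sum_xc2; congr (_ * _); rewrite mulr_suml mulr_sumr; apply: eq_bigr => i _; ring.
 rewrite -3!mulr_sumr lerD2l; apply: ler_wpM2l; last exact: kk.
 by apply: mulr_ge0; [exact: ler0n|exact: sqr_ge0].
have df := defect u1 uw an (fun k => erefl (P k)).
have uP : dot (u^~ x) P = 0.
 rewrite /dot /P; under eq_bigr do rewrite mulr_sumr; rewrite exchange_big /= big1// => i _.
 have -> : \sum_k u k x*(xc i x*w k i x) = xc i x*dot (u^~ x) (fun k => w k i x).
  by rewrite mulr_sumr; apply: eq_bigr => k _; ring.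
 by rewrite uw mulr0.
(* Only the tangential part of beta meets P, because u . P = 0; this is why [K0] bounds |beta|^2 -
   (u . beta)^2 and not |beta|^2. *)
pose bT k := beta k x - (1 - q)*u k x.
have bTP : dot (beta^~ x) P = dot bT P.
 transitivity (dot (beta^~ x) P + - (1 - q)*dot (u^~ x) P); first by rewrite uP mulr0 addr0.
 by rewrite /dot mulr_sumr -big_split /=; apply: eq_bigr => k _; rewrite /bT; ring.
have bTT : dot bT bT = dot (beta^~ x) (beta^~ x) - (1 - q)^+2.
 transitivity (dot (beta^~ x) (beta^~ x) + - (2*(1 - q))*dot (u^~ x) (beta^~ x) + (1 - q)^+2*dot (u^~ x) (u^~ x)).
  by rewrite /dot !mulr_sumr -!big_split /=; apply: eq_bigr => k _; rewrite /bT; ring.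
 by rewrite qE u1; ring.
have cross : 8 * ph*g'*dot (beta^~ x) P <= 7/4 * ph^+2*(dot P P / yc x) + 64/7*(yc x*g'^+2)*dot bT bT.
 rewrite bTP; have [yy|yn] := eqVneq (yc x) 0.
  have P0 : dot P P = 0.
   have xz i : xc i x = 0.
    apply/eqP; rewrite -sqrf_eq0; move/eqP: yy; rewrite -sum_xc2 psumr_eq0; last by move=> l _; exact: sqr_ge0.
    by move/allP/(_ i); rewrite mem_index_enum => /(_ isT).
   by rewrite /dot big1// => k _; rewrite /P big1 ?mulr0// => i _; rewrite xz mul0r.
  have := dot_CS bT P; rewrite P0 mulr0 => h.
  have -> : dot bT P = 0 by apply/eqP; rewrite -sqrf_eq0; apply/eqP/le_anti; rewrite h sqr_ge0.
  by rewrite ?P0 yy !(mul0r, mulr0) addr0.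
 have yp : 0 < yc x by rewrite lt_neqAle eq_sym yn.
 set s := sqrt (yc x); have sp : 0 < s by rewrite sqrtr_gt0.
 have sE : s^+2 = yc x by rewrite sqr_sqrtr.
 have h := @young R (`|ph| * n5 P / s) (8 * `|g'| * n5 bT*s) (7/2) ltac:(lra).
 apply: (@le_trans _ _ (`|ph| * n5 P / s*(8 * `|g'| * n5 bT*s))).
  apply: le_trans (ler_norm _) _; rewrite 3!normrM ger0_norm//.
  have -> : `|ph| * n5 P / s*(8 * `|g'| * n5 bT*s) = 8 * `|ph| * `|g'|*(n5 bT * n5 P) by field; rewrite gt_eqF.
  by apply: ler_wpM2l; [rewrite !mulr_ge0|exact: dot_le].
 apply: le_trans h _; rewrite !exprMn !real_normK ?num_real// !n5_sqr exprVn sE.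
 by rewrite le_eqVlt; apply/orP; left; apply/eqP; field.
have efB : nrm5 (ef u phi beta ^~ x) <= 24 * ph^+2.
 have bTb : dot bT bT <= 4.
  rewrite bTT; have : dot (beta^~ x) (beta^~ x) <= 4.
   by rewrite -n5_sqr; have := n5_ge0 (beta^~ x); move: (n5 _) b2 => z; nra.
  have := sqr_ge0 (1 - q); lra.
 have -> : nrm5 (ef u phi beta ^~ x) = ph^+2 * `|3 + 3*q| * n5 bT.
  rewrite /nrm5 /n5 -dot_sqr.
  rewrite (eq_bigr (fun k => (ph^+2*(3 + 3*q))^+2*bT k^+2)); last first.
   by move=> k _; rewrite /ef -/q qE -/(bT k) exprMn.
  by rewrite -mulr_sumr sqrtrM ?sqr_ge0// sqrtr_sqr normrM (ger0_norm (sqr_ge0 ph)).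
 have n2 : n5 bT <= 2 by apply: sqr_le_le; rewrite ?n5_ge0// n5_sqr; lra.
 have h : `|3 + 3*q| <= 12 by move: q13 => /andP[]; rewrite ler_norml; lra.
 rewrite -mulrA mulrC; apply: ler_wpM2r; first exact: sqr_ge0.
 have := n5_ge0 bT; have := normr_ge0 (3 + 3*q); move: (n5 bT) (`|3 + 3*q|) n2 h => a b; nra.
have qB : 3*q^+2 + Bu u beta x <= 36.
 rewrite /Bu qE; have : dot (beta^~ x) (beta^~ x) <= 4.
  by rewrite -n5_sqr; have := n5_ge0 (beta^~ x); move: (n5 _) b2 => z; nra.
 move: q13 => /andP[l1 l2]; have : (q + 1)*(3 - q) >= 0 by rewrite mulr_ge0; lra.
 move: (dot (beta^~ x) _) => D; lra.
have ph2 : 0 <= ph^+2 := sqr_ge0 ph.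
have yg : 0 <= yc x*g'^+2 by rewrite mulr_ge0// sqr_ge0.
have t1 : Ktau R * lam*(4*(ph^+2*(3*q^+2 + Bu u beta x)) + nrm5 (ef u phi beta ^~ x)) <= Ktau R * lam*(168 * ph^+2).
 by apply: ler_wpM2l=> //; have := ler_wpM2l ph2 qB; lra.
have t2 : 7/4 * ph^+2*(2 * `|Lam x| / sqrt (yc x) + dot P P / yc x) <= 7/4 * ph^+2 * \sum_i dot (m i) (m i).
 by apply: ler_wpM2l=> //; rewrite mulr_ge0.
have t3 := ler_wpM2l yg KK; rewrite -bTT in t3.
rewrite -/ph -/g' -[phi x]/ph -/q.
have -> : Cc * ph^+2 = 980 * ph^+2 * kap0 + Ktau R * lam*(168 * ph^+2) by rewrite /Cc; ring.
have e1 (p L i D : R) : 7/4 * p*(2*L * i + D) = 7/2*(p*L * i) + 7/4 * p*D by field.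
rewrite e1 in t2.
have e2 : yc x*g'^+2*(4*(3*q^+2 + Bu u beta x) + 64/7*dot bT bT) = 4*(yc x*g'^+2)*(3*q^+2 + Bu u beta x) + 64/7*(yc x*g'^+2)*dot bT bT by ring.
rewrite e2 in t3.
have e3 : 4*(yc x*g'^+2)*(3*q^+2 + Bu u beta x + 4^-1) = 4*(yc x*g'^+2)*(3*q^+2 + Bu u beta x) + yc x*g'^+2 by field.
rewrite e3 in S.
lra.
Qed.

Lemma mB_yc : mB yc.
Proof. by apply: mB_continuous; apply: smooth_continuous; apply: gsm_smooth; exact: gsm_yc. Qed.

Lemma cont_Phi : continuous Phi.
Proof. by move=> y; apply: differentiable_continuous; apply/derivable1_diffP; have [] := dP y. Qed.

Lemma mB_comp_continuous (h : R -> R) (g : R3 R -> R) : continuous h -> mB g -> mB (fun x => h (g x)).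
Proof. by move=> ch mg; apply: (measurableT_comp (continuous_measurable_fun ch)). Qed.

Lemma mB_Lam : mB (fun x => Phi (yc x)^+2 * `|Lam x| / sqrt (yc x)).
Proof.
have A := mn_app M; have mw k i := af_mw (A k) i.
have mc i : mB (@coord R i) by apply: mB_continuous; exact: coord_continuous.
have mx1 : mB (fun x : R3 R => x.1.1) := mc 0.
have mx2 : mB (fun x : R3 R => x.1.2) := mc 1.
have mx3 : mB (fun x : R3 R => x.2) := mc 2.
have mk (t : R) : mB (fun=> t) by exact: measurable_cst.
have my := mB_yc.
have mr : mB rho2 by apply: mB_add; apply: measurable_funX.
have mz : mB (fun x : R3 R => - (x.2 - c0)) by apply: measurableT_comp=> //; apply: measurable_funB.
have mz' : mB (fun x : R3 R => x.2 - c0) by apply: measurable_funB.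
apply: mB_mul; last by apply: (measurableT_comp (@measurable_inv R)); apply: (measurableT_comp (@measurable_sqrt R)).
apply: mB_mul; first by apply: measurable_funX; apply: mB_comp_continuous=> //; exact: cont_Phi.
apply: measurableT_comp=> //; apply: mB_mul; last by apply: (measurableT_comp (@measurable_inv R)).
apply: mB_add; last by apply: mB_mul.
by apply: measurable_funB; apply: mB_mul=> //; apply: mB_mul.
Qed.

(** The meridian term is integrable because [defect] bounds twice its value by phi^2 |D u|^2. *)
Lemma radial_ineq :
 L1B (fun x => Phi (yc x)^+2 * `|Lam x| / sqrt (yc x)) /\
 7/2*IB (fun x => Phi (yc x)^+2 * `|Lam x| / sqrt (yc x)) <=
 IB (fun x => (K0 + 1)*(yc x*dPhi (yc x)^+2) + Cc*Phi (yc x)^+2).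
Proof.
have A := mn_app M.
have AE : aeB (fun x => 2*(Phi (yc x)^+2 * `|Lam x| / sqrt (yc x)) <= Phi (yc x)^+2*sq2 w x).
 have := aeB_and (aeB_and (mn_1 M) (mn_w M)) ang; apply: aeB_mono => x _ [[u1 uw] an].
 have := defect u1 uw an (fun k => erefl (\sum_i xc i x*w k i x)); set P := dot _ _ => h.
 have P0 : 0 <= P / yc x by rewrite divr_ge0 ?dot_ge0 ?yc_ge0.
 have -> : 2*(Phi (yc x)^+2 * `|Lam x| / sqrt (yc x)) = Phi (yc x)^+2*(2 * `|Lam x| / sqrt (yc x)) by ring.
 apply: ler_wpM2l; first exact: sqr_ge0.
 have -> : sq2 w x = \sum_i dot (fun k => w k i x) (fun k => w k i x) by apply: eq_bigr => i _; rewrite dot_sqr.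
 by apply: le_trans h; rewrite lerDl.
have cy : continuous yc by apply: smooth_continuous; apply: gsm_smooth; exact: gsm_yc.
have Lc (h : R -> R) : continuous h -> Linf (fun x => h (yc x)).
 by move=> ch; apply: Linf_continuous => x; apply: (continuous_comp (cy x)); exact: ch.
have Lp := Lc _ cont_Phi; have Ld := Lc _ cdP; have Ly := Linf_continuous cy.
have L1 : L1B (fun x => Phi (yc x)^+2*sq2 w x).
 rewrite (_ : (fun x => _) = fun x => Phi (yc x)*Phi (yc x)*sq2 w x); last by apply/funext.
 by apply: L1B_Linf; [exact: Linf_mul|exact: L1_sq2 A].
have L2 : L1B (fun x => Phi (yc x)^+2 * `|Lam x| / sqrt (yc x)).
 apply: (L1B_le mB_Lam L1); apply: aeB_mono AE => x _ h.
 have t0 : 0 <= Phi (yc x)^+2 * `|Lam x| / sqrt (yc x) by apply: mulr_ge0; [apply: mulr_ge0; [exact: sqr_ge0|exact: normr_ge0]|rewrite invr_ge0 sqrtr_ge0].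
 rewrite ger0_norm//; lra.
split=> //.
have L3 : L1B (fun x => (K0 + 1)*(yc x*dPhi (yc x)^+2) + Cc*Phi (yc x)^+2).
 apply: L1B_add; apply: L1B_scale; apply: Linf_L1.
  rewrite (_ : (fun x => _) = fun x => yc x*(dPhi (yc x)*dPhi (yc x))); last by apply/funext.
  by apply: Linf_mul=> //; exact: Linf_mul.
 by rewrite (_ : (fun x => _) = fun x => Phi (yc x)*Phi (yc x)); [exact: Linf_mul|apply/funext].
rewrite -IBZ// -subr_ge0 -IBB//; last exact: L1B_scale.
have [LS St] := @stability R lam f u w c phi beta l0 M sphi sbeta bdry.
apply: le_trans St _; apply: IB_le=> //; first by apply: L1B_sub=> //; exact: L1B_scale.
have := aeB_and (aeB_and (mn_1 M) (mn_w M)) ang; apply: aeB_mono => x Bx [[u1 uw] an].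
exact: radial_pointwise.
Qed.

End Radial.

(** * Rotations about the axis, acting on points, fields and integrals *)

Section Rotation.
Variable R : realType.
Local Notation B := (@B1 R).
Local Notation mu := (vol R).
Implicit Types (f g phi : R3 R -> R) (v : 'I_5 -> R) (x : R3 R).

Definition rt (c s : R) x : R3 R := ((c*x.1.1 - s*x.1.2, s*x.1.1 + c*x.1.2), x.2).

Definition rmx (c s : R) : 'M[R]_3 := mat33 c (- s) 0 s c 0 0 0 1.

(** The action A -> R A R^t in coordinates: weight 0 on the first one, weight 1 on the next two and
    weight 2 on the last two, c^2 - s^2 and 2 c s being the cosine and sine of the double angle. *)
Definition Rv (c s : R) v (k : 'I_5) : R :=
 [:: v 0; c * v 1 - s * v 2; s * v 1 + c * v 2;
   (c^+2 - s^+2) * v 3 - 2*c*s * v 4; 2*c*s * v 3 + (c^+2 - s^+2) * v 4]`_k.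

Lemma rotzE t : rotz t = rmx (cos t) (sin t) :> 'M[R]_3.
Proof.
apply: matrix3P => i j; rewrite /rotz mxE; move: i j.
by apply: I3_case; apply: I3_case; rewrite /rmx /mat33 mxE.
Qed.

Lemma rmx_tr c s : (rmx c s)^T = rmx c (- s).
Proof.
apply: matrix3P => i j; rewrite mxE; move: i j.
by apply: I3_case; apply: I3_case; rewrite !mat33E ?opprK.
Qed.

Lemma mul33 (a b c d e f g h k a' b' c' d' e' f' g' h' k' : R) :
 mat33 a b c d e f g h k *m mat33 a' b' c' d' e' f' g' h' k' =
 mat33 (a*a' + b*d' + c*g') (a*b' + b*e' + c*h') (a*c' + b*f' + c * k')
    (d*a' + e*d' + f*g') (d*b' + e*e' + f*h') (d*c' + e*f' + f * k')
    (g*a' + h*d' + k*g') (g*b' + h*e' + k*h') (g*c' + h*f' + k * k').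
Proof.
by apply: matrix3P; apply: I3_case; apply: I3_case; rewrite mxE big_I3 !mat33E.
Qed.

Lemma rmx_mul c s : c^+2 + s^+2 = 1 -> rmx c s *m rmx c (- s) = 1%:M.
Proof.
move=> cs; have E : s^+2 = 1 - c^+2 by lra.
by rewrite /rmx mul33; apply: matrix3P; apply: I3_case; apply: I3_case; rewrite !mat33E !mxE /=; ring: E.
Qed.

Lemma act_rmx c s x : act (rmx c s) x = rt c s x.
Proof.
apply: R3_eq => i; rewrite coord_act big_I3; move: i.
by apply: I3_case; rewrite !mat33E /coord /=; ring.
Qed.

Lemma rmx_Mv c s v : c^+2 + s^+2 = 1 -> rmx c s *m Mv v *m (rmx c s)^T = Mv (Rv c s v).
Proof.
move=> cs; rewrite rmx_tr !MvE /rmx !mul33 /Rv /=.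
have E : s^+2 = 1 - c^+2 by lra.
congr mat33; try ring; rewrite -?[- _ * v 0]mulNr; set a := (sqrt 6)^-1; set b := (sqrt 2)^-1;
by [ring: E | ring].
Qed.

Lemma rt_enorm c s x : c^+2 + s^+2 = 1 -> enorm (rt c s x) = enorm x.
Proof.
move=> cs; rewrite /enorm /rt /=; congr sqrt.
by have E : s^+2 = 1 - c^+2 by [lra]; ring: E.
Qed.

Lemma rt_B c s x : c^+2 + s^+2 = 1 -> B (rt c s x) = B x.
Proof. by move=> cs; rewrite /B1 /= rt_enorm. Qed.

Lemma rtK c s x : c^+2 + s^+2 = 1 -> rt c (- s) (rt c s x) = x.
Proof.
move=> cs; have E : s^+2 = 1 - c^+2 by lra.
by move: x=> [[x y] z]; rewrite /rt /=; congr ((_, _), _); ring: E.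
Qed.

Lemma nrm_rt c s x : c^+2 + s^+2 = 1 -> nrm (rt c s x) = rt c s (nrm x).
Proof.
move=> cs; rewrite /nrm rt_enorm//; apply: R3_eq => i; rewrite coordZ; move: i.
by apply: I3_case; rewrite /coord /rt /=; rewrite /GRing.scale /=; ring.
Qed.

Lemma measurable_x1 : mfun (fun x : R3 R => x.1.1).
Proof. by apply: continuous_measurable_R3; exact: (@coord_continuous R 0). Qed.
Lemma measurable_x2 : mfun (fun x : R3 R => x.1.2).
Proof. by apply: continuous_measurable_R3; exact: (@coord_continuous R 1). Qed.
Lemma measurable_x3 : mfun (fun x : R3 R => x.2).
Proof. by apply: continuous_measurable_R3; exact: (@coord_continuous R 2). Qed.

Lemma measurable_R3 (a b c : R3 R -> R) : mfun a -> mfun b -> mfun c ->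
 mfun (fun x => ((a x, b x), c x) : R3 R).
Proof. by move=> ma mb mc; apply: measurable_fun_pair=> //; exact: measurable_fun_pair. Qed.

Lemma measurable_rt c s : mfun (rt c s).
Proof.
apply: measurable_R3; last exact: measurable_x3.
- by apply: measurable_funB; apply: measurable_funM=> //; [exact: measurable_x1|exact: measurable_x2].
- by apply: measurable_funD; apply: measurable_funM=> //; [exact: measurable_x1|exact: measurable_x2].
Qed.

(** Shears act on lines along an axis as shifts, so [vol_eq_lines] shows that they preserve volume;
    rotations are composed of them. *)
Definition sh1 (a : R) x : R3 R := ((x.1.1 + a*x.1.2, x.1.2), x.2).
Definition sh2 (a : R) x : R3 R := ((x.1.1, x.1.2 + a*x.1.1), x.2).

Lemma measurable_sh1 a : mfun (sh1 a).
Proof.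
apply: measurable_R3; [|exact: measurable_x2|exact: measurable_x3].
by apply: measurable_funD; [exact: measurable_x1|apply: measurable_funM=> //; exact: measurable_x2].
Qed.
Lemma measurable_sh2 a : mfun (sh2 a).
Proof.
apply: measurable_R3; [exact: measurable_x1| |exact: measurable_x3].
by apply: measurable_funD; [exact: measurable_x2|apply: measurable_funM=> //; exact: measurable_x1].
Qed.

Lemma measurable_upd i x : mfun (fun s : mTR R => upd i x s).
Proof.
move: i; apply: I3_case.
- rewrite (_ : (fun s => _) = fun s => ((s, x.1.2), x.2)); last by apply/funext => s; exact: upd0E.
 by apply: measurable_fun_pair=> //; apply: measurable_fun_pair.
- rewrite (_ : (fun s => _) = fun s => ((x.1.1, s), x.2)); last by apply/funext => s; exact: upd1E.
 by apply: measurable_fun_pair=> //; apply: measurable_fun_pair.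
- rewrite (_ : (fun s => _) = fun s => (x.1, s)); last by apply/funext => s; exact: upd2E.
 by apply: measurable_fun_pair.
Qed.

Lemma vol_sh1 a (F : R3 R -> \bar R) : mfun F -> (forall x, 0 <= F x)%E ->
 (\int[mu]_x F (sh1 a x) = \int[mu]_x F x)%E.
Proof.
move=> mF F0; apply: (@vol_eq_lines R 0)=> //; first by apply: measurableT_comp=> //; exact: measurable_sh1.
move=> x; have mFu : mfun (fun s => F (upd 0 x s)) by apply: measurableT_comp=> //; exact: measurable_upd.
rewrite -(leb_shift (a*x.1.2) mFu)//; apply: eq_integral => s _.
by rewrite !upd0E /sh1.
Qed.

Lemma vol_sh2 a (F : R3 R -> \bar R) : mfun F -> (forall x, 0 <= F x)%E ->
 (\int[mu]_x F (sh2 a x) = \int[mu]_x F x)%E.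
Proof.
move=> mF F0; apply: (@vol_eq_lines R 1)=> //; first by apply: measurableT_comp=> //; exact: measurable_sh2.
move=> x; have mFu : mfun (fun s => F (upd 1 x s)) by apply: measurableT_comp=> //; exact: measurable_upd.
rewrite -(leb_shift (a*x.1.1) mFu)//; apply: eq_integral => s _.
by rewrite !upd1E /sh2.
Qed.

(** A rotation is a product of three shears, the outer ones with factor -s / (1 + c), minus the
    tangent of half the angle. The half turn, where 1 + c = 0, is the square of a quarter turn. *)
Lemma vol_rt c s (F : R3 R -> \bar R) : c^+2 + s^+2 = 1 -> mfun F -> (forall x, 0 <= F x)%E ->
 (\int[mu]_x F (rt c s x) = \int[mu]_x F x)%E.
Proof.
have gen c' s' G : c'^+2 + s'^+2 = 1 -> 1 + c' != 0 -> mfun G -> (forall x, 0 <= G x)%E ->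
  (\int[mu]_x G (rt c' s' x) = \int[mu]_x G x)%E.
 move=> cs c1 mG G0; pose t := - (s'/(1 + c')).
 have mG1 : mfun (fun x => G (sh1 t x)) by apply: measurableT_comp=> //; exact: measurable_sh1.
 have mG2 : mfun (fun x => G (sh1 t (sh2 s' x))).
  by apply: (measurableT_comp mG1); exact: measurable_sh2.
 rewrite -[RHS](vol_sh1 t mG G0) -[RHS](vol_sh2 s' mG1 (fun x => G0 _)) -[RHS](vol_sh1 t mG2 (fun x => G0 _)).
 apply: eq_integral => x _; congr G; rewrite /rt /sh1 /sh2 /= /t.
 have E : s'^+2 = 1 - c'^+2 by lra.
 congr ((_, _), _); first by field: E.
 by field: E.
move=> cs mF F0; have [c1|c1] := eqVneq (1 + c) 0; last exact: gen.
have cN : c = -1 by lra.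
have s0 : s = 0 by apply/eqP; rewrite -sqrf_eq0; apply/eqP; rewrite cN in cs; lra.
have u : (0 : R)^+2 + 1^+2 = 1 by ring.
have n0 : 1 + (0 : R) != 0 by rewrite addr0 oner_neq0.
have m1 : mfun (fun x => F (rt 0 1 x)) by apply: measurableT_comp=> //; exact: measurable_rt.
rewrite -[RHS](gen 0 1 _ u n0 mF F0) -[RHS](gen 0 1 _ u n0 m1 (fun x => F0 _)).
by apply: eq_integral => x _; congr F; rewrite /rt /= cN s0; congr ((_, _), _); ring.
Qed.

Lemma negligible_rt c s (N : set (R3 R)) : c^+2 + s^+2 = 1 -> mu.-negligible N -> mu.-negligible (rt c s @^-1` N).
Proof.
move=> cs [A [mA A0 NA]]; exists (rt c s @^-1` A); split.
- by rewrite -[X in measurable X]setTI; exact: measurable_rt.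
- have mI : mfun (fun x => (\1_A x : R)%:E) by apply/measurable_EFinP; exact: measurable_indic.
 have mA' : measurable (rt c s @^-1` A) by rewrite -[X in measurable X]setTI; exact: measurable_rt.
 rewrite -(setIT (rt c s @^-1` A)) -integral_indic// -A0 -[in RHS](setIT A) -integral_indic//.
 by rewrite -[RHS](vol_rt cs mI)// => x; rewrite lee_fin.
- by move=> x /NA.
Qed.

Lemma aeB_rt c s (P : R3 R -> Prop) : c^+2 + s^+2 = 1 -> aeB P -> aeB (fun x => P (rt c s x)).
Proof.
move=> cs H; have := negligible_rt cs H; apply: negligibleS => x /= nP BP; apply: nP => Bx.
by apply: BP; rewrite rt_B.
Qed.

Lemma mB_rt c s f : c^+2 + s^+2 = 1 -> mB f -> mB (fun x => f (rt c s x)).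
Proof.
move=> cs mf; apply: (measurable_comp _ _ mf); [exact: measurable_B1| |].
- by move=> _ [x Bx <-]; rewrite rt_B.
- by apply: measurable_funTS; exact: measurable_rt.
Qed.

Lemma intB_rt c s (F : R3 R -> \bar R) : c^+2 + s^+2 = 1 -> measurable_fun B F -> (forall x, B x -> 0 <= F x)%E ->
 (\int[mu]_(x in B) F (rt c s x) = \int[mu]_(x in B) F x)%E.
Proof.
move=> cs mF F0; rewrite [RHS]integral_mkcond [LHS]integral_mkcond.
rewrite -[RHS](vol_rt cs); last 2 first.
- by apply/(measurable_restrictT _ _).1=> //; exact: measurable_B1.
- by move=> x; rewrite patchE; case: ifPn=> // /set_mem; exact: F0.
apply: eq_integral => x _; rewrite !patchE; congr (if _ then _ else _).
by apply/idP/idP => /set_mem; rewrite ?rt_B// => ?; apply/mem_set; rewrite ?rt_B.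
Qed.

Lemma IB_rt c s f : c^+2 + s^+2 = 1 -> mB f -> IB (fun x => f (rt c s x)) = IB f.
Proof.
move=> cs mf; have mE : measurable_fun B (EFin \o f) by apply/measurable_EFinP.
rewrite /IB /Rintegral; congr fine; rewrite [LHS]integralE [RHS]integralE; congr (_ - _)%E.
- rewrite -[RHS](intB_rt cs (measurable_funepos mE)); last by move=> x _; exact: funepos_ge0.
 by apply: eq_integral => x _; rewrite !funeposE.
- rewrite -[RHS](intB_rt cs (measurable_funeneg mE)); last by move=> x _; exact: funeneg_ge0.
 by apply: eq_integral => x _; rewrite !funenegE.
Qed.

Lemma L1B_rt c s f : c^+2 + s^+2 = 1 -> L1B f -> L1B (fun x => f (rt c s x)).
Proof.
move=> cs /integrableP[mf If]; apply/integrableP; split; first by apply/measurable_EFinP; apply: mB_rt=> //; exact/measurable_EFinP.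
rewrite (_ : (\int[mu]_(x in B) _ = \int[mu]_(x in B) `|(EFin \o f) x|)%E)//.
rewrite -[RHS](intB_rt cs)//; exact: measurableT_comp.
Qed.

Lemma L2B_rt c s f : c^+2 + s^+2 = 1 -> L2B f -> L2B (fun x => f (rt c s x)).
Proof. by move=> cs [mf If]; split; [exact: mB_rt|exact: (L1B_rt cs If)]. Qed.

Lemma partial_rt c s f i x : smooth f ->
 partial i (fun y => f (rt c s y)) x = \sum_j rmx c s j i * partial j f (rt c s x).
Proof.
move=> sf; have [da dE] := act_differentiable (rmx c s) x.
have df y : differentiable f y by case: (smooth_differentiable y sf).
have -> : (fun y => f (rt c s y)) = f \o act (rmx c s) by apply/funext => y /=; rewrite act_rmx.
rewrite /partial deriveE; last exact: differentiable_comp.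
rewrite diff_comp//= dE d_lin//; apply: eq_bigr => j _; congr (_ * _); last by rewrite act_rmx.
rewrite coord_act (bigD1 i)//= coord_basis eqxx mulr1 big1 ?addr0// => l li.
by rewrite coord_basis (negbTE li) mulr0.
Qed.

Lemma af_rt c s (f : nat -> R3 R -> R) (v : R3 R -> R) w b : c^+2 + s^+2 = 1 -> AppF f v w b ->
 AppF (fun n x => f n (rt c s x)) (fun x => v (rt c s x))
  (fun i x => \sum_j rmx c s j i*w j (rt c s x)) (fun x => b (rt c s x)).
Proof.
move=> cs A; have rmx1 i j : `|rmx c s j i| <= 1.
 have c1 : `|c| <= 1 by rewrite -sqr_normr_le1 || (apply: sqr_le_le=> //; rewrite real_normK ?num_real// expr1n -cs lerDl sqr_ge0).
 have s1 : `|s| <= 1 by apply: sqr_le_le=> //; rewrite real_normK ?num_real// expr1n -cs lerDr sqr_ge0.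
 by move: j i; apply: I3_case; apply: I3_case; rewrite !mat33E ?normrN ?normr0 ?normr1.
have sf := af_s A.
have srt n : smooth (fun x => f n (rt c s x)).
 rewrite (_ : (fun x => _) = fun x => f n (act (rmx c s) x)); first exact: smooth_act.
 by apply/funext => x; rewrite act_rmx.
split=> //.
- have [M HM] := af_b A; exists M => n x xb; apply: HM; by rewrite /cl_ball /= rt_enorm.
- by apply: mB_rt=> //; exact: (af_m A).
- by move=> i; apply: mB_sum => j; apply: mB_mul; [exact: measurable_cst|apply: mB_rt=> //; exact: (af_mw A)].
- rewrite (_ : (fun x => _) = fun x => (fun y => b (nrm y)) (rt c s x)).
  exact: (mB_rt cs (af_mc A)).
 by apply/funext => x; rewrite nrm_rt.
- exact: aeB_rt (af_c A).
- have := aeB_rt cs (af_cw A); apply: aeB_mono => x _ H i.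
 under eq_fun do rewrite partial_rt//.
 by apply: cvg_sumr => j; apply: cvgM; [exact: cvg_cst|exact: H].
- have [G G2 HG] := af_d A; exists (fun x => 3*G (rt c s x)).
  by apply: L2B_scale; exact: L2B_rt.
 have := aeB_rt cs HG; apply: aeB_mono => x _ H n i; rewrite partial_rt// big_I3.
 have H' j : `|rmx c s j i * partial j (f n) (rt c s x)| <= G (rt c s x).
  by rewrite normrM; apply: le_trans (H n j); rewrite ler_piMl.
 have T (p q r g : R) : `|p| <= g -> `|q| <= g -> `|r| <= g -> `|p + q + r| <= 3*g.
  by rewrite !ler_norml => /andP[? ?] /andP[? ?] /andP[? ?]; apply/andP; split; lra.
 exact: T.
- have := aeB_rt cs (af_t A); apply: aeB_mono => x _.
 by under eq_fun do rewrite nrm_rt//; rewrite nrm_rt.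
Qed.

Lemma Rv_linE c s v k : Rv c s v k = \sum_l Rv c s (fun m => (m == l)%:R) k * v l.
Proof. by rewrite big_I5 /Rv; move: k; apply: I5_case => /=; ring. Qed.

Lemma Rv_lin c s k : exists a : 'I_5 -> R, forall v, Rv c s v k = \sum_l a l * v l.
Proof. by exists (fun l => Rv c s (fun m => (m == l)%:R) k) => v; exact: Rv_linE. Qed.

Lemma af_Rv c s (f : 'I_5 -> nat -> R3 R -> R) (v : 'I_5 -> R3 R -> R) w b : AppV f v w b ->
 AppV (fun k n x => Rv c s (fun l => f l n x) k) (fun k x => Rv c s (v^~ x) k)
   (fun k i x => Rv c s (fun l => w l i x) k) (fun k x => Rv c s (b^~ x) k).
Proof.
move=> A k; have [a E] := Rv_lin c s k.
have := af_sum (index_enum 'I_5) (fun l => af_scale (a l) (A l)).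
have -> : (fun n x => \sum_l a l*f l n x) = (fun n x => Rv c s (fun l => f l n x) k).
 by apply/funext => n; apply/funext => x; rewrite E.
apply: eq_af=> [x|i x|x]; by rewrite E.
Qed.

Lemma Rv_sqr c s v : c^+2 + s^+2 = 1 -> \sum_k Rv c s v k^+2 = \sum_k v k^+2.
Proof.
move=> cs; have E : s^+2 = 1 - c^+2 by lra.
by rewrite !big_I5 /Rv /=; ring: E.
Qed.

Lemma tr_conj c s (A : 'M[R]_3) : c^+2 + s^+2 = 1 ->
 \tr ((rmx c s *m A *m (rmx c s)^T)^+3) = \tr (A^+3).
Proof.
move=> cs; have K : (rmx c s)^T *m rmx c s = 1%:M.
 by rewrite rmx_tr; have := @rmx_mul c (- s); rewrite opprK sqrrN; apply.
have conjM (X Y : 'M[R]_3) : (rmx c s *m X *m (rmx c s)^T) *m (rmx c s *m Y *m (rmx c s)^T) =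
  rmx c s *m (X *m Y) *m (rmx c s)^T.
 by rewrite !mulmxA -[rmx c s *m X *m _ *m rmx c s]mulmxA K mulmx1.
have tc (X : 'M[R]_3) : \tr (rmx c s *m X *m (rmx c s)^T) = \tr X by rewrite mxtrace_mulC mulmxA K mul1mx.
have cube (X : 'M[R]_3) : X^+3 = X *m (X *m X) by rewrite 2!exprS expr1 -!mulmxE.
by rewrite !cube !conjM tc.
Qed.

Lemma Wv_Rv c s v : c^+2 + s^+2 = 1 -> Wv (Rv c s v) = Wv v.
Proof. by move=> cs; rewrite -!W_Mv -rmx_Mv// /W /betat tr_conj. Qed.

Lemma sum_rmx c s (a : 'I_3 -> R) : c^+2 + s^+2 = 1 -> \sum_i (\sum_j rmx c s j i*a j)^+2 = \sum_i a i^+2.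
Proof.
move=> cs; have E : s^+2 = 1 - c^+2 by lra.
by rewrite !big_I3 !mat33E; ring: E.
Qed.

End Rotation.

Section PartialCoord.
Variable R : realType.
Lemma partial_coord i j (x : R3 R) : partial i (coord j) x = (j == i)%:R.
Proof.
have sc : smooth (@coord R j) by apply: gsm_smooth; exact: Gcoord.
have [dc E] := smooth_differentiable x sc.
have lE : coord j = lin_form (fun l => (j == l)%:R) :> (R3 R -> R).
 by apply/funext => y; rewrite /lin_form big_I3; move: j {E dc sc}; apply: I3_case; rewrite /= ?mulr1 ?mulr0 ?addr0 ?add0r.
rewrite /partial deriveE// [in 'd _ _]lE diff_lin; last exact: lin_form_continuous.
by rewrite -[LHS]/(lin_form _ _) -lE coord_basis.
Qed.
End PartialCoord.

(** * Rotated minimizers *)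

Section Equivariance.
Variable R : realType.
Local Notation B := (@B1 R).
Local Notation mu := (vol R).
Variables (lam : R) (b : R3 R -> 'M[R]_3) (c : 'I_5 -> R3 R -> R).
Hypothesis bc : forall x, enorm x != 0 -> b (nrm x) = Mv (fun k => c k (nrm x)).
Hypothesis c1 : forall x, enorm x != 0 -> \sum_k c k (nrm x)^+2 = 1.
Hypothesis mc : forall k, mB (fun x => c k (nrm x)).
Hypothesis mb : forall i j, mB (fun x => b (nrm x) i j).
Hypothesis ceq : forall C S x k, C^+2 + S^+2 = 1 -> c k (rt C S x) = Rv C S (c^~ x) k.

(** The rotated approximations approximate the rotated map; their boundary values are unchanged by
    the equivariance [ceq] of the datum, and the density is carried along by the rotation. *)
Lemma adm_rot C S Q : C^+2 + S^+2 = 1 -> admissible b Q ->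
 admissible b (fun x => rmx C S *m Q (rt C (- S) x) *m (rmx C S)^T) /\
 energy lam (fun x => rmx C S *m Q (rt C (- S) x) *m (rmx C S)^T) = energy lam Q.
Proof.
move=> cs aQ; have cs' : C^+2 + (- S)^+2 = 1 by rewrite sqrrN.
have [f [v [w [A QE v1 _ En]]]] := app_of_adm lam aQ bc c1 mc mb.
have A1 : AppV _ _ _ _ := fun k => af_rt cs' (A k).
pose v' k x := Rv C S (fun l => v l (rt C (- S) x)) k.
pose w' k i x := Rv C S (fun l => \sum_j rmx C (- S) j i*w l j (rt C (- S) x)) k.
have A2 : AppV _ v' w' _ := af_Rv C S A1.
have mQ i j : mB (fun x => Q x i j) by case: aQ => W _ _; have [[]] := W i j.
have mQ' i j : mB (fun x => (rmx C S *m Q (rt C (- S) x) *m (rmx C S)^T) i j).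
 rewrite (_ : (fun x => _) = fun x => \sum_l (\sum_m rmx C S i m*Q (rt C (- S) x) m l)*rmx C S j l).
  apply: mB_sum => l; apply: mB_mul; last exact: measurable_cst.
  by apply: mB_sum => m; apply: mB_mul; [exact: measurable_cst|exact: (mB_rt cs' (mQ m l))].
 by apply/funext => x; rewrite mxE; apply: eq_bigr => l _; rewrite !mxE.
have QE' : aeB (fun x => rmx C S *m Q (rt C (- S) x) *m (rmx C S)^T = Mv (fun k => v' k x)).
 by apply: aeB_mono (aeB_rt cs' QE) => x _ ->; rewrite rmx_Mv.
have v1' : aeB (fun x => \sum_k v' k x^+2 = 1).
 by apply: aeB_mono (aeB_rt cs' v1) => x _ E; rewrite Rv_sqr.
have bc' x : enorm x != 0 -> b (nrm x) = Mv (fun k => Rv C S (fun l => c l (rt C (- S) (nrm x))) k).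
 move=> x0; rewrite bc//; congr Mv; apply/funext => k; rewrite -ceq//.
 by have := @rtK R C (- S) (nrm x) cs'; rewrite opprK=> ->.
split.
 have [a1 a2 a3] := adm_of_app A2 v1' bc' mb.
 have AQ i j := af_sum (index_enum 'I_5) (fun k => af_scale (ebasis R k i j) (A2 k)).
 have vE i j : aeB (fun x => (rmx C S *m Q (rt C (- S) x) *m (rmx C S)^T) i j = \sum_k ebasis R k i j * v' k x).
  by apply: aeB_mono QE' => x _ ->; rewrite Mv_ij.
 split.
 - by move=> i j; exact: (af_W12 (AQ i j) (mQ' i j) (vE i j)).
 - by move: (aeB_and v1' QE'); rewrite /aeB; apply: filterS => x H /H [E ->]; exact: Mv_S4.
 - move=> i j; apply: (af_trace (AQ i j) (mQ' i j) (vE i j))=> //; last exact: ae_enorm_neq0.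
  by move=> x x0; rewrite bc'// Mv_ij.
rewrite (energy_app lam A2 mQ' QE') En; congr EFin.
rewrite -[RHS](IB_rt cs'); last by apply: L1B_m; exact: (L1_dens lam A).
congr (Rintegral _ _ _); apply/funext => x; rewrite /dens; congr (_ * _ + _ * _); last exact: Wv_Rv.
rewrite exchange_big [RHS]exchange_big /=.
transitivity (\sum_k \sum_i (\sum_j rmx C (- S) j i*w k j (rt C (- S) x))^+2).
 rewrite exchange_big [RHS]exchange_big /=; apply: eq_bigr => i _; exact: Rv_sqr.
by apply: eq_bigr => k _; exact: sum_rmx.
Qed.

Lemma minimizer_rot C S Q : C^+2 + S^+2 = 1 -> minimizer lam b Q ->
 minimizer lam b (fun x => rmx C S *m Q (rt C (- S) x) *m (rmx C S)^T).
Proof.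
by move=> cs [aQ mQ]; have [aQ' E] := adm_rot cs aQ; split=> // Q' aQ''; rewrite E; exact: mQ.
Qed.

End Equivariance.

(** * The angular derivative of an equivariant field *)

Section Angular.
Variable R : realType.
Local Notation B := (@B1 R).
Local Notation mu := (vol R).
Implicit Types (phi : R3 R -> R).

Lemma curve_derive phi (g1 g2 g3 d1 d2 d3 : R -> R) (t : R) : smooth phi ->
 is_derive t (1 : R) g1 (d1 t) -> is_derive t (1 : R) g2 (d2 t) -> is_derive t (1 : R) g3 (d3 t) ->
 is_derive t (1 : R) (fun s => phi ((g1 s, g2 s), g3 s) : R)
  (d1 t * partial 0 phi ((g1 t, g2 t), g3 t) + d2 t * partial 1 phi ((g1 t, g2 t), g3 t) + d3 t * partial 2 phi ((g1 t, g2 t), g3 t)).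
Proof.
move=> sp i1 i2 i3; pose g s : R3 R := ((g1 s, g2 s), g3 s).
have dg (h : R -> R) d : is_derive t (1 : R) h d -> differentiable h t /\ 'd h t 1 = d.
 move=> [dh hE]; have D : differentiable h t by apply/derivable1_diffP.
 by split=> //; rewrite -(deriveE _ D).
have [D1 E1] := dg _ _ i1; have [D2 E2] := dg _ _ i2; have [D3 E3] := dg _ _ i3.
have D12 : differentiable (fun s => (g1 s, g2 s)) t by exact: differentiable_pair.
have D : differentiable g t by exact: differentiable_pair.
have [df _] := smooth_differentiable (g t) sp.
have dfg : differentiable (phi \o g) t by exact: differentiable_comp.
split; first by apply/derivable1_diffP.
rewrite deriveE// diff_comp//= d_lin// big_I3.
have -> : 'd g t 1 = ((d1 t, d2 t), d3 t).
 rewrite /g diff_pair//= E3; congr (_, _); rewrite -[LHS]/('d (fun s => (g1 s, g2 s)) t 1).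
 by rewrite diff_pair//= E1 E2.
by rewrite /coord /=.
Qed.

Definition ang_field phi (x : R3 R) : R := x.1.1 * partial 1 phi x - x.1.2 * partial 0 phi x.

Lemma rt_derive phi x (t : R) : smooth phi ->
 is_derive t (1 : R) (fun s => phi (rt (cos s) (sin s) x) : R) (ang_field phi (rt (cos t) (sin t) x)).
Proof.
move=> sp.
have D1 : is_derive t (1 : R) (fun s => cos s*x.1.1 - sin s*x.1.2) (- sin t*x.1.1 - cos t*x.1.2).
 apply: is_derive_eq; rewrite /GRing.scale /=; ring.
have D2 : is_derive t (1 : R) (fun s => sin s*x.1.1 + cos s*x.1.2) (cos t*x.1.1 - sin t*x.1.2).
 apply: is_derive_eq; rewrite /GRing.scale /=; ring.
have D3 : is_derive t (1 : R) (fun=> x.2) 0 by exact: is_derive_cst.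
have := @curve_derive phi _ _ _ (fun t => - sin t*x.1.1 - cos t*x.1.2) (fun t => cos t*x.1.1 - sin t*x.1.2) (fun=> 0) t sp D1 D2 D3.
by move=> H; apply: (is_derive_eq H); rewrite /ang_field /rt /=; ring.
Qed.

Lemma cos2sin2 (t : R) : cos t^+2 + sin t^+2 = 1. Proof. by rewrite cos2Dsin2. Qed.

Lemma smooth_ang phi : smooth phi -> smooth (ang_field phi).
Proof.
move=> sp; apply: gsm_smooth; apply: gsm_sub.
- by apply: Gmul; [exact: (Gcoord _ 0)|apply: Gsmooth; exact: smooth_partial].
- by apply: Gmul; [exact: (Gcoord _ 1)|apply: Gsmooth; exact: smooth_partial].
Qed.

(** The mean value theorem along the orbit gives a bound uniform in x and t, the majorant for the
    limit in [vphi_Lv]. *)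
Lemma rt_quotient_bound phi : smooth phi -> exists M, forall x (t : R), cl_ball x -> t != 0 ->
 `|(phi (rt (cos t) (sin t) x) - phi x) / t| <= M.
Proof.
move=> sp; have [M M0 HM] := continuous_bounded_cl (smooth_continuous (smooth_ang sp)).
exists M => x t xb t0; pose k s : R := phi (rt (cos s) (sin s) x).
have dk s : is_derive s (1 : R) k (ang_field phi (rt (cos s) (sin s) x)) := rt_derive x s sp.
have ck : continuous k.
 by move=> s; apply: differentiable_continuous; apply/derivable1_diffP; have [] := dk s.
have k0 : k 0 = phi x by rewrite /k cos0 sin0 /rt !mul1r !mul0r subr0 add0r; case: (x)=> [[]].
have bd s : `|ang_field phi (rt (cos s) (sin s) x)| <= M.
 by apply: HM; rewrite /cl_ball /= rt_enorm ?cos2sin2.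
have [t1|t1] := ltP 0 t.
 have [|s _ E] := @MVT R k (fun s => ang_field phi (rt (cos s) (sin s) x)) 0 t t1 (fun s _ => dk s).
  by move=> s; apply: continuous_subspaceT.
 by rewrite -k0 -/(k t) E subr0 mulfK.
have t2 : t < 0 by rewrite lt_neqAle t0.
have [|s _ E] := @MVT R k (fun s => ang_field phi (rt (cos s) (sin s) x)) t 0 t2 (fun s _ => dk s).
 by move=> s; apply: continuous_subspaceT.
by rewrite -k0 -/(k t) -opprB E sub0r mulrN opprK mulfK.
Qed.

Lemma quotient_cvg (k : R -> R) (d : R) (t : nat -> R) : is_derive (0 : R) (1 : R) k d -> (forall n, t n != 0) ->
 t n @[n --> \oo] --> (0 : R) -> (k (t n) - k 0) / t n @[n --> \oo] --> d.
Proof.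
move=> [dk kE] tn t0.
have := dk; rewrite /derivable -[X in cvg X -> _]/(_ @ _) => C; have {C}C : _ --> 'D_1 k 0 := C.
rewrite kE in C.
have T : t n @[n --> \oo] --> (0 : R)^'.
 move=> A [e e0 HA]; have [N _ HN] := t0 _ (nbhsx_ballx (0 : R) e e0).
 by exists N=> // n /HN h; apply: HA.
have := cvg_comp _ _ T C; apply: cvg_trans; apply: near_eq_cvg; near=> n.
by rewrite /= scaler1 addr0 /GRing.scale /= mulrC.
Unshelve. all: end_near. Qed.

Lemma rt_quotient_cvg phi x (t : nat -> R) : smooth phi -> (forall n, t n != 0) -> t n @[n --> \oo] --> (0 : R) ->
 (phi (rt (cos (t n)) (sin (t n)) x) - phi x) / t n @[n --> \oo] --> ang_field phi x.
Proof.
move=> sp tn t0; pose k s : R := phi (rt (cos s) (sin s) x).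
have rt0 : rt (cos 0) (sin 0) x = x.
 by rewrite cos0 sin0 /rt !mul1r !mul0r subr0 add0r; case: (x)=> [[]].
have D : is_derive (0 : R) (1 : R) k (ang_field phi x) by have := rt_derive x 0 sp; rewrite rt0.
by have := quotient_cvg D tn t0; rewrite /k rt0.
Qed.

End Angular.

Section AngularIdentity.
Variable R : realType.
Local Notation B := (@B1 R).
Local Notation mu := (vol R).
Variables (f : 'I_5 -> nat -> R3 R -> R) (u : 'I_5 -> R3 R -> R) (w : 'I_5 -> 'I_3 -> R3 R -> R) (c : 'I_5 -> R3 R -> R).
Hypothesis A : AppV f u w c.
Hypothesis eq : forall t : R, aeB (fun x => forall k, u k (rt (cos t) (sin t) x) = Rv (cos t) (sin t) (u^~ x) k).

(** The infinitesimal generator: the derivative of [Rv (cos t) (sin t) v] at t = 0. *)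
Definition Lv (v : 'I_5 -> R) (k : 'I_5) : R := [:: 0; - v 2; v 1; - (2 * v 4); 2 * v 3]`_k.

Lemma IB_ang k phi : test_function B phi ->
 IB (fun x => vphi w k x * phi x) = - IB (fun x => u k x*ang_field phi x).
Proof.
move=> [sp [K [cK KB K0]]]; have sc i : smooth (@coord R i) by apply: gsm_smooth; exact: Gcoord.
have tst i : test_function B (fun x => coord i x * phi x).
 by split; [exact: smooth_mul|exists K; split=> // x /K0 ->; rewrite mulr0].
have W j i := af_weak j (A k) (tst i).
have Lu := af_Linf (A k); have Lw i := L2B_L1 (af_L2 i (A k)).
have Ls (g : R3 R -> R) : smooth g -> Linf g by move=> sg; apply: Linf_continuous; exact: smooth_continuous.
have Lc i := Ls _ (sc i); have Lp := Ls _ sp; have Ld i := Ls _ (smooth_partial i sp).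
have W1 : IB (fun x => u k x*(coord 0 x * partial 1 phi x)) = - IB (fun x => w k 1 x*(coord 0 x * phi x)).
 have := W 1 0; rewrite -/(IB _) -/(IB _) => <-; congr (Rintegral _ _ _); apply/funext => x.
 rewrite (partialM 1 x (sc 0) sp) (_ : partial 1 (coord 0) x = 0) ?mulr0 ?addr0//.
 exact: partial_coord.
have W2 : IB (fun x => u k x*(coord 1 x * partial 0 phi x)) = - IB (fun x => w k 0 x*(coord 1 x * phi x)).
 have := W 0 1; rewrite -/(IB _) -/(IB _) => <-; congr (Rintegral _ _ _); apply/funext => x.
 rewrite (partialM 0 x (sc 1) sp) (_ : partial 0 (coord 1) x = 0) ?mulr0 ?addr0//.
 exact: partial_coord.
have e1 : (fun x => vphi w k x * phi x) = fun x => w k 1 x*(coord 0 x * phi x) - w k 0 x*(coord 1 x * phi x).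
 by apply/funext => x; rewrite /vphi /coord /=; ring.
have e2 : (fun x => u k x*ang_field phi x) = fun x => u k x*(coord 0 x * partial 1 phi x) - u k x*(coord 1 x * partial 0 phi x).
 by apply/funext => x; rewrite /ang_field /coord /=; ring.
have L1 i j : L1B (fun x => w k i x*(coord j x * phi x)).
 by rewrite (_ : (fun x => _) = fun x => (coord j x * phi x)*w k i x); [apply: L1B_Linf=> //; exact: Linf_mul|apply/funext => x; rewrite mulrC].
have L2 i j : L1B (fun x => u k x*(coord i x * partial j phi x)).
 by apply: Linf_L1; apply: Linf_mul=> //; exact: Linf_mul.
rewrite e1 e2 !IBB// W1 W2; ring.
Qed.

(** A rotation of the variables moves the difference quotient from the test function to the field,
    where equivariance makes it algebraic in the values of [u]. *)
Lemma IB_rot_quotient k phi (t : R) : test_function B phi -> t != 0 ->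
 IB (fun x => u k x*((phi (rt (cos (- t)) (sin (- t)) x) - phi x) / t)) =
 IB (fun x => ((Rv (cos t) (sin t) (u^~ x) k - u k x) / t) * phi x).
Proof.
move=> [sp _] t0; have cs := cos2sin2 t; have cs' : cos t^+2 + (- sin t)^+2 = 1 by rewrite sqrrN.
rewrite cosN sinN; have Lu l := af_Linf (A l).
have Ls (g : R3 R -> R) : smooth g -> Linf g by move=> sg; apply: Linf_continuous; exact: smooth_continuous.
have Lp := Ls _ sp.
have sr : smooth (fun x => phi (rt (cos t) (- sin t) x)).
 rewrite (_ : (fun x => _) = fun x => phi (act (rmx (cos t) (- sin t)) x)); first exact: smooth_act.
 by apply/funext => x; rewrite act_rmx.
have Lr := Ls _ sr.
have LR : Linf (fun x => Rv (cos t) (sin t) (u^~ x) k).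
 have [a E] := Rv_lin (cos t) (sin t) k; rewrite (_ : (fun x => _) = fun x => \sum_l a l*u l x); last by apply/funext.
 by apply: Linf_sum => l; apply: Linf_mul=> //; exact: Linf_cst.
have -> : (fun x => u k x*((phi (rt (cos t) (- sin t) x) - phi x) / t)) =
  fun x => t^-1*(u k x * phi (rt (cos t) (- sin t) x) - u k x * phi x) by apply/funext => x; ring.
have -> : (fun x => ((Rv (cos t) (sin t) (u^~ x) k - u k x) / t) * phi x) =
  fun x => t^-1*(Rv (cos t) (sin t) (u^~ x) k * phi x - u k x * phi x) by apply/funext => x; ring.
have I1 : L1B (fun x => u k x * phi (rt (cos t) (- sin t) x)) by apply: Linf_L1; exact: Linf_mul.
have I2 : L1B (fun x => u k x * phi x) by apply: Linf_L1; exact: Linf_mul.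
have I3 : L1B (fun x => Rv (cos t) (sin t) (u^~ x) k * phi x) by apply: Linf_L1; exact: Linf_mul.
rewrite !IBZ; try exact: L1B_sub.
rewrite !IBB//; congr (_*(_ - _)).
rewrite -(IB_rt cs); last by apply: L1B_m.
have mu' := mB_rt cs (L1B_m I1).
apply: IB_ae_eq=> //; first exact: L1B_m.
apply: aeB_mono (eq t) => x _ E; rewrite E; congr (_ * phi _); exact: rtK.
Qed.

Lemma Rv_quotient (t : nat -> R) (v : 'I_5 -> R) k : (forall n, t n != 0) -> t n @[n --> \oo] --> (0 : R) ->
 (Rv (cos (t n)) (sin (t n)) v k - v k) / t n @[n --> \oo] --> Lv v k.
Proof.
move=> tn t0; have D : is_derive (0 : R) (1 : R) (fun s => Rv (cos s) (sin s) v k) (Lv v k).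
 have c0 := cos0 R; have s0 := sin0 R.
 rewrite /Rv /Lv; move: k; apply: I5_case => /=; apply: is_derive_eq;
  rewrite /GRing.scale /= ?cos0 ?sin0; ring.
by have := quotient_cvg D tn t0; rewrite cos0 sin0 (_ : Rv 1 0 v k = v k)// /Rv; move: k {D}; apply: I5_case => /=; ring.
Qed.

Lemma Lv_linE v k : Lv v k = \sum_l Lv (fun m => (m == l)%:R) k * v l.
Proof. by rewrite big_I5 /Lv; move: k; apply: I5_case => /=; ring. Qed.

(** Both sides are tested against phi. The difference quotients of phi converge to the angular
    derivative, which is weakly the angular derivative of [u]; those of [Rv] converge to [Lv].
    [fund_lemma] concludes. *)
Lemma vphi_Lv : aeB (fun x => forall k, vphi w k x = Lv (u^~ x) k).
Proof.
apply: aeB_forall => k; have Lu l := af_Linf (A l).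
have Ls (g : R3 R -> R) : smooth g -> Linf g by move=> sg; apply: Linf_continuous; exact: smooth_continuous.
have sc i : smooth (@coord R i) by apply: gsm_smooth; exact: Gcoord.
have Lv1 : Linf (fun x => Lv (u^~ x) k).
 rewrite (_ : (fun x => _) = fun x => \sum_l Lv (fun m => (m == l)%:R) k*u l x).
  by apply: Linf_sum => l; apply: Linf_mul=> //; exact: Linf_cst.
 by apply/funext => x; exact: Lv_linE.
have Iv : L1B (vphi w k).
 have I i j : L1B (fun x => coord j x*w k i x) by apply: L1B_Linf; [exact: Ls|exact: (L2B_L1 (af_L2 i (A k)))].
 rewrite (_ : vphi w k = fun x => coord 0 x*w k 1 x - coord 1 x*w k 0 x); first exact: L1B_sub.
 by apply/funext => x; rewrite /vphi /coord /=.
have IL := Linf_L1 Lv1.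
suff H : aeB (fun x => vphi w k x - Lv (u^~ x) k = 0).
 by apply: aeB_mono H => x _ /eqP; rewrite subr_eq0 => /eqP.
apply: fund_lemma; first exact: L1B_sub.
move=> phi tp; have [sp _] := tp; have Lp := Ls _ sp.
have Lx (g : R3 R -> R) : L1B g -> L1B (fun x => g x * phi x).
 by move=> Ig; rewrite (_ : (fun x => _) = fun x => phi x*g x); [exact: L1B_Linf|apply/funext => x; rewrite mulrC].
have -> : (fun x => (vphi w k x - Lv (u^~ x) k) * phi x) = fun x => vphi w k x * phi x - Lv (u^~ x) k * phi x.
 by apply/funext => x; rewrite mulrBl.
rewrite IBB; [|exact: Lx|exact: Lx]; rewrite (IB_ang k tp).
pose t n : R := n.+1%:R^-1; have tn n : t n != 0 by rewrite invr_eq0 pnatr_eq0.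
have tn' n : - t n != 0 by rewrite oppr_eq0.
have t0 : t n @[n --> \oo] --> (0 : R) by exact: cvg_harmonic.
have t0' : - t n @[n --> \oo] --> (0 : R) by rewrite -oppr0; exact: cvgN.
have C1 : IB (fun x => ((Rv (cos (t n)) (sin (t n)) (u^~ x) k - u k x) / t n) * phi x) @[n --> \oo] --> IB (fun x => Lv (u^~ x) k * phi x).
 have E (a : 'I_5 -> R) : IB (fun x => (\sum_l a l*u l x) * phi x) = \sum_l a l*IB (fun x => u l x * phi x).
  have I l : L1B (fun x => u l x * phi x) by apply: Linf_L1; exact: Linf_mul.
  rewrite (_ : (fun x => _) = fun x => \sum_l a l*(u l x * phi x)); last by apply/funext => x; rewrite mulr_suml; apply: eq_bigr => l _; ring.
  by rewrite IB_sum=> [|l]; [apply: eq_bigr => l _; rewrite IBZ|exact: L1B_scale].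
 rewrite (_ : (fun x => Lv (u^~ x) k * phi x) = fun x => (\sum_l Lv (fun m => (m == l)%:R) k*u l x) * phi x); last by apply/funext => x; rewrite -Lv_linE.
 rewrite E; have F n : IB (fun x => ((Rv (cos (t n)) (sin (t n)) (u^~ x) k - u k x) / t n) * phi x) =
  \sum_l ((Rv (cos (t n)) (sin (t n)) (fun m => (m == l)%:R) k - (k == l)%:R) / t n)*IB (fun x => u l x * phi x).
  rewrite -E; congr (Rintegral _ _ _); apply/funext => x; congr (_ * _).
  rewrite Rv_linE -[X in _ - X](_ : \sum_l (k == l)%:R*u l x = u k x).
   by rewrite -sumrB mulr_suml; apply: eq_bigr => l _; ring.
  by rewrite (bigD1 k)//= eqxx mul1r big1 ?addr0// => l lk; rewrite eq_sym (negbTE lk) mul0r.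
 under eq_fun do rewrite F.
 by apply: cvg_sumr => l; apply: cvgM; [exact: Rv_quotient|exact: cvg_cst].
have C2 : IB (fun x => u k x*((phi (rt (cos (- t n)) (sin (- t n)) x) - phi x) / t n)) @[n --> \oo] --> IB (fun x => u k x * - ang_field phi x).
 have [M HM] := rt_quotient_bound sp; have [mu' [K HK]] := Lu k.
 have mr n : mB (fun x => u k x*((phi (rt (cos (- t n)) (sin (- t n)) x) - phi x) / t n)).
  apply: mB_mul=> //; apply: mB_mul; last exact: measurable_cst.
  apply: measurable_funB; last by apply: mB_continuous; exact: smooth_continuous.
  by apply: mB_rt; [exact: cos2sin2|apply: mB_continuous; exact: smooth_continuous].
 have ma : mB (fun x => u k x * - ang_field phi x).
  apply: mB_mul=> //; apply: measurableT_comp=> //; apply: mB_continuous; apply: smooth_continuous; exact: smooth_ang.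
 have [] // := @dct_B R _ _ (fun=> K*M) mr ma (L1B_cst _).
  apply: aeB_all => x _; apply: cvgM; first exact: cvg_cst.
  suff -> : (fun n => (phi (rt (cos (- t n)) (sin (- t n)) x) - phi x) / t n) =
    fun n => - ((phi (rt (cos (- t n)) (sin (- t n)) x) - phi x) / - t n).
   by apply: cvgN; exact: (@rt_quotient_cvg R phi x (fun n => - t n) sp tn' t0').
  by apply/funext => n; rewrite invrN mulrN opprK.
 apply: aeB_mono HK => x Bx Hx n; rewrite normrM; apply: ler_pM=> //.
 have := HM x (- t n) (B1_cl_ball Bx) (tn' n); by rewrite invrN mulrN normrN.
have C3 : IB (fun x => u k x*((phi (rt (cos (- t n)) (sin (- t n)) x) - phi x) / t n)) @[n --> \oo] --> IB (fun x => Lv (u^~ x) k * phi x).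
 by under eq_fun do rewrite (IB_rot_quotient k tp (tn _)).
have E : IB (fun x => u k x * - ang_field phi x) = IB (fun x => Lv (u^~ x) k * phi x) by exact: (cvg_unique _ C2 C3).
rewrite -E -IBN; last by apply: Linf_L1; apply: Linf_mul=> //; apply: Ls; exact: smooth_ang.
apply/eqP; rewrite subr_eq0; apply/eqP; congr (Rintegral _ _ _); apply/funext => x; by rewrite mulrN.
Qed.

(** The angular derivative has square norm u_1^2 + u_2^2 + 4 u_3^2 + 4 u_4^2: all components other
    than u_0 have weight at least 1. *)
Lemma angular_ineq : aeB (fun x => dot (u^~ x) (u^~ x) = 1) ->
 aeB (fun x => 1 - u 0 x^+2 <= dot (vphi w ^~ x) (vphi w ^~ x)).
Proof.
move=> u1; apply: aeB_mono2 u1 vphi_Lv => x _ u1 V.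
move: u1; rewrite /dot !big_I5 !V /Lv /= => u1.
have := sqr_ge0 (u 3 x); have := sqr_ge0 (u 4 x); rewrite !expr2; lra.
Qed.

End AngularIdentity.

(** * The boundary maps Q_{1,nu} and their limit *)

Section BoundaryData.
Variable R : realType.
Local Notation B := (@B1 R).
Implicit Types (x : R3 R).

(* On the unit sphere |x - e_3|^2 = 2 (1 - x_3) and |x + e_3|^2 = 2 (1 + x_3); writing the
   second factor of the denominator of [Qmu] through these makes it positive on all of R^3. *)
Definition bE x : R := (rho2 x + (1 + x.2)^+2)/2 + (rho2 x + (1 - x.2)^+2)/18.
Definition bD (nu : R) x : R := 2*(1 + x.2)^+2 + nu^+2*((1 - x.2)^+2*bE x).

(** The limit nu = 0, in coordinates the linear map x -> (x_3, x_1 + i x_2, 0). Its first component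
    has opposite signs at the two poles. *)
Definition b0 (k : 'I_5) x : R := [:: x.2; x.1.1; x.1.2; 0; 0]`_k.
Definition ba (k : 'I_5) x : R := [:: 0; 0; 0;
 2*(x.1.1^+2 - x.1.2^+2)*(1 + x.2 + (1 - x.2)/3);
 4*x.1.1*x.1.2*(1 + x.2 + (1 - x.2)/3)]`_k.
Definition bb (k : 'I_5) x : R := [::
 - (1 - x.2)^+2*(1 + x.2 - (1 - x.2)/9 + x.2*bE x);
 - x.1.1*(1 - x.2)^+2*(2/3 + bE x);
 - x.1.2*(1 - x.2)^+2*(2/3 + bE x); 0; 0]`_k.

(** Q_{1,nu} written as its limit plus corrections of order nu and nu^2 over one denominator. The
    formula is smooth and equivariant on all of R^3, and the corrections are small wherever 1 + x_3
    stays away from 0. *)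
Definition bnu (nu : R) (k : 'I_5) x : R := b0 k x + (nu*ba k x + nu^+2*bb k x) / bD nu x.

Lemma bE_ge0 x : 0 <= bE x.
Proof. by rewrite /bE /rho2; apply: addr_ge0; apply: divr_ge0=> //; rewrite !addr_ge0// sqr_ge0. Qed.

Lemma bD_gt0 nu x : 0 < nu -> 0 < bD nu x.
Proof.
move=> n0; have [E|E] := eqVneq (1 + x.2) 0.
 have x2 : x.2 = -1 by lra.
 rewrite /bD /bE /rho2 x2; apply: ltr_wpDl; first by rewrite mulr_ge0// sqr_ge0.
 apply: mulr_gt0; first by rewrite exprn_gt0.
 have := sqr_ge0 x.1.1; have := sqr_ge0 x.1.2; move: (x.1.1^+2) (x.1.2^+2) => a b; nra.
rewrite /bD; apply: ltr_pwDl; first by rewrite mulr_gt0// lt_neqAle eq_sym sqrf_eq0 E sqr_ge0.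
by apply: mulr_ge0; [exact: sqr_ge0|apply: mulr_ge0; [exact: sqr_ge0|exact: bE_ge0]].
Qed.

Lemma of_coordsE (t : R) (z1 z2 : R[i]) : of_coords t z1 z2 =
 Mv (fun k=> [:: t; complex.Re z1; complex.Im z1; complex.Re z2; complex.Im z2]`_k).
Proof. by rewrite /of_coords /Mv big_I5 /ebasis. Qed.

Lemma Mv_scale (a : R) v : a *: Mv v = Mv (fun k => a * v k).
Proof. by rewrite /Mv scaler_sumr; apply: eq_bigr => k _; rewrite scalerA. Qed.

(** With z_0 = 1 + x_3 and x_1^2 + x_2^2 = (1 + x_3) (1 - x_3), numerators and denominator have the
    common factor (1 + x_3)^3, which is cancelled. The south pole, with its own homogeneous
    coordinates, is checked directly. *)
Lemma Qmu_bnu nu x : 0 < nu -> enorm x = 1 -> Qmu 1 nu%:C%C x = Mv (bnu nu ^~ x).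
Proof.
move=> n0 x1; have S : x.1.1^+2 + x.1.2^+2 = (1 + x.2)*(1 - x.2).
 have := sqr_enorm x; rewrite x1 expr1n => h.
 have -> : x.1.1^+2 + x.1.2^+2 = 1 - x.2^+2 by lra.
 ring.
have D0 := bD_gt0 x n0.
rewrite /Qmu /proj_coords; case: eqP=> [z1|z1].
 have x1' : x.1.1^+2 + x.1.2^+2 = 0 by rewrite S z1; ring.
 have a0 : x.1.1 = 0.
  by apply/eqP; rewrite -sqrf_eq0; apply/eqP; have := sqr_ge0 x.1.1; have := sqr_ge0 x.1.2; lra.
 have b0' : x.1.2 = 0.
  by apply/eqP; rewrite -sqrf_eq0; apply/eqP; have := sqr_ge0 x.1.1; have := sqr_ge0 x.1.2; lra.
 rewrite of_coordsE Mv_scale /sqmod /=; congr Mv; apply/funext => k.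
 rewrite /bnu /b0 /ba /bb /bD /bE /rho2 z1 a0 b0'; move: k.
 by apply: I5_case => /=; field; rewrite ?gt_eqF.
have p0 : 1 + x.2 != 0 by apply/eqP => h; apply: z1; lra.
rewrite of_coordsE Mv_scale /sqmod /=; congr Mv; apply/funext => k.
have D1 : bD nu x != 0 by rewrite gt_eqF.
have eD : bD nu x = 2*(1 + x.2)^+2 + nu^+2*(1 - x.2)^+2*(1 + x.2 + (1 - x.2)/9).
 by rewrite /bD /bE /rho2 S; field.
have eE : bE x = 1 + x.2 + (1 - x.2)/9 by rewrite /bE /rho2 S; field.
have DD : 0 < 2*(1 + x.2)^+2 + nu^+2*(1 - x.2)^+2*(1 + x.2 + (1 - x.2)/9) by rewrite -eD.
rewrite /bnu eD /b0 /ba /bb eE; move: S DD p0; move: (x.1.1) (x.1.2) (x.2) => a b z S DD p0 {z1 D0 D1 eD eE x1}.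
have Sb : b^+2 = (1 + z)*(1 - z) - a^+2 by lra.
have dn := lt0r_neq0 DD.
have aux (D' Dh N' B0 X : R) : Dh != 0 -> D' = (1 + z)^+3*Dh -> N' = (1 + z)^+3*(B0*Dh + X) ->
  D'^-1*N' = B0 + X / Dh.
 by move=> h -> ->; field; rewrite h p0.
apply: (aux _ _ _ _ _ dn); first by field: Sb.
by move: k; apply: I5_case => /=; field: Sb.
Qed.

Lemma gsm_rho2 : gsm (@rho2 R).
Proof. by apply: Gadd; apply: gsm_sqr; [exact: (Gcoord _ 0)|exact: (Gcoord _ 1)]. Qed.

Lemma gsm_p : gsm (fun x : R3 R => 1 + x.2).
Proof. by apply: Gadd; [exact: Gcst|exact: (Gcoord _ 2)]. Qed.

Lemma gsm_m : gsm (fun x : R3 R => 1 - x.2).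
Proof. by apply: gsm_sub; [exact: Gcst|exact: (Gcoord _ 2)]. Qed.

Definition bD1 x : R := 2*(1 + x.2)^+2.
Definition bD2 x : R := (1 - x.2)^+2*bE x.

Lemma gsm_bE : gsm bE.
Proof.
by apply: Gadd; apply: Gmul; try exact: Gcst; apply: Gadd; try exact: gsm_rho2; apply: gsm_sqr;
 [exact: gsm_p|exact: gsm_m].
Qed.
Lemma gsm_bD1 : gsm bD1.
Proof. by apply: Gmul; [exact: Gcst|apply: gsm_sqr; exact: gsm_p]. Qed.
Lemma gsm_bD2 : gsm bD2.
Proof. by apply: Gmul; [apply: gsm_sqr; exact: gsm_m|exact: gsm_bE]. Qed.

Lemma gsm_b0 k : gsm (b0 k).
Proof.
by move: k; apply: I5_case; rewrite /b0 /=;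
 [exact: (Gcoord _ 2)|exact: (Gcoord _ 0)|exact: (Gcoord _ 1)|exact: Gcst|exact: Gcst].
Qed.

Lemma gsm_ba k : gsm (ba k).
Proof.
have x1 : gsm (fun x : R3 R => x.1.1) := Gcoord _ 0; have x2 : gsm (fun x : R3 R => x.1.2) := Gcoord _ 1.
have pm : gsm (fun x : R3 R => 1 + x.2 + (1 - x.2)/3).
 by apply: Gadd; [exact: gsm_p|apply: Gmul; [exact: gsm_m|exact: Gcst]].
move: k; apply: I5_case; rewrite /ba /=; try exact: Gcst.
- by apply: Gmul=> //; apply: Gmul; [exact: Gcst|apply: gsm_sub; exact: gsm_sqr].
- by apply: Gmul=> //; apply: Gmul=> //; apply: Gmul=> //; exact: Gcst.
Qed.

Lemma gsm_opp (f : R3 R -> R) : gsm f -> gsm (fun x => - f x).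
Proof.
move=> gf; rewrite (_ : (fun x => _) = fun x => -1*f x); last by apply/funext => x; rewrite mulN1r.
by apply: Gmul=> //; exact: Gcst.
Qed.

Lemma gsm_bb k : gsm (bb k).
Proof.
have x1 : gsm (fun x : R3 R => x.1.1) := Gcoord _ 0; have x2 : gsm (fun x : R3 R => x.1.2) := Gcoord _ 1.
have m2 : gsm (fun x : R3 R => (1 - x.2)^+2) by apply: gsm_sqr; exact: gsm_m.
have e : gsm (fun x => 2/3 + bE x) by apply: Gadd; [exact: Gcst|exact: gsm_bE].
move: k; apply: I5_case; rewrite /bb /=; try exact: Gcst.
- apply: Gmul; first exact: gsm_opp.
 apply: Gadd; last by apply: Gmul; [exact: (Gcoord _ 2)|exact: gsm_bE].
 by apply: gsm_sub; [exact: gsm_p|apply: Gmul; [exact: gsm_m|exact: Gcst]].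
- by apply: Gmul=> //; apply: Gmul=> //; exact: gsm_opp.
- by apply: Gmul=> //; apply: Gmul=> //; exact: gsm_opp.
Qed.

Lemma gsm_bD nu : gsm (bD nu).
Proof. by apply: Gadd; [exact: gsm_bD1|apply: Gmul; [exact: Gcst|exact: gsm_bD2]]. Qed.

Lemma gsm_bnu nu k : 0 < nu -> gsm (bnu nu k).
Proof.
move=> n0; apply: Gadd; first exact: gsm_b0.
apply: Gmul; last by apply: Ginv; [exact: gsm_bD|move=> x; exact: bD_gt0].
by apply: Gadd; apply: Gmul; try exact: Gcst; [exact: gsm_ba|exact: gsm_bb].
Qed.

Lemma bnu_rt nu c s x k : c^+2 + s^+2 = 1 -> bnu nu k (rt c s x) = Rv c s (bnu nu ^~ x) k.
Proof.
move=> cs; have E : s^+2 = 1 - c^+2 by lra.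
have rE : rho2 (rt c s x) = rho2 x by rewrite /rho2 /rt /=; ring: E.
have eE : bE (rt c s x) = bE x by rewrite /bE rE.
have dE : bD nu (rt c s x) = bD nu x by rewrite /bD eE.
rewrite /bnu /Rv dE /b0 /ba /bb eE; move: (bD nu x)^-1 (bE x) => d e.
by move: k; apply: I5_case => /=; ring: E.
Qed.

Lemma partial_bnu nu k i x : 0 < nu -> partial i (bnu nu k) x =
 partial i (b0 k) x + ((nu * partial i (ba k) x + nu^+2 * partial i (bb k) x) / bD nu x
 - (nu*ba k x + nu^+2*bb k x)*(partial i bD1 x + nu^+2 * partial i bD2 x) / bD nu x^+2).
Proof.
move=> n0; have S0 := gsm_smooth (gsm_b0 k); have Sa := gsm_smooth (gsm_ba k); have Sb := gsm_smooth (gsm_bb k).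
have S1 := gsm_smooth gsm_bD1; have S2 := gsm_smooth gsm_bD2; have SD := gsm_smooth (gsm_bD nu).
have DP y := bD_gt0 y n0; have SI := smooth_inv SD DP.
have sk (t : R) (f : R3 R -> R) : smooth f -> smooth (fun x => t*f x) := smooth_mul (smooth_cst t).
have pk (t : R) (f : R3 R -> R) : smooth f -> partial i (fun x => t*f x) x = t * partial i f x.
 by move=> sf; rewrite (partialM i x (smooth_cst t) sf) partial_cst mulr0 addr0.
have SN := smooth_add (sk nu _ Sa) (sk (nu^+2) _ Sb).
rewrite (partialD i x S0 (smooth_mul SN SI)) (partialM i x SN SI) (partialV i x SD DP).
have eD : partial i (bD nu) x = partial i bD1 x + nu^+2 * partial i bD2 x.
 by rewrite -(pk (nu^+2) _ S2); exact: (partialD i x S1 (sk (nu^+2) _ S2)).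
rewrite eD (partialD i x (sk nu _ Sa) (sk (nu^+2) _ Sb)) (pk nu _ Sa) (pk (nu^+2) _ Sb).
move: (partial i bD1 x) (partial i bD2 x) (partial i (ba k) x) (partial i (bb k) x) => d1 d2 d3 d4 {eD}.
by field; rewrite gt_eqF.
Qed.

Lemma b0_partial i k x : `|partial i (b0 k) x| <= 1.
Proof.
have pc j : `|partial i (coord j) x| <= 1 by rewrite partial_coord; case: (j == i); rewrite ?normr1 ?normr0.
by move: k; apply: I5_case; rewrite /b0 /= ?partial_cst ?normr0//; [exact: (pc 2)|exact: (pc 0)|exact: (pc 1)].
Qed.

(** Numerators and derivatives have a common bound K on the closed ball, and the denominator is at
    least 2 de^2 where 1 + x_3 >= de; so for fixed de the corrections are of order nu. The gradient
    bound 2 consists of 1 for [b0] and two corrections of at most 1/2. *)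
Lemma bnu_near (e de : R) : 0 < e <= 2^-1 -> 0 < de <= 1 -> exists2 nu0 : R, 0 < nu0 & forall nu x, 0 < nu < nu0 ->
 cl_ball x -> de <= 1 + x.2 ->
 (forall k, `|bnu nu k x - b0 k x| <= e) /\ forall k i, `|partial i (bnu nu k) x| <= 2.
Proof.
move=> /andP[e0 e2] /andP[d0 d1].
pose H k i x := partial i (ba k) x^+2 + partial i (bb k) x^+2.
pose A k x := ba k x^+2 + bb k x^+2 + \sum_i H k i x.
pose C i x := partial i bD1 x^+2 + partial i bD2 x^+2.
(* A single smooth function above the squares of all numerators and of all derivatives involved, so
   that one compactness argument gives one constant. *)
pose G x := \sum_k A k x + \sum_i C i x.
have H0 k i x : 0 <= H k i x by rewrite addr_ge0 ?sqr_ge0.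
have C0 i x : 0 <= C i x by rewrite addr_ge0 ?sqr_ge0.
have S0 x k : 0 <= \sum_i H k i x by apply: sumr_ge0 => i _.
have A0 k x : 0 <= A k x by apply: addr_ge0=> //; rewrite addr_ge0 ?sqr_ge0.
have le1 (I : finType) (F : I -> R) i : (forall j, 0 <= F j) -> F i <= \sum_j F j.
 by move=> F0; rewrite (bigD1 i)//= lerDl sumr_ge0.
have sq (f : R3 R -> R) : smooth f -> smooth (fun x => f x^+2) by move=> sf; exact: (smooth_mul sf sf).
have sG : smooth G.
 apply: smooth_add; apply: smooth_sum.
  move=> k; apply: smooth_add; first by apply: smooth_add; apply: sq; apply: gsm_smooth; [exact: gsm_ba|exact: gsm_bb].
  apply: smooth_sum => i; apply: smooth_add; apply: sq; apply: smooth_partial; apply: gsm_smooth; [exact: gsm_ba|exact: gsm_bb].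
 move=> i; apply: smooth_add; apply: sq; apply: smooth_partial; apply: gsm_smooth; [exact: gsm_bD1|exact: gsm_bD2].
have [M M0 HM] := continuous_bounded_cl (smooth_continuous sG).
pose K := 1 + M; have K0 : 0 < K by rewrite ltr_pwDl.
have KB x (v : R) : cl_ball x -> v^+2 <= G x -> `|v| <= K.
 move=> /HM h hv; have gM : G x <= M := le_trans (ler_norm _) h.
 have : `|v|^+2 <= M by rewrite real_normK ?num_real//; exact: le_trans gM.
 by move: (`|v|) => t ht; have := sqr_ge0 (t - 1); rewrite /K; nra.
have G1 x k : A k x <= G x.
 apply: (@le_trans _ _ (\sum_k A k x)); first exact: (le1 _ (A^~ x)).
 by rewrite lerDl; apply: sumr_ge0 => i _.
have G2 x i : C i x <= G x.
 apply: (@le_trans _ _ (\sum_i C i x)); first exact: (le1 _ (C^~ x)).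
 by rewrite lerDr; apply: sumr_ge0 => k _.
have G3 x k i : H k i x <= G x.
 apply: le_trans (G1 x k); apply: (@le_trans _ _ (\sum_i H k i x)); first exact: (le1 _ (fun i => H k i x)).
 by rewrite lerDr addr_ge0 ?sqr_ge0.
pose L := K + K^+2; have L0 : 0 < L by rewrite addr_gt0 ?exprn_gt0.
pose nu0 := Num.min 1 (e*de^+4 / L).
exists nu0; first by rewrite lt_min ltr01 /= divr_gt0// mulr_gt0// exprn_gt0.
move=> nu x /andP[n0]; rewrite lt_min => /andP[n1]; rewrite ltr_pdivlMr// => nL xb px.
have DP := bD_gt0 x n0; have D0 : 2*de^+2 <= bD nu x.
 rewrite /bD -[leLHS]addr0; apply: lerD; last by apply: mulr_ge0; [exact: sqr_ge0|apply: mulr_ge0; [exact: sqr_ge0|exact: bE_ge0]].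
 by apply: ler_wpM2l=> //; rewrite ler_pXn2r// nnegrE; lra.
have dd : 0 < de^+2 by rewrite exprn_gt0.
have dq : de^+2 <= 1 by rewrite exprn_ile1// ltW.
have nn : nu^+2 <= nu by rewrite expr2 ler_piMl// ltW.
have nn0 : 0 <= nu^+2 := sqr_ge0 nu.
have cmb (a b : R) : `|a| <= K -> `|b| <= K -> `|nu*a + nu^+2*b| <= 2 * nu*K.
 move=> ha hb; apply: le_trans (ler_normD _ _) _; rewrite [`|nu*a|]normrM [`|nu^+2*b|]normrM (gtr0_norm n0) (ger0_norm nn0).
 have := ler_wpM2l (ltW n0) ha; have : nu^+2 * `|b| <= nu*K by apply: ler_pM.
 lra.
have inv1 : (bD nu x)^-1 <= (2*de^+2)^-1 by rewrite lef_pV2// posrE mulr_gt0.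
have ival : 0 <= (bD nu x)^-1 by rewrite invr_ge0 ltW.
have Ka k : `|ba k x| <= K by apply: (KB x)=> //; apply: le_trans (G1 x k); have := S0 x k; have := sqr_ge0 (bb k x); rewrite /A; lra.
have Kb k : `|bb k x| <= K by apply: (KB x)=> //; apply: le_trans (G1 x k); have := S0 x k; have := sqr_ge0 (ba k x); rewrite /A; lra.
have K1 k i : `|partial i (ba k) x| <= K by apply: (KB x)=> //; apply: le_trans (G3 x k i); rewrite lerDl sqr_ge0.
have K2 k i : `|partial i (bb k) x| <= K by apply: (KB x)=> //; apply: le_trans (G3 x k i); rewrite lerDr sqr_ge0.
have K3 i : `|partial i bD1 x| <= K by apply: (KB x)=> //; apply: le_trans (G2 x i); rewrite lerDl sqr_ge0.
have K4 i : `|partial i bD2 x| <= K by apply: (KB x)=> //; apply: le_trans (G2 x i); rewrite lerDr sqr_ge0.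
have d4 : de^+4 = de^+2*de^+2 by rewrite -exprD.
have nK : nu*K / de^+2 <= e*de^+2.
 rewrite ler_pdivrMr// -mulrA -d4; apply: le_trans (ltW nL).
 by apply: ler_wpM2l; [exact: ltW|rewrite /L lerDl sqr_ge0].
have B1' (v : R) : `|v| <= 2 * nu*K -> `|v / bD nu x| <= e*de^+2.
 move=> hv; rewrite normrM (ger0_norm ival); apply: le_trans nK.
 have -> : nu*K / de^+2 = 2 * nu*K*(2*de^+2)^-1 by field; rewrite gt_eqF.
 exact: ler_pM.
have h1000 : e*de^+2 <= e by rewrite ler_piMr// ltW.
split=> [k|k i].
 by rewrite /bnu addrC addKr; apply: le_trans h1000; apply: B1'; exact: cmb.
rewrite partial_bnu//; apply: le_trans (ler_normD _ _) _.
have A0' := b0_partial i k x.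
have A1 := B1' _ (cmb _ _ (K1 k i) (K2 k i)).
set X := _ / bD nu x in A1 *; set Y := _ / bD nu x^+2.
have A2 : `|Y| <= 2^-1.
 have Yd : `|partial i bD1 x + nu^+2 * partial i bD2 x| <= 2*K.
  apply: le_trans (ler_normD _ _) _; rewrite normrM (ger0_norm nn0).
  have : nu^+2 * `|partial i bD2 x| <= 1*K by apply: ler_pM=> //; apply: le_trans nn _; exact: ltW.
  have := K3 i; lra.
 have D2 : 4*de^+4 <= bD nu x^+2.
  by rewrite (_ : 4*de^+4 = (2*de^+2)^+2); [rewrite ler_pXn2r// nnegrE; [apply: mulr_ge0=> //; exact: ltW|exact: ltW]|ring].
 rewrite /Y normrM normfV (ger0_norm (sqr_ge0 (bD nu x))) ler_pdivrMr ?exprn_gt0//.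
 apply: (@le_trans _ _ (2 * nu*K*(2*K))); first by rewrite normrM; apply: ler_pM=> //; exact: cmb.
 have h : nu*K^+2 <= e*de^+4.
  by apply: le_trans (ltW nL); apply: ler_wpM2l; [exact: ltW|rewrite /L lerDr ltW].
 have : e*de^+4 <= 2^-1*de^+4 by apply: ler_wpM2r=> //; rewrite exprn_ge0// ltW.
 lra.
have := ler_normB X Y; lra.
Qed.

End BoundaryData.

(** * The logarithmic cut-off and its pointwise estimate *)

Section Cutoff.
Variable R : realType.
Local Notation leb := (@lebesgue_measure R).

Definition step (t : R) : R := flat 0 t/(flat 0 t + flat 0 (1 - t)).
Definition dstep (t : R) : R := (flat 2 t*flat 0 (1 - t) + flat 0 t*flat 2 (1 - t))/(flat 0 t + flat 0 (1 - t))^+2.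

Lemma step_den (t : R) : 0 < flat 0 t + flat 0 (1 - t).
Proof.
have P (s : R) : 0 < s -> 0 < flat 0 s by move=> s0; rewrite /flat s0 expr0 mulr1 expR_gt0.
have [t0|t0] := ltP 0 t; first by apply: ltr_pwDl; [exact: P|exact: flat_ge0].
by apply: ltr_wpDl; [exact: flat_ge0|apply: P; lra].
Qed.

Lemma step_01 t : 0 <= step t <= 1.
Proof.
have d := step_den t; have a := flat_ge0 0 t; have b := flat_ge0 0 (1 - t).
by rewrite divr_ge0 ?(ltW d)//= ler_pdivrMr// mul1r lerDl.
Qed.

Lemma step_le0 t : t <= 0 -> step t = 0 /\ dstep t = 0.
Proof.
move=> t0; have F k : flat k t = 0 by rewrite /flat ltNge t0.
by rewrite /step /dstep !F !mul0r addr0 mul0r.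
Qed.

Lemma step_ge1 t : 1 <= t -> step t = 1 /\ dstep t = 0.
Proof.
move=> t1; have F k : flat k (1 - t) = 0 by rewrite /flat subr_gt0 ltNge t1.
have := step_den t; rewrite /step /dstep !F !mulr0 !addr0 mul0r => d.
by rewrite divff// gt_eqF.
Qed.

Lemma step_derive t : is_derive t (1 : R) step (dstep t).
Proof.
have d := lt0r_neq0 (step_den t).
have D1 := @flat_derive R 0 t.
have D2 : is_derive t (1 : R) (fun s : R => flat 0 (1 - s)) (- flat 2 (1 - t)).
 have i : is_derive t (1 : R) (fun s : R => 1 - s) (-1) by apply: is_derive_eq; ring.
 have := @is_derive1_comp _ (flat 0) (fun s => 1 - s) t _ _ (@flat_derive R 0 (1 - t)) i.
 by move=> H; apply: (is_derive_eq H); ring.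
have D3 : is_derive t (1 : R) (fun s : R => flat 0 s + flat 0 (1 - s)) (flat 2 t - flat 2 (1 - t)).
 by apply: is_derive_eq; ring.
have D4 := @is_deriveV R (fun s : R => flat 0 s + flat 0 (1 - s)) t _ 1 d D3.
have := is_deriveM D1 D4; move=> H; apply: (is_derive_eq H).
rewrite /dstep /GRing.scale /=; field.
exact: d.
Qed.

Lemma dstep_continuous : continuous dstep.
Proof.
move=> t; have C k : {for t, continuous (fun s : R => flat k s)} by exact: flat_continuous.
have C' k : {for t, continuous (fun s : R => flat k (1 - s))}.
 apply: (@continuous_comp _ _ _ (fun s : R => 1 - s) (flat k)); last exact: flat_continuous.
 by apply: continuousB; [exact: cvg_cst|exact: cvg_id].
rewrite /continuous_at /dstep; apply: cvgM.
 by apply: cvgD; apply: cvgM; [exact: C|exact: C'|exact: C|exact: C'].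
apply: cvgV; first by rewrite expf_neq0// gt_eqF// step_den.
by apply: (@continuous_comp _ _ _ (fun s : R => flat 0 s + flat 0 (1 - s)) (fun s => s^+2)); [apply: cvgD; [exact: C|exact: C']|exact: exprn_continuous].
Qed.

Lemma dstep_bounded : exists2 L, 0 < L & forall t, `|dstep t| <= L.
Proof.
have [|M [_ HM]] := @compact_bounded R R^o (dstep @` `[0, 1]%classic).
 apply: continuous_compact; last exact: segment_compact.
 by apply: continuous_subspaceT; exact: dstep_continuous.
exists (`|M| + 1); first by rewrite ltr_wpDl.
move=> t; have [t0|t0] := ltP t 0.
 by have [_ ->] := step_le0 (ltW t0); rewrite normr0 addr_ge0.
have [t1|t1] := ltP 1 t.
 by have [_ ->] := step_ge1 (ltW t1); rewrite normr0 addr_ge0.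
apply: HM; first by rewrite (le_lt_trans (ler_norm M))// ltrDl.
by exists t=> //=; rewrite in_itv /= t0 t1.
Qed.

Variables (de y0 : R).
Hypothesis de0 : 0 < de.
Hypothesis dey : 4*de <= y0.

Let y00 : 0 < y0. Proof. by apply: lt_le_trans dey; rewrite mulr_gt0. Qed.

Definition cN (y : R) : R := y^+2 + de^+2.
(* y^(-1/4), regularized at the scale [de] *)
Definition cg (y : R) : R := (sqrt (sqrt (sqrt (cN y))))^-1.
(** Zero outside [de, y0] and equal to 1 on [2 de, y0/2]. *)
Definition psi (y : R) : R := step (y / de - 1)*step (2 - 2*y / y0).
Definition dpsi (y : R) : R := dstep (y / de - 1) / de*step (2 - 2*y / y0)
 - step (y / de - 1)*(2 / y0*dstep (2 - 2*y / y0)).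
Definition cPhi (y : R) : R := psi y*cg y.
Definition dcPhi (y : R) : R := dpsi y*cg y - psi y*cg y*y/(4*cN y).

Lemma cN_gt0 y : 0 < cN y.
Proof. by rewrite ltr_wpDl ?sqr_ge0// exprn_gt0. Qed.

Lemma cg_gt0 y : 0 < cg y.
Proof. by rewrite invr_gt0 !sqrtr_gt0 cN_gt0. Qed.

Lemma cg8 y : cg y^+8*cN y = 1.
Proof.
have c0 := cN_gt0 y; rewrite /cg exprVn.
have -> : sqrt (sqrt (sqrt (cN y)))^+8 = cN y.
 rewrite (_ : 8 = (2*(2*2)))%N// exprM sqr_sqrtr ?sqrtr_ge0// exprM sqr_sqrtr ?sqrtr_ge0// sqr_sqrtr//; exact: ltW.
by rewrite mulVf// gt_eqF.
Qed.

Lemma psi_01 y : 0 <= psi y <= 1.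
Proof.
have /andP[a b] := step_01 (y / de - 1); have /andP[c d] := step_01 (2 - 2*y / y0).
by rewrite mulr_ge0//= mulr_ile1.
Qed.

Lemma cPhi_out y : y <= de \/ y0 <= y -> [/\ psi y = 0, dpsi y = 0, cPhi y = 0 & dcPhi y = 0].
Proof.
move=> H; suff [a b] : psi y = 0 /\ dpsi y = 0 by rewrite /cPhi /dcPhi a b !mul0r subr0.
case: H=> [yd|yy].
 have [s0 d0] : step (y / de - 1) = 0 /\ dstep (y / de - 1) = 0 by apply: step_le0; rewrite subr_le0 ler_pdivrMr// mul1r.
 by rewrite /psi /dpsi s0 d0 !mul0r subr0.
have [s0 d0] : step (2 - 2*y / y0) = 0 /\ dstep (2 - 2*y / y0) = 0.
 by apply: step_le0; rewrite subr_le0 ler_pdivlMr//; apply: ler_wpM2l.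
by rewrite /psi /dpsi s0 d0 !mulr0 subr0.
Qed.

Lemma is_derive_aff (a b t : R) : is_derive t (1 : R) (fun s : R => a*s + b) a.
Proof. by apply: is_derive_eq; rewrite /GRing.scale /=; ring. Qed.

Lemma psi_derive y : is_derive y (1 : R) psi (dpsi y).
Proof.
have e1 : (fun s => s / de - 1) = (fun s => de^-1*s + -1) by apply/funext => s; ring.
have e2 : (fun s => 2 - 2*s / y0) = (fun s => (- (2 / y0))*s + 2) by apply/funext => s; ring.
have D1 : is_derive y (1 : R) (fun s => step (s / de - 1)) (dstep (y / de - 1)*de^-1).
 have i : is_derive y (1 : R) (fun s => s / de - 1) de^-1 by rewrite e1; exact: is_derive_aff.
 by have := @is_derive1_comp _ step (fun s => s / de - 1) y _ _ (step_derive _) i.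
have D2 : is_derive y (1 : R) (fun s => step (2 - 2*s / y0)) (dstep (2 - 2*y / y0)*(- (2 / y0))).
 have i : is_derive y (1 : R) (fun s => 2 - 2*s / y0) (- (2 / y0)) by rewrite e2; exact: is_derive_aff.
 by have := @is_derive1_comp _ step (fun s => 2 - 2*s / y0) y _ _ (step_derive _) i.
have := is_deriveM D1 D2; move=> H; apply: (is_derive_eq H).
by rewrite /dpsi /GRing.scale /=; ring.
Qed.

Lemma cg_derive y : is_derive y (1 : R) cg (- (cg y*y/(4*cN y))).
Proof.
have c0 := cN_gt0 y; set a := sqrt (cN y); set b := sqrt a; set d := sqrt b.
have a0 : 0 < a by rewrite sqrtr_gt0. have b0 : 0 < b by rewrite sqrtr_gt0. have d0 : 0 < d by rewrite sqrtr_gt0.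
have D0 : is_derive y (1 : R) cN (2*y) by apply: is_derive_eq; rewrite /GRing.scale /=; ring.
have D1 := @is_derive1_comp _ sqrt cN y _ _ (is_derive1_sqrt c0) D0.
have D2 := @is_derive1_comp _ sqrt (sqrt \o cN) y _ _ (is_derive1_sqrt a0) D1.
have D3 := @is_derive1_comp _ sqrt (sqrt \o (sqrt \o cN)) y _ _ (is_derive1_sqrt b0) D2.
have D4 := @is_deriveV R (sqrt \o (sqrt \o (sqrt \o cN))) y _ 1 (lt0r_neq0 d0) D3.
apply: (is_derive_eq D4); rewrite /GRing.scale /= -/a -/b -/d /cg -/a -/b -/d.
have eb : b = d^+2 by rewrite sqr_sqrtr// ltW. have ea : a = b^+2 by rewrite sqr_sqrtr// ltW.
have ec : cN y = a^+2 by rewrite sqr_sqrtr// ltW.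
by rewrite ec ea eb; field; rewrite gt_eqF.
Qed.

Lemma cPhi_derive y : is_derive y (1 : R) cPhi (dcPhi y).
Proof.
have := is_deriveM (psi_derive y) (cg_derive y); move=> H; apply: (is_derive_eq H).
by rewrite /dcPhi /GRing.scale /=; ring.
Qed.

Lemma is_derive_cont (f df : R -> R) : (forall y, is_derive y (1 : R) f (df y)) -> continuous f.
Proof. by move=> D y; apply: differentiable_continuous; apply/derivable1_diffP; have [] := D y. Qed.

Lemma dcPhi_continuous : continuous dcPhi.
Proof.
have ca (a b : R) : continuous (fun s : R => a*s + b) := is_derive_cont (is_derive_aff a b).
have e1 : (fun s : R => s / de - 1) = (fun s => de^-1*s + -1) by apply/funext => s; ring.
have e2 : (fun s : R => 2 - 2*s / y0) = (fun s => (- (2 / y0))*s + 2) by apply/funext => s; ring.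
have c1 : continuous (fun s : R => s / de - 1) by rewrite e1.
have c2 : continuous (fun s : R => 2 - 2*s / y0) by rewrite e2.
have cs := is_derive_cont step_derive; have cd := dstep_continuous.
have k1 (h : R -> R) : continuous h -> continuous (fun s : R => h (s / de - 1)) by move=> ch y; exact: (continuous_comp (c1 y) (ch _)).
have k2 (h : R -> R) : continuous h -> continuous (fun s : R => h (2 - 2*s / y0)) by move=> ch y; exact: (continuous_comp (c2 y) (ch _)).
have cdp : continuous dpsi.
 move=> y; apply: cvgB; apply: cvgM.
 - by apply: cvgM; [exact: (k1 _ cd)|exact: cvg_cst].
 - exact: (k2 _ cs).
 - exact: (k1 _ cs).
 - by apply: cvgM; [exact: cvg_cst|exact: (k2 _ cd)].
have cp := is_derive_cont psi_derive; have cc := is_derive_cont cg_derive.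
have cn : continuous cN by move=> y; apply: cvgD; [exact: exprn_continuous|exact: cvg_cst].
move=> y; apply: cvgB; first by apply: cvgM; [exact: cdp|exact: cc].
apply: cvgM; first by apply: cvgM; [apply: cvgM; [exact: cp|exact: cc]|exact: cvg_id].
apply: cvgV; first by rewrite mulf_neq0// gt_eqF// cN_gt0.
by apply: cvgM; [exact: cvg_cst|exact: cn].
Qed.

Lemma gsm_step (f : R3 R -> R) : gsm f -> gsm (fun x => step (f x)).
Proof.
move=> gf; have gf' : gsm (fun x => 1 - f x) by apply: gsm_sub=> //; exact: Gcst.
apply: Gmul; first exact: Gflat.
by apply: Ginv; [apply: Gadd; exact: Gflat|move=> x; exact: step_den].
Qed.

Lemma gsm_cPhi (f : R3 R -> R) : gsm f -> gsm (fun x => cPhi (f x)).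
Proof.
move=> gf; apply: Gmul; first apply: Gmul.
- by apply: gsm_step; apply: gsm_sub; [apply: Gmul=> //; exact: Gcst|exact: Gcst].
- by apply: gsm_step; apply: gsm_sub; [exact: Gcst|apply: Gmul; [apply: Gmul=> //; exact: Gcst|exact: Gcst]].
have gN : gsm (fun x => cN (f x)) by apply: Gadd; [exact: gsm_sqr|exact: Gcst].
apply: Ginv; last by move=> x; rewrite !sqrtr_gt0 cN_gt0.
apply: Gsqrt; last by move=> x; rewrite !sqrtr_gt0 cN_gt0.
apply: Gsqrt; last by move=> x; rewrite !sqrtr_gt0 cN_gt0.
by apply: Gsqrt=> // x; exact: cN_gt0.
Qed.

(** For Phi = y^(-1/4) the left term 66 y^(3/2) Phi'^2 is 66/16 times Phi^2 y^(-1/2), well below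
    13/2. The gap pays for the regularization, since t = cg^2 sqrt(y) lies in [5/6, 1], and for the
    product rule in (psi cg)', where Young's inequality costs 396 = 66 * 6 times y psi'^2; a surplus
    psi^2 / y is left over. *)
Lemma cutoff_pointwise (C y : R) : 0 <= C -> de <= y ->
 (66*(y*dcPhi y^+2) + C*cPhi y^+2)*sqrt y
 + (psi y^+2 / y - 396*(y*dpsi y^+2) - C * psi y^+2) <= 13/2*(cPhi y^+2 / sqrt y).
Proof.
move=> C0 yd; have yp : 0 < y by apply: lt_le_trans yd.
have /andP[p0 p1] := psi_01 y; have g0 := cg_gt0 y; have G8 := cg8 y; have N0 := cN_gt0 y.
set s := sqrt y; have s0 : 0 < s by rewrite sqrtr_gt0.
have sE : y = s^+2 by rewrite sqr_sqrtr// ltW.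
have NE : cN y = y^+2 + de^+2 by [].
have N1 : y^+2 <= cN y by rewrite lerDl sqr_ge0.
have N2 : cN y <= 2*y^+2.
 have h : de^+2 <= y^+2 by rewrite ler_pXn2r// nnegrE ltW.
 rewrite NE; lra.
pose t := cg y^+2*s; have t0 : 0 < t by rewrite mulr_gt0// exprn_gt0.
have t4 : t^+4*cN y = y^+2.
 have -> : t^+4*cN y = cg y^+8*cN y*(s^+2)^+2 by rewrite /t; ring.
 by rewrite G8 mul1r -sE.
have t1 : t <= 1.
 rewrite -(@ler_pXn2r _ 4)// ?nnegrE ?(ltW t0)// expr1n -(ler_pM2r N0) t4 mul1r; exact: N1.
(* For y >= de one has t^4 = y^2 / (y^2 + de^2) >= 1/2 > (5/6)^4. *)
have t56 : 5/6 <= t.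
 suff h : (5/6)^+4 <= t^+4 by rewrite -(@ler_pXn2r _ 4) // nnegrE; [lra|exact: ltW].
 rewrite -(ler_pM2r N0) t4; apply: (@le_trans _ _ ((5/6)^+4*(2*y^+2))).
  by apply: ler_wpM2l=> //; rewrite exprn_ge0//; lra.
 have := sqr_ge0 y; lra.
set p := psi y in p0 p1 *; set d := dpsi y; set g := cg y in g0 t t0 t4 t1 t56 *.
have eP : cPhi y^+2 = p^+2*t / s by rewrite /cPhi -/p -/g /t; field; rewrite gt_eqF.
have eD : dcPhi y^+2 = (d - p*(y/(4*cN y)))^+2*t / s.
 by rewrite /dcPhi -/p -/g -/d /t; field; rewrite !gt_eqF.
rewrite eP eD.
have -> : p^+2*t / s / s = t*(p^+2 / y) by rewrite sE; field; rewrite gt_eqF.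
have -> : (66*(y*((d - p*(y/(4*cN y)))^+2*t / s)) + C*(p^+2*t / s))*s =
 66*(t*(y*(d - p*(y/(4*cN y)))^+2)) + C*(p^+2*t) by field; rewrite !gt_eqF.
have h1 : (d - p*(y/(4*cN y)))^+2 <= 6*d^+2 + 6/5*(p*(y/(4*cN y)))^+2.
 move: (p * _) => b; have := sqr_ge0 (5*d + b); nra.
have h2 : y*(y/(4*cN y))^+2 <= 16^-1 / y.
 rewrite (_ : y * _ = 16^-1*(y^+3 / cN y^+2)); last by field; rewrite gt_eqF.
 apply: ler_wpM2l; first by rewrite invr_ge0.
 rewrite ler_pdivrMr ?exprn_gt0// mulrC ler_pdivlMr// -exprSr.
 by rewrite (_ : y^+4 = (y^+2)^+2); [rewrite ler_pXn2r// nnegrE ?(ltW N0)// sqr_ge0|rewrite -exprM].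
have P0 : 0 <= p^+2 := sqr_ge0 p.
have h3 : y*(d - p*(y/(4*cN y)))^+2 <= 6*(y*d^+2) + 3/40*(p^+2 / y).
 apply: le_trans (ler_wpM2l (ltW yp) h1) _.
 have h := ler_wpM2l P0 h2.
 have e1 (r : R) : y*(6*d^+2 + 6/5*(p*r)^+2) = 6*(y*d^+2) + 6/5*(p^+2*(y*r^+2)) by ring.
 have e2 : 6/5*(p^+2*(16^-1 / y)) = 3/40*(p^+2 / y) by field; rewrite gt_eqF.
 rewrite e1 lerD2l -e2; apply: ler_wpM2l=> //; lra.
have yd0 : 0 <= y*d^+2 by rewrite mulr_ge0 ?sqr_ge0// ltW.
have py0 : 0 <= p^+2 / y by rewrite divr_ge0// ltW.
move: (y*d^+2) (p^+2 / y) yd0 py0 h3 => X Y X0 Y0; move: (y * _) => Z h3.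
have h4 : t*Z <= t*(6*X + 3/40*Y) by apply: ler_wpM2l=> //; exact: ltW.
have h5 : t*X <= X by rewrite ler_piMl.
have h6 : C*(p^+2*t) <= C * p^+2 by apply: ler_wpM2l=> //; rewrite ler_piMr.
have h7 : 5/6*Y <= t*Y by apply: ler_wpM2r.
lra.
Qed.

End Cutoff.

(** * The choice of the cut-off scale *)

Section CutoffIntegrals.
Variable R : realType.
Local Notation leb := (@lebesgue_measure R).
Notation I1 f := (leb.-integrable setT (EFin \o (f : mTR R -> R))).

Lemma integrable_cmpct (f : R -> R) (a b M : R) : mfun (f : mTR R -> R) ->
 (forall y, a <= y <= b -> `|f y| <= M) -> (forall y, ~~ (a <= y <= b) -> f y = 0) -> I1 f.
Proof.
move=> mf fM f0; apply: (@le_integrable _ _ _ leb setT measurableT (EFin \o f) (fun y => (M * \1_(`[a, b]%classic) y)%:E)).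
- exact/measurable_EFinP.
- move=> y _; rewrite !abse_EFin lee_fin indicE mem_setE in_itv /=; have [h|h] := boolP (a <= y <= b).
  by rewrite mulr1; apply: le_trans (fM _ h) _; exact: ler_norm.
 by rewrite f0// mulr0 normr0.
- have := integrableZl measurableT M (integrable_indic_itv a b true false).
 by under eq_fun do rewrite /= -EFinM.
Qed.

Lemma I1_indic (k a b : R) : a <= b -> I1 (fun y => k * \1_(`[a, b]%classic) y) /\
 \int[leb]_y (k * \1_(`[a, b]%classic) y) = k*(b - a).
Proof.
move=> ab; have i := @integrable_indic_itv R a b true false; split.
 by have := integrableZl measurableT k i; under eq_fun do rewrite /= -EFinM.
rewrite RintegralZl//; congr (_ * _); rewrite /Rintegral integral_indic// setIT.
apply: (congr1 fine (y := (b - a)%:E)); apply: etrans (lebesgue_measure_itv _) _.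
rewrite /= lte_fin; case: ltP=> // h.
by rewrite (@le_anti _ _ a b) ?subrr// ab h.
Qed.

Lemma I1_add f g : I1 f -> I1 g -> I1 (fun y => f y + g y).
Proof. by move=> i j; have := integrableD measurableT i j; under eq_fun do rewrite /= -EFinD. Qed.
Lemma I1_scale k f : I1 f -> I1 (fun y => k*f y).
Proof. by move=> i; have := integrableZl measurableT k i; under eq_fun do rewrite /= -EFinM. Qed.

(** The surplus of [cutoff_pointwise] is bounded below separately on the rise, the plateau and the
    fall of [psi]. On the plateau 1/y is replaced by the smaller y / cN, which is continuous on the
    whole line with primitive ln(cN) / 2. *)
Lemma cutoff_lower (C de y0 L y : R) : 0 <= C -> 0 < de -> 5*de <= y0 -> (forall t : R, `|dstep t| <= L) -> 0 < L ->
 forall K1 K2, K1 = 792*L^+2 / de -> K2 = 1584*L^+2 / y0 ->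
 66*(y*dcPhi de y0 y^+2*sqrt y) + C*(cPhi de y0 y^+2*sqrt y) +
 (y / cN de y*((2*de <= y <= y0/2)%R)%:R + (- K1*((de <= y <= 2*de)%R)%:R +
  (- K2*((y0/2 <= y <= y0)%R)%:R + - C*((de <= y <= y0)%R)%:R)))
 <= 13/2*(cPhi de y0 y^+2 / sqrt y).
Proof.
move=> C0 de0 dy5 HL L0 K1 K2 K1E K2E.
have dey : 4*de <= y0 by lra. have y00 : 0 < y0 by lra.
have nin : ~~ (de <= y <= y0) -> y <= de \/ y0 <= y.
 by rewrite negb_and -!ltNge => /orP[/ltW|/ltW]; [left|right].
have K10 : 0 <= K1.
 by rewrite K1E; apply: divr_ge0; [apply: mulr_ge0; [exact: ler0n|exact: sqr_ge0]|exact: ltW].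
have K20 : 0 <= K2.
 by rewrite K2E; apply: divr_ge0; [apply: mulr_ge0; [exact: ler0n|exact: sqr_ge0]|exact: ltW].
pose P := cPhi de y0; pose dP := dcPhi de y0; rewrite -/P -/dP.
have [yi|yn] := boolP (de <= y <= y0); last first.
 have [_ _ p0 d0] := cPhi_out de0 dey (nin yn); rewrite /P /dP p0 d0.
 have b1 : (2*de <= y <= y0/2) = false.
  by apply/negP => /andP[h1 h2]; case/negP: yn; apply/andP; split; lra.
 rewrite b1 !expr0n /= !(mul0r, mulr0, add0r).
 have := ler0n R (de <= y <= 2*de)%R; have := ler0n R (y0/2 <= y <= y0)%R.
 move: (nat_of_bool _)%:R (nat_of_bool _)%:R => s t s0 t0; have := mulr_ge0 K10 t0; have := mulr_ge0 K20 s0; lra.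
have [y1 y2] := andP yi; have yp : 0 < y by exact: lt_le_trans y1.
have := @cutoff_pointwise R de y0 de0 C y C0 y1; rewrite -/P -/dP.
have /andP[p0 p1] := psi_01 de y0 y; have p2 : psi de y0 y^+2 <= 1 by rewrite exprn_ile1.
have p20 := sqr_ge0 (psi de y0 y).
set A := 13/2 * _; set H := (66 * _ + _) * _ => hh.
have -> : 66*(y*dP y^+2*sqrt y) + C*(P y^+2*sqrt y) = H by rewrite /H; ring.
suff : y / cN de y*((2*de <= y <= y0/2)%R)%:R + (- K1*((de <= y <= 2*de)%R)%:R + (- K2*((y0/2 <= y <= y0)%R)%:R + - C*true%:R))
 <= psi de y0 y^+2 / y - 396*(y*dpsi de y0 y^+2) - C * psi de y0 y^+2 by lra.
have cp : C * psi de y0 y^+2 <= C by rewrite ler_piMr.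
have pY : 0 <= psi de y0 y^+2 / y by rewrite divr_ge0// ltW.
have tN (t : R) : `|dstep t|^+2 <= L^+2 by rewrite ler_pXn2r// ?nnegrE// ltW.
have st (t : R) : 0 <= step t^+2 <= 1.
 by have /andP[a b] := step_01 t; rewrite sqr_ge0 exprn_ile1.
have [lo|] := boolP (y < 2*de).
 have b1 : (2*de <= y <= y0/2) = false by rewrite leNgt lo.
 have b2 : (de <= y <= 2*de) by rewrite y1 ltW.
 have b3 : (y0/2 <= y <= y0) = false by apply/negP => /andP[h1 h2]; lra.
 rewrite b1 b2 b3 /= mulr0 add0r mulr1 mulr0 add0r mulr1.
 have [s1 d1] : step (2 - 2*y / y0) = 1 /\ dstep (2 - 2*y / y0) = 0.
  have h : 2*y / y0 <= 1 by rewrite ler_pdivrMr// mul1r; lra.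
  by apply: step_ge1; lra.
 have -> : dpsi de y0 y = dstep (y / de - 1) / de by rewrite /dpsi s1 d1; ring.
 have : 396*(y*(dstep (y / de - 1) / de)^+2) <= K1.
  rewrite (_ : K1 = 396*(2*de*(L^+2 / de^+2))); last by rewrite K1E; field; exact: lt0r_neq0.
  apply: ler_wpM2l; first exact: ler0n.
  apply: ler_pM; [exact: ltW|exact: sqr_ge0|exact: ltW|].
  rewrite expr_div_n; apply: ler_wpM2r; first by rewrite invr_ge0 sqr_ge0.
  by rewrite -(real_normK (num_real (dstep _))).
 lra.
rewrite -leNgt => lo; have [hi|] := boolP (y <= y0/2).
 have b1 : (2*de <= y <= y0/2) by rewrite lo hi.
 have [s1 d1] : step (2 - 2*y / y0) = 1 /\ dstep (2 - 2*y / y0) = 0.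
  have h : 2*y / y0 <= 1 by rewrite ler_pdivrMr// mul1r; lra.
  by apply: step_ge1; lra.
 have [s2 d2] : step (y / de - 1) = 1 /\ dstep (y / de - 1) = 0.
  by apply: step_ge1; rewrite lerBrDr ler_pdivlMr.
 have -> : dpsi de y0 y = 0 by rewrite /dpsi s1 d1 d2; ring.
 have -> : psi de y0 y = 1 by rewrite /psi s1 s2 mulr1.
 rewrite lo /= mulr1 expr0n /= expr1n !mulr0 !mulr1 mul1r.
 have q : y / cN de y <= y^-1.
  rewrite ler_pdivrMr ?cN_gt0// /cN mulrDr expr2 mulKf ?gt_eqF// lerDl.
  by rewrite mulr_ge0 ?sqr_ge0// invr_ge0 ltW.
 have := ler0n R (de <= y <= 2*de)%R; have := ler0n R (y0/2 <= y <= y0)%R.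
 move: (nat_of_bool _)%:R (nat_of_bool _)%:R => s t s0 t0; have := mulr_ge0 K10 t0; have := mulr_ge0 K20 s0; lra.
rewrite -ltNge => hi.
have b1 : (2*de <= y <= y0/2) = false by apply/negP => /andP[_]; rewrite leNgt hi.
have b2 : (de <= y <= 2*de) = false by apply/negP => /andP[_ h]; lra.
have b3 : (y0/2 <= y <= y0) by rewrite y2 ltW.
rewrite andbF b2 b3 !mulr0 !add0r !mulr1.
have [s2 d2] : step (y / de - 1) = 1 /\ dstep (y / de - 1) = 0.
 by apply: step_ge1; rewrite lerBrDr ler_pdivlMr//; lra.
have -> : dpsi de y0 y = - (2 / y0*dstep (2 - 2*y / y0)) by rewrite /dpsi s2 d2; ring.
have : 396*(y*(- (2 / y0*dstep (2 - 2*y / y0)))^+2) <= K2.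
 rewrite (_ : K2 = 396*(y0*((2 / y0)^+2*L^+2))); last by rewrite K2E; field; exact: lt0r_neq0.
 apply: ler_wpM2l; first exact: ler0n.
 apply: ler_pM; [exact: ltW|exact: sqr_ge0|exact: y2|].
 rewrite sqrrN exprMn; apply: ler_wpM2l; first exact: sqr_ge0.
 by rewrite -(real_normK (num_real (dstep _))).
lra.
Qed.

(** The plateau contributes half of ln(cN(y0/2) / cN(2 de)), which is unbounded as de decreases. The
    rise and the fall cost 792 L^2 each, at every scale, and the term with C costs at most C y0. *)
Lemma cutoff_integrals (C y0 : R) : 0 <= C -> 0 < y0 -> exists de, [/\ 0 < de /\ 4*de <= y0,
 I1 (fun y => cPhi de y0 y^+2 / sqrt y), I1 (fun y => y*dcPhi de y0 y^+2*sqrt y),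
 I1 (fun y => cPhi de y0 y^+2*sqrt y) &
 66*(\int[leb]_y (y*dcPhi de y0 y^+2*sqrt y)) + C*(\int[leb]_y (cPhi de y0 y^+2*sqrt y))
 < 13/2*(\int[leb]_y (cPhi de y0 y^+2 / sqrt y))].
Proof.
move=> C0 y00; have [L L0 HL] := @dstep_bounded R.
pose Z := 1584*L^+2 + C*y0.
have Z0 : 0 <= Z by apply: addr_ge0; apply: mulr_ge0; rewrite ?ler0n ?sqr_ge0// ltW.
(* [Z] is the total cost. As cN(2 de) = 5 de^2, this [de] makes the quotient in the logarithm larger
   than exp(2 Z). *)
pose de := y0*expR (- Z)/5; have e0 : 0 < expR (- Z) by exact: expR_gt0.
have e1 : expR (- Z) <= 1 by rewrite -expR0 ler_expR oppr_le0.
have de0 : 0 < de by rewrite divr_gt0// mulr_gt0.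
have dy5 : 5*de <= y0.
 have -> : 5*de = y0*expR (- Z) by rewrite /de; field.
 by rewrite ler_piMr// ltW.
have dey : 4*de <= y0 by lra.
set P := cPhi de y0; set dP := dcPhi de y0.
have out y : y <= de \/ y0 <= y -> _ := cPhi_out de0 dey (y := y).
have cP : continuous P := is_derive_cont (@cPhi_derive R de y0 de0).
have cd : continuous dP := @dcPhi_continuous R de y0 de0.
have cbd (f : R -> R) : continuous f -> exists2 M, 0 <= M & forall y, de <= y <= y0 -> `|f y| <= M.
 move=> cf; have [|M [_ HM]] := @compact_bounded R R^o (f @` `[de, y0]%classic).
  by apply: continuous_compact; [exact: continuous_subspaceT|exact: segment_compact].
 exists (`|M| + 1); first by rewrite addr_ge0.
 move=> y yi; apply: HM; first by rewrite (le_lt_trans (ler_norm M))// ltrDl.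
 by exists y=> //=; rewrite in_itv.
have [M M0 HM] := cbd P cP; have [N N0 HN] := cbd dP cd.
have msq : mfun (fun y : mTR R => sqrt y) := @measurable_sqrt R.
have mP : mfun (P : mTR R -> R) by exact: continuous_measurable_fun.
have mdP : mfun (dP : mTR R -> R) by exact: continuous_measurable_fun.
have mP2 : mfun (fun y : mTR R => P y^+2) by exact: measurable_funX.
have nin y : ~~ (de <= y <= y0) -> y <= de \/ y0 <= y.
 by rewrite negb_and -!ltNge => /orP[/ltW|/ltW]; [left|right].
have sd : 0 < sqrt de by rewrite sqrtr_gt0.
have P2 y : de <= y <= y0 -> P y^+2 <= M^+2.
 by move=> /HM h; rewrite -(real_normK (num_real (P y))) ler_pXn2r// nnegrE.
have i1 : I1 (fun y => P y^+2 / sqrt y).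
 apply: (@integrable_cmpct _ de y0 (M^+2 / sqrt de)).
 - by apply: measurable_funM=> //; apply: (measurableT_comp (@measurable_inv R)).
 - move=> y yi; rewrite ger0_norm; last by rewrite divr_ge0 ?sqr_ge0 ?sqrtr_ge0.
  apply: ler_pM; rewrite ?sqr_ge0 ?invr_ge0 ?sqrtr_ge0//; first exact: P2.
  case/andP: yi => y1 _; rewrite lef_pV2 ?posrE//; first by rewrite ler_wsqrtr.
  by rewrite sqrtr_gt0; apply: lt_le_trans y1.
 - by move=> y /nin /out[_ _ p0 _]; rewrite /P p0 expr0n mul0r.
have i3 : I1 (fun y => P y^+2*sqrt y).
 apply: (@integrable_cmpct _ de y0 (M^+2*sqrt y0)).
 - exact: measurable_funM.
 - move=> y yi; rewrite ger0_norm; last by rewrite mulr_ge0 ?sqr_ge0 ?sqrtr_ge0.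
  by apply: ler_pM; rewrite ?sqr_ge0 ?sqrtr_ge0//; [exact: P2|case/andP: yi => _ y1; rewrite ler_wsqrtr].
 - by move=> y /nin /out[_ _ p0 _]; rewrite /P p0 expr0n mul0r.
have i2 : I1 (fun y => y*dP y^+2*sqrt y).
 apply: (@integrable_cmpct _ de y0 (y0*N^+2*sqrt y0)).
 - by apply: measurable_funM=> //; apply: measurable_funM=> //; exact: measurable_funX.
 - move=> y yi; have y1 : 0 <= y by case/andP: yi => y1 _; apply: le_trans y1; exact: ltW.
  rewrite ger0_norm; last by apply: mulr_ge0; [apply: mulr_ge0=> //; exact: sqr_ge0|exact: sqrtr_ge0].
  apply: ler_pM; [by apply: mulr_ge0=> //; exact: sqr_ge0|exact: sqrtr_ge0| |by case/andP: yi => _ y2; rewrite ler_wsqrtr].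
  apply: ler_pM; rewrite ?sqr_ge0//; first by case/andP: yi.
  by rewrite -(real_normK (num_real (dP y))) ler_pXn2r// ?nnegrE//; exact: HN.
 - by move=> y /nin /out[_ _ _ p0]; rewrite /dP p0 expr0n mulr0 mul0r.
exists de; split=> //.
pose K1 := 792*L^+2 / de; pose K2 := 1584*L^+2 / y0.
have [j1 J1] := @I1_indic (- K1) de (2*de) ltac:(lra).
have [j2 J2] := @I1_indic (- K2) (y0/2) y0 ltac:(lra).
have [j3 J3] := @I1_indic (- C) de y0 ltac:(lra).
pose q1 y := y / cN de y.
have cn0 y : 0 < cN de y := cN_gt0 de0 y.
have cq : continuous q1.
 move=> y; apply: cvgM; first exact: cvg_id.
 apply: cvgV; first by rewrite gt_eqF.
 by apply: cvgD; [exact: exprn_continuous|exact: cvg_cst].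
have ab : 2*de < y0/2 by lra.
have FT : (\int[leb]_(s in `[(2*de)%R, (y0/2)%R]) (q1 s)%:E)%E = ((ln (cN de (y0/2))/2)%:E - (ln (cN de (2*de))/2)%:E)%E.
 apply: (@FTC_all R q1 (fun y => ln (cN de y)/2) (2*de) (y0/2) ab cq) => s.
 have D0 : is_derive s (1 : R) (cN de) (2*s) by apply: is_derive_eq; rewrite /GRing.scale /=; ring.
 have D1 := @is_derive1_comp _ (@ln R) (cN de) s _ _ (is_derive1_ln (cn0 s)) D0.
 have D2 : is_derive s (1 : R) (fun y => ln (cN de y)*2^-1) _ := is_deriveM D1 (is_derive_cst (2^-1 : R) s 1).
 apply: (is_derive_eq D2); rewrite /GRing.scale /= /q1; field; exact: lt0r_neq0.
have jq : I1 (fun y => q1 y * \1_(`[(2*de)%R, (y0/2)%R]%classic) y).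
 have [T T0 HT] := cbd q1 cq.
 apply: (@integrable_cmpct _ de y0 T).
 - by apply: measurable_funM; [exact: continuous_measurable_fun|exact: measurable_indic].
 - move=> y /HT h; rewrite normrM -[leRHS]mulr1; apply: ler_pM=> //.
  by rewrite indicE; case: (_ \in _); rewrite ?normr1 ?normr0.
 - move=> y yn; rewrite indicE mem_setE in_itv /=; case: andP; rewrite ?mulr0// => -[h1 h2].
  by case/negP: yn; apply/andP; split; lra.
have JQ : \int[leb]_y (q1 y * \1_(`[(2*de)%R, (y0/2)%R]%classic) y) = ln (cN de (y0/2))/2 - ln (cN de (2*de))/2.
 rewrite /Rintegral; transitivity (fine (\int[leb]_(s in `[(2*de)%R, (y0/2)%R]) (q1 s)%:E)%E); last by rewrite FT.
 rewrite [in RHS]integral_mkcond; congr fine; apply: eq_integral => y _.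
 by rewrite patchE indicE; case: (_ \in _); rewrite ?mulr1 ?mulr0.
have LZ : Z < ln (cN de (y0/2))/2 - ln (cN de (2*de))/2.
 have c5 : cN de (2*de) = 5*de^+2 by rewrite /cN; ring.
 have E2 : expR (2*Z)*expR (- Z)^+2 = 1 by rewrite -expRM_natl -expRD (_ : 2*Z + _ = 0) ?expR0//; ring.
 have h : 2*Z + ln (cN de (2*de)) < ln (cN de (y0/2)).
  rewrite -{1}(expRK (2*Z)) -lnM ?posrE ?expR_gt0// ltr_ln ?posrE ?mulr_gt0 ?expR_gt0//.
  rewrite c5 (_ : de^+2 = y0^+2/25*expR (- Z)^+2); last by rewrite /de; field.
  rewrite (_ : expR (2*Z) * _ = y0^+2/5*(expR (2*Z)*expR (- Z)^+2)); last by field.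
  rewrite E2 mulr1 /cN; have : 0 < y0^+2 by rewrite exprn_gt0.
  have := sqr_ge0 de; rewrite expr_div_n; lra.
 lra.
have J0 : - K1*(2*de - de) - K2*(y0 - y0/2) - C*(y0 - de) >= - Z.
 have a1 : K1*(2*de - de) = 792*L^+2 by rewrite /K1; field; exact: lt0r_neq0.
 have a2 : K2*(y0 - y0/2) = 792*L^+2 by rewrite /K2; field; exact: lt0r_neq0.
 have a3 : 0 <= C*de by rewrite mulr_ge0// ltW.
 rewrite mulNr a1 a2 /Z; lra.
pose q0 y := q1 y * \1_(`[(2*de)%R, (y0/2)%R]%classic) y + (- K1 * \1_(`[de, (2*de)%R]%classic) y
 + (- K2 * \1_(`[(y0/2)%R, y0]%classic) y + - C * \1_(`[de, y0]%classic) y)).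
have k1 := I1_add j2 j3; have k2 := I1_add j1 k1; have k3 : I1 q0 := I1_add jq k2.
have Q0 : 0 < \int[leb]_y q0 y.
 rewrite /q0 RintegralD// RintegralD// RintegralD// J1 J2 J3 JQ; lra.
have l1 := I1_add (I1_scale 66 i2) (I1_scale C i3); have l2 := I1_add l1 k3.
have l3 := I1_scale (13/2) i1.
rewrite -!RintegralZl// -RintegralD//; try exact: I1_scale.
apply: (@lt_le_trans _ _ (\int[leb]_y (66*(y*dP y^+2*sqrt y) + C*(P y^+2*sqrt y)) + \int[leb]_y q0 y)); first by rewrite ltrDl.
rewrite -RintegralD//; apply: le_Rintegral=> // y' _; move: (y' : R) => {y'} y.
have ind (a b : R) : \1_(`[a, b]%classic) y = ((a <= y <= b)%R)%:R :> R by rewrite indicE mem_setE in_itv.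
rewrite /q0 !ind; exact: (cutoff_lower y C0 de0 dy5 HL L0 erefl erefl).
Qed.

End CutoffIntegrals.

(** * Null sets under maps and under slicing *)

Section NullSets.
Context d1 d2 (T1 : measurableType d1) (T2 : measurableType d2) (R : realType).
Local Open Scope ereal_scope.

(** An inequality in the change of variables is enough: integrating the indicator of a null set
    shows that its preimage is null where the density [J] is positive. *)
Lemma negligible_push (m1 : {measure set T1 -> \bar R}) (m2 : {measure set T2 -> \bar R})
  (phi : T1 -> T2) (J : T1 -> R) (N : set T2) : mfun phi -> mfun J ->
 (forall p, (0 <= J p)%R) ->
 (forall F : T2 -> \bar R, mfun F -> (forall x, 0 <= F x) ->
  \int[m1]_p ((J p)%:E*F (phi p)) <= \int[m2]_x F x) ->
 m2.-negligible N -> m1.-negligible [set p | (0 < J p)%R /\ N (phi p)].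
Proof.
move=> mphi mJ J0 H [A [mA A0 NA]].
have mI : mfun (fun x => (\1_A x : R)%:E) by apply/measurable_EFinP; exact: measurable_indic.
have mIp : mfun (fun p => (\1_A (phi p) : R)%:E) by apply: (measurableT_comp mI).
have mF : mfun (fun p => (J p)%:E*(\1_A (phi p) : R)%:E).
 by apply: emeasurable_funM=> //; apply/measurable_EFinP.
have F0 p : 0 <= (J p)%:E*(\1_A (phi p) : R)%:E by apply: mule_ge0; rewrite lee_fin ?J0.
have I0 : \int[m1]_p `|(J p)%:E*(\1_A (phi p) : R)%:E| = 0.
 under eq_integral do rewrite gee0_abs//.
 apply/eqP; rewrite eq_le; apply/andP; split; last by apply: integral_ge0.
 apply: le_trans (H _ mI _) _; first by move=> x; rewrite lee_fin.
 by rewrite integral_indic// setIT A0.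
have [E _] := ae_eq_integral_abs m1 measurableT mF; have := E I0.
apply: negligibleS => p [Jp Np] /= /(_ I); apply/eqP.
by rewrite indicE (mem_set (NA _ Np)) mule1 eqe gt_eqF.
Qed.

Lemma ae_slices (m1 : {sigma_finite_measure set T1 -> \bar R}) (m2 : {sigma_finite_measure set T2 -> \bar R})
  (Q : T1*T2 -> Prop) :
 {ae (m1 \x m2), forall p, Q p} -> {ae m1, forall x, {ae m2, forall y, Q (x, y)}}.
Proof.
move=> [A [mA A0 NA]].
have mS := measurable_fun_xsection m2 mA.
have I0 : \int[m1]_x `|(m2 \o xsection A) x| = 0.
 by rewrite -[RHS]A0; apply: eq_integral => x _; rewrite gee0_abs//; exact: measure_ge0.
have [E _] := ae_eq_integral_abs m1 measurableT mS; have := E I0.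
apply: negligibleS => x /= nQ E0; apply: nQ; exists (xsection A x); split.
- exact: measurable_xsection.
- exact: (E0 I).
- by move=> y /= nQ; rewrite /xsection /= inE; apply: NA.
Qed.

Lemma ae_slices_fin (m1 : {sigma_finite_measure set T1 -> \bar R}) (m2 : {sigma_finite_measure set T2 -> \bar R})
  (F : T1*T2 -> \bar R) : mfun F -> (forall p, 0 <= F p) ->
 \int[m1 \x m2]_p F p < +oo -> {ae m1, forall x, \int[m2]_y F (x, y) < +oo}.
Proof.
move=> mF F0 Ioo; have mf := measurable_fun_fubini_tonelli_F (m2 := m2) F mF F0.
have i : m1.-integrable setT (fubini_F m2 F).
 apply/integrableP; split=> //; rewrite (le_lt_trans _ Ioo)// (fubini_tonelli1 (m1 := m1) (m2 := m2))//.
 rewrite le_eqVlt; apply/orP; left; apply/eqP; apply: eq_integral => x _; rewrite gee0_abs//.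
 by apply: integral_ge0 => y _.
have := integrable_ae measurableT i; apply: filterS => x /(_ I); rewrite /fubini_F => /fin_numPlt /andP[_].
by [].
Qed.

End NullSets.

(** * Coordinates adapted to meridian half-planes and to spheres about axis points *)

Section SlopeCoordinates.
Variable R : realType.
Local Notation leb := (@lebesgue_measure R).
Local Notation mu := (vol R).
Local Notation mR := (mTR R).

(* The half-spaces s x_1 > 0, s = 1 or -1, in the coordinates m = x_2 / x_1, w = x_1^2 + x_2^2, z = x_3. *)
Definition spt (s m w z : R) : R3 R := let r := sqrt (w/(1 + m^+2)) in ((s*r, s*(m*r)), z).
(** The Jacobian of [spt], extended by 0 beyond the range w > 0 of these coordinates. *)
Definition sJ (m w : R) : R := if 0 < w then (2*(1 + m^+2))^-1 else 0.

Lemma onesqr_gt0 (m : R) : 0 < 1 + m^+2. Proof. by rewrite ltr_pwDl// sqr_ge0. Qed.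

Lemma sJ_ge0 m w : 0 <= sJ m w.
Proof. by rewrite /sJ; case: ifP=> // _; rewrite invr_ge0 mulr_ge0// ltW// onesqr_gt0. Qed.

Lemma measurable_sJ d (T : measurableType d) (a b : T -> R) : mfun a -> mfun b ->
 mfun (fun p => sJ (a p) (b p)).
Proof.
move=> ma mb; rewrite (_ : (fun p => _) = fun p => \1_(`]0, +oo[%classic) (b p)*(2*(1 + a p^+2))^-1).
 apply: measurable_funM.
  have mi : mfun (\1_(`]0, +oo[%classic : set mR) : mR -> R) by apply: measurable_indic; exact: measurable_itv.
  exact: (measurableT_comp mi mb).
 apply: (measurableT_comp (@measurable_inv R)); apply: measurable_funM=> //; apply: measurable_funD=> //.
 exact: measurable_funX.
apply/funext => p; rewrite /sJ indicE mem_setE in_itv /= andbT; by case: ifP; rewrite ?mul1r ?mul0r.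
Qed.

Lemma measurable_spt d (T : measurableType d) s (a b c : T -> R) : mfun a -> mfun b ->
 mfun c -> mfun (fun p => spt s (a p) (b p) (c p)).
Proof.
move=> ma mb mc.
have mr : mfun (fun p => sqrt (b p/(1 + a p^+2))).
 apply: (measurableT_comp (@measurable_sqrt R)); apply: measurable_funM=> //.
 by apply: (measurableT_comp (@measurable_inv R)); apply: measurable_funD=> //; exact: measurable_funX.
apply: measurable_fun_pair=> //; apply: measurable_fun_pair; first exact: measurable_funM.
by apply: measurable_funM=> //; exact: measurable_funM.
Qed.

Lemma rho2_spt s m w z : s^+2 = 1 -> 0 <= w -> rho2 (spt s m w z) = w.
Proof.
move=> s1 w0; rewrite /rho2 /spt /= !exprMn s1 !mul1r -[X in X + _]mul1r -mulrDl.
rewrite sqr_sqrtr ?divr_ge0 ?(ltW (onesqr_gt0 m))//; field; exact: lt0r_neq0 (onesqr_gt0 m).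
Qed.

Lemma sqr_enorm_spt s m w z : s^+2 = 1 -> 0 <= w -> enorm (spt s m w z)^+2 = w + z^+2.
Proof. by move=> s1 w0; rewrite sqr_enorm; have := rho2_spt m z s1 w0; rewrite /rho2=> ->. Qed.

Lemma B1_enorm2 (x : R3 R) : B1 x <-> enorm x^+2 < 1.
Proof.
by rewrite /B1 /= expr_lt1 ?enorm_ge0.
Qed.

Lemma spt_B s m w z : s^+2 = 1 -> 0 <= w -> B1 (spt s m w z) <-> w + z^+2 < 1.
Proof. by move=> s1 w0; rewrite B1_enorm2 sqr_enorm_spt. Qed.

Local Open Scope ereal_scope.

Lemma slope_vol (F : R3 R -> \bar R) : mfun F -> (forall x, 0 <= F x) ->
 \int[mu]_x F x = \int[mu]_p ((sJ p.1.1 p.1.2)%:E*(F (spt 1 p.1.1 p.1.2 p.2) + F (spt (-1) p.1.1 p.1.2 p.2))).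
Proof.
move=> mF F0; have m1 := @measurable_x1 R; have m2 := @measurable_x2 R; have m3 := @measurable_x3 R.
pose G s (p : R3 R) := (sJ p.1.1 p.1.2)%:E*F (spt s p.1.1 p.1.2 p.2).
have mG s : mfun (G s).
 apply: emeasurable_funM; first by apply/measurable_EFinP; exact: measurable_sJ.
 by apply: (measurableT_comp mF); exact: measurable_spt.
have G0 s p : 0 <= G s p by rewrite mule_ge0// lee_fin sJ_ge0.
under [RHS]eq_integral do rewrite ge0_muleDr//.
rewrite (ge0_integralD _ measurableT (f1 := G 1%R) (f2 := G (-1)%R))// !(vol_iter_z)//.
have half s z : (s^+2 = 1)%R -> \int[leb]_(x in `]0%R, +oo[) \int[leb]_y F ((s*x, s*y), z)%R = \int[leb2 R]_p G s (p, z).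
 move=> s1; pose H (p : mR * mR) := F (((s * p.1)%R, (s * p.2)%R), z).
 have mH : mfun H.
  apply: (measurableT_comp mF); apply: measurable_fun_pair=> //; apply: measurable_fun_pair; exact: measurable_funM.
 have := leb2_slope_half mH (fun p => F0 _); rewrite /H /==> ->.
 have mGz : mfun (fun p => G s (p, z)) by exact: (measurable_fun_pair1 (f := G s) z (mG s)).
 rewrite (leb2_iter mGz (fun p => G0 s _)); apply: eq_integral => m _; rewrite integral_mkcond; apply: eq_integral => w _.
 rewrite patchE mem_setE in_itv /= andbT /G /sJ /=; case: ifP=> [w0|]; last by rewrite mul0e.
 by [].
have opp (x : R) z : \int[leb]_y F ((x, y), z) = \int[leb]_y F ((x, (-1*y)%R), z).
 rewrite -(leb_opp (F := fun y => F ((x, y), z)))//; last by apply: (measurableT_comp mF); apply: measurable_fun_pair=> //; apply: measurable_fun_pair.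
 by apply: eq_integral => y _; rewrite mulN1r.
rewrite -ge0_integralD//; last 4 first.
- by move=> z _; apply: integral_ge0.
- by apply: (measurable_fun_fubini_tonelli_G (m1 := leb2 R)).
- by move=> z _; apply: integral_ge0.
- by apply: (measurable_fun_fubini_tonelli_G (m1 := leb2 R)).
apply: eq_integral => z _; rewrite -!half ?expr1n ?sqrrN ?expr1n//.
have mFz : mfun (fun p => F (p, z)) by exact: (measurable_fun_pair1 (f := F) z mF).
rewrite (leb2_iter mFz)// leb_half//; last 2 first.
- by apply: (measurable_fun_fubini_tonelli_F (m2 := leb) (fun p => F (p, z))).
- by move=> x; apply: integral_ge0.
congr (_ + _); apply: eq_integral => x _.
- by apply: eq_integral => y _; rewrite !mul1r.
- by rewrite opp; apply: eq_integral => y _; rewrite !mulN1r.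
Qed.

Lemma slope_vol_le s (F : R3 R -> \bar R) : (s = 1 \/ s = -1)%R -> mfun F -> (forall x, 0 <= F x) ->
 \int[mu]_p ((sJ p.1.1 p.1.2)%:E*F (spt s p.1.1 p.1.2 p.2)) <= \int[mu]_x F x.
Proof.
move=> sE mF F0; rewrite [leRHS]slope_vol//.
have m1 := @measurable_x1 R; have m2 := @measurable_x2 R; have m3 := @measurable_x3 R.
have mJ : mfun (fun p : R3 R => (sJ p.1.1 p.1.2)%:E) by apply/measurable_EFinP; exact: measurable_sJ.
have ms t : mfun (fun p : R3 R => F (spt t p.1.1 p.1.2 p.2)) by apply: (measurableT_comp mF); exact: measurable_spt.
have J0 (p : R3 R) : 0 <= (sJ p.1.1 p.1.2)%:E by rewrite lee_fin sJ_ge0.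
apply: ge0_le_integral=> //.
- by move=> p _; exact: mule_ge0.
- exact: emeasurable_funM.
- by apply: emeasurable_funM=> //; exact: emeasurable_funD.
- move=> p _; apply: lee_wpmul2l=> //; case: sE=> ->; [exact: leeDl|exact: leeDr].
Qed.

Lemma ae_spt s (P : R3 R -> Prop) : (s = 1 \/ s = -1)%R -> {ae mu, forall x, P x} ->
 {ae mu, forall p : R3 R, (0 < p.1.2)%R -> P (spt s p.1.1 p.1.2 p.2)}.
Proof.
move=> sE H; have m1 := @measurable_x1 R; have m2 := @measurable_x2 R; have m3 := @measurable_x3 R.
have := @negligible_push _ _ _ _ R mu mu (fun p : R3 R => spt s p.1.1 p.1.2 p.2) (fun p => sJ p.1.1 p.1.2) _
 (measurable_spt s m1 m2 m3) (measurable_sJ m1 m2) (fun p => sJ_ge0 _ _) (fun F mF F0 => slope_vol_le sE mF F0) H.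
apply: negligibleS => p /= /not_implyP[w0 nP]; split=> //.
by rewrite /sJ w0 invr_gt0 mulr_gt0// onesqr_gt0.
Qed.

(* In terms of the spheres centered at (0, 0, c): y = w + (z - c)^2. *)
Definition shc (c : R) (p : R3 R) : R3 R := ((p.1.1, (p.1.2 - (p.2 - c)^+2)%R), p.2).

Lemma measurable_shc c : mfun (shc c).
Proof.
apply: measurable_R3; [exact: measurable_x1| |exact: measurable_x3].
by apply: measurable_funB; [exact: measurable_x2|apply: measurable_funX; apply: measurable_funB=> //; exact: measurable_x3].
Qed.

Lemma vol_shc c (F : R3 R -> \bar R) : mfun F -> (forall x, 0 <= F x) ->
 \int[mu]_x F (shc c x) = \int[mu]_x F x.
Proof.
move=> mF F0; apply: (@vol_eq_lines R 1%R)=> //; first by apply: measurableT_comp=> //; exact: measurable_shc.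
move=> x; have mFu : mfun (fun s => F (upd 1%R x s)) by apply: measurableT_comp=> //; exact: measurable_upd.
rewrite -(leb_shift (- (x.2 - c)^+2)%R mFu)//; apply: eq_integral => s _.
by rewrite !upd1E /shc.
Qed.

Lemma negligible_mpres (phi : R3 R -> R3 R) (N : set (R3 R)) : mfun phi ->
 (forall F : R3 R -> \bar R, mfun F -> (forall x, 0 <= F x) -> \int[mu]_x F (phi x) = \int[mu]_x F x) ->
 mu.-negligible N -> mu.-negligible (phi @^-1` N).
Proof.
move=> mp H nN; have := @negligible_push _ _ _ _ R mu mu phi (fun=> 1%R) N mp (@measurable_cst _ _ _ _ _ _) (fun=> ler01) _ nN.
move=> K; apply: negligibleS (K _)=> [x Nx|F mF F0]; first by split.
by under eq_integral do rewrite mul1e; rewrite H.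
Qed.

Lemma ae_shc c (P : R3 R -> Prop) : {ae mu, forall x, P x} -> {ae mu, forall x, P (shc c x)}.
Proof. by move=> H; apply: (negligible_mpres (measurable_shc c) _ H) => F mF F0; exact: vol_shc. Qed.

(** Composed with [spt] it makes the slope the last variable, so that slices run along horizontal
    half-circles at fixed w and z. *)
Definition cyc (p : R3 R) : R3 R := ((p.2, p.1.1), p.1.2).

Lemma measurable_cyc : mfun cyc.
Proof. by apply: measurable_R3; [exact: measurable_x3|exact: measurable_x1|exact: measurable_x2]. Qed.

Lemma vol_cyc (F : R3 R -> \bar R) : mfun F -> (forall x, 0 <= F x) ->
 \int[mu]_x F (cyc x) = \int[mu]_x F x.
Proof.
move=> mF F0; have mFc : mfun (fun x => F (cyc x)) by apply: (measurableT_comp mF); exact: measurable_cyc.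
rewrite (vol_iter_h mFc)// (vol_iter_z mF)//.
have mG : mfun (fun h : mR * mR => \int[leb]_m F (cyc (h, m))).
 exact: (measurable_fun_fubini_tonelli_F (m2 := leb) (fun p => F (cyc p))).
rewrite (leb2_iter2 mG); last by move=> h; apply: integral_ge0.
apply: eq_integral => z _.
have mFz : mfun (fun p => F (p, z)) by exact: (measurable_fun_pair1 (f := F) z mF).
by rewrite (leb2_iter2 mFz)//.
Qed.

Lemma ae_cyc (P : R3 R -> Prop) : {ae mu, forall x, P x} -> {ae mu, forall x, P (cyc x)}.
Proof. by move=> H; apply: (negligible_mpres measurable_cyc _ H) => F mF F0; exact: vol_cyc. Qed.

End SlopeCoordinates.

(** * The fundamental theorem of calculus for limits of smooth functions *)

Section FTC.
Variable R : realType.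
Local Notation leb := (@lebesgue_measure R).

(** The theorem for each [g n], followed by dominated convergence of the derivatives. A pointwise
    limit may be discontinuous, so its end values are represented by the limits [la] and [lb] of the
    sequence. *)
Lemma FTC_limit (a b : R) (g g' : nat -> R -> R) (h H : R -> R) (la lb : R) : a < b ->
 (forall n s, a <= s <= b -> is_derive s (1 : R) (g n) (g' n s)) ->
 (forall n s, a <= s <= b -> {for s, continuous (g' n)}) ->
 measurable_fun (`[a, b]%classic : set (mTR R)) (h : mTR R -> R) ->
 leb.-integrable (`[a, b]%classic : set (mTR R)) (EFin \o H) ->
 {ae leb, forall s : mTR R, a <= s <= b -> (forall n, `|g' n s| <= H s) /\ g' n s @[n --> \oo] --> h s} ->
 g n a @[n --> \oo] --> la -> g n b @[n --> \oo] --> lb ->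
 ((`|lb - la|)%:E <= \int[leb]_(s in `[a, b]) (`|h s|)%:E)%E.
Proof.
move=> ab dg cg mh iH cv ca cb.
pose D : set (mTR R) := `[a, b]%classic.
have mD : measurable D by exact: measurable_itv.
have cw n : {within `[a, b], continuous (g' n)} by apply: continuous_in_subspaceT => s; rewrite inE /= in_itv /=; exact: cg.
have mg n : measurable_fun D (g' n) by exact: (subspace_continuous_measurable_fun mD (cw n)).
have FT n : (\int[leb]_(s in D) (g' n s)%:E = (g n b)%:E - (g n a)%:E)%E.
 have cgn s : a <= s <= b -> {for s, continuous (g n)}.
  by move=> /(dg n) d; apply: differentiable_continuous; apply/derivable1_diffP; have [] := d.
 apply: (@continuous_FTC2 R (g' n) (g n))=> //.
 - split=> [s||].
  + by rewrite in_itv /= => /andP[s1 s2]; have [] := dg n s ltac:(by rewrite !ltW).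
  + by apply: cvg_at_right_filter; apply: cgn; rewrite lexx ltW.
  + by apply: cvg_at_left_filter; apply: cgn; rewrite lexx ltW.
 - move=> s; rewrite in_itv /= => /andP[s1 s2]; rewrite derive1E.
  by have d := dg n s ltac:(by rewrite !ltW); rewrite derive_val.
have aeD (P : R -> Prop) : {ae leb, forall s : mTR R, a <= s <= b -> P s} -> {ae leb, forall s : mTR R, D s -> P s}.
 by apply: filterS => s K; rewrite /D /= in_itv.
have K := dominated_convergence mD (f_ := fun n s => (`|g' n s|)%:E) (f := fun s => (`|h s|)%:E) (g := fun s => (H s)%:E).
have {K}[_ _ C] : [/\ leb.-integrable D (fun s => (`|h s|)%:E),
  [sequence (\int[leb]_(s in D) (`|(`|g' n s|)%:E - (`|h s|)%:E|))%E]_n @ \oo --> 0%E &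
  [sequence (\int[leb]_(s in D) ((`|g' n s|)%:E))%E]_n @ \oo --> (\int[leb]_(s in D) ((`|h s|)%:E))%E].
 apply: K=> //.
 - by move=> n; apply/measurable_EFinP; apply: measurableT_comp.
 - by apply/measurable_EFinP; apply: measurableT_comp.
 - apply: filterS cv => s K; rewrite /D /= in_itv /= => /K[_ c].
  by apply: cvg_EFin; [exact: nearW|exact: cvg_norm].
 - by apply: filterS cv => s K n; rewrite /D /= in_itv /= => /K[d _]; rewrite lee_fin normr_id.
have C0 : (`|g n b - g n a|)%:E @[n --> \oo] --> (`|lb - la|)%:E.
 by apply: cvg_EFin; [exact: nearW|apply: cvg_norm; exact: cvgB].
apply: (lee_cvg_to C0 C); apply: nearW => n.
rewrite /= -[leLHS]/(`|(g n b)%:E - (g n a)%:E|)%E -FT.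
by apply: le_trans (le_abse_integral leb mD _) _; [apply/measurable_EFinP|].
Qed.

End FTC.

(** * Restriction to meridian circles and to horizontal circles *)

Section Slices.
Variable R : realType.
Local Notation leb := (@lebesgue_measure R).
Local Notation mu := (vol R).
Local Notation B := (@B1 R).
Local Notation mR := (mTR R).

Lemma bounded_itv (d : R -> R) (a b : R) : (forall s, a <= s <= b -> {for s, continuous d}) ->
 exists2 K, 0 <= K & forall s, a <= s <= b -> `|d s| <= K.
Proof.
move=> cd; have [|K [_ HK]] := @compact_bounded R R^o (d @` `[a, b]%classic).
 apply: continuous_compact; last exact: segment_compact.
 by apply: continuous_in_subspaceT => s; rewrite inE /= in_itv /=; exact: cd.
exists (`|K| + 1); first by rewrite addr_ge0.
move=> s si; apply: HK; first by rewrite (le_lt_trans (ler_norm K))// ltrDl.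
by exists s=> //=; rewrite in_itv.
Qed.

(** The chain rule bounds the derivative along the curve by the majorant of the gradient times the
    speed, which is bounded on the compact parameter interval. *)
Lemma slice_FTC (f : nat -> R3 R -> R) (g1 g2 g3 d1 d2 d3 Gs : R -> R) (wi : 'I_3 -> R -> R) (a b la lb : R) :
 a < b -> (forall n, smooth (f n)) ->
 (forall s, a <= s <= b -> [/\ is_derive s (1 : R) g1 (d1 s), is_derive s (1 : R) g2 (d2 s) & is_derive s (1 : R) g3 (d3 s)]) ->
 (forall s, a <= s <= b -> [/\ {for s, continuous d1}, {for s, continuous d2} & {for s, continuous d3}]) ->
 leb.-integrable (`[a, b]%classic : set mR) (EFin \o Gs) ->
 (forall i, measurable_fun (`[a, b]%classic : set mR) (wi i : mR -> R)) ->
 {ae leb, forall s : mR, a <= s <= b -> (forall n i, `|partial i (f n) ((g1 s, g2 s), g3 s)| <= Gs s) /\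
  forall i, partial i (f n) ((g1 s, g2 s), g3 s) @[n --> \oo] --> wi i s} ->
 f n ((g1 a, g2 a), g3 a) @[n --> \oo] --> la -> f n ((g1 b, g2 b), g3 b) @[n --> \oo] --> lb ->
 ((`|lb - la|)%:E <= \int[leb]_(s in `[a, b]) (`|d1 s*wi 0 s + d2 s*wi 1 s + d3 s*wi 2 s|)%:E)%E.
Proof.
move=> ab sf dg cd iG mw H ca cb.
have [K1 K10 H1] := bounded_itv (fun s si => let: And3 c1 _ _ := cd s si in c1).
have [K2 K20 H2] := bounded_itv (fun s si => let: And3 _ c2 _ := cd s si in c2).
have [K3 K30 H3] := bounded_itv (fun s si => let: And3 _ _ c3 := cd s si in c3).
pose ga s : R3 R := ((g1 s, g2 s), g3 s).
pose g' n s := d1 s * partial 0 (f n) (ga s) + d2 s * partial 1 (f n) (ga s) + d3 s * partial 2 (f n) (ga s).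
have cga s : a <= s <= b -> {for s, continuous ga}.
 move=> /dg[[e1 _] [e2 _] [e3 _]].
 move/derivable1_diffP in e1; move/derivable1_diffP in e2; move/derivable1_diffP in e3.
 apply: differentiable_continuous; apply: differentiable_pair=> //; exact: differentiable_pair.
have md (d : R -> R) : (forall s, a <= s <= b -> {for s, continuous d}) -> measurable_fun (`[a, b]%classic : set mR) d.
 move=> c; have mD : measurable (`[a, b]%classic : set mR) by exact: measurable_itv.
 apply: (subspace_continuous_measurable_fun mD).
 by apply: continuous_in_subspaceT => s; rewrite inE /= in_itv /=; exact: c.
apply: (@FTC_limit R a b (fun n s => f n (ga s)) g' _ (fun s => (K1 + K2 + K3)*Gs s))=> //.
- move=> n s /dg[i1 i2 i3]; exact: curve_derive.
- move=> n s si; have [c1 c2 c3] := cd s si.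
 have cp i : {for s, continuous (fun s => partial i (f n) (ga s))}.
  by apply: (continuous_comp (cga s si)); apply: smooth_continuous; exact: smooth_partial.
 by apply: cvgD; [apply: cvgD|]; apply: cvgM=> //; exact: cp.
- apply: measurable_funD; [apply: measurable_funD|]; apply: measurable_funM=> //; apply: md => s si; by have [] := cd s si.
- have mD : measurable (`[a, b]%classic : set mR) by exact: measurable_itv.
 exact: (integrableZl mD (K1 + K2 + K3) iG).
- apply: filterS H => s Hs si; have {Hs}[hb hc] := Hs si; split.
  move=> n; have G0 : 0 <= Gs s := le_trans (normr_ge0 _) (hb 0%N 0).
  have t (d p K : R) : `|d| <= K -> `|p| <= Gs s -> `|d * p| <= K*Gs s by move=> hd hp; rewrite normrM; exact: ler_pM.
  have T1 := t _ _ _ (H1 s si) (hb n 0); have T2 := t _ _ _ (H2 s si) (hb n 1); have T3 := t _ _ _ (H3 s si) (hb n 2).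
  rewrite /g' -/(ga s) !mulrDl in T1 T2 T3 *.
  apply: le_trans (ler_normD _ _) _; apply: lerD=> //.
  by apply: le_trans (ler_normD _ _) _; exact: lerD.
 by apply: cvgD; [apply: cvgD|]; apply: cvgM; (exact: cvg_cst || exact: hc).
Qed.

Lemma ae_neq (x : R) : {ae leb, forall z : mR, z != x}.
Proof.
exists [set x]; split; [exact: measurable_set1|exact: lebesgue_measure_set1|].
by move=> z /= /negP; rewrite negbK => /eqP.
Qed.

(** The point at height z on the circle |x - c e_3|^2 = y in the half-plane of slope m on the side
    s. *)
Definition cvp (s c m y z : R) : R3 R := spt s m (y - (z - c)^+2) z.

Lemma measurable_restrB (g : R3 R -> R) : mB g -> mfun (g \_ B).
Proof. by move=> mg; apply/(measurable_restrictT _ _).1=> //; exact: measurable_B1. Qed.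

Lemma ae_curve s c (P : R3 R -> Prop) : (s = 1 \/ s = -1) -> aeB P ->
 {ae leb2 R, forall h : mR * mR, {ae leb, forall z : mR, 0 < h.2 - (z - c)^+2 -> B (cvp s c h.1 h.2 z) -> P (cvp s c h.1 h.2 z)}}.
Proof.
move=> sE H; have := ae_slices (m1 := leb2 R) (m2 := leb) (ae_shc c (ae_spt sE H)).
exact.
Qed.

(** The slopes' Jacobian turns the integral of |G| over the ball, G being 0 outside, into an
    iterated one, whose inner integrals are finite almost everywhere. *)
Lemma fin_slices s (phi : R3 R -> R3 R) (G : R3 R -> R) : (s = 1 \/ s = -1) -> L1B G -> mfun phi ->
 (forall F : R3 R -> \bar R, mfun F -> (forall x, 0 <= F x)%E -> (\int[mu]_x F (phi x) = \int[mu]_x F x)%E) ->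
 {ae leb2 R, forall h : mR * mR, (\int[leb]_z ((sJ (phi (h, z)).1.1 (phi (h, z)).1.2)%:E *
  (`|(G \_ B) (spt s (phi (h, z)).1.1 (phi (h, z)).1.2 (phi (h, z)).2)|)%:E) < +oo)%E}.
Proof.
move=> sE LG mphi vphi; have m1 := @measurable_x1 R; have m2 := @measurable_x2 R; have m3 := @measurable_x3 R.
have mF : mfun (fun x => (`|(G \_ B) x|)%:E).
 by apply/measurable_EFinP; apply: measurableT_comp=> //; apply: measurable_restrB; exact: L1B_m.
pose F (p : R3 R) := ((sJ p.1.1 p.1.2)%:E*(`|(G \_ B) (spt s p.1.1 p.1.2 p.2)|)%:E)%E.
have mFp : mfun F.
 apply: emeasurable_funM; first by apply/measurable_EFinP; exact: measurable_sJ.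
 by apply: (measurableT_comp mF); exact: measurable_spt.
have F0 p : (0 <= F p)%E by rewrite mule_ge0// lee_fin ?sJ_ge0.
apply: (@ae_slices_fin _ _ _ _ _ (leb2 R) leb (fun p => F (phi p))).
- exact: (measurableT_comp mFp).
- by move=> p; exact: F0.
rewrite (_ : (\int[_]_p _)%E = (\int[mu]_p F p)%E); last exact: vphi.
apply: (@le_lt_trans _ _ (\int[mu]_x (`|(G \_ B) x|)%:E)%E); first exact: (slope_vol_le sE mF).
case/integrableP: LG => mG; rewrite integral_mkcond; apply: le_lt_trans.
rewrite le_eqVlt; apply/orP; left; apply/eqP; apply: eq_integral => x _; rewrite !patchE.
by case: ifP=> // _; rewrite normr0.
Qed.

Lemma fin_curve s c (G : R3 R -> R) : (s = 1 \/ s = -1) -> L1B G ->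
 {ae leb2 R, forall h : mR * mR, (\int[leb]_z ((sJ h.1 (h.2 - (z - c)^+2))%:E*(`|(G \_ B) (cvp s c h.1 h.2 z)|)%:E) < +oo)%E}.
Proof. by move=> sE LG; exact: (fin_slices sE LG (measurable_shc c) (@vol_shc R c)). Qed.

Variables (f : nat -> R3 R -> R) (v : R3 R -> R) (w : 'I_3 -> R3 R -> R) (b : R3 R -> R).
Hypothesis A : AppF f v w b.

(** The derivative with respect to the height along the circles [cvp]: the one along V_tau divided
    by its third component [rho2]. *)
Definition lamw (c : R) x := (- (x.2 - c)*x.1.1*w 0 x - (x.2 - c)*x.1.2*w 1 x + rho2 x*w 2 x) / rho2 x.

Lemma spt_comp (s m : R) (g : R -> R) (t dgt : R) : is_derive t (1 : R) g dgt -> 0 < g t ->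
 is_derive t (1 : R) (fun z => s*sqrt (g z/(1 + m^+2))) (dgt/(2*g t)*(s*sqrt (g t/(1 + m^+2)))).
Proof.
move=> D g0; have o := onesqr_gt0 m.
have q0 : 0 < g t/(1 + m^+2) by rewrite divr_gt0.
have D1 : is_derive t (1 : R) (fun z => g z/(1 + m^+2)) (dgt/(1 + m^+2)).
 have := is_deriveM D (is_derive_cst ((1 + m^+2)^-1 : R) t 1); move=> H; apply: (is_derive_eq H).
 by rewrite /GRing.scale /=; ring.
have D2 := @is_derive1_comp _ sqrt _ t _ _ (is_derive1_sqrt q0) D1.
have D3 := is_deriveM (is_derive_cst (s : R) t 1) D2; apply: (is_derive_eq D3).
rewrite /GRing.scale /= mulr0 addr0; set r := sqrt (g t / _).
have r0 : 0 < r by rewrite sqrtr_gt0.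
have E : g t = r^+2*(1 + m^+2) by rewrite sqr_sqrtr ?ltW// divfK// gt_eqF.
by rewrite E; field; rewrite !gt_eqF.
Qed.

(** As long as w > 0, the Jacobian on a circle depends on m alone, so the slice of the majorant G is
    integrable in z. The exceptional set of circles is fixed before the end heights, which are
    chosen freely later. *)
Lemma z_slice s c : (s = 1 \/ s = -1) ->
 {ae leb2 R, forall h : mR * mR, forall z1 z2 l1 l2 : R, z1 < z2 ->
  (forall z, z1 <= z <= z2 -> 0 < h.2 - (z - c)^+2) ->
  (forall z, z1 < z < z2 -> B (cvp s c h.1 h.2 z)) ->
  f n (cvp s c h.1 h.2 z1) @[n --> \oo] --> l1 -> f n (cvp s c h.1 h.2 z2) @[n --> \oo] --> l2 ->
  ((`|l2 - l1|)%:E <= \int[leb]_(z in `[z1, z2]) (`|(lamw c \_ B) (cvp s c h.1 h.2 z)|)%:E)%E}.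
Proof.
move=> sE; have s2 := sgn_sqr sE.
have [G G2 HG] := af_d A; have LG := L2B_L1 G2; have mG := L1B_m LG.
have good := aeB_and HG (af_cw A).
have := ae_curve c sE good; have := fin_curve c sE LG; apply: filterS2 => -[m y] /= Fin Ae z1 z2 l1 l2 z12 wp inB c1 c2.
pose r z := sqrt ((y - (z - c)^+2)/(1 + m^+2)).
have mcv : mfun (fun z : mR => cvp s c m y z).
 by apply: measurable_spt=> //; apply: measurable_funB=> //; apply: measurable_funX; apply: measurable_funB.
pose wi i z := (w i \_ B) (cvp s c m y z).
have mwi i : mfun (wi i : mR -> R) by apply: (measurableT_comp _ mcv); apply: measurable_restrB; exact: (af_mw A).
have mI : measurable (`[z1, z2]%classic : set mR) by exact: measurable_itv.
pose d1 z := - (2*(z - c))/(2*(y - (z - c)^+2))*(s*r z).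
have dw z : is_derive z (1 : R) (fun z => y - (z - c)^+2) (- (2*(z - c))).
 by apply: is_derive_eq; rewrite /GRing.scale /=; ring.
have D1 z : z1 <= z <= z2 -> is_derive z (1 : R) (fun z => s*r z) (d1 z) by move=> zi; apply: spt_comp=> //; exact: wp.
have D2 z : z1 <= z <= z2 -> is_derive z (1 : R) (fun z => s*(m*r z)) (m*d1 z).
 move=> /D1 D; rewrite (_ : (fun z => s*(m*r z)) = fun z => m*(s*r z)); last by apply/funext => t; ring.
 have := is_deriveM (is_derive_cst (m : R) z 1) D; move=> H; apply: (is_derive_eq H).
 by rewrite /GRing.scale /= mulr0 addr0.
have cd1 z : z1 <= z <= z2 -> {for z, continuous d1}.
 move=> zi; have cw : {for z, continuous (fun z => y - (z - c)^+2)}.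
  by apply: differentiable_continuous; apply/derivable1_diffP; have [] := dw z.
 have ca : {for z, continuous (fun z : R => - (2*(z - c)))}.
  by apply: cvgN; apply: cvgM; [exact: cvg_cst|apply: cvgB; [exact: cvg_id|exact: cvg_cst]].
 have cs : {for z, continuous (fun z => s*r z)}.
  by apply: differentiable_continuous; apply/derivable1_diffP; have [] := D1 z zi.
 apply: cvgM; last exact: cs.
 apply: cvgM=> //; apply: cvgV; last by apply: cvgM; [exact: cvg_cst|exact: cw].
 by rewrite mulf_neq0// gt_eqF// wp.
have H := @slice_FTC f (fun z => s*r z) (fun z => s*(m*r z)) id d1 (fun z => m*d1 z) (fun=> 1)
 (fun z => `|(G \_ B) (cvp s c m y z)|) wi z1 z2 l1 l2 z12 (af_s A).
have {}H : ((`|l2 - l1|)%:E <= \int[leb]_(z in `[z1, z2]) (`|d1 z*wi 0 z + m*d1 z*wi 1 z + 1*wi 2 z|)%:E)%E.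
 apply: H=> //.
 - move=> z zi; split; [exact: D1|exact: D2|exact: is_derive_id].
 - move=> z zi; split; [exact: cd1| |exact: cvg_cst].
  by apply: cvgM; [exact: cvg_cst|exact: cd1].
 - apply/integrableP; split.
   apply/measurable_EFinP; apply: measurable_funTS; apply: measurableT_comp=> //.
   by apply: (measurableT_comp _ mcv); exact: measurable_restrB.
  have k0 : 0 < 2*(1 + m^+2) by rewrite mulr_gt0// onesqr_gt0.
  have mF : mfun (fun z : mR => (`|(G \_ B) (cvp s c m y z)|)%:E).
   apply/measurable_EFinP; apply: measurableT_comp=> //.
   by apply: (measurableT_comp _ mcv); exact: measurable_restrB.
  have mJ : mfun (fun z : mR => (sJ m (y - (z - c)^+2))%:E*(`|(G \_ B) (cvp s c m y z)|)%:E)%E.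
   apply: emeasurable_funM=> //; apply/measurable_EFinP; apply: measurable_sJ=> //.
   by apply: measurable_funB=> //; apply: measurable_funX; apply: measurable_funB.
  have J0 z : (0 <= (sJ m (y - (z - c)^+2))%:E*(`|(G \_ B) (cvp s c m y z)|)%:E)%E by rewrite mule_ge0// lee_fin sJ_ge0.
  apply: (@le_lt_trans _ _ ((2*(1 + m^+2))%:E * \int[leb]_(z in `[z1, z2]) ((sJ m (y - (z - c)^+2))%:E*(`|(G \_ B) (cvp s c m y z)|)%:E))%E).
   rewrite -ge0_integralZl//; last 2 first.
   - exact: measurable_funTS.
   - by rewrite lee_fin ltW.
   rewrite le_eqVlt; apply/orP; left; apply/eqP; apply: eq_integral => z; rewrite inE /= in_itv /= => zi.
   have E : sJ m (y - (z - c)^+2) = (2*(1 + m^+2))^-1 by rewrite /sJ wp.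
   by rewrite -!EFinM normr_id E mulrA divff ?gt_eqF// mul1r.
  apply: lte_mul_pinfty; rewrite ?lee_fin ?(ltW k0)//; apply: le_lt_trans Fin.
  by apply: ge0_subset_integral=> //; exact: measurableT.
 - by move=> i; exact: measurable_funTS.
 (* The end points may lie on the unit sphere, outside the open ball; they are removed as a null
    set. *)
 - have aeI : {ae leb, forall z : mR, z != z1 /\ z != z2} by apply: filterS2 (ae_neq z1) (ae_neq z2).
  apply: filterS2 aeI Ae => z [n1 n2] Hz zi.
  have Bz : B (cvp s c m y z).
   by case/andP: zi => a1 a2; apply: inB; rewrite !lt_neqAle a1 a2 eq_sym n1 n2.
  have [hb hc] := Hz (wp z zi) Bz; rewrite /wi !patchE (mem_set Bz); split=> [n i|i].
   by apply: le_trans (hb n i) _; exact: ler_norm.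
  by rewrite patchE (mem_set Bz); exact: hc.
apply: le_trans H _; rewrite le_eqVlt; apply/orP; left; apply/eqP.
apply: eq_integral => z; rewrite inE /= in_itv /= => zi; congr (`| _ |)%:E.
rewrite /wi !patchE; case: ifP => _; last by rewrite !mulr0 !addr0.
have w0 := wp z zi; rewrite /lamw (rho2_spt m z s2 (ltW w0)) /cvp /spt /= -/(r z).
by rewrite /d1; field; exact: lt0r_neq0.
Qed.

Definition angw x := x.1.1*w 1 x - x.1.2*w 0 x.

Lemma ae_cyc_spt s (P : R3 R -> Prop) : (s = 1 \/ s = -1) -> aeB P ->
 {ae leb2 R, forall h : mR * mR, {ae leb, forall m : mR, 0 < h.1 -> B (spt s m h.1 h.2) -> P (spt s m h.1 h.2)}}.
Proof.
move=> sE H; have := ae_slices (m1 := leb2 R) (m2 := leb) (ae_cyc (ae_spt sE H)).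
exact.
Qed.

Lemma fin_cyc_spt s (G : R3 R -> R) : (s = 1 \/ s = -1) -> L1B G ->
 {ae leb2 R, forall h : mR * mR, (\int[leb]_m ((sJ m h.1)%:E*(`|(G \_ B) (spt s m h.1 h.2)|)%:E) < +oo)%E}.
Proof. by move=> sE LG; exact: (fin_slices sE LG (@measurable_cyc R) (@vol_cyc R)). Qed.

(** At fixed w and z the derivative in m is the angular derivative divided by 1 + m^2, so it
    vanishes and all limits of the sequence along the half-circle agree. *)
Lemma m_slice s : (s = 1 \/ s = -1) -> aeB (fun x => angw x = 0) ->
 {ae leb2 R, forall h : mR * mR, 0 < h.1 -> h.1 + h.2^+2 < 1 -> forall m1 m2 l1 l2 : R, m1 < m2 ->
  f n (spt s m1 h.1 h.2) @[n --> \oo] --> l1 -> f n (spt s m2 h.1 h.2) @[n --> \oo] --> l2 -> l1 = l2}.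
Proof.
move=> sE ang0; have s2 := sgn_sqr sE.
have [G G2 HG] := af_d A; have LG := L2B_L1 G2; have mG := L1B_m LG.
have good := aeB_and (aeB_and HG (af_cw A)) ang0.
have := ae_cyc_spt sE good; have := fin_cyc_spt sE LG; apply: filterS2 => -[y z] /= Fin Ae y0 yz m1 m2 l1 l2 m12 c1 c2.
pose r m := sqrt (y/(1 + m^+2)).
have Bm m : B (spt s m y z) by apply/spt_B=> //; exact: ltW.
have mcv : mfun (fun m : mR => spt s m y z) by exact: measurable_spt.
pose wi i m := (w i \_ B) (spt s m y z).
have mwi i : mfun (wi i : mR -> R) by apply: (measurableT_comp _ mcv); apply: measurable_restrB; exact: (af_mw A).
have mI : measurable (`[m1, m2]%classic : set mR) by exact: measurable_itv.
have o (m : R) : 0 < 1 + m^+2 := onesqr_gt0 m.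
pose d1 m := - m/(1 + m^+2)*(s*r m).
have D1 m : is_derive m (1 : R) (fun m => s*r m) (d1 m).
 have D0 : is_derive m (1 : R) (fun m : R => 1 + m^+2) (2 * m) by apply: is_derive_eq; rewrite /GRing.scale /=; ring.
 have Di := @is_deriveV R (fun m : R => 1 + m^+2) m _ 1 (lt0r_neq0 (o m)) D0.
 have Dy := is_deriveM (is_derive_cst (y : R) m 1) Di.
 have q0 : 0 < y/(1 + m^+2) by rewrite divr_gt0.
 have D2 := @is_derive1_comp _ sqrt _ m _ _ (is_derive1_sqrt q0) Dy.
 have D3 := is_deriveM (is_derive_cst (s : R) m 1) D2; apply: (is_derive_eq D3).
 rewrite /GRing.scale /= !mulr0 !addr0 -/(r m) /d1; have r0 : 0 < r m by rewrite sqrtr_gt0.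
 have E : y = r m^+2*(1 + m^+2) by rewrite sqr_sqrtr ?ltW// divfK// gt_eqF.
 by rewrite {1}E; field; rewrite !gt_eqF.
pose d2 m := s*r m + m*d1 m.
have D2 m : is_derive m (1 : R) (fun m => s*(m*r m)) (d2 m).
 rewrite (_ : (fun m => s*(m*r m)) = fun m => m*(s*r m)); last by apply/funext => t; ring.
 have := is_deriveM (is_derive_id m (1 : R)) (D1 m); move=> H; apply: (is_derive_eq H).
 by rewrite /GRing.scale /= /d2; ring.
have cr : continuous (fun m => s*r m) := is_derive_cont D1.
have cd1 : continuous d1.
 move=> m; apply: cvgM; last exact: cr.
 apply: cvgM; first by apply: cvgN; exact: cvg_id.
 apply: cvgV; first by rewrite gt_eqF.
 by apply: cvgD; [exact: cvg_cst|exact: exprn_continuous].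
have cd2 : continuous d2.
 by move=> m; apply: cvgD; [exact: cr|apply: cvgM; [exact: cvg_id|exact: cd1]].
have H := @slice_FTC f (fun m => s*r m) (fun m => s*(m*r m)) (fun=> z) d1 d2 (fun=> 0)
 (fun m => `|(G \_ B) (spt s m y z)|) wi m1 m2 l1 l2 m12 (af_s A).
have {}H : ((`|l2 - l1|)%:E <= \int[leb]_(m in `[m1, m2]) (`|d1 m*wi 0 m + d2 m*wi 1 m + 0*wi 2 m|)%:E)%E.
 apply: H=> //.
 - by move=> m _; split; [exact: D1|exact: D2|exact: is_derive_cst].
 - by move=> m _; split; [exact: cd1|exact: cd2|exact: cvg_cst].
 - have mF : mfun (fun m : mR => (`|(G \_ B) (spt s m y z)|)%:E).
   apply/measurable_EFinP; apply: measurableT_comp=> //.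
   by apply: (measurableT_comp _ mcv); exact: measurable_restrB.
  apply/integrableP; split; first by apply: measurable_funTS.
  pose K := 2*(1 + (m1^+2 + m2^+2)); have K0 : 0 < K by rewrite mulr_gt0// ltr_pwDl// addr_ge0// sqr_ge0.
  have mJ : mfun (fun m : mR => (sJ m y)%:E*(`|(G \_ B) (spt s m y z)|)%:E)%E.
   by apply: emeasurable_funM=> //; apply/measurable_EFinP; exact: measurable_sJ.
  have J0 m : (0 <= (sJ m y)%:E*(`|(G \_ B) (spt s m y z)|)%:E)%E by rewrite mule_ge0// lee_fin sJ_ge0.
  apply: (@le_lt_trans _ _ (K%:E * \int[leb]_(m in `[m1, m2]) ((sJ m y)%:E*(`|(G \_ B) (spt s m y z)|)%:E))%E).
   rewrite -ge0_integralZl//; last 2 first.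
   - exact: measurable_funTS.
   - by rewrite lee_fin ltW.
   apply: ge0_le_integral=> //.
   + by apply: measurableT_comp=> //; exact: measurable_funTS.
   + by apply: emeasurable_funM=> //; exact: measurable_funTS.
   + move=> m; rewrite /= in_itv /= => /andP[a1 a2]; rewrite normr_id -!EFinM lee_fin mulrA ler_peMl//.
    rewrite /sJ y0 -/(K / _) ler_pdivlMr ?mulr_gt0// mul1r /K; apply: ler_wpM2l=> //; rewrite lerD2l.
    have [mm|mm] := leP 0 m; [have := sqr_ge0 m1; nra|have := sqr_ge0 m2; nra].
  apply: lte_mul_pinfty; rewrite ?lee_fin ?(ltW K0)//; apply: le_lt_trans Fin.
  by apply: ge0_subset_integral=> //; exact: measurableT.
 - by move=> i; exact: measurable_funTS.
 - apply: filterS Ae => m Hm mi; have [[hb hc] _] := Hm y0 (Bm m).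
  rewrite /wi !patchE (mem_set (Bm m)); split=> [n i|i]; first by apply: le_trans (hb n i) _; exact: ler_norm.
  by rewrite patchE (mem_set (Bm m)); exact: hc.
have I0 : (\int[leb]_(m in `[m1, m2]) (`|d1 m*wi 0 m + d2 m*wi 1 m + 0*wi 2 m|)%:E = 0)%E.
 have mh : measurable_fun (`[m1, m2]%classic : set mR) (fun m => (`|d1 m*wi 0 m + d2 m*wi 1 m + 0*wi 2 m|)%:E).
  apply: measurable_funTS; apply/measurable_EFinP; apply: measurableT_comp=> //.
  apply: measurable_funD; [apply: measurable_funD|]; apply: measurable_funM=> //; exact: continuous_measurable_fun.
 rewrite (ae_eq_integral (cst 0%E))//; first by rewrite integral0.
 apply: filterS Ae => m Hm _; have [_ E] := Hm y0 (Bm m).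
 rewrite /wi !patchE (mem_set (Bm m)) mul0r addr0 /=.
 have -> : d1 m*w 0 (spt s m y z) + d2 m*w 1 (spt s m y z) = angw (spt s m y z)/(1 + m^+2).
  by rewrite /angw /spt /= -/(r m) /d2 /d1; field; rewrite gt_eqF.
 by rewrite E mul0r normr0.
move: H; rewrite I0 lee_fin normr_le0 subr_eq0 => /eqP ->; by [].
Qed.

End Slices.

(** * Boundary values on slices and behaviour at the axis *)

Section Affine.
Variable R : realType.
Local Notation leb := (@lebesgue_measure R).
Local Notation mu := (vol R).
Local Notation B := (@B1 R).
Local Notation mR := (mTR R).

Lemma leb_affine (a b : R) (F : mR -> \bar R) : a != 0 -> mfun F -> (forall x, 0 <= F x)%E ->
 (\int[leb]_x ((`|a|)%:E*F (a*x + b)%R) = \int[leb]_x F x)%E.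
Proof.
have gen k G : 0 < k -> mfun G -> (forall x, 0 <= G x)%E -> (\int[leb]_x (k%:E*G (k*x + b)%R) = \int[leb]_x G x)%E.
 move=> k0 mG G0; have mGb : mfun (fun x : mR => G (x + b)) by apply: (measurableT_comp mG); exact: measurable_funD.
 rewrite -[RHS](leb_shift b mG)// (leb_scale k0 mGb)// ge0_integralZl//; last by rewrite lee_fin ltW.
 by apply: (measurableT_comp mGb); exact: measurable_funM.
move=> a0 mF F0; have [ap|an] := ltP 0 a; first by rewrite gtr0_norm//; exact: gen.
have an' : 0 < - a by rewrite oppr_gt0 lt_neqAle a0.
have mFn : mfun (fun x : mR => ((- a)%:E*F (a*x + b)%R)%E).
 apply: emeasurable_funM=> //; apply: (measurableT_comp mF); apply: measurable_funD=> //; exact: measurable_funM.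
rewrite ler0_norm// -[RHS](gen _ _ an' mF F0) -(leb_opp mFn); last by move=> x; rewrite mule_ge0// lee_fin ltW.
by apply: eq_integral => x _; rewrite mulrN mulNr.
Qed.

Lemma ae_affine (a b : R) (P : R -> Prop) : a != 0 -> {ae leb, forall x : mR, P x} -> {ae leb, forall x : mR, P (a*x + b)}.
Proof.
move=> a0 H; have maf : mfun (fun x : mR => a*x + b) by apply: measurable_funD=> //; exact: measurable_funM.
have := @negligible_push _ _ _ _ R leb leb (fun x : mR => a*x + b) (fun=> `|a|) _ maf (@measurable_cst _ _ _ _ _ _) (fun=> normr_ge0 a) _ H.
move=> K; apply: negligibleS (K _)=> [x /= Nx|F mF F0]; first by split; rewrite ?normr_gt0.
by rewrite leb_affine.
Qed.

Lemma ae_exists (a b : R) (P : R -> Prop) : a < b -> {ae leb, forall x : mR, P x} -> exists2 x, a < x < b & P x.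
Proof.
move=> ab [N [mN N0 HN]]; apply: contrapT => H.
have sub : `]a, b[%classic `<=` N.
 move=> x /=; rewrite in_itv /= => xi; apply: HN => /= Px; apply: H; by exists x.
have mI : measurable (`]a, b[%classic : set mR) by exact: measurable_itv.
have le := @le_measure _ _ _ leb _ _ (mem_set mI) (mem_set mN) sub.
have E : leb `]a, b[%classic = (b - a)%:E by apply: etrans (lebesgue_measure_itv _) _; rewrite /= lte_fin ab.
have : ((b - a)%:E <= 0)%E by rewrite -E; apply: le_trans le _; rewrite le_eqVlt; apply/orP; left; apply/eqP; exact: N0.
by rewrite lee_fin subr_le0 leNgt ab.
Qed.

Lemma nrm_spt (s m w z : R) : s^+2 = 1 -> 0 < w -> let k := sqrt (w + z^+2) in
 nrm (spt s m w z) = spt s m (1 - (z / k)^+2) (z / k).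
Proof.
move=> s2 w0 k; have q0 : 0 < w + z^+2 by rewrite ltr_pwDl// sqr_ge0.
have k0 : 0 < k by rewrite sqrtr_gt0.
have kE : k^+2 = w + z^+2 by rewrite sqr_sqrtr// ltW.
have eE : enorm (spt s m w z) = k.
 by rewrite /k -(sqr_enorm_spt m z s2 (ltW w0)) sqrtr_sqr ger0_norm// enorm_ge0.
have wk : 1 - (z / k)^+2 = w / k^+2 by rewrite expr_div_n kE; field; exact: lt0r_neq0.
have o := onesqr_gt0 m.
have rk : sqrt (w / k^+2/(1 + m^+2)) = sqrt (w/(1 + m^+2)) / k.
 rewrite (_ : w / k^+2/(1 + m^+2) = w/(1 + m^+2)*(k^-1)^+2); last by field; rewrite !gt_eqF.
 by rewrite sqrtrM ?divr_ge0 ?(ltW w0) ?(ltW o)// sqrtr_sqr ger0_norm// invr_ge0 ltW.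
rewrite /nrm eE wk /spt rk; apply: R3_eq => i; rewrite coordZ; move: i.
by apply: I3_case; rewrite /coord /=; ring.
Qed.

(** Convergence on the sphere is known at [nrm x] for almost every x of the ball. For a generic
    slope one generic value q of |x|^2 is fixed, and the slice |x|^2 = q is projected radially,
    which rescales heights by sqrt(q). *)
Lemma trace_slice (f : nat -> R3 R -> R) v w b s : AppF f v w b -> (s = 1 \/ s = -1) ->
 {ae leb, forall m : mR, {ae leb, forall z : mR, -1 < z < 1 ->
  f n (spt s m (1 - z^+2) z) @[n --> \oo] --> b (spt s m (1 - z^+2) z)}}.
Proof.
move=> A sE; have s2 := sgn_sqr sE.
have H1 := ae_slices (m1 := leb2 R) (m2 := leb) (ae_shc 0 (ae_spt sE (af_t A))).
have := ae_slices (m1 := leb) (m2 := leb) H1; apply: filterS => m Hm.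
have [q /andP[q0 q1] Hq] := ae_exists (@ltr01 R) Hm.
set k := sqrt q; have k0 : 0 < k by rewrite sqrtr_gt0.
have kE : k^+2 = q by rewrite sqr_sqrtr// ltW.
have := ae_affine 0 (lt0r_neq0 k0) Hq; apply: filterS => z /= Hz zi.
have z2 : z^+2 < 1 by case/andP: zi => a1 a2; nra.
have E : k*z + 0 - 0 = k*z by ring.
have w0 : 0 < q - (k*z)^+2 by rewrite exprMn kE -[X in X - _]mulr1 -mulrBr mulr_gt0// subr_gt0.
have ek : sqrt (q - (k*z)^+2 + (k*z)^+2) = k by rewrite subrK.
move: Hz; rewrite E addr0 => /(_ w0); rewrite (nrm_spt m (k*z) s2 w0) /= ek (_ : k*z / k = z); last by field; rewrite gt_eqF.
apply; apply/spt_B=> //; first exact: ltW.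
by rewrite subrK.
Qed.

(** By scaling, the integrals over ]0, h[ and ]0, h/2[ coincide, although they differ by a positive
    amount; so they cannot be finite. *)
Lemma inv_integral_infty (h : R) : 0 < h -> (\int[leb]_(x in `]0%R, h[) (x^-1)%:E = +oo)%E.
Proof.
move=> h0; pose F k (x : mR) : \bar R := (((fun x : R => x^-1) \_ `]0, k[%classic) x)%:E.
have mI k : measurable (`]0, k[%classic : set mR) by exact: measurable_itv.
have m0 k : mfun ((fun x : mR => x^-1) \_ `]0, k[%classic).
 by apply/(measurable_restrictT _ _).1=> //; apply: measurable_funTS; exact: measurable_inv.
have mF k : mfun (F k) by apply/measurable_EFinP; exact: m0.
have F0 k x : (0 <= F k x)%E.
 by rewrite /F patchE lee_fin; case: ifPn=> // /set_mem; rewrite /= in_itv /= => /andP[x0 _]; rewrite invr_ge0 ltW.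
have IE k : (\int[leb]_(x in `]0%R, k[) (x^-1)%:E = \int[leb]_x F k x)%E.
 by rewrite integral_mkcond; apply: eq_integral => x _; rewrite /F !patchE; case: ifP.
have scale : (\int[leb]_x F h x = \int[leb]_x F (h/2)%R x)%E.
 have t0 : 0 < 2 :> R by [].
 rewrite (leb_scale t0 (mF h))// -ge0_integralZl//; last by apply: (measurableT_comp (mF h)); exact: measurable_funM.
 apply: eq_integral => x _; rewrite /F !patchE -EFinM !mem_setE !in_itv /=; congr EFin.
 rewrite pmulr_rgt0// ltr_pdivlMr// [x*2]mulrC; case: ifP=> [/andP[x0 _]|_]; last by rewrite mulr0.
 by field; exact: lt0r_neq0.
have split3 : (\int[leb]_x F h x = \int[leb]_x F (h/2)%R x + \int[leb]_(x in `[(h/2)%R, h[) (x^-1)%:E)%E.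
 have h2 : 0 < h/2 by exact: divr_gt0.
 have mh : measurable (`[h/2, h[%classic : set mR) by exact: measurable_itv.
 have mi (D : set mR) : measurable_fun D (fun x : mR => (x^-1)%:E).
  by apply/measurable_EFinP; apply: measurable_funTS; exact: measurable_inv.
 have i0 (x : mR) : (`]0, h/2[%classic `|` `[h/2, h[%classic) x -> (0 <= (x^-1)%:E)%E.
  case; rewrite /= in_itv /= => /andP[a1 a2]; rewrite lee_fin invr_ge0 ltW//; exact: lt_le_trans a1.
 have disj : [disjoint (`]0, h/2[%classic : set mR) & (`[h/2, h[%classic : set mR)].
  apply/disj_setPS => x [] /=; rewrite !in_itv /= => /andP[_ a1] /andP[a2 _]; move: (lt_le_trans a1 a2); by rewrite ltxx.
 rewrite -!IE -(ge0_integral_setU leb (mI _) mh (mi _) i0 disj); congr (integral leb _ _).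
 apply/seteqP; split=> x /=; rewrite !in_itv /=.
  by move=> /andP[a1 a2]; have [l|l] := ltP x (h/2); [left; rewrite a1|right; rewrite a2].
 by case=> /andP[a1 a2]; apply/andP; split=> //; [lra|exact: lt_le_trans a1].
have pos : (0 < \int[leb]_(x in `[(h/2)%R, h[) (x^-1)%:E)%E.
 have mJ : measurable (`[(h/2)%R, h[%classic : set mR) by exact: measurable_itv.
 apply: (@lt_le_trans _ _ (\int[leb]_(x in `[(h/2)%R, h[) (h^-1)%:E)%E).
  rewrite integral_cst// -[X in (_*X)%E]/(leb _).
  have -> : leb `[(h/2)%R, h[%classic = (h/2)%:E.
   apply: etrans (lebesgue_measure_itv _) _; rewrite /= lte_fin; have -> : h/2 < h by lra.
   by rewrite -EFinB; congr EFin; lra.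
  by rewrite -EFinM lte_fin mulr_gt0 ?invr_gt0// divr_gt0.
 apply: ge0_le_integral=> //.
 - by move=> x _; rewrite lee_fin invr_ge0 ltW.
 - by apply/measurable_EFinP; apply: measurable_funTS; exact: measurable_inv.
 - move=> x; rewrite /= in_itv /= => /andP[a1 a2]; have x0 : 0 < x by apply: lt_le_trans a1; exact: divr_gt0.
  by rewrite lee_fin lef_pV2 ?posrE// ltW.
rewrite IE; apply/eqP; rewrite eq_le leey /= leNgt; apply/negP => fin.
have F0' : (0 <= \int[leb]_x F h x)%E by apply: integral_ge0.
have fn : (\int[leb]_x F h x)%E \is a fin_num by rewrite ge0_fin_numE.
move: split3; rewrite -scale => /eqP; rewrite eq_sym -[X in _ == X]adde0 => /eqP /(congr1 (fun t => t - \int[leb]_x F h x)%E).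
rewrite adde0 addeAC subee// add0e => E; by move: pos; rewrite E ltxx.
Qed.

(* [F] blows up at least like 1/w near the end z = e of the circle, unless the numerator comes close to 0. *)
Lemma axis_end (c m y si : R) (g : R -> R) (P : R -> Prop) (eta h : R) : (si = 1 \/ si = -1) -> 0 < y -> 0 < eta -> 0 < h ->
 mfun (g : mR -> R) -> (forall z, 0 <= g z) ->
 (\int[leb]_z ((sJ m (y - (z - c)^+2))%:E*(g z)%:E) < +oo)%E ->
 {ae leb, forall z : mR, P z} ->
 exists2 z, P z & [/\ 0 < y - (z - c)^+2, `|z - (c + si*sqrt y)| < h, 0 < si*(z - c) & g z*(y - (z - c)^+2) < eta].
Proof.
move=> siE y0 e0 h0 mg g0 Fin Pae; apply: contrapT => H.
set q := sqrt y; have q0 : 0 < q by rewrite sqrtr_gt0.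
have qE : q^+2 = y by rewrite sqr_sqrtr// ltW.
have s2 := sgn_sqr siE.
have sn : si != 0 by case: siE=> ->; rewrite ?oppr_eq0 oner_neq0.
have sN : `|si| = 1 by case: siE=> ->; rewrite ?normrN normr1.
pose k := Num.min h q; have k0 : 0 < k by rewrite lt_min h0.
have kh : k <= h by rewrite ge_min lexx. have kq : k <= q by rewrite ge_min lexx orbT.
pose F (z : mR) : \bar R := ((sJ m (y - (z - c)^+2))%:E*(g z)%:E)%E.
have mF : mfun F.
 apply: emeasurable_funM; apply/measurable_EFinP=> //; apply: measurable_sJ=> //.
 by apply: measurable_funB=> //; apply: measurable_funX; exact: measurable_funB.
have F0 z : (0 <= F z)%E by rewrite mule_ge0// lee_fin ?sJ_ge0.
have Fin' : (\int[leb]_x F (- si*x + (c + si*q))%R < +oo)%E.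
 have := leb_affine (c + si*q) (_ : - si != 0) mF F0; rewrite oppr_eq0 normrN sN => /(_ sn).
 by under eq_integral do rewrite mul1e; move=> ->.
have nsn : - si != 0 by rewrite oppr_eq0.
have Pae' := ae_affine (c + si*q) nsn Pae.
(* At distance x from the end, w = x (2 q - x) <= 2 q x. If g w >= eta held there, the integrand
   would be at least K / x. *)
pose K := eta/(2*(1 + m^+2)*(2*q)); have K0 : 0 < K by rewrite divr_gt0// !mulr_gt0// onesqr_gt0.
have : (\int[leb]_(x in `]0%R, k[) (K*x^-1)%:E <= \int[leb]_x F (- si*x + (c + si*q))%R)%E.
 have mI : measurable (`]0, k[%classic : set mR) by exact: measurable_itv.
 have mFa : mfun (fun x : mR => F (- si*x + (c + si*q))%R).
  by apply: (measurableT_comp mF); apply: measurable_funD=> //; exact: measurable_funM.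
 apply: (@le_trans _ _ (\int[leb]_(x in `]0%R, k[) F (- si*x + (c + si*q))%R)%E); last first.
  by apply: ge0_subset_integral=> //; exact: measurableT.
 apply: ae_ge0_le_integral=> //.
 - by move=> x; rewrite /= in_itv /= => /andP[x0 _]; rewrite lee_fin; apply: mulr_ge0; [exact: ltW|rewrite invr_ge0 ltW].
 - by apply/measurable_EFinP; apply: measurable_funM=> //; apply: measurable_funTS; exact: measurable_inv.
 - exact: measurable_funTS.
 apply: filterS Pae' => x /= Px; rewrite in_itv /= => /andP[x0 xk].
 set z := - si*x + (c + si*q) in Px *.
 have zc : z - c = si*(q - x) by rewrite /z; ring.
 have wE : y - (z - c)^+2 = x*(2*q - x) by rewrite zc exprMn s2 mul1r -qE; ring.
 have w0 : 0 < y - (z - c)^+2 by rewrite wE mulr_gt0//; lra.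
 have big : eta <= g z*(y - (z - c)^+2).
  rewrite leNgt; apply/negP => small; apply: H; exists z=> //; split=> //.
  - have -> : z - (c + si*q) = - si*x by rewrite /z; ring.
   by rewrite normrM normrN sN mul1r gtr0_norm//; exact: lt_le_trans kh.
  - by rewrite zc mulrA -expr2 s2 mul1r; lra.
 rewrite /F /sJ w0 -EFinM lee_fin /K; have o := onesqr_gt0 m.
 rewrite -(ler_pM2r w0) -[leRHS]mulrA; set W := y - _ in w0 wE big *.
 apply: (@le_trans _ _ ((2*(1 + m^+2))^-1*eta)); last by apply: ler_wpM2l=> //; rewrite invr_ge0 mulr_ge0// ltW.
 rewrite wE (_ : eta / _ / x * _ = (2*(1 + m^+2))^-1*eta*((2*q - x)/(2*q))).
  have c0 : 0 <= (2*(1 + m^+2))^-1*eta by rewrite mulr_ge0 ?(ltW e0)// invr_ge0 mulr_ge0// ltW.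
  rewrite -[leRHS]mulr1; apply: ler_wpM2l=> //; rewrite ler_pdivrMr ?mulr_gt0// mul1r; lra.
 by field; rewrite !gt_eqF.
under eq_integral do rewrite EFinM.
rewrite ge0_integralZl//; last 3 first.
- by apply/measurable_EFinP; apply: measurable_funTS; exact: measurable_inv.
- by move=> x; rewrite /= in_itv /= => /andP[x0 _]; rewrite lee_fin invr_ge0 ltW.
- by rewrite lee_fin ltW.
rewrite inv_integral_infty// gt0_muley ?lte_fin// => L; by have := le_lt_trans L Fin'.
Qed.

End Affine.

Lemma ae_imp2 d (T : measurableType d) (R : realType) (m : {measure set T -> \bar R}) (P Q S : T -> Prop) :
 (forall x, P x -> Q x -> S x) -> {ae m, forall x, P x} -> {ae m, forall x, Q x} -> {ae m, forall x, S x}.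
Proof. by move=> PQ; apply: filterS2. Qed.

(** The converse of [ae_slices], for a measurable set. *)
Lemma ae_prod d1 d2 (T1 : measurableType d1) (T2 : measurableType d2) (R : realType)
  (m1 : {sigma_finite_measure set T1 -> \bar R}) (m2 : {sigma_finite_measure set T2 -> \bar R}) (E : set (T1*T2)) :
 measurable E -> {ae m1, forall x, {ae m2, forall y, ~ E (x, y)}} -> {ae (m1 \x m2)%E, forall p, ~ E p}.
Proof.
move=> mE H; exists E; split=> //; last by move=> p /= /contrapT.
rewrite /product_measure1.
rewrite (@ae_eq_integral _ _ _ m1 setT (cst 0%E)) ?integral0 //.
- exact: measurable_fun_xsection.
- apply: filterS H => x /= [N [mN N0 sN]] _; apply/eqP; rewrite eq_le measure_ge0 andbT -N0.
 apply: le_measure; rewrite ?inE //; first exact: measurable_xsection.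
 by move=> y /xsectionP Exy; apply: sN => /= H; exact: H.
Qed.

Lemma measurable_pred d (T : measurableType d) (g : T -> bool) : mfun g -> measurable [set x | g x].
Proof. by move=> mg; have := mg measurableT [set true] I; rewrite setTI. Qed.

(** * The sign of the profile on meridian circles *)

Section Meridian.
Variable R : realType.
Local Notation leb := (@lebesgue_measure R).
Local Notation mu := (vol R).
Local Notation B := (@B1 R).
Local Notation mR := (mTR R).
Variables (f : nat -> R3 R -> R) (t : R3 R -> R) (w : 'I_3 -> R3 R -> R) (b : R3 R -> R).
Hypothesis A : AppF f t w b.
Hypothesis ang0 : aeB (fun x => angw w x = 0).
Hypothesis sym : aeB (fun x => t (rt (-1) 0 x) = t x).

Lemma spt_opp m a z : spt (-1) m a z = rt (-1) 0 (spt 1 m a z) :> R3 R.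
Proof. by rewrite /rt /spt /=; congr (_, _, _); ring. Qed.

(** By [m_slice] t is constant in m, so its restriction to one generic half-plane serves as [T]; the
    opposite side is reached by the half turn [sym]. A function of w and z that is measurable and
    defined everywhere makes different circles comparable at their crossings. *)
Lemma meridian_profile : exists T : mR * mR -> R, mfun T /\ forall s, (s = 1 \/ s = -1) ->
 {ae mu, forall p : R3 R, 0 < p.1.2 -> p.1.2 + p.2^+2 < 1 -> t (spt s p.1.1 p.1.2 p.2) = T (p.1.2, p.2)}.
Proof.
have m1 := @measurable_x1 R; have m2 := @measurable_x2 R; have m3 := @measurable_x3 R.
have mt := measurable_restrB (af_m A).
have s1 : (1 = 1 :> R \/ 1 = - 1 :> R) by left.
have Hs := ae_spt s1 (af_c A).
have [m0 _ H0] := ae_exists (@ltr01 R) (ae_slices (m1 := leb) (m2 := leb) (ae_slices (m1 := leb2 R) (m2 := leb) Hs)).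
have [k1 k2] : (1 : R)^+2 = 1 /\ (0 : R) < 1 by rewrite expr1n ltr01.
pose T (h : mR * mR) := (t \_ B) (spt 1 m0 h.1 h.2).
have mT : mfun T by apply: (measurableT_comp mt); apply: measurable_spt.
exists T; split=> //.
pose E : set (R3 R) := [set p | [/\ 0 < p.1.2, p.1.2 + p.2^+2 < 1 & (t \_ B) (spt 1 p.1.1 p.1.2 p.2) != T (p.1.2, p.2)]].
have mE : measurable E.
 have -> : E = [set p | [&& 0 < p.1.2, p.1.2 + p.2^+2 < 1 & (t \_ B) (spt 1 p.1.1 p.1.2 p.2) != T (p.1.2, p.2)]].
  by apply/seteqP; split => p; rewrite /E /= => /and3P.
 apply: measurable_pred; apply: measurable_and; first exact: measurable_fun_ltr.
 apply: measurable_and.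
  by apply: measurable_fun_ltr=> //; apply: measurable_funD=> //; exact: measurable_funX.
 apply: measurable_neg; apply: measurable_fun_eqr.
  by apply: (measurableT_comp mt); apply: measurable_spt.
 by apply: (measurableT_comp mT); apply/measurable_fun_pairP; split.
have key : {ae leb2 R, forall h : mR * mR, {ae leb, forall m : mR, ~ E (cyc (h, m))}}.
 pose E' : set (mR * mR * mR) := [set q | E (cyc q)].
 have mE' : measurable E' by rewrite -[E']setTI; apply: (@measurable_cyc R).
 (* The exceptional pairs of w and z form a measurable set, so the iterated almost everywhere
    statements can be assembled by [ae_prod]. *)
 pose N : set (mR * mR) := [set h | leb (xsection E' h) != 0%E].
 have mN : measurable N.
  apply: measurable_pred; apply: measurable_neg.
  by apply: measurable_fun_eqe=> //; exact: measurable_fun_xsection.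
 have H2 := ae_slices (m1 := leb) (m2 := leb) (m_slice A s1 ang0).
 have H3 := ae_slices (m1 := leb) (m2 := leb) (ae_cyc_spt s1 (af_c A)).
 have HN : {ae leb2 R, forall h, ~ N h}.
  apply: (@ae_prod _ _ _ _ _ leb leb)=> //.
  apply: filterS3 H0 H2 H3 => a Ha1 Ha2 Ha3; apply: filterS3 Ha1 Ha2 Ha3 => z h1 h2 h3.
  rewrite /N /= => /negP; apply; apply/eqP.
  have [M [mM M0 sM]] : leb.-negligible (xsection E' (a, z)).
   apply: negligibleS h3 => m /xsectionP [/= a0 az ne] /(_ a0) h3; move/negP: ne; apply; apply/eqP.
   have BB m' : B (spt 1 m' a z) by apply/spt_B=> //; exact: ltW.
   move: (h3 (BB m)) (h1 a0 (BB m0)) => c1 c2; rewrite /T /= !patchE !mem_set ?BB//.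
   have [l|l|->//] := ltgtP m m0; first exact: (h2 a0 az _ _ _ _ l c1 c2).
   by apply/esym; exact: (h2 a0 az _ _ _ _ l c2 c1).
  by apply/eqP; rewrite eq_le measure_ge0 andbT -M0 le_measure// ?inE//; exact: measurable_xsection.
 apply: filterS HN => h /negP; rewrite negbK => /eqP Nh.
 exists (xsection E' h); split=> //; first exact: measurable_xsection.
 by move=> m /= /contrapT Em; apply/xsectionP.
have EE : {ae mu, forall p, ~ E p}.
 have : {ae mu, forall q, ~ E (cyc q)}.
  apply: (@ae_prod _ _ _ _ _ (leb2 R) leb [set q | E (cyc q)])=> //.
  by rewrite -[X in measurable X]setTI; apply: (@measurable_cyc R).
 by move=> /ae_cyc /ae_cyc; apply: filterS => -[[p1 p2] p3].
have P1 : {ae mu, forall p : R3 R, 0 < p.1.2 -> p.1.2 + p.2^+2 < 1 -> t (spt 1 p.1.1 p.1.2 p.2) = T (p.1.2, p.2)}.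
 apply: filterS EE => p nE p0 p1; apply/eqP; apply/negPn/negP => ne; apply: nE; split=> //.
 by rewrite patchE mem_set//; apply/spt_B=> //; exact: ltW.
move=> s [->//|->]; have := ae_spt s1 sym; apply: filterS2 P1 => p H1 Hsym p0 p1.
by rewrite spt_opp -H1// Hsym//; apply/spt_B=> //; exact: ltW.
Qed.

Lemma integral_adjacent (F : mR -> \bar R) (x y z : R) : x < y -> y < z -> mfun F -> (forall s, 0 <= F s)%E ->
 (\int[leb]_(s in `[x, y]) F s + \int[leb]_(s in `[y, z]) F s <= \int[leb]_(s in `[x, z]) F s)%E.
Proof.
move=> xy yz mF F0; rewrite -(@integral_itv_bndo_bndc _ _ y); last exact: measurable_funTS.
have mU : measurable_fun (`[x, y[ `|` `[y, z]) F by exact: measurable_funTS.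
have mx : measurable (`[x, y[%classic : set mR) by exact: measurable_itv.
have my : measurable (`[y, z]%classic : set mR) by exact: measurable_itv.
rewrite -(ge0_integral_setU leb mx my mU)=> //.
 apply: ge0_subset_integral=> //.
 - exact: measurableU.
 - exact: measurable_funTS.
 - by move=> s [] /=; rewrite !in_itv /= => /andP[a1 a2]; apply/andP; split; lra.
by apply/disj_setPS => s [] /=; rewrite !in_itv /= => /andP[_ a1] /andP[a2 _]; move: (lt_le_trans a1 a2); rewrite ltxx.
Qed.

(** The total variation of t along the part of the circle inside the ball, as the integral of
    |dt/dz|. *)
Definition vari (s c m y : R) : \bar R := (\int[leb]_z (`|(lamw w c \_ B) (cvp s c m y z)|)%:E)%E.

Lemma mB_lamw c : mB (lamw w c).
Proof.
have m1 : mB (fun x : R3 R => x.1.1) by apply: measurable_funTS; exact: measurable_x1.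
have m2 : mB (fun x : R3 R => x.1.2) by apply: measurable_funTS; exact: measurable_x2.
have m3 : mB (fun x : R3 R => x.2 - c) by apply: measurable_funTS; apply: measurable_funB=> //; exact: measurable_x3.
have mr : mB (@rho2 R) by apply: mB_add; apply: mB_mul.
apply: mB_mul; last by apply: (measurableT_comp (@measurable_inv R)).
apply: mB_add; last by apply: mB_mul=> //; exact: (af_mw A).
apply: measurable_funB; apply: mB_mul; try exact: (af_mw A); apply: mB_mul=> //.
exact: measurableT_comp.
Qed.

Lemma measurable_lamw_cvp s c m y : mfun (fun z : mR => (`|(lamw w c \_ B) (cvp s c m y z)|)%:E).
Proof.
apply/measurable_EFinP; apply: measurableT_comp=> //; apply: (measurableT_comp (measurable_restrB (@mB_lamw c))).
apply: measurable_spt=> //; apply: measurable_funB=> //; apply: measurable_funX; exact: measurable_funB.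
Qed.

(** Four points: the inner two are compared in sign, the outer two are taken near the ends of the
    arc, where |t| is bounded below. *)
Definition var_bound (s c m y : R) : Prop := forall z0 z1 z2 z3 l0 l1 l2 l3 : R, z0 < z1 -> z1 < z2 -> z2 < z3 ->
  (forall z, z0 <= z <= z3 -> 0 < y - (z - c)^+2) ->
  (forall z, z0 < z < z3 -> B (cvp s c m y z)) ->
  f n (cvp s c m y z0) @[n --> \oo] --> l0 -> f n (cvp s c m y z1) @[n --> \oo] --> l1 ->
  f n (cvp s c m y z2) @[n --> \oo] --> l2 -> f n (cvp s c m y z3) @[n --> \oo] --> l3 ->
  ((`|l1 - l0| + `|l2 - l1| + `|l3 - l2|)%:E <= vari s c m y)%E.

Lemma variation4 (s c : R) : (s = 1 \/ s = -1) -> {ae leb2 R, forall h : mR * mR, var_bound s c h.1 h.2}.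
Proof.
move=> sE; have := z_slice A c sE; apply: filterS => h H z0 z1 z2 z3 l0 l1 l2 l3 a1 a2 a3 dom inB c0 c1 c2 c3.
have mF := measurable_lamw_cvp s c h.1 h.2.
have F0 z : (0 <= (`|(lamw w c \_ B) (cvp s c h.1 h.2 z)|)%:E)%E by rewrite lee_fin.
have h1 := H _ _ _ _ a1 _ _ c0 c1; have h2 := H _ _ _ _ a2 _ _ c1 c2; have h3 := H _ _ _ _ a3 _ _ c2 c3.
have {}h1 : (_ <= _)%E := h1 (fun z hz => dom z ltac:(lra)) (fun z hz => inB z ltac:(lra)).
have {}h2 : (_ <= _)%E := h2 (fun z hz => dom z ltac:(lra)) (fun z hz => inB z ltac:(lra)).
have {}h3 : (_ <= _)%E := h3 (fun z hz => dom z ltac:(lra)) (fun z hz => inB z ltac:(lra)).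
rewrite !EFinD; apply: (le_trans (leeD (leeD h1 h2) h3)).
have a4 := lt_trans a1 a2.
apply: (le_trans (leeD (integral_adjacent a1 a2 mF F0) (lexx _))).
apply: (le_trans (integral_adjacent a4 a3 mF F0)).
by apply: ge0_subset_integral=> //; exact: measurable_itv.
Qed.

Variables (G : R3 R -> R) (T : mR * mR -> R).
Hypothesis LG : L1B G.
Hypothesis axis : aeB (fun x => 1 - t x^+2 <= rho2 x * `|G x|).
Hypothesis HT : forall s : R, (s = 1 \/ s = -1) ->
 {ae mu, forall p : R3 R, 0 < p.1.2 -> p.1.2 + p.2^+2 < 1 -> t (spt s p.1.1 p.1.2 p.2) = T (p.1.2, p.2)}.

Definition onc (c y z : R) : mR * mR := (y - (z - c)^+2, z).

(** What almost every height on almost every circle satisfies. In the application G is |D u|^2, and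
    the second clause says 1 - t^2 <= w |D u|^2. *)
Definition good (s c m y z : R) : Prop := 0 < (onc c y z).1 -> (onc c y z).1 + z^+2 < 1 ->
 f n (cvp s c m y z) @[n --> \oo] --> T (onc c y z) /\
 1 - T (onc c y z)^+2 <= (onc c y z).1 * `|(G \_ B) (cvp s c m y z)|.

Lemma ae_good (s c : R) : (s = 1 \/ s = -1) -> {ae leb2 R, forall h : mR * mR, {ae leb, forall z : mR, good s c h.1 h.2 z}}.
Proof.
move=> sE; have s2 := sgn_sqr sE.
have h1 := ae_curve c sE (aeB_and (af_c A) axis).
have h2 := ae_slices (m1 := leb2 R) (m2 := leb) (ae_shc c (HT sE)).
apply: filterS2 h1 h2 => h; apply: filterS2 => z H1 H2 w0 w1.
have Bz : B (cvp s c h.1 h.2 z) by apply/spt_B=> //; exact: ltW.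
have E : t (cvp s c h.1 h.2 z) = T (onc c h.2 z) := H2 w0 w1.
have rE : rho2 (cvp s c h.1 h.2 z) = (onc c h.2 z).1 by rewrite /cvp rho2_spt// ltW.
case: (H1 w0 Bz) => cv; rewrite rE E => le.
by split; [rewrite -E|rewrite patchE mem_set].
Qed.

(* The defect [1 - t^2] vanishes on the axis in an averaged sense, hence [|t|] comes close to 1 along
   almost every circle at both of its endpoints on the axis. *)
Lemma axis_anchor (s c m y si th z : R) : (s = 1 \/ s = -1) -> (si = 1 \/ si = -1) -> 0 < th < 1 ->
 {ae leb, forall z : mR, good s c m y z} ->
 (\int[leb]_z ((sJ m (y - (z - c)^+2))%:E*(`|(G \_ B) (cvp s c m y z)|)%:E) < +oo)%E ->
 0 < y - (z - c)^+2 ->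
 (forall z', 0 < y - (z' - c)^+2 -> 0 < si*(z' - z) -> y - (z' - c)^+2 + z'^+2 < 1) ->
 exists z' l', [/\ 0 < si*(z' - z), 0 < y - (z' - c)^+2, f n (cvp s c m y z') @[n --> \oo] --> l' & th <= `|l'|].
Proof.
move=> sE siE /andP[t0 t1] gd fin zc inB.
have y0 : 0 < y by apply: lt_le_trans zc _; rewrite lerBlDr lerDl sqr_ge0.
set q := sqrt y; have q0 : 0 < q by rewrite sqrtr_gt0.
have qE : q^+2 = y by rewrite sqr_sqrtr// ltW.
have s2 : si*si = 1 by case: siE=> ->; rewrite ?mulrNN mulr1.
have k0 : 0 < q - si*(z - c).
 have : (si*(z - c))^+2 < q^+2 by rewrite exprMn expr2 s2 mul1r qE; lra.
 by rewrite subr_gt0 => h; rewrite ltNge; apply/negP => h'; nra.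
have eta0 : 0 < 1 - th by lra.
have mg : mfun (fun z : mR => `|(G \_ B) (cvp s c m y z)|).
 apply: measurableT_comp=> //; apply: (measurableT_comp (measurable_restrB (L1B_m LG))).
 apply: measurable_spt=> //; apply: measurable_funB=> //; apply: measurable_funX; exact: measurable_funB.
have [z' gz' [w0 near _ small]] := axis_end siE y0 eta0 k0 mg (fun=> normr_ge0 _) fin gd.
have dz : 0 < si*(z' - z).
 have : - (q - si*(z - c)) < si*(z' - (c + si*q)).
  move: near; rewrite -/q ltr_norml => /andP[n1 n2]; case: siE => E; move: n1 n2; rewrite E => n1 n2; lra.
 rewrite !mulrBr !mulrDr mulrA s2 mul1r; lra.
have [cv dfc] := gz' w0 (inB _ w0 dz).
exists z', (T (onc c y z')); split=> //.
have : 1 - T (onc c y z')^+2 < 1 - th by apply: le_lt_trans dfc _; rewrite mulrC.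
rewrite -real_normK ?num_real//; set a := `|_| => h; have a0 : 0 <= a by exact: normr_ge0.
rewrite leNgt; apply/negP => at_; nra.
Qed.

Lemma sign_chain (a l l2 e : R) : 0 < a*e -> 0 < l2*e -> 0 < l * l2 -> 0 < a * l.
Proof.
move=> p1 p2 p3; rewrite -(pmulr_lgt0 _ (exprn_gt0 2 p2)).
have -> : (a * l)*(l2*e)^+2 = (a*e)*(l2*e)*(l * l2) by ring.
by rewrite mulr_gt0// mulr_gt0.
Qed.

(** A change of sign costs a variation of at least 2 th, either once on the way from end to end or
    on the way to the other sign and back. *)
Lemma same_sign4 (th l0 l1 l2 l3 : R) : 0 < th -> th <= `|l0| -> th <= `|l3| ->
 `|l1 - l0| + `|l2 - l1| + `|l3 - l2| < 2*th -> [/\ 0 < l0 * l1, 0 < l1 * l2 & 0 < l2 * l3].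
Proof.
move=> t0 h0 h3 h.
have k (a : R) : a <= `|a| /\ - a <= `|a| by rewrite ler_norm -normrN ler_norm.
have [a1 a2] := k (l1 - l0); have [b1 b2] := k (l2 - l1); have [c1 c2] := k (l3 - l2).
have [p0|p0] := lerP 0 l0; have [p3|p3] := lerP 0 l3;
 rewrite ?(ger0_norm p0) ?(ltr0_norm p0) in h0; rewrite ?(ger0_norm p3) ?(ltr0_norm p3) in h3; try (exfalso; lra).
- have q1 : 0 < l1 by lra. have q2 : 0 < l2 by lra. by split; apply: mulr_gt0=> //; lra.
- have q1 : l1 < 0 by lra. have q2 : l2 < 0 by lra. by split; rewrite nmulr_rgt0.
Qed.

Definition signc (ep c y : R) := {ae leb, forall z : mR, 0 < (onc c y z).1 -> (onc c y z).1 + z^+2 < 1 -> 0 < ep*T (onc c y z)}.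

(** A strict inequality leaves room for a threshold th below a. The room is used because |t| comes
    close to 1 near the axis without attaining it. *)
Lemma fin_scale (V : \bar R) (a : R) : (0 <= V)%E -> (V < (2*a)%:E)%E -> 0 < a -> exists2 th, 0 < th < a & (V < (2*th)%:E)%E.
Proof.
move=> V0 Va a0; have fV : V \is a fin_num by rewrite ge0_fin_numE// (lt_trans Va)// ltry.
move: V0 Va; rewrite -(fineK fV) lee_fin lte_fin => V0 Va.
by exists ((fine V + 2*a)/4); rewrite ?lte_fin; [apply/andP; split; lra|lra].
Qed.

Lemma vari_ge0 s c m y : (0 <= vari s c m y)%E.
Proof. by apply: integral_ge0 => z _; rewrite lee_fin. Qed.

(** Any two good heights lie between anchors near the two ends on the axis, so [same_sign4] gives
    them the same sign; comparison with one reference height [zr] decides which. *)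
Lemma interior_sign (s c m y : R) : (s = 1 \/ s = -1) -> var_bound s c m y -> {ae leb, forall z : mR, good s c m y z} ->
 (\int[leb]_z ((sJ m (y - (z - c)^+2))%:E*(`|(G \_ B) (cvp s c m y z)|)%:E) < +oo)%E ->
 0 < y -> sqrt y < 1 - `|c| -> (vari s c m y < (2*1)%:E)%E -> signc 1 c y \/ signc (-1) c y.
Proof.
move=> sE; have s2 := sgn_sqr sE.
move=> TV gd fin y0 yc Vlt.
have [th /andP[t0 t1] {}Vlt] := fin_scale (vari_ge0 _ _ _ _) Vlt ltr01.
set q := sqrt y in yc; have q0 : 0 < q by rewrite sqrtr_gt0.
have qE : q^+2 = y by rewrite sqr_sqrtr// ltW.
have inq z : 0 < y - (z - c)^+2 <-> c - q < z < c + q.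
 rewrite -qE; split=> [h|/andP[a1 a2]]; last by nra.
 by apply/andP; split; rewrite ltNge; apply/negP => h'; nra.
have c1 : `|c| < 1 - q by lra.
move: c1; rewrite ltr_norml => /andP[c1 c2].
have inB z : 0 < y - (z - c)^+2 -> y - (z - c)^+2 + z^+2 < 1.
 by move=> /inq/andP[a1 a2]; rewrite -qE; have [c0|c0] := lerP 0 c; nra.
have key z1 z2 : good s c m y z1 -> good s c m y z2 -> 0 < y - (z1 - c)^+2 -> 0 < y - (z2 - c)^+2 -> z1 < z2 ->
  0 < T (onc c y z1)*T (onc c y z2).
 move=> g1 g2 w1 w2 z12; have [cv1 _] := g1 w1 (inB _ w1); have [cv2 _] := g2 w2 (inB _ w2).
 have th1 : 0 < th < 1 by rewrite t0.
 have [z0 [l0 [d0 w0 cv0 b0]]] := axis_anchor (z := z1) sE (or_intror erefl) th1 gd fin w1 (fun z' w _ => inB z' w).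
 have [z3 [l3 [d3 w3 cv3 b3]]] := axis_anchor (z := z2) sE (or_introl erefl) th1 gd fin w2 (fun z' w _ => inB z' w).
 have z01 : z0 < z1 by lra. have z23 : z2 < z3 by lra.
 move/inq: w0 => /andP[e0 _]; move/inq: w3 => /andP[_ e3].
 have dom z : z0 <= z <= z3 -> 0 < y - (z - c)^+2 by move=> /andP[? ?]; apply/inq/andP; split; lra.
 have inB' z : z0 < z < z3 -> B (cvp s c m y z).
  move=> /andP[? ?]; have dz : 0 < y - (z - c)^+2 by apply: dom; apply/andP; split; lra.
  by apply/spt_B=> //; [exact: ltW|exact: inB].
 have := TV _ _ _ _ _ _ _ _ z01 z12 z23 dom inB' cv0 cv1 cv2 cv3 => /le_lt_trans /(_ Vlt); rewrite lte_fin => tv.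
 by have [] := same_sign4 t0 b0 b3 tv.
have cq : c - q < c + q by lra.
have [zr /andP[r1 r2] gr] := ae_exists cq gd.
have wr : 0 < y - (zr - c)^+2 by apply/inq/andP.
have T0 z : good s c m y z -> 0 < y - (z - c)^+2 -> z != zr -> 0 < T (onc c y zr)*T (onc c y z).
 move=> gz wz; have [l _|l _|->] := ltgtP z zr; [rewrite mulrC; exact: key|exact: key|by []].
have nz := ae_neq zr.
have [p|p] := lerP 0 (T (onc c y zr)); [left|right].
- apply: (ae_imp2 _ gd nz) => z gz zr_ w0 w1; have := T0 z gz w0 zr_; rewrite mul1r => h.
 by rewrite ltNge; apply/negP => h'; nra.
- apply: (ae_imp2 _ gd nz) => z gz zr_ w0 w1; have := T0 z gz w0 zr_; rewrite mulN1r oppr_gt0 => h.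
 by rewrite ltNge; apply/negP => h'; nra.
Qed.

Lemma cap_sign (s ka m y : R) : (s = 1 \/ s = -1) -> (ka = 1 \/ ka = -1) ->
 var_bound s ka m y -> {ae leb, forall z : mR, good s ka m y z} ->
 (\int[leb]_z ((sJ m (y - (z - ka)^+2))%:E*(`|(G \_ B) (cvp s ka m y z)|)%:E) < +oo)%E ->
 (let zb := - ka/2*y + ka in -1 < zb < 1 ->
  f n (spt s m (1 - zb^+2) zb) @[n --> \oo] --> b (spt s m (1 - zb^+2) zb)) ->
 (forall m z : R, -1 < z < 1 -> 31/32 <= ka*z <= 1 - y/2 -> 15/16 <= ka*b (spt s m (1 - z^+2) z)) ->
 0 < y -> y <= 1/16 -> (vari s ka m y < (2*(15/16))%:E)%E -> signc ka ka y.
Proof.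
move=> sE kE TV gd fin tr bcap y0 y1 Vlt; have s2 := sgn_sqr sE.
have kk : ka * ka = 1 by case: kE=> ->; rewrite ?mulrNN mulr1.
have [th /andP[t0 t1] {}Vlt] := fin_scale (vari_ge0 _ _ _ _) Vlt (divr_gt0 (ltr0n _ 15) (ltr0n _ 16)).
move: tr; set zb := - ka/2*y + ka => /= tr.
have kzb : ka*zb = 1 - y/2 by rewrite /zb mulrDr kk !mulrA mulrN kk; ring.
have zb2 : zb^+2 = (1 - y/2)^+2 by rewrite -kzb exprMn [ka^+2]expr2 kk mul1r.
have zbi : -1 < zb < 1 by case: kE kzb=> ->; rewrite ?mul1r ?mulN1r => e; apply/andP; split; lra.
have eb : cvp s ka m y zb = spt s m (1 - zb^+2) zb.
 congr spt; have -> : (zb - ka)^+2 = zb^+2 - 2*(ka*zb) + ka * ka by ring.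
 by rewrite kk kzb zb2; field.
have {}tr := tr zbi; rewrite -eb in tr.
have bb : 15/16 <= ka*b (cvp s ka m y zb) by rewrite eb; apply: bcap=> //; rewrite kzb lexx andbT; lra.
have bn : th <= `|b (cvp s ka m y zb)|.
 have -> : `|b (cvp s ka m y zb)| = `|ka*b (cvp s ka m y zb)| by rewrite normrM; case: kE=> ->; rewrite ?normrN normr1 mul1r.
 by rewrite ger0_norm; lra.
have dist u : (u - ka)^+2 = (1 - ka*u)^+2 by case: kE=> ->; ring.
have inB u : (y - (u - ka)^+2 + u^+2 < 1) = (ka*u < 1 - y/2).
 have -> : y - (u - ka)^+2 + u^+2 = y - 1 + 2*(ka*u) by case: kE=> ->; ring.
 by apply/idP/idP => ?; lra.
have th1 : 0 < th < 1 by apply/andP; split; lra.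
(* For ka = -1 the heights decrease from the axis to the sphere, so the four points are taken in
   reverse order. *)
have TV' z0 z1 z2 z3 l0 l1 l2 l3 : 0 < ka*(z1 - z0) -> 0 < ka*(z2 - z1) -> 0 < ka*(z3 - z2) ->
  (forall u, ka*z0 <= ka*u <= ka*z3 -> 0 < y - (u - ka)^+2) ->
  (forall u, ka*z0 < ka*u < ka*z3 -> B (cvp s ka m y u)) ->
  f n (cvp s ka m y z0) @[n --> \oo] --> l0 -> f n (cvp s ka m y z1) @[n --> \oo] --> l1 ->
  f n (cvp s ka m y z2) @[n --> \oo] --> l2 -> f n (cvp s ka m y z3) @[n --> \oo] --> l3 ->
  `|l1 - l0| + `|l2 - l1| + `|l3 - l2| < 2*th.
 move=> d0 d1 d2 dom iB c0 c1 c2 c3; rewrite -lte_fin; apply: le_lt_trans Vlt.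
 case: (kE) => ke; rewrite ke ?mul1r ?mulN1r in d0 d1 d2 dom iB.
  have [a0 a1 a2] : [/\ z0 < z1, z1 < z2 & z2 < z3] by split; lra.
  have := TV _ _ _ _ _ _ _ _ a0 a1 a2 _ _ c0 c1 c2 c3; apply => u; rewrite -?ke => ?.
   by rewrite ke; apply: dom; rewrite !mul1r.
  by rewrite ke; apply: iB; rewrite !mul1r.
 have [a0 a1 a2] : [/\ z1 < z0, z2 < z1 & z3 < z2] by split; lra.
 rewrite (_ : `|l1 - l0| + `|l2 - l1| + `|l3 - l2| = `|l2 - l3| + `|l1 - l2| + `|l0 - l1|); last first.
  by rewrite (distrC l0) (distrC l1 l2) (distrC l2 l3); ring.
 have := TV _ _ _ _ _ _ _ _ a2 a1 a0 _ _ c3 c2 c1 c0; apply => u /andP[u1 u2].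
  by rewrite ke; apply: dom; rewrite !mulN1r; apply/andP; split; lra.
 by rewrite ke; apply: iB; rewrite !mulN1r; apply/andP; split; lra.
apply: (ae_imp2 _ gd gd) => z gz _ w0 w1; have [cv _] := gz w0 w1; move: (w1); rewrite /onc /= inB => kz.
have nk : - ka = 1 \/ - ka = -1 by case: kE=> ->; [right|left; rewrite opprK].
have [z0 [l0 [d0 v0 cv0 b0]]] : exists z' l', [/\ 0 < - ka*(z' - z), 0 < y - (z' - ka)^+2, f n (cvp s ka m y z') @[n --> \oo] --> l' & th <= `|l'|].
 by apply: axis_anchor=> // z' _ d'; rewrite inB; lra.
have [z2 [g2 e1 e2]] : exists z2, [/\ good s ka m y z2, 0 < ka*(z2 - z) & 0 < ka*(zb - z2)].
 case: (kE) => ke; rewrite ke ?mul1r ?mulN1r in kz kzb *.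
  have l : z < zb by lra. have [x /andP[x1 x2] gx] := ae_exists l gd; exists x; split; [by rewrite -ke|lra|lra].
 have l : zb < z by lra. have [x /andP[x1 x2] gx] := ae_exists l gd; exists x; split; [by rewrite -ke|lra|lra].
have dom u : ka*z0 <= ka*u <= ka*zb -> 0 < y - (u - ka)^+2.
 by move: v0; rewrite !dist kzb => v0 /andP[u1 u2]; nra.
have k2z : ka*z2 < 1 - y/2 by rewrite -kzb; lra.
have [cv2 _] : f n (cvp s ka m y z2) @[n --> \oo] --> T (onc ka y z2) /\ 1 - T (onc ka y z2)^+2 <= (onc ka y z2).1 * `|(G \_ B) (cvp s ka m y z2)|.
 by apply: g2; rewrite /onc /= ?inB//; apply: dom; apply/andP; split; lra.
have iB u : ka*z0 < ka*u < ka*zb -> B (cvp s ka m y u).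
 move=> /andP[u1 u2]; apply/spt_B=> //; last by rewrite inB -kzb.
 by apply/ltW/dom/andP; split; exact: ltW.
have d0' : 0 < ka*(z - z0) by lra.
have tv := TV' _ _ _ _ _ _ _ _ d0' e1 e2 dom iB cv0 cv cv2 tr.
have [_ p1 p2] := same_sign4 t0 b0 bn tv.
have q1 : 0 < ka*b (cvp s ka m y zb) by lra.
exact: sign_chain q1 p2 p1.
Qed.

Lemma circle_interior (s c : R) : (s = 1 \/ s = -1) -> {ae leb, forall m : mR, {ae leb, forall y : mR, 0 < y -> sqrt y < 1 - `|c| ->
 (vari s c m y < (2*1)%:E)%E -> signc 1 c y \/ signc (-1) c y}}.
Proof.
move=> sE; have h1 := ae_slices (m1 := leb) (m2 := leb) (variation4 c sE).
have h2 := ae_slices (m1 := leb) (m2 := leb) (ae_good c sE).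
have h3 := ae_slices (m1 := leb) (m2 := leb) (fin_curve c sE LG).
apply: filterS3 h1 h2 h3 => m k1 k2 k3; apply: filterS3 k1 k2 k3 => y TV gd fin; exact: (interior_sign sE TV gd fin).
Qed.

Lemma circle_cap (s ka d : R) : 0 < d -> (s = 1 \/ s = -1) -> (ka = 1 \/ ka = -1) ->
 (forall m z : R, -1 < z < 1 -> 31/32 <= ka*z <= 1 - d/2 -> 15/16 <= ka*b (spt s m (1 - z^+2) z)) ->
 {ae leb, forall m : mR, {ae leb, forall y : mR, d <= y <= 1/16 -> (vari s ka m y < (2*(15/16))%:E)%E -> signc ka ka y}}.
Proof.
move=> d0 sE kE bcap.
have kn : ka != 0 by case: kE=> ->; rewrite ?oppr_eq0 oner_neq0.
have kh : - ka/2 != 0 by rewrite mulf_neq0 ?oppr_eq0 ?invr_eq0.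
have h1 := ae_slices (m1 := leb) (m2 := leb) (variation4 ka sE).
have h2 := ae_slices (m1 := leb) (m2 := leb) (ae_good ka sE).
have h3 := ae_slices (m1 := leb) (m2 := leb) (fin_curve ka sE LG).
(* The exit height is an affine function of y, so convergence at almost every height of the sphere
   holds at the exit of almost every circle. *)
apply: filterS2 (filterI h1 h2) (filterI h3 (trace_slice A sE)) => m [k1 k2] [k3 /(ae_affine ka kh) k4].
apply: filterS2 (filterI k1 k2) (filterI k3 k4) => y /= [TV gd] [fin tr] /andP[y0 y1].
apply: (cap_sign sE kE TV gd fin tr _ (lt_le_trans d0 y0) y1) => m' z zi /andP[z1 z2]; apply: bcap=> //.
by rewrite z1 /=; move: (y : R) z2 y0 => y' z2 y0; lra.
Qed.
End Meridian.

(** * From integrals over the ball to integrals over circles *)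

Section VolumeComparison.
Variable R : realType.
Local Notation leb := (@lebesgue_measure R).
Local Notation mu := (vol R).
Local Notation B := (@B1 R).
Local Notation mR := (mTR R).
Local Open Scope ereal_scope.

(** The share of the two half-planes of slope m in the sphere |x - c e_3|^2 = y. Up to the slope
    density, volume is dm dy dz: Archimedes' theorem on spheres. *)
Definition circle_mass (c : R) (F : R3 R -> \bar R) (m y : R) : \bar R :=
 \int[leb]_z ((sJ m (y - (z - c)^+2)%R)%:E*(F (cvp 1 c m y z) + F (cvp (-1) c m y z))).

(** Its value is pi/2; being positive and finite, it cancels in [variation_deficit]. *)
Definition slope_mass : \bar R := \int[leb]_m ((2*(1 + m^+2))^-1)%:E.

Lemma slope_mass_fin : 0 < slope_mass < +oo.
Proof.
have mf : mfun (fun m : mR => ((2*(1 + m^+2))^-1)%:E).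
 apply/measurable_EFinP; apply: (measurableT_comp (@measurable_inv R)).
 by apply: measurable_funM=> //; apply: measurable_funD=> //; exact: measurable_funX.
have p0 (m : R) : (0 < (2*(1 + m^+2))^-1)%R by rewrite invr_gt0 mulr_gt0// onesqr_gt0.
have f0 (m : mR) : 0 <= ((2*(1 + m^+2))^-1)%:E by rewrite lee_fin ltW.
have half : \int[leb]_(m in `]0%R, +oo[) ((2*(1 + m^+2))^-1)%:E < +oo.
 have mo : mfun (fun m : mR => ((oneDsqr m)^-1)%:E).
  apply/measurable_EFinP; apply: (measurableT_comp (@measurable_inv R)).
  by apply: measurable_funD=> //; exact: measurable_funX.
 apply: (@le_lt_trans _ _ (\int[leb]_(m in `[0%R, +oo[) ((oneDsqr m)^-1)%:E)); last by rewrite integral0y_oneDsqr ltry.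
 apply: (@le_trans _ _ (\int[leb]_(m in `]0%R, +oo[) ((oneDsqr m)^-1)%:E)).
  apply: ge0_le_integral=> //; try exact: measurable_funTS.
  move=> m _; have o1 : (0 < oneDsqr m)%R by exact: (lt_le_trans ltr01 (oneDsqr_ge1 m)).
  rewrite lee_fin lef_pV2 ?posrE ?mulr_gt0 ?onesqr_gt0//.
  by have := onesqr_gt0 m; rewrite /oneDsqr; lra.
 apply: ge0_subset_integral=> //; try exact: measurable_funTS.
 by move=> m /=; rewrite !in_itv /= !andbT; exact: ltW.
apply/andP; split; last first.
 rewrite /slope_mass leb_half//.
 have -> : \int[leb]_(m in `]0%R, +oo[) ((2*(1 + (- m)^+2))^-1)%:E = \int[leb]_(m in `]0%R, +oo[) ((2*(1 + m^+2))^-1)%:E.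
  by apply: eq_integral => m _; rewrite sqrrN.
 exact: lte_add_pinfty.
have m01 : measurable (`[0%R, 1%R]%classic : set mR) by exact: measurable_itv.
apply: (@lt_le_trans _ _ (\int[leb]_(m in `[0%R, 1%R]) (4^-1)%:E)).
 rewrite integral_cst// -[X in (_*X)]/(leb _).
 have -> : leb `[0%R, 1%R]%classic = 1%:E by apply: etrans (lebesgue_measure_itv _) _; rewrite /= lte_fin ltr01 sube0.
 by rewrite mule1 lte_fin invr_gt0.
apply: (@le_trans _ _ (\int[leb]_(m in `[0%R, 1%R]) ((2*(1 + m^+2))^-1)%:E)); last exact: ge0_subset_integral.
apply: ge0_le_integral=> //; try exact: measurable_funTS.
move=> m; rewrite /= in_itv /= => /andP[a0 a1]; rewrite lee_fin lef_pV2 ?posrE ?mulr_gt0 ?onesqr_gt0//; nra.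
Qed.

Lemma measurable_spt_sum F : mfun F ->
 mfun (fun p : R3 R => (sJ p.1.1 p.1.2)%:E*(F (spt 1 p.1.1 p.1.2 p.2) + F (spt (-1) p.1.1 p.1.2 p.2))).
Proof.
move=> mF; have m1 := @measurable_x1 R; have m2 := @measurable_x2 R; have m3 := @measurable_x3 R.
apply: emeasurable_funM; first by apply/measurable_EFinP; exact: measurable_sJ.
by apply: emeasurable_funD; apply: (measurableT_comp mF); exact: measurable_spt.
Qed.

Lemma circle_vol c F : mfun F -> (forall x, 0 <= F x) ->
 \int[mu]_x F x = \int[leb]_m \int[leb]_y circle_mass c F m y.
Proof.
move=> mF F0; have mH := measurable_spt_sum mF; set H := (fun p : R3 R => _ * _) in mH.
have H0 p : 0 <= H p by rewrite mule_ge0// ?lee_fin ?sJ_ge0// adde_ge0.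
have mHc : mfun (fun p => H (shc c p)) by apply: (measurableT_comp mH); exact: measurable_shc.
rewrite slope_vol// -[LHS](vol_shc c mH H0) vol_iter_h// leb2_iter//.
- exact: (measurable_fun_fubini_tonelli_F (m2 := leb) (fun p => H (shc c p))).
- by move=> h; apply: integral_ge0.
Qed.

Section Bounds.
Variables (c : R) (F : R3 R -> \bar R) (g : R -> R).
Hypothesis mF : mfun F.
Hypothesis F0 : forall x, 0 <= F x.
Hypothesis mg : mfun (g : mR -> R).
Hypothesis g0 : forall y, (0 <= g y)%R.

Let p0 (m : R) : (0 <= (2*(1 + m^+2))^-1)%R.
Proof. by rewrite invr_ge0 mulr_ge0// ltW// onesqr_gt0. Qed.

Let mp : mfun (fun h : mR * mR => ((2*(1 + h.1^+2))^-1*g h.2)%:E).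
Proof.
apply/measurable_EFinP; apply: measurable_funM; last exact: (measurableT_comp mg).
apply: (measurableT_comp (@measurable_inv R)).
by apply: measurable_funM=> //; apply: measurable_funD=> //; apply: measurable_funX.
Qed.

Let q0 (h : mR * mR) : 0 <= ((2*(1 + h.1^+2))^-1*g h.2)%:E.
Proof. by rewrite lee_fin mulr_ge0. Qed.

Lemma circle_mass_ge0 m y : 0 <= circle_mass c F m y.
Proof. by apply: integral_ge0 => z _; rewrite mule_ge0// ?lee_fin ?sJ_ge0// adde_ge0. Qed.

Lemma measurable_circle_mass : mfun (fun h : mR * mR => circle_mass c F h.1 h.2).
Proof.
have mH := measurable_spt_sum mF; set H := (fun p : R3 R => _ * _) in mH.
apply: (measurable_fun_fubini_tonelli_F (m2 := leb) (fun p => H (shc c p))).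
 by apply: (measurableT_comp mH); exact: measurable_shc.
by move=> p; rewrite mule_ge0// ?lee_fin ?sJ_ge0// adde_ge0.
Qed.

Lemma iter_product : \int[leb]_m \int[leb]_y ((2*(1 + m^+2))^-1*g y)%:E = slope_mass * \int[leb]_y (g y)%:E.
Proof.
have mgE : mfun (fun y : mR => (g y)%:E) by apply/measurable_EFinP.
have gE y : (0 <= (g y)%:E) by rewrite lee_fin.
have E m : \int[leb]_y ((2*(1 + m^+2))^-1*g y)%:E = ((2*(1 + m^+2))^-1)%:E * \int[leb]_y (g y)%:E.
 under eq_integral do rewrite EFinM.
 by rewrite ge0_integralZl// lee_fin.
under eq_integral do rewrite E.
rewrite ge0_integralZr//; first by apply/measurable_EFinP; apply: (measurableT_comp (@measurable_inv R));
 apply: measurable_funM=> //; apply: measurable_funD=> //; exact: measurable_funX.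
 by move=> m _; rewrite lee_fin.
by apply: integral_ge0.
Qed.

Lemma circle_lower : {ae leb, forall m : mR, {ae leb, forall y : mR, ((2*(1 + m^+2))^-1*g y)%:E <= circle_mass c F m y}} ->
 slope_mass * \int[leb]_y (g y)%:E <= \int[mu]_x F x.
Proof.
move=> H; rewrite (circle_vol c)// -iter_product.
apply: ae_ge0_le_integral=> //.
- by move=> m _; apply: integral_ge0 => y _; exact: (q0 (m, y)).
- exact: (measurable_fun_fubini_tonelli_F (m2 := leb) _ mp q0).
- by move=> m _; apply: integral_ge0 => y _; exact: circle_mass_ge0.
- by apply: (measurable_fun_fubini_tonelli_F (m2 := leb) _ measurable_circle_mass) => h; exact: circle_mass_ge0.
apply: filterS H => m H _; apply: ae_ge0_le_integral=> //.
- by move=> y _; exact: (q0 (m, y)).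
- exact: (measurable_fun_pair2 m mp).
- by move=> y _; exact: circle_mass_ge0.
- exact: (measurable_fun_pair2 m measurable_circle_mass).
by apply: filterS H => y H _.
Qed.

Lemma circle_upper : (forall m y, circle_mass c F m y <= ((2*(1 + m^+2))^-1*g y)%:E) ->
 \int[mu]_x F x <= slope_mass * \int[leb]_y (g y)%:E.
Proof.
move=> H; rewrite (circle_vol c)// -iter_product.
apply: ge0_le_integral=> //.
- by move=> m _; apply: integral_ge0 => y _; exact: circle_mass_ge0.
- by apply: (measurable_fun_fubini_tonelli_F (m2 := leb) _ measurable_circle_mass) => h; exact: circle_mass_ge0.
- exact: (measurable_fun_fubini_tonelli_F (m2 := leb) _ mp q0).
move=> m _; apply: ge0_le_integral=> //.
- by move=> y _; exact: circle_mass_ge0.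
- exact: (measurable_fun_pair2 m measurable_circle_mass).
- exact: (measurable_fun_pair2 m mp).
Qed.
End Bounds.

(** The square root of a nonpositive number is 0, so heights beyond the circle are sent to the axis,
    where [lamw] is 0 through division by 0. *)
Lemma cvp_out (s c m y z : R) : (y - (z - c)^+2 <= 0)%R -> rho2 (cvp s c m y z) = 0%R.
Proof.
move=> h; rewrite /rho2 /cvp /spt /= ler0_sqrtr ?mulr0 ?expr0n ?addr0//.
by rewrite -oppr_ge0 -mulNr; apply: divr_ge0; [rewrite oppr_ge0|exact/ltW/onesqr_gt0].
Qed.

Lemma yc_cvp (s c m y z : R) : (s = 1 \/ s = -1)%R -> (0 < y - (z - c)^+2)%R -> yc c (cvp s c m y z) = y.
Proof.
move=> sE w0; have s2 := sgn_sqr sE.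
by have := rho2_spt m z s2 (ltW w0); rewrite /yc /rho2=> ->; rewrite /= subrK.
Qed.

Lemma measurable_arc (c y : R) : measurable [set z : mR | ((0 < y - (z - c)^+2) && (y - (z - c)^+2 + z^+2 < 1))%R].
Proof.
have mw : mfun (fun z : mR => y - (z - c)^+2)%R.
 by apply: measurable_funB=> //; apply: measurable_funX; exact: measurable_funB.
apply: measurable_pred; apply: measurable_and; apply: measurable_fun_ltr=> //.
by apply: measurable_funD=> //; exact: measurable_funX.
Qed.

Lemma mass_cancel (k V I i1 i2 l J : R) : (0 < k -> k*(2*V*I) <= i1 -> 7/2 * i1 <= i2 -> i2 <= k*(2 * l*J) ->
 7/2*(V*I) <= l*J)%R.
Proof.
move=> k0; have e1 : (k*(2*V*I) = 2*(k*(V*I)))%R by ring.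
have e2 : (k*(2 * l*J) = 2*(k*(l*J)))%R by ring.
have e3 : (k*(7/2*(V*I)) = 7/2*(k*(V*I)))%R by ring.
rewrite e1 e2 => h1 h2 h3; rewrite -(ler_pM2l k0) e3.
move: (k*(V*I))%R (k*(l*J))%R h1 h3 => a b h1 h3; lra.
Qed.

(** The meridian term is constant in z up to |dt/dz|, so on each circle it is bounded below by V0;
    the right side is constant in z and picks up the arc length, at most ell sqrt(y). The factor 2
    for the two half-planes and the factor [slope_mass] are common to both sides. *)
Lemma variation_deficit (w : 'I_3 -> R3 R -> R) (c V0 ell K C de y0 : R) (Phi dPhi : R -> R) :
 mB (lamw w c) -> continuous Phi -> continuous dPhi -> (0 < de)%R -> (0 <= V0)%R -> (0 <= K)%R -> (0 <= C)%R -> (0 <= ell)%R ->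
 (forall y, (y <= de \/ y0 <= y)%R -> Phi y = 0%R /\ dPhi y = 0%R) ->
 (forall y, (de <= y <= y0)%R -> leb [set z : mR | ((0 < y - (z - c)^+2) && (y - (z - c)^+2 + z^+2 < 1))%R] <= (ell*sqrt y)%:E) ->
 L1B (fun x => Phi (yc c x)^+2 * `|lamw w c x| / sqrt (yc c x))%R ->
 L1B (fun x => K*(yc c x*dPhi (yc c x)^+2) + C*Phi (yc c x)^+2)%R ->
 (7/2*IB (fun x => Phi (yc c x)^+2 * `|lamw w c x| / sqrt (yc c x)) <=
  IB (fun x => K*(yc c x*dPhi (yc c x)^+2) + C*Phi (yc c x)^+2))%R ->
 leb.-integrable setT (EFin \o (fun y : mR => Phi y^+2 / sqrt y)%R) ->
 leb.-integrable setT (EFin \o (fun y : mR => y*dPhi y^+2*sqrt y)%R) ->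
 leb.-integrable setT (EFin \o (fun y : mR => Phi y^+2*sqrt y)%R) ->
 (forall s : R, (s = 1 \/ s = -1)%R -> {ae leb, forall m : mR, {ae leb, forall y : mR, (de <= y <= y0)%R -> V0%:E <= vari w s c m y}}) ->
 (7/2*(V0 * \int[leb]_y (Phi y^+2 / sqrt y)) <=
  ell*(K * \int[leb]_y (y*dPhi y^+2*sqrt y) + C * \int[leb]_y (Phi y^+2*sqrt y)))%R.
Proof.
move=> mlam cP cdP de0 V00 K0 C0 ell0 out len L1 L2 ineq I1 I2 I3 HV.
have mP : mfun (Phi : mR -> R) by exact: continuous_measurable_fun.
have mdP : mfun (dPhi : mR -> R) by exact: continuous_measurable_fun.
have msq : mfun (sqrt : mR -> R) by exact: measurable_sqrt.
set f1 := fun x : R3 R => (Phi (yc c x)^+2 * `|lamw w c x| / sqrt (yc c x))%R in L1 ineq.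
set f2 := fun x : R3 R => (K*(yc c x*dPhi (yc c x)^+2) + C*Phi (yc c x)^+2)%R in L2 ineq.
have p0 (m : R) : (0 <= (2*(1 + m^+2))^-1)%R by rewrite invr_ge0 mulr_ge0// ltW// onesqr_gt0.
have f10 x : (0 <= f1 x)%R by rewrite /f1 mulr_ge0 ?invr_ge0 ?sqrtr_ge0// mulr_ge0 ?sqr_ge0.
have yd (y : R) : (0 <= y*dPhi y^+2)%R.
 have [yde|yde] := leP y de; last by rewrite mulr_ge0 ?sqr_ge0// ltW// (lt_trans de0).
 by have [_ ->] := out y (or_introl yde); rewrite expr0n mulr0.
have f20 x : (0 <= f2 x)%R by rewrite /f2 addr_ge0// mulr_ge0 ?sqr_ge0.
have restr (f : R3 R -> R) : L1B f -> (forall x, (0 <= f x)%R) -> [/\ mfun (fun x => ((f \_ B) x)%:E),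
  (forall x, 0 <= ((f \_ B) x)%:E) & \int[mu]_x ((f \_ B) x)%:E = (IB f)%:E].
 move=> Lf f0; split.
 - by apply/measurable_EFinP; apply: measurable_restrB; exact: L1B_m.
 - by move=> x; rewrite patchE; case: ifP => _; rewrite lee_fin.
 - by rewrite -IB_EFin// [RHS]integral_mkcond; apply: eq_integral => x _; rewrite !patchE; case: ifP.
have [m1 n1 e1] := restr _ L1 f10. have [m2 n2 e2] := restr _ L2 f20.
pose g1 (y : R) : R := (2*V0*(Phi y^+2 / sqrt y))%R.
pose g2 (y : R) : R := (2*ell*(K*(y*dPhi y^+2*sqrt y) + C*(Phi y^+2*sqrt y)))%R.
have q0 y : (0 <= Phi y^+2 / sqrt y)%R by apply: divr_ge0; [exact: sqr_ge0|exact: sqrtr_ge0].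
have g10 y : (0 <= g1 y)%R by apply: mulr_ge0; [exact: mulr_ge0|].
have g20 y : (0 <= g2 y)%R.
 apply: mulr_ge0; first exact: mulr_ge0.
 by apply: addr_ge0; apply: mulr_ge0=> //; apply: mulr_ge0; rewrite ?sqrtr_ge0 ?sqr_ge0.
have mg1 : mfun (g1 : mR -> R).
 by apply: measurable_funM=> //; apply/measurable_EFinP; exact: measurable_int I1.
have mg2 : mfun (g2 : mR -> R).
 apply: measurable_funM=> //; apply: measurable_funD; apply: measurable_funM=> //; apply/measurable_EFinP;
  [exact: measurable_int I2|exact: measurable_int I3].
have low : slope_mass * \int[leb]_y (g1 y)%:E <= (IB f1)%:E.
 rewrite -e1; apply: (circle_lower (c := c))=> //.
 have H1 := HV 1%R (or_introl erefl); have H2 := HV (-1)%R (or_intror erefl).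
 apply: filterS2 H1 H2 => m H1 H2; apply: filterS2 H1 H2 => y H1 H2.
 have key s z : (s = 1 \/ s = -1)%R -> (sJ m (y - (z - c)^+2))%:E*((f1 \_ B) (cvp s c m y z))%:E =
  ((2*(1 + m^+2))^-1*(Phi y^+2 / sqrt y))%:E*(`|(lamw w c \_ B) (cvp s c m y z)|)%:E.
  move=> sE; rewrite -!EFinM; congr EFin; rewrite /sJ; case: ltP=> [w0|w0]; last first.
   by rewrite mul0r patchE; case: ifP => _; rewrite ?normr0 ?mulr0// /lamw cvp_out// invr0 mulr0 normr0 mulr0.
  rewrite !patchE; case: ifP => _; last by rewrite normr0 !mulr0.
  by rewrite /f1 yc_cvp//; ring.
 rewrite /circle_mass.
 have kap0 : (0 <= (2*(1 + m^+2))^-1*(Phi y^+2 / sqrt y))%R by rewrite mulr_ge0// mulr_ge0 ?sqr_ge0 ?invr_ge0 ?sqrtr_ge0.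
 have ml s : mfun (fun z : mR => (`|(lamw w c \_ B) (cvp s c m y z)|)%:E).
  apply/measurable_EFinP; apply: measurableT_comp=> //; apply: (measurableT_comp (measurable_restrB mlam)).
  apply: measurable_spt=> //; apply: measurable_funB=> //; apply: measurable_funX; exact: measurable_funB.
 under eq_integral => z _.
  rewrite ge0_muleDr// key; last by left.
  rewrite key; last by right.
  over.
 rewrite ge0_integralD//; last 4 first.
 - by move=> z _; rewrite -EFinM lee_fin mulr_ge0.
 - exact: measurable_funeM.
 - by move=> z _; rewrite -EFinM lee_fin mulr_ge0.
 - exact: measurable_funeM.
 have a0 s z : 0 <= (`|(lamw w c \_ B) (cvp s c m y z)|)%:E by rewrite lee_fin.
 rewrite !ge0_integralZl_EFin// -ge0_muleDr; [|exact: integral_ge0|exact: integral_ge0].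
 have [yy|yy] := boolP ((de <= y <= y0)%R).
  apply: (@le_trans _ _ (((2*(1 + m^+2))^-1*(Phi y^+2 / sqrt y))%:E*(V0 + V0)%:E)).
   by rewrite -EFinM lee_fin /g1 le_eqVlt; apply/orP; left; apply/eqP; ring.
  by apply: lee_wpmul2l=> //; rewrite EFinD; apply: leeD; [exact: H1|exact: H2].
 have P0 : Phi y = 0%R.
  have oy : (y <= de \/ y0 <= y)%R by move: yy; rewrite negb_and -!ltNge => /orP[/ltW|/ltW]; [left|right].
  by have [] := out y oy.
 by rewrite /g1 P0 expr0n /= mul0r !mulr0 mul0e.
have upp : (IB f2)%:E <= slope_mass * \int[leb]_y (g2 y)%:E.
 rewrite -e2; apply: (circle_upper (c := c))=> // m y.
 pose D : set mR := [set z | ((0 < y - (z - c)^+2) && (y - (z - c)^+2 + z^+2 < 1))%R].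
 have mD : measurable D := measurable_arc c y.
 have mw : mfun (fun z : mR => y - (z - c)^+2)%R by apply: measurable_funB=> //; apply: measurable_funX; exact: measurable_funB.
 pose a := ((2*(1 + m^+2))^-1*(2*(K*(y*dPhi y^+2) + C*Phi y^+2)))%R.
 have a0 : (0 <= a)%R by rewrite mulr_ge0// mulr_ge0// addr_ge0// mulr_ge0 ?sqr_ge0.
 apply: (@le_trans _ _ (\int[leb]_z (a%:E*(\1_D z)%:E))).
  apply: ge0_le_integral=> //.
  - by move=> z _; apply: mule_ge0; [rewrite lee_fin sJ_ge0|exact: adde_ge0].
  - apply: emeasurable_funM; first by apply/measurable_EFinP; exact: measurable_sJ.
   by apply: emeasurable_funD; apply: (measurableT_comp m2); apply: measurable_spt.
  - by apply: measurable_funeM; apply/measurable_EFinP; exact: measurable_indic.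
  move=> z _; rewrite -EFinD -!EFinM lee_fin /sJ; case: ltP=> [w0|w0]; last by rewrite mul0r mulr_ge0.
  have inD s : (s = 1 \/ s = -1)%R -> ((f2 \_ B) (cvp s c m y z) <= (K*(y*dPhi y^+2) + C*Phi y^+2) * \1_D z)%R.
   move=> sE; have s2 := sgn_sqr sE.
   rewrite patchE; case: ifPn=> [/set_mem Bz|_]; last by rewrite mulr_ge0// addr_ge0// mulr_ge0 ?sqr_ge0.
   rewrite /f2 yc_cvp// indicE mem_set ?mulr1// /D /= w0 /=.
   by move/spt_B: Bz; apply=> //; exact: ltW.
  rewrite /a -!mulrA; apply: ler_wpM2l=> //.
  have := lerD (inD 1%R (or_introl erefl)) (inD (-1)%R (or_intror erefl)) => /le_trans; apply.
  by rewrite le_eqVlt; apply/orP; left; apply/eqP; ring.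
 rewrite ge0_integralZl_EFin//; last by apply/measurable_EFinP; exact: measurable_indic.
 rewrite integral_indic// setIT.
 have [yy|yy] := boolP ((de <= y <= y0)%R).
  apply: (le_trans (lee_wpmul2l _ (len y yy))); first by rewrite lee_fin.
  by rewrite -EFinM lee_fin /a /g2 le_eqVlt; apply/orP; left; apply/eqP; ring.
 have oy : (y <= de \/ y0 <= y)%R by move: yy; rewrite negb_and -!ltNge => /orP[/ltW|/ltW]; [left|right].
 have [P0 dP0] := out y oy; rewrite /a P0 dP0 expr0n /= !mulr0 addr0 !mulr0 mul0e lee_fin.
 by rewrite mulr_ge0.
have /andP[k0 koo] := slope_mass_fin.
have kf : slope_mass = (fine slope_mass)%:E by rewrite fineK// ge0_fin_numE// ltW.
move: low upp; rewrite kf.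
have k0' : (0 < fine slope_mass)%R by rewrite -lte_fin -kf.
have J1 : \int[leb]_y (g1 y)%:E = (2*V0 * \int[leb]_y (Phi y^+2 / sqrt y))%:E.
 have G := I1_scale (2*V0) I1; rewrite -[LHS]fineK; last exact: (integrable_fin_num measurableT G).
 by congr EFin; rewrite -[LHS]/(Rintegral leb setT g1) RintegralZl.
have J2 : \int[leb]_y (g2 y)%:E = (2*ell*(K * \int[leb]_y (y*dPhi y^+2*sqrt y) + C * \int[leb]_y (Phi y^+2*sqrt y)))%:E.
 have i2 := I1_scale K I2; have i3 := I1_scale C I3; have i4 := I1_add i2 i3.
 have G := I1_scale (2*ell) i4; rewrite -[LHS]fineK; last exact: (integrable_fin_num measurableT G).
 by congr EFin; rewrite -[LHS]/(Rintegral leb setT g2) RintegralZl// RintegralD// !RintegralZl.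
rewrite J1 J2 -!EFinM !lee_fin => low upp.
exact: (mass_cancel k0' low ineq upp).
Qed.
End VolumeComparison.

(** * Sets of circles, crossings and chains of crossings *)

Section Crossing.
Variable R : realType.
Local Notation leb := (@lebesgue_measure R).
Local Notation mR := (mTR R).

(** A substitute for density points, for a set that is not known to be measurable. If S were null
    near every point, the supremum of the x below which S is null could be pushed up to b. *)
Lemma cluster_point (S : set mR) (a b : R) : a <= b -> (forall y, S y -> a <= y <= b) -> ~ leb.-negligible S ->
 exists2 y, a <= y <= b & forall r, 0 < r -> ~ leb.-negligible (S `&` [set x | `|x - y| < r]).
Proof.
move=> ab Sab nS; apply: contrapT => H.
have loc y : a <= y <= b -> exists2 r, 0 < r & leb.-negligible (S `&` [set x | `|x - y| < r]).
 move=> yab; apply: contrapT => H'; apply: H; exists y=> // r r0 neg; apply: H'; by exists r.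
pose E := [set x : R | x <= b /\ leb.-negligible (S `&` [set y | y <= x])].
have Ea : E a.
 split=> //; exists [set a]; split=> //; first exact: lebesgue_measure_set1.
 by move=> y [/Sab/andP[ay _] /= ya]; apply/eqP; rewrite eq_le ya.
have sE : has_sup E by split; [exists a|exists b => x []].
set e := sup E.
have ae : a <= e by apply: ub_le_sup=> //; case: sE.
have eb : e <= b by apply: ge_sup; [exists a|move=> x []].
have [r r0 nr] := loc e (introT andP (conj ae eb)).
have [x [xb nx] xe] := sup_adherent r0 sE.
have key d : 0 < d -> d < r -> leb.-negligible (S `&` [set y | y <= e + d]).
 move=> d0 dr; apply: negligibleS (negligibleU nx nr) => y [Sy /= ye].
 have [yx|yx] := leP y x; [by left|right; split=> //=]; rewrite ltr_norml; apply/andP; split; rewrite -/e in xe; lra.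
have r2 : 0 < r/2 by lra. have r2r : r/2 < r by lra.
have [be|be] := leP b (e + r/2).
 by apply: nS; apply: negligibleS (key _ r2 r2r) => y Sy; split=> //=; case/andP: (Sab _ Sy) => _ yb; lra.
have : E (e + r/2) by split; [exact: ltW|exact: key].
by move/(ub_le_sup (proj2 sE)); rewrite -/e; lra.
Qed.

(** [A1] and [A2] are not assumed measurable; they are enlarged to the measurable sets [B1] and [B2]
    of points whose relevant sections are null. By Tonelli's theorem both S and its complement are
    then null in B1 x B2. *)
Lemma rectangle_conflict (S : set (mR * mR)) (J1 J2 A1 A2 : set mR) :
 measurable S -> measurable J1 -> measurable J2 -> A1 `<=` J1 -> A2 `<=` J2 ->
 (forall y, A1 y -> {ae leb, forall y' : mR, J2 y' -> S (y, y')}) ->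
 (forall y', A2 y' -> {ae leb, forall y : mR, J1 y -> ~ S (y, y')}) ->
 leb.-negligible A1 \/ leb.-negligible A2.
Proof.
move=> mS mJ1 mJ2 s1 s2 h1 h2.
pose S1 : set (mR * mR) := (setT `*` J2) `&` ~` S.
pose S2 : set (mR * mR) := (J1 `*` setT) `&` S.
have mS1 : measurable S1 by apply: measurableI; [exact: measurableX|exact: measurableC].
have mS2 : measurable S2 by apply: measurableI=> //; exact: measurableX.
pose B1 : set mR := J1 `&` [set y | leb (xsection S1 y) == 0%E].
pose B2 : set mR := J2 `&` [set y | leb (ysection S2 y) == 0%E].
have mB1 : measurable B1.
 by apply: measurableI=> //; apply: measurable_pred; apply: measurable_fun_eqe=> //; exact: measurable_fun_xsection.
have mB2 : measurable B2.
 by apply: measurableI=> //; apply: measurable_pred; apply: measurable_fun_eqe=> //; exact: measurable_fun_ysection.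
have A1B : A1 `<=` B1.
 move=> y Ay; split; first exact: s1.
 have [N [mN N0 sN]] := h1 y Ay; rewrite /= eq_le measure_ge0 andbT -N0; apply: le_measure; rewrite ?inE//.
  exact: measurable_xsection.
 by move=> y' /xsectionP [[_ /= J] nS]; apply: sN => /= H; apply: nS; exact: H.
have A2B : A2 `<=` B2.
 move=> y Ay; split; first exact: s2.
 have [N [mN N0 sN]] := h2 y Ay; rewrite /= eq_le measure_ge0 andbT -N0; apply: le_measure; rewrite ?inE//.
  exact: measurable_ysection.
 by move=> y' /ysectionP [[/= J _] nS]; apply: sN => /= H; exact: (H J).
have mBB : measurable (B1 `*` B2) by exact: measurableX.
pose E1 := (B1 `*` B2) `&` ~` S; pose E2 := (B1 `*` B2) `&` S.
have mE1 : measurable E1 by apply: measurableI=> //; exact: measurableC.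
have mE2 : measurable E2 by exact: measurableI.
have Z1 : (\int[leb2 R]_p (\1_E1 p)%:E = 0)%E.
 rewrite leb2_iter; last by move=> p; rewrite lee_fin.
  rewrite -[RHS](integral0 leb setT); apply: eq_integral => y _.
  transitivity (\int[leb]_y' (\1_(xsection E1 y) y')%:E)%E.
   by apply: eq_integral => y' _; rewrite !indicE mem_xsection.
  rewrite integral_indic//; last exact: measurable_xsection.
  rewrite setIT; have [/set_mem [_ /eqP z]|ny] := boolP (y \in B1).
   apply/eqP; rewrite eq_le measure_ge0 andbT -z; apply: le_measure; rewrite ?inE//; try exact: measurable_xsection.
   by move=> y' /xsectionP [[/= _ [J _]] nS]; apply/xsectionP.
  rewrite (_ : xsection E1 y = set0) ?measure0//; apply/seteqP; split=> // y' /xsectionP [[/= b _] _].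
  by move: ny; rewrite mem_set.
 by apply/measurable_EFinP; exact: measurable_indic.
have Z2 : (\int[leb2 R]_p (\1_E2 p)%:E = 0)%E.
 rewrite leb2_iter2; last by move=> p; rewrite lee_fin.
  rewrite -[RHS](integral0 leb setT); apply: eq_integral => y _.
  transitivity (\int[leb]_y' (\1_(ysection E2 y) y')%:E)%E.
   by apply: eq_integral => y' _; rewrite !indicE mem_ysection.
  rewrite integral_indic//; last exact: measurable_ysection.
  rewrite setIT; have [/set_mem [_ /eqP z]|ny] := boolP (y \in B2).
   apply/eqP; rewrite eq_le measure_ge0 andbT -z; apply: le_measure; rewrite ?inE//; try exact: measurable_ysection.
   by move=> y' /ysectionP [[/= [J _] _] nS]; apply/ysectionP.
  rewrite (_ : ysection E2 y = set0) ?measure0//; apply/seteqP; split=> // y' /ysectionP [[/= _ b] _].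
  by move: ny; rewrite mem_set.
 by apply/measurable_EFinP; exact: measurable_indic.
have Z : (leb B1 * leb B2 = 0)%E.
 rewrite -(product_measure1E leb leb mB1 mB2) -[LHS]/(leb2 R (B1 `*` B2)) (_ : leb2 R (B1 `*` B2) = \int[leb2 R]_p (\1_(B1 `*` B2) p)%:E)%E; last first.
  by rewrite integral_indic// setIT.
 rewrite -[RHS]adde0 -{1}Z1 -Z2 -ge0_integralD//; last 2 first.
 - by apply/measurable_EFinP; exact: measurable_indic.
 - by apply/measurable_EFinP; exact: measurable_indic.
 apply: eq_integral => p _; rewrite -EFinD !indicE.
 have -> : (p \in E1) = (p \in B1 `*` B2) && (p \notin S) by rewrite in_setI in_setC.
 have -> : (p \in E2) = (p \in B1 `*` B2) && (p \in S) by rewrite in_setI.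
 by case: (p \in B1 `*` B2); case: (p \in S) => /=; rewrite ?addr0 ?add0r.
move/eqP: Z; rewrite mule_eq0 => /orP[] /eqP Z; [left|right].
 by exists B1.
by exists B2.
Qed.

(* The balls [(a c, b c)] with sign [neg] reachable from -1 through crossings have a supremum [e] of right ends,
   and the ball centred at [e] crosses one of them. *)
Lemma crossing_chain (a b : R -> R) (neg : R -> Prop) : (forall c : R, -1 <= c <= 1 -> a c < c < b c) ->
 neg (-1) -> ~ neg 1 -> (forall c : R, -1 < c < 1 -> -1 < a c /\ b c < 1) -> b (-1) < 1 -> -1 < a 1 ->
 (forall c c' : R, -1 <= c <= 1 -> -1 <= c' <= 1 -> a c < a c' -> a c' < b c -> b c < b c' -> neg c <-> neg c') -> False.
Proof.
move=> abc n0 n1 inn b1 a1 cross.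
pose X c c' := [/\ a c < a c', a c' < b c & b c < b c'].
(* Reachability from -1, as the least predicate that contains -1 and is closed under crossings. *)
pose Rc (c : R) := forall P : R -> Prop, P (-1) ->
 (forall c c' : R, -1 <= c <= 1 -> -1 <= c' <= 1 -> P c -> X c c' \/ X c' c -> P c') -> P c.
have R0 : Rc (-1) by move=> P.
have RX c c' : -1 <= c <= 1 -> -1 <= c' <= 1 -> Rc c -> X c c' \/ X c' c -> Rc c'.
 by move=> hc hc' rc x P P0 Ps; apply: (Ps c)=> //; exact: rc.
have Rneg c : Rc c -> (-1 <= c <= 1) /\ neg c.
 move=> rc; apply: (rc (fun c => (-1 <= c <= 1) /\ neg c)); first by split=> //; lra.
 move=> k k' hk hk' [_ nk] [[x1 x2 x3]|[x1 x2 x3]]; split=> //; first exact/(cross k k').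
 exact/(cross k' k).
have bR c : Rc c -> b c <= 1.
 move=> /Rneg[/andP[c0 c1] nc]; have [->|c_] := eqVneq c (-1); first exact: ltW.
 have [c1'|c1'] := eqVneq c 1; first by rewrite c1' in nc.
 have : -1 < c < 1 by rewrite !lt_neqAle c0 c1 c1' eq_sym c_.
 by move/inn=> [_ /ltW].
pose E := [set x | exists2 c, Rc c & x = b c].
have sE : has_sup E by split; [exists (b (-1)); exists (-1)|exists 1 => x [c rc ->]; exact: bR].
set e := sup E.
have be c : Rc c -> b c <= e by move=> rc; apply: ub_le_sup; [case: sE|exists c].
have hm1 : -1 <= (-1 : R) <= 1 by lra.
have [_ bm1] := andP (abc (-1) hm1).
have e0 : -1 < e by apply: lt_le_trans bm1 _; exact: be.
have e1 : e <= 1 by apply: ge_sup; [exists (b (-1)); exists (-1)|move=> x [c rc ->]; exact: bR].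
have he : -1 <= e <= 1 by apply/andP; split=> //; exact: ltW.
have /andP[ae eb] := abc e he.
have am1 : -1 < a e.
 have [->//|e1'] := eqVneq e 1.
 have : -1 < e < 1 by rewrite e0 lt_neqAle e1'.
 by move/inn=> [].
have nRe : ~ Rc e by move=> /be; lra.
(* Induction along the chain: a reachable interval that starts below [a e] and ends beyond it would
   cross the interval of e and make e reachable, against [nRe]. Ends bounded by [a e] < e contradict
   the supremum. *)
have far c : Rc c -> b c <= a e.
 move=> rc; have [] // := rc (fun c => Rc c /\ b c <= a e).
  split=> //; rewrite leNgt; apply/negP => h; apply: nRe; apply: (RX (-1) e)=> //; left; split=> //.
   by have /andP[x1 _] := abc (-1) hm1; exact: lt_trans am1.
  by apply: le_lt_trans eb; exact: be.
 move=> k k' hk hk' [rk bk] x; have rk' := RX k k' hk hk' rk x; split=> //.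
 rewrite leNgt; apply/negP => h; apply: nRe; apply: (RX k' e)=> //; left; split=> //.
  by case: x => -[x1 x2 x3]; lra.
 by apply: le_lt_trans eb; exact: be.
have ea : 0 < e - a e by lra.
have [x [c rc ->] xe] := sup_adherent ea sE.
by have := far c rc; rewrite -/e in xe; lra.
Qed.
End Crossing.

(** * No profile has the signs of the boundary data at both poles *)

Section Profile.
Variable R : realType.
Local Notation leb := (@lebesgue_measure R).
Local Notation mR := (mTR R).
Variable T : mR * mR -> R.
Hypothesis mT : mfun T.

(** Fubini's theorem sees sets of circles and not single ones. Non-null sets arbitrarily close to
    one circle are used, so that its crossing with another circle persists. *)
Definition clusters (ep c y : R) := forall r : R, 0 < r -> ~ leb.-negligible ([set x : mR | signc T ep c x] `&` [set x | `|x - y| < r]).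

Lemma circle_in_ball (c q Z : R) : 0 < q -> q < 1 - `|c| -> (Z - c)^+2 < q^+2 -> q^+2 - (Z - c)^+2 + Z^+2 < 1.
Proof.
move=> q0 qc h; have : `|c| < 1 - q by lra.
rewrite ltr_norml => /andP[c1 c2].
have [a1 a2] : c - q < Z /\ Z < c + q by split; rewrite ltNge; apply/negP => ?; nra.
by have [c0|c0] := lerP 0 c; nra.
Qed.

(** Z is the height of the radical line of the two circles. The product in the proof is Heron's
    expression, positive exactly when the two radii and the distance of the centres form a
    triangle. *)
Lemma circles_meet (c c' q q' : R) : 0 < q -> 0 < q' -> c - q < c' - q' -> c' - q' < c + q -> c + q < c' + q' ->
 let Z := (q^+2 - q'^+2 + c'^+2 - c^+2)/(2*(c' - c)) in
 (Z - c)^+2 < q^+2 /\ q^+2 - (Z - c)^+2 = q'^+2 - (Z - c')^+2.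
Proof.
move=> q0 q0' h1 h2 h3 Z; have d0 : 0 < c' - c by lra.
have dn := lt0r_neq0 d0.
have eZ : Z - c = (q^+2 - q'^+2 + (c' - c)^+2)/(2*(c' - c)) by rewrite /Z; field.
have eZ' : Z - c' = (q^+2 - q'^+2 - (c' - c)^+2)/(2*(c' - c)) by rewrite /Z; field.
split; last by rewrite eZ eZ'; field.
have p : 0 < (q' - (c' - c - q))*(q' + (c' - c - q))*((c' - c + q - q')*(c' - c + q + q')) by rewrite !mulr_gt0//; lra.
have d2 : 0 < (2*(c' - c))^+2 by rewrite exprn_gt0// mulr_gt0.
rewrite eZ expr_div_n ltr_pdivrMr// -subr_gt0 (_ : _ - _ = (q' - (c' - c - q))*(q' + (c' - c - q))*((c' - c + q - q')*(c' - c + q + q')))//; ring.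
Qed.

(** The height of the crossing is affine in y and in y'. With y fixed, almost every y' therefore
    meets the first circle at a height where its sign is known, and likewise with the roles
    exchanged; [rectangle_conflict] applies. *)
Lemma opposite_signs (c c' y y' ep : R) : 0 < y -> 0 < y' -> let q := sqrt y in let q' := sqrt y' in
 c - q < c' - q' -> c' - q' < c + q -> c + q < c' + q' -> q < 1 - `|c| \/ q' < 1 - `|c'| ->
 clusters ep c y -> clusters (- ep) c' y' -> False.
Proof.
move=> y0 y0' q q' h1 h2 h3 inn k1 k2.
have [q0 q0'] : 0 < q /\ 0 < q' by rewrite !sqrtr_gt0.
have [qE qE'] : q^+2 = y /\ q'^+2 = y' by rewrite !sqr_sqrtr ?ltW.
have d0 : 0 < c' - c by lra. have dn := lt0r_neq0 d0.
pose i := (2*(c' - c))^-1; pose k := (c'^+2 - c^+2) * i.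
pose Z (p : R*R) : R := i * p.1 - i * p.2 + k.
pose Wf (p : R*R) : R := p.1 - (Z p - c)^+2.
have eW p : Wf p = p.2 - (Z p - c')^+2 by rewrite /Wf /Z /k /i; field.
have cZ : continuous Z.
 move=> p; apply: cvgD; last exact: cvg_cst.
 by apply: cvgB; apply: cvgM; (try exact: cvg_cst); [exact: cvg_fst|exact: cvg_snd].
have cW : continuous Wf.
 move=> p; apply: cvgB; first exact: cvg_fst.
 rewrite (_ : (fun x : R*R => (Z x - c)^+2) = fun x => (Z x - c)*(Z x - c)); last by apply/funext => x; rewrite expr2.
 by apply: cvgM; apply: cvgB; (try exact: cvg_cst); exact: cZ.
have [m1 m2] := circles_meet q0 q0' h1 h2 h3; set Z0 := _ / _ in m1 m2.
have eZ : Z (y, y') = Z0 by rewrite /Z /k /i /Z0 /= -qE -qE'; field.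
have W0 : 0 < Wf (y, y') by rewrite /Wf eZ /= -qE subr_gt0.
have V0 : 0 < 1 - (Wf (y, y') + Z (y, y')*Z (y, y')).
 rewrite /Wf eZ /= -qE -expr2 subr_gt0; case: inn => h; first exact: circle_in_ball.
 by rewrite m2; apply: circle_in_ball=> //; rewrite -subr_gt0 -m2 subr_gt0.
have cV : continuous (fun p => 1 - (Wf p + Z p*Z p)).
 move=> p; apply: cvgB; first exact: cvg_cst.
 by apply: cvgD; [exact: cW|apply: cvgM; exact: cZ].
have N1 : \forall p \near (y, y'), 0 < Wf p by exact: (cvgr_gt _ (cW (y, y')) _ W0).
have N2 : \forall p \near (y, y'), 0 < 1 - (Wf p + Z p*Z p) by exact: (cvgr_gt _ (cV (y, y')) _ V0).
have NN : \forall p \near (y, y'), 0 < Wf p /\ 0 < 1 - (Wf p + Z p*Z p) by apply: filterI N1 N2.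
move/nbhs_ballP: NN=> [r /= r0 Hr].
pose J (a : R) : set mR := [set x | `|x - a| < r].
have mJ a : measurable (J a).
 apply: measurable_pred; apply: measurable_fun_ltr=> //; apply: measurableT_comp=> //; exact: measurable_funB.
have inJ a a' : J y a -> J y' a' -> 0 < Wf (a, a') /\ Wf (a, a') + Z (a, a')^+2 < 1.
 move=> /= ja ja'; have [//|w1] := Hr (a, a'); last by rewrite subr_gt0 -expr2.
 by split => /=; rewrite /ball /= distrC.
pose S : set (mR * mR) := [set p | 0 < ep*T (Wf p, Z p)].
have mZ : mfun (Z : mR * mR -> mR).
 apply: measurable_funD=> //; apply: measurable_funB; apply: measurable_funM=> //.
have mW : mfun (Wf : mR * mR -> mR).
 apply: measurable_funB=> //; apply: measurable_funX; exact: measurable_funB.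
have mS : measurable S.
 apply: measurable_pred; apply: measurable_fun_ltr=> //; apply: measurable_funM=> //.
 by apply: (measurableT_comp mT); exact: measurable_fun_pair.
have i0 : i != 0 by rewrite invr_eq0 mulf_neq0 ?pnatr_eq0.
have ni0 : - i != 0 by rewrite oppr_eq0.
have [] := rectangle_conflict (J1 := J y) (J2 := J y') (A1 := [set x : mR | signc T ep c x] `&` J y)
  (A2 := [set x : mR | signc T (- ep) c' x] `&` J y') mS (mJ y) (mJ y') _ _ _ _.
- by move=> x [].
- by move=> x [].
- move=> a [/= sa ja]; have := ae_affine (i*a + k) ni0 sa; apply: filterS => a' Ha' ja'.
 have [w0 w1] := inJ _ _ ja ja'; move: Ha'.
 have -> : - i*a' + (i*a + k) = Z (a, a') by rewrite /Z /=; ring.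
 by apply.
- move=> a' [/= sa ja']; have := ae_affine (- i*a' + k) i0 sa; apply: filterS => a Ha ja.
 have [w0 w1] := inJ _ _ ja ja'; move: Ha.
 have -> : i*a + (- i*a' + k) = Z (a, a') by rewrite /Z /=; ring.
 rewrite /onc /= -(eW (a, a')) => /(_ w0 w1); rewrite /S /= mulNr oppr_gt0 => h; apply/negP; rewrite -leNgt; exact: ltW.
- exact: k1.
- exact: k2.
Qed.

(** The intervals of length 2 sqrt(y) centred at c feed [crossing_chain]. Radii of at most 1/4 at
    the poles keep the two polar circles apart, so of two crossing circles at least one lies in the
    open ball, and so does their crossing point. *)
Lemma no_profile : (forall c : R, `|c| < 1 -> exists ep y : R, [/\ ep = 1 \/ ep = -1, 0 < y, sqrt y < 1 - `|c| & clusters ep c y]) ->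
 (forall ka : R, ka = 1 \/ ka = -1 -> exists y, [/\ 0 < y, sqrt y <= 1/4 & clusters ka ka y]) -> False.
Proof.
move=> H Hcap.
have /choice [g Hg] : forall c : R, exists p : R*R, -1 <= c <= 1 ->
  [/\ p.1 = 1 \/ p.1 = -1, 0 < p.2, (`|c| < 1 -> sqrt p.2 < 1 - `|c|),
    (`|c| = 1 -> p.1 = c /\ sqrt p.2 <= 1/4) & clusters p.1 c p.2].
 move=> c; have [/andP[c1 c2]|nc] := boolP (-1 <= c <= 1); last by exists (0, 0).
 have [l|l] := ltP `|c| 1.
  have [ep [y [e1 e2 e3 e4]]] := H c l; exists (ep, y) => _; split=> // E; by rewrite E ltxx in l.
 have cE : c = 1 \/ c = -1.
  by move: l; have [p|p] := lerP 0 c; rewrite ?(ger0_norm p) ?(ltr0_norm p) => l; [left|right]; lra.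
 have [y [e1 e2 e3]] := Hcap c cE; by exists (c, y) => _; split=> //.
pose q c := sqrt (g c).2.
have q0 c : -1 <= c <= 1 -> 0 < q c by move=> /Hg [_ ? _ _ _]; rewrite sqrtr_gt0.
have [i1 i2] : -1 <= (-1 : R) <= 1 /\ -1 <= (1 : R) <= 1 by split; lra.
have n1 : `|-1 : R| = 1 by rewrite normrN normr1.
have n2 : `|1 : R| = 1 by rewrite normr1.
have [_ _ _ /(_ n1) [s1 t1] _] := Hg _ i1; have [_ _ _ /(_ n2) [s2 t2] _] := Hg _ i2.
apply: (crossing_chain (a := fun c => c - q c) (b := fun c => c + q c) (neg := fun c => (g c).1 = -1))=> //.
- by move=> c /q0 h; apply/andP; split; lra.
- by rewrite s2; lra.
- move=> c /andP[c1 c2]; have l : `|c| < 1 by rewrite ltr_norml c1.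
 have hc : -1 <= c <= 1 by apply/andP; split; exact: ltW.
 have [_ _ /(_ l) h _ _] := Hg _ hc; rewrite -/(q c) in h.
 have : `|c| < 1 - q c by lra.
 by rewrite ltr_norml => /andP[a1 a2]; split; lra.
- by rewrite /q; lra.
- by rewrite /q; lra.
move=> c c' hc hc' h1 h2 h3.
have [e1 y1 l1 k1 cl1] := Hg _ hc; have [e2 y2 l2 k2 cl2] := Hg _ hc'.
have inn : q c < 1 - `|c| \/ q c' < 1 - `|c'|.
 have [l|l] := ltP `|c| 1; first by left; exact: l1.
 have [l'|l'] := ltP `|c'| 1; first by right; exact: l2.
 have b1 : `|c| = 1 by apply/eqP; rewrite eq_le l andbT ler_norml; lra.
 have b2 : `|c'| = 1 by apply/eqP; rewrite eq_le l' andbT ler_norml; lra.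
 have [_ t3] := k1 b1; have [_ t4] := k2 b2; rewrite -/(q c) in t3; rewrite -/(q c') in t4.
 move: b1 b2; have [p|p] := lerP 0 c; have [p'|p'] := lerP 0 c'; rewrite ?(ger0_norm p) ?(ltr0_norm p) ?(ger0_norm p') ?(ltr0_norm p') => b1 b2; lra.
have conf ep : (g c).1 = ep -> (g c').1 = - ep -> False.
 by move=> E1 E2; rewrite E1 in cl1; rewrite E2 in cl2; exact: (opposite_signs y1 y2 h1 h2 h3 inn cl1 cl2).
case: e1 => E1; case: e2 => E2; rewrite E1 E2 //; split=> // _; exfalso.
- by apply: (conf 1).
- by apply: (conf (-1)); rewrite ?opprK.
Qed.
End Profile.

(** * Circles of small variation and the contradiction *)

Section SignSets.
Variable R : realType.
Local Notation leb := (@lebesgue_measure R).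
Local Notation mu := (vol R).
Local Notation B := (@B1 R).
Local Notation mR := (mTR R).

Lemma segment_length (D : set mR) (a b l : R) : measurable D -> a <= b -> b - a <= l -> (forall z, D z -> a <= z <= b) -> (leb D <= l%:E)%E.
Proof.
move=> mD ab bl Dab; apply: (@le_trans _ _ (leb `[a, b]%classic)).
 by apply: le_measure; rewrite ?inE.
have -> : (leb `[a, b]%classic = (b - a)%:E)%E; last by rewrite lee_fin.
apply: etrans (lebesgue_measure_itv _) _; rewrite /= lte_fin -EFinB; have [//|ba] := ltP a b.
by congr EFin; lra.
Qed.

(** If the set were null, almost all circles would have variation at least [V0] and
    [variation_deficit] would hold for a cut-off that was built to violate it. The numerical
    hypotheses fit [V0], [K0] and the lower order coefficient to the constants 13/2, 66 and C of
    that cut-off. *)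
Lemma sign_set_big (lam : R) f u w b (c K0 kap0 ell V0 C y0 de : R) (beta : 'I_5 -> R3 R -> R) (P : R -> Prop) :
 0 < lam -> Min lam f u w b -> 0 <= K0 -> 0 <= kap0 -> 0 <= ell -> 13/2 <= 7/2*V0 -> ell*(K0 + 1) <= 66 ->
 ell*(980 * kap0 + 168*Ktau R * lam) <= C -> 0 < de -> 4*de <= y0 ->
 leb.-integrable setT (EFin \o (fun y : mR => cPhi de y0 y^+2 / sqrt y)) ->
 leb.-integrable setT (EFin \o (fun y : mR => y*dcPhi de y0 y^+2*sqrt y)) ->
 leb.-integrable setT (EFin \o (fun y : mR => cPhi de y0 y^+2*sqrt y)) ->
 66*(\int[leb]_y (y*dcPhi de y0 y^+2*sqrt y)) + C*(\int[leb]_y (cPhi de y0 y^+2*sqrt y))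
 < 13/2*(\int[leb]_y (cPhi de y0 y^+2 / sqrt y)) ->
 (forall k, smooth (beta k)) ->
 (forall x, enorm x != 0 -> cPhi de y0 (yc c (nrm x)) = 0 \/ forall k, beta k (nrm x) = b k (nrm x)) ->
 aeB (fun x => 1 - u 0 x^+2 <= dot (vphi w ^~ x) (vphi w ^~ x)) ->
 (forall x, B x -> de < yc c x < y0 ->
  [/\ n5 (beta^~ x) <= 2, \sum_i dot (fun k => partial i (beta k) x) (fun k => partial i (beta k) x) <= kap0 &
  dot (u^~ x) (u^~ x) = 1 -> 4*(3*qq u beta x^+2 + Bu u beta x) +
   64/7*(dot (beta^~ x) (beta^~ x) - (1 - qq u beta x)^+2) <= K0]) ->
 (forall y, de <= y <= y0 -> (leb [set z : mR | (0 < y - (z - c)^+2)%R && (y - (z - c)^+2 + z^+2 < 1)%R] <= (ell*sqrt y)%:E)%E) ->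
 (forall s : R, (s = 1 \/ s = -1) -> {ae leb, forall m : mR, {ae leb, forall y : mR, de <= y <= y0 -> (vari (w 0%R) s c m y < V0%:E)%E -> P y}}) ->
 ~ leb.-negligible [set y : mR | de <= y <= y0 /\ P y].
Proof.
move=> l0 M K00 kap00 ell0 hV hK hC de0 dey I1 I2 I3 cut sb bdry ang supp len HP neg.
have out y : y <= de \/ y0 <= y -> cPhi de y0 y = 0 /\ dcPhi de y0 y = 0 by move=> /(cPhi_out de0 dey) [].
have sP : smooth (fun x => cPhi de y0 (yc c x)) by apply: gsm_smooth; apply: gsm_cPhi=> //; exact: gsm_yc.
have cP : continuous (cPhi de y0) by apply: is_derive_cont => y; exact: cPhi_derive.
have cd := dcPhi_continuous (y0 := y0) de0.
have supp' x : B x -> (cPhi de y0 (yc c x) = 0 /\ dcPhi de y0 (yc c x) = 0) \/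
  [/\ n5 (beta^~ x) <= 2, \sum_i dot (fun k => partial i (beta k) x) (fun k => partial i (beta k) x) <= kap0 &
  dot (u^~ x) (u^~ x) = 1 -> 4*(3*qq u beta x^+2 + Bu u beta x) +
   64/7*(dot (beta^~ x) (beta^~ x) - (1 - qq u beta x)^+2) <= K0].
 move=> Bx; have [a|a] := leP (yc c x) de; first by left; apply: out; left.
 have [a'|a'] := leP y0 (yc c x); first by left; apply: out; right.
 by right; apply: supp=> //; rewrite a.
have KL : 0 <= 168*Ktau R * lam by rewrite mulr_ge0 ?(ltW l0)// mulr_ge0 ?Ktau_ge0 ?ler0n.
have C0 : 0 <= 980 * kap0 + 168*Ktau R * lam by apply: addr_ge0 KL; apply: mulr_ge0 kap00; exact: ler0n.
have K1 : 0 <= K0 + 1 by rewrite addr_ge0.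
have [L1 ineq] := radial_ineq l0 M sP (cPhi_derive y0 de0) cd sb bdry ang supp'.
have cy : continuous (@yc R c) by apply: smooth_continuous; apply: gsm_smooth; exact: gsm_yc.
have Lc (h : R -> R) : continuous h -> Linf (fun x => h (yc c x)).
 by move=> ch; apply: Linf_continuous => x; apply: (continuous_comp (cy x)); exact: ch.
have L2 : L1B (fun x => (K0 + 1)*(yc c x*dcPhi de y0 (yc c x)^+2) + (980 * kap0 + 168*Ktau R * lam)*cPhi de y0 (yc c x)^+2).
 have Lp := Lc _ cP; have Ld := Lc _ cd; have Ly := Linf_continuous cy.
 apply: L1B_add; apply: L1B_scale; apply: Linf_L1.
  apply: Linf_mul=> //; rewrite (_ : (fun x => _) = fun x => dcPhi de y0 (yc c x)*dcPhi de y0 (yc c x)); [exact: Linf_mul|by apply/funext => x; rewrite expr2].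
 by rewrite (_ : (fun x => _) = fun x => cPhi de y0 (yc c x)*cPhi de y0 (yc c x)); [exact: Linf_mul|apply/funext => x; rewrite expr2].
have V00 : 0 <= V0 by move: hV; clear; lra.
have HV (s : R) : (s = 1 \/ s = -1) -> {ae leb, forall m : mR, {ae leb, forall y : mR, de <= y <= y0 -> (V0%:E <= vari (w 0%R) s c m y)%E}}.
 have nP : {ae leb, forall y : mR, ~ (de <= y <= y0 /\ P y)}.
  by apply: negligibleS neg => y /= /contrapT.
 move=> /HP; apply: filterS => m; apply: filterS2 nP => y nPy Hy yy; rewrite leNgt; apply/negP => h.
 by apply: nPy; split=> //; exact: Hy.
have mlam : mB (lamw (w 0) c) by apply: (mB_lamw (mn_app M 0)).
have := variation_deficit mlam cP cd de0 V00 K1 C0 ell0 out len L1 L2 ineq I1 I2 I3 HV.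
have j1 : 0 <= \int[leb]_y (y*dcPhi de y0 y^+2*sqrt y).
 apply: Rintegral_ge0 => y _; apply: mulr_ge0 (sqrtr_ge0 _).
 have [yde|yde] := leP y de; last by rewrite mulr_ge0 ?sqr_ge0// ltW// (lt_trans de0).
 by have [_ ->] := out y (or_introl yde); rewrite expr0n mulr0.
have j2 : 0 <= \int[leb]_y (cPhi de y0 y^+2*sqrt y) by apply: Rintegral_ge0 => y _; rewrite mulr_ge0 ?sqr_ge0 ?sqrtr_ge0.
have j3 : 0 <= \int[leb]_y (cPhi de y0 y^+2 / sqrt y) by apply: Rintegral_ge0 => y _; rewrite mulr_ge0 ?invr_ge0 ?sqr_ge0 ?sqrtr_ge0.
have := ler_wpM2r j1 hK; have := ler_wpM2r j2 hC; have := ler_wpM2r j3 hV; move: cut.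
move: (\int[leb]_y (y*dcPhi de y0 y^+2*sqrt y)) (\int[leb]_y (cPhi de y0 y^+2*sqrt y)) (\int[leb]_y (cPhi de y0 y^+2 / sqrt y)) => J1 J2 J3.
move: (K0 + 1) (980 * kap0 + 168*Ktau R * lam) => k1 k2.
have -> : ell*(k1*J1 + k2*J2) = ell * k1*J1 + ell * k2*J2 by ring.
have -> : 7/2*(V0*J3) = 7/2*V0*J3 by ring.
move: (ell * k1*J1) (ell * k2*J2) (7/2*V0*J3) (C*J2) => a1 a2 a3 a4; clear; lra.
Qed.

Lemma cluster_in (a b : R) (P : R -> Prop) : a <= b -> ~ leb.-negligible [set y : mR | a <= y <= b /\ P y] ->
 exists2 y, a <= y <= b & forall r, 0 < r -> ~ leb.-negligible ([set x : mR | P x] `&` [set x | `|x - y| < r]).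
Proof.
move=> ab h; have [//|y yab H] := cluster_point ab _ h; first by move=> y [].
by exists y=> // r r0 neg; apply: (H r r0); apply: negligibleS neg => x [[_ Px] xr].
Qed.

(** For beta = b of length 1 the expression is largest at u = -b, where it equals 64; a deviation of
    1/1000 per component costs less than 1. *)
Lemma near_unit_field (b beta u : 'I_5 -> R) : dot b b <= 1 -> (forall k, `|beta k - b k| <= 1000^-1) -> dot u u = 1 ->
 n5 beta <= 2 /\ 4*(3*(1 - dot u beta)^+2 + (dot beta beta - 2*dot u beta + 1)) + 64/7*(dot beta beta - dot u beta^+2) <= 65.
Proof.
move=> b1 near u1.
have bk k : beta k^+2 <= b k^+2 + 2/1000 + 1000^-1^+2.
 have : `|b k| <= 1.
  have : b k^+2 <= dot b b by rewrite /dot (bigD1 k)//= -expr2 lerDl sumr_ge0// => j _; rewrite -expr2 sqr_ge0.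
  by move=> h; rewrite ler_norml; apply/andP; split; nra.
 have := near k; rewrite !ler_norml => /andP[n1 n2] /andP[m1 m2]; nra.
have bb : dot beta beta <= 1 + 11/1000.
 apply: (@le_trans _ _ (\sum_k (b k^+2 + 2/1000 + 1000^-1^+2))).
  by apply: ler_sum => k _; rewrite -expr2.
 by rewrite !big_split /= dot_sqr !sumr_const card_ord; move: b1; lra.
have b0' := dot_ge0 beta; have n0 := n5_ge0 beta; have ns := n5_sqr beta.
have cs := dot_CS u beta; rewrite u1 mul1r in cs.
split; first by rewrite leNgt; apply/negP => h; nra.
move: (dot beta beta) (dot u beta) bb b0' cs => X D hX X0 hD.
have D1 : - D <= 1006/1000 by rewrite leNgt; apply/negP => h; nra.
have -> : 4*(3*(1 - D)^+2 + (X - 2*D + 1)) + 64/7*(X - D^+2) = 16 - 32*D + 20/7*D^+2 + 92/7*X by field.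
lra.
Qed.

Lemma dot_b0 (x : R3 R) : dot (@b0 R ^~ x) (@b0 R ^~ x) = enorm x^+2.
Proof. by rewrite /dot big_I5 sqr_enorm /b0 /=; ring. Qed.

Lemma sum_partial_le (beta : 'I_5 -> R3 R -> R) x : (forall k i, `|partial i (beta k) x| <= 2) ->
 \sum_i dot (fun k => partial i (beta k) x) (fun k => partial i (beta k) x) <= 60.
Proof.
move=> h; apply: (@le_trans _ _ (\sum_(i < 3) \sum_(k < 5) (4 : R))).
 apply: ler_sum => i _; apply: ler_sum => k _; rewrite -expr2 -real_normK ?num_real//.
 by rewrite (_ : 4 = 2^+2 :> R); [rewrite lerXn2r// nnegrE|ring].
by rewrite !sumr_const !card_ord -!mulrnA -mulr_natr; apply: lexx.
Qed.

(** Cauchy-Schwarz in the two horizontal directions. Together with [angular_ineq] it bounds 1 - t^2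
    by w times the integrable |D u|^2, the form that the anchors on the axis use. *)
Lemma axis_defect (w : 'I_5 -> 'I_3 -> R3 R -> R) (x : R3 R) :
 dot (vphi w ^~ x) (vphi w ^~ x) <= rho2 x * `|sq2 w x|.
Proof.
have s0 : 0 <= sq2 w x by apply: sumr_ge0 => i _; apply: sumr_ge0 => k _; exact: sqr_ge0.
rewrite ger0_norm// /sq2 exchange_big /= mulr_sumr; apply: ler_sum => k _.
rewrite !big_ord_recl big_ord0 -expr2 /vphi /rho2.
have -> : lift ord0 ord0 = 1 :> 'I_3 by apply/val_inj.
have -> : lift ord0 (lift ord0 ord0) = 2 :> 'I_3 by apply/val_inj.
have -> : ord0 = 0 :> 'I_3 by apply/val_inj.
move: x.1.1 x.1.2 (w k 0 x) (w k 1 x) (w k 2 x) => a b p q r.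
rewrite -subr_ge0 (_ : _ - _ = (a * p + b*q)^+2 + (a^+2 + b^+2)*r^+2); last by ring.
by apply: addr_ge0 (sqr_ge0 _) _; apply: mulr_ge0 (sqr_ge0 _); apply: addr_ge0; exact: sqr_ge0.
Qed.

Definition arc (c y : R) : set mR := [set z : mR | (0 < y - (z - c)^+2)%R && (y - (z - c)^+2 + z^+2 < 1)%R].

Lemma arc_length (c y : R) : 0 < y -> (leb (arc c y) <= (2*sqrt y)%:E)%E.
Proof.
move=> yp; set q := sqrt y; have qp : 0 < q by rewrite sqrtr_gt0.
have qE : q^+2 = y by rewrite sqr_sqrtr// ltW.
apply: (segment_length (a := c - q) (b := c + q)); [exact: measurable_arc|lra|lra|].
move=> z /andP[]; rewrite -qE => h _; apply/andP; split; rewrite leNgt; apply/negP => h'; nra.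
Qed.

(** Half of the bound for interior centres: the ball lies on one side of its tangent plane at the
    pole, so only heights on one side of the centre count. *)
Lemma arc_length_pole (ka y : R) : ka = 1 \/ ka = -1 -> 0 < y -> (leb (arc ka y) <= (1*sqrt y)%:E)%E.
Proof.
move=> kE yp; rewrite mul1r; set q := sqrt y; have qp : 0 < q by rewrite sqrtr_gt0.
have qE : q^+2 = y by rewrite sqr_sqrtr// ltW.
have H z : arc ka y z -> 1 - q <= ka*z <= 1.
 move=> /andP[]; rewrite -qE; case: kE=> -> a1 a2; apply/andP; split; rewrite leNgt; apply/negP => h; nra.
case: (kE) => ke.
 apply: (segment_length (a := 1 - q) (b := 1)); [exact: measurable_arc|lra|lra|].
 by move=> z /H; rewrite ke mul1r.
apply: (segment_length (a := -1) (b := -1 + q)); [exact: measurable_arc|lra|lra|].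
by move=> z /H; rewrite ke mulN1r => /andP[a1 a2]; apply/andP; split; lra.
Qed.

(** It makes the interior cut-offs vanish on the sphere. Their outer scale is (1 - |c|)^2 / 2, so
    that radii are strictly smaller than 1 - |c|. *)
Lemma sphere_far (c : R) (x : R3 R) : `|c| < 1 -> enorm x = 1 -> (1 - `|c|)^+2/2 <= yc c x.
Proof.
move=> c1 x1; have := sqr_enorm x; rewrite x1 expr1n => e1.
have : `|c*x.2| <= `|c| by rewrite normrM ler_piMr//; have := coord_le_enorm 2 x; rewrite x1.
rewrite ler_norml => /andP[m1 m2].
have -> : yc c x = 1 - 2*(c*x.2) + c^+2 by rewrite [X in X - _]e1 /yc; ring.
rewrite -[c^+2]real_normK ?num_real//; have := normr_ge0 c.
by move: m1 m2 c1; move: (c*x.2) `|c| => a b; clear; nra.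
Qed.

Lemma small_radius (a y : R) : 0 < a -> 0 < y -> y <= a^+2/2 -> sqrt y < a.
Proof.
move=> a0 yp a2; rewrite -(ltr_pXn2r (n := 2))// ?nnegrE ?sqrtr_ge0 ?(ltW a0)// sqr_sqrtr ?(ltW yp)//.
by apply: le_lt_trans a2 _; rewrite ltr_pdivrMr// ltr_pMr ?exprn_gt0//; lra.
Qed.

(** For ka = -1 one has de < |x + e_3|^2 < 2 (1 + x_3) inside the ball; for ka = 1 the point is
    close to the north pole. *)
Lemma away_from_south (ka de : R) (x : R3 R) : ka = 1 \/ ka = -1 -> 4*de <= 1/16 -> B x -> de < yc ka x -> yc ka x < 1/16 ->
 de/2 <= 1 + x.2.
Proof.
move=> kE d Bx; have := (B1_enorm2 x).1 Bx; rewrite sqr_enorm /yc.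
by case: kE=> ->; move: x.1.1 x.1.2 x.2 d => a b z; clear; nra.
Qed.

Lemma polar_value (ka z a : R) : ka = 1 \/ ka = -1 -> `|a - z| <= 1000^-1 -> 31/32 <= ka*z -> 15/16 <= ka*a.
Proof.
move=> kE; rewrite ler_norml => /andP[n2 n3]; case: kE=> ->; lra.
Qed.

(** The order of choices matters: the polar scale [de] depends on lam alone, [nu0] comes from
    [bnu_near] at de/2, and the interior scales depend on c and lam but not on nu. *)
Lemma equivariant_contradiction (lam : R) : 0 < lam -> exists2 nu0 : R, 0 < nu0 & forall nu f u w, 0 < nu < nu0 ->
 Min lam f u w (bnu nu) ->
 (forall t : R, aeB (fun x => forall k, u k (rt (cos t) (sin t) x) = Rv (cos t) (sin t) (u^~ x) k)) -> False.
Proof.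
move=> l0; have KL : 0 <= 168*Ktau R * lam by rewrite mulr_ge0 ?(ltW l0)// mulr_ge0 ?Ktau_ge0 ?ler0n.
pose Cc : R := 980*60 + 168*Ktau R * lam.
have C0 : 0 <= Cc by apply: addr_ge0 KL; apply: mulr_ge0; exact: ler0n.
(* The largest squared radius of polar circles: their radii stay below 1/4, and they leave the ball
   at ka z = 1 - y/2 >= 31/32. *)
have y16 : 0 < 1/16 :> R by lra.
have [de Hde] := cutoff_integrals C0 y16; have [[de0 dey] _ _ _ _] := Hde.
have e0 : 0 < (1000^-1 : R) <= 2^-1 by rewrite invr_gt0 ltr0n lef_pV2 ?posrE ?ltr0n// ler_nat.
have de2 : 0 < de/2 <= 1 by apply/andP; split; lra.
have [nu0 nu00 near] := bnu_near e0 de2; exists nu0=> // nu f u w nu1 M eq.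
have nup : 0 < nu by case/andP: nu1.
have A := mn_app M; have ang := angular_ineq A eq (mn_1 M).
have ang0 : aeB (fun x => angw (w 0) x = 0).
 by apply: aeB_mono (vphi_Lv A eq) => x _ /(_ 0).
have sym : aeB (fun x => u 0 (rt (-1) 0 x) = u 0 x).
 by have := eq pi; rewrite cospi sinpi; apply: aeB_mono => x _ /(_ 0).
have [T [mT HT]] := meridian_profile (A 0) ang0 sym.
have LG := L1_sq2 A.
have axis : aeB (fun x => 1 - u 0 x^+2 <= rho2 x * `|sq2 w x|).
 by apply: aeB_mono ang => x _ h; apply: le_trans h _; exact: axis_defect.
apply: (no_profile mT).
- move=> c c1; pose y0 := (1 - `|c|)^+2/2.
 have cc : 0 < 1 - `|c| by rewrite subr_gt0.
 have y00 : 0 < y0 by rewrite divr_gt0// exprn_gt0.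
 have C20 : 0 <= 2*(980*0 + 168*Ktau R * lam) by rewrite mulr0 add0r mulr_ge0.
 have [d Hd] := cutoff_integrals C20 y00; have [[d0 dy] _ _ _ _] := Hd.
 have sq y : d <= y <= y0 -> 0 < y /\ sqrt y < 1 - `|c|.
  by move=> /andP[a1 a2]; have yp := lt_le_trans d0 a1; split=> //; exact: small_radius.
 have [y yy cl] : exists2 y, d <= y <= y0 & clusters T 1 c y \/ clusters T (-1) c y.
  have nn : ~ leb.-negligible [set y : mR | d <= y <= y0 /\ (signc T 1 c y \/ signc T (-1) c y)].
   have [_ J1 J2 J3 cut'] := Hd.
   (* Here beta = 0, so K0 = 4 (3 + 1) = 16, and no gradient of beta appears. Arcs have up to twice
      the radius as length, and the threshold 2 corresponds to |t| = 1 at both ends: 2 * 17 <= 66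
      and 7/2 * 2 >= 13/2. *)
   apply: (@sign_set_big lam f u w (bnu nu) c 16 0 2 (2*1) _ y0 d (fun _ _ => 0)
    (fun y => signc T 1 c y \/ signc T (-1) c y) l0 M (ler0n _ _) (lexx 0) (ler0n _ _) _ _ (lexx _) d0 dy J1 J2 J3 cut' _ _ ang _ _ _);
    clear J1 J2 J3 cut'.
   - by clear; lra.
   - by clear; lra.
   - by move=> k; exact: smooth_cst.
   - move=> x x0; left; have out := sphere_far c1 (enorm_nrm x0).
    by have [] := cPhi_out d0 dy (or_intror out).
   - move=> x Bx _; have dz (a : 'I_5 -> R) : dot a (fun=> 0) = 0 by rewrite /dot big1// => k _; rewrite mulr0.
    rewrite /n5 /qq /Bu !dz sqrtr0; split; first exact: ler0n.
     by rewrite big1// => i _; rewrite /dot big1// => k _; rewrite partial_cst mul0r.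
    by move=> _; clear; lra.
   - by move=> y yy; have [yp _] := sq y yy; exact: arc_length.
   - move=> s sE; have := circle_interior (A 0) LG axis HT c sE; apply: filterS => m; apply: filterS => y Hy yy.
    by have [yp yq] := sq y yy; exact: Hy.
  have dy0 : d <= y0 by move: d0 dy; clear; lra.
  (* The union of the two sign sets is not null, hence one of them is not; that one has a cluster
     point. *)
  have [n1|n1] := pselect (leb.-negligible [set y : mR | d <= y <= y0 /\ signc T 1 c y]); last first.
   by have [y yy H] := cluster_in dy0 n1; exists y=> //; left.
  have [n2|n2] := pselect (leb.-negligible [set y : mR | d <= y <= y0 /\ signc T (-1) c y]); last first.
   by have [y yy H] := cluster_in dy0 n2; exists y=> //; right.
  by exfalso; apply: nn; apply: negligibleS (negligibleU n1 n2) => y [yy []] ?; [left|right].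
 have [yp yq] := sq y yy.
 by case: cl => cl; [exists 1|exists (-1)]; exists y; split=> //; [left|right].
move=> ka kE.
have kk : ka * ka = 1 by case: kE=> ->; rewrite ?mulrNN mulr1.
have dey0 : de <= 1/16 by move: de0 dey; clear; lra.
have nn : ~ leb.-negligible [set y : mR | de <= y <= 1/16 /\ signc T ka ka y].
 have [_ I1 I2 I3 cut] := Hde.
 have hC : 1*(980*60 + 168*Ktau R * lam) <= Cc by rewrite mul1r.
 (* Here beta extends the datum: K0 = 65 by [near_unit_field], and 60 bounds the 15 squared
    derivatives. Arcs have at most the radius as length, and the threshold is 2 * 15/16 because of
    the end on the sphere: 65 + 1 <= 66 and 7/2 * 15/8 = 105/16 >= 13/2. *)
 apply: (@sign_set_big lam f u w (bnu nu) ka 65 60 1 (2*(15/16)) Cc (1/16) de (bnu nu) (fun y => signc T ka ka y)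
  l0 M (ler0n _ _) (ler0n _ _) ler01 _ _ hC de0 dey I1 I2 I3 cut _ _ ang _ _ _); clear I1 I2 I3 cut hC.
 - by clear; lra.
 - by clear; lra.
 - by move=> k; apply: gsm_smooth; exact: gsm_bnu.
 - by move=> x x0; right.
 - move=> x Bx /andP[h1 h2]; have x1 := B1_cl_ball Bx.
  have px := away_from_south kE dey Bx h1 h2.
  have [n1 n2] := near nu x nu1 x1 px.
  have b1 : dot (@b0 R ^~ x) (@b0 R ^~ x) <= 1 by rewrite dot_b0 exprn_ile1 ?enorm_ge0.
  split; [|exact: sum_partial_le|].
   have [u5 u51] : exists u5 : 'I_5 -> R, dot u5 u5 = 1.
    by exists (fun k => (k == 0)%:R); rewrite /dot big_I5 /= !mulr0 mulr1 !addr0.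
   by have [] := near_unit_field b1 n1 u51.
  move=> u1; have [_] := near_unit_field b1 n1 u1; rewrite /qq /Bu.
  by rewrite subKr.
 - by move=> y /andP[y1 y2]; apply: arc_length_pole=> //; exact: lt_le_trans y1.
 - move=> s sE; apply: (circle_cap (A 0) LG axis HT de0 sE kE) => m z /andP[z1 z2] /andP[k1 k2].
  have s2 := sgn_sqr sE.
  have zz : 0 <= 1 - z^+2 by move: z1 z2; clear; nra.
  have xc : cl_ball (spt s m (1 - z^+2) z).
   by rewrite /cl_ball /= -(ler_pXn2r (n := 2))// ?nnegrE ?enorm_ge0// sqr_enorm_spt// subrK expr1n.
  have px : de/2 <= 1 + (spt s m (1 - z^+2) z).2.
   by move: k1 k2 dey0; rewrite /=; case: (kE)=> ->; clear; lra.
  have [n1 _] := near nu _ nu1 xc px; exact: polar_value kE (n1 0) k1.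
have [y /andP[y1 y2] H] := cluster_in dey0 nn; exists y; split=> //; first exact: lt_le_trans y1.
have -> : 1/4 = sqrt ((1/4)^+2) :> R by rewrite sqrtr_sqr ger0_norm//; lra.
by apply: ler_wsqrtr; move: y2; clear; lra.
Qed.
End SignSets.

Local Open Scope complex_scope.
Local Open Scope ring_scope.

(** * Application to the boundary data *)

Section BoundaryValues.
Variable R : realType.
Local Notation B := (@B1 R).
Variable nu : R.
Hypothesis nu0 : 0 < nu.

Lemma Qmu_nrm (x : R3 R) : enorm x != 0 -> Qmu 1 nu%:C%C (nrm x) = Mv (fun k => bnu nu k (nrm x)).
Proof. by move=> x0; rewrite Qmu_bnu// enorm_nrm. Qed.

Lemma bnu_unit (x : R3 R) : enorm x = 1 -> \sum_k bnu nu k x^+2 = 1.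
Proof.
move=> x1; have := sqr_enorm x; rewrite x1 expr1n => e.
have D0 := lt0r_neq0 (bD_gt0 x nu0).
pose p := 1 + x.2; pose m := 1 - x.2.
have N (k : 'I_5) : bnu nu k x = [:: 2 * p^+2*x.2 - nu^+2 * m^+2*(p - m/9);
  x.1.1*(2 * p^+2 - 2/3 * nu^+2 * m^+2); x.1.2*(2 * p^+2 - 2/3 * nu^+2 * m^+2);
  2 * nu*(x.1.1^+2 - x.1.2^+2)*(p + m/3); 4 * nu*x.1.1*x.1.2*(p + m/3)]`_k / bD nu x.
 apply: (mulIf D0); rewrite divfK// /bnu mulrDl divfK// /b0 /ba /bb /bD /p /m; move: (bE x) => E.
 by move: k; apply: I5_case; rewrite /=; field.
have S : (2 * p^+2*x.2 - nu^+2 * m^+2*(p - m/9))^+2 + (x.1.1*(2 * p^+2 - 2/3 * nu^+2 * m^+2))^+2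
 + (x.1.2*(2 * p^+2 - 2/3 * nu^+2 * m^+2))^+2 + (2 * nu*(x.1.1^+2 - x.1.2^+2)*(p + m/3))^+2
 + (4 * nu*x.1.1*x.1.2*(p + m/3))^+2 = bD nu x^+2.
 have r : rho2 x = 1 - x.2^+2 by rewrite /rho2 [in RHS]e; ring.
 rewrite /bD /bE r -/p -/m.
 transitivity ((2 * p^+2*x.2 - nu^+2 * m^+2*(p - m/9))^+2 + rho2 x*(2 * p^+2 - 2/3 * nu^+2 * m^+2)^+2
  + 4 * nu^+2*rho2 x^+2*(p + m/3)^+2); first by rewrite /rho2; ring.
 by rewrite r /p /m; field.
by rewrite big_I5 !N /= !expr_div_n -!mulrDl S divff// expf_neq0.
Qed.

Lemma bnu_nrm_unit (x : R3 R) : enorm x != 0 -> \sum_k bnu nu k (nrm x)^+2 = 1.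
Proof. by move=> x0; rewrite bnu_unit// enorm_nrm. Qed.

Lemma measurable_bnu k : mfun (bnu nu k).
Proof. by apply: continuous_measurable_R3; apply: smooth_continuous; apply: gsm_smooth; exact: gsm_bnu. Qed.

Lemma mB_bnu_nrm k : mB (fun x => bnu nu k (nrm x)).
Proof. exact: mB_nrm (measurable_bnu k). Qed.

Lemma mB_Mv (v : 'I_5 -> R3 R -> R) i j : (forall k, mB (v k)) -> mB (fun x => Mv (v^~ x) i j).
Proof.
move=> mv; rewrite (_ : (fun x => _) = fun x => \sum_k ebasis R k i j * v k x); last by apply/funext => x; rewrite Mv_ij.
by apply: mB_sum => k; apply: mB_mul=> //; exact: measurable_cst.
Qed.

(** [nrm] sends the origin to itself, off the sphere, since 0 is its own inverse by convention; this
    point is separated before [Qmu] is replaced by [bnu]. *)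
Lemma mB_Qmu_nrm i j : mB (fun x => Qmu 1 nu%:C%C (nrm x) i j).
Proof.
rewrite (_ : (fun x => _) = fun x => if enorm x == 0 then Qmu 1 nu%:C%C (0 : R3 R) i j else Mv (fun k => bnu nu k (nrm x)) i j); last first.
 apply/funext => x; case: ifPn=> [/eqP x0|x0]; last by rewrite Qmu_nrm.
 by rewrite /nrm x0 invr0 scale0r.
apply: measurable_funTS; apply: measurable_fun_ifT.
- by apply: measurable_fun_eqr=> //; apply: continuous_measurable_R3; exact: enorm_continuous.
- exact: measurable_cst.
rewrite (_ : (fun x => _) = fun x => \sum_k ebasis R k i j*bnu nu k (nrm x)); last by apply/funext => x; rewrite Mv_ij.
apply: measurable_sum => k; apply: measurable_funM=> //.
by apply: (measurableT_comp (measurable_bnu k)); exact: measurable_nrm.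
Qed.

Lemma Min_of_minimizer (lam : R) (Q : R3 R -> 'M[R]_3) : minimizer lam (Qmu 1 nu%:C%C) Q ->
 exists f v w, aeB (fun x => Q x = Mv (fun k => v k x)) /\ Min lam f v w (bnu nu).
Proof.
case=> adm mn.
have [f [v [w [A QE v1 vw EQ]]]] := app_of_adm lam adm Qmu_nrm bnu_nrm_unit mB_bnu_nrm mB_Qmu_nrm.
exists f, v, w; split=> //; split=> //.
 by move=> x x0; exact: bnu_nrm_unit.
move=> f' v' w' c' A' v1' cE.
have v1s : aeB (fun x => \sum_k v' k x^+2 = 1) by apply: aeB_mono v1' => x _; rewrite dot_sqr.
have bE x : enorm x != 0 -> Qmu 1 nu%:C%C (nrm x) = Mv (fun k => c' k (nrm x)).
 by move=> x0; rewrite Qmu_nrm//; congr Mv; apply/funext => k; rewrite cE.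
have := mn _ (adm_of_app A' v1s bE mB_Qmu_nrm).
rewrite EQ (energy_app lam A')//; last exact: aeB_all.
by move=> i j; apply: mB_Mv => k; exact: (af_m (A' k)).
Qed.

Lemma equivariant_coords (Q : R3 R -> 'M[R]_3) (v : 'I_5 -> R3 R -> R) : aeB (fun x => Q x = Mv (fun k => v k x)) -> equivariant Q ->
 forall t : R, aeB (fun x => forall k, v k (rt (cos t) (sin t) x) = Rv (cos t) (sin t) (v^~ x) k).
Proof.
move=> QE eqQ t; have cs := cos2sin2 t.
have E1 : aeB (fun x => Q (act (rotz t) x) = rotz t *m Q x *m (rotz t)^T) by apply: eqQ; exists t.
have E2 := aeB_rt cs QE.
apply: aeB_mono (aeB_and E1 (aeB_and QE E2)) => x _ [e1 [e2 e3]] k.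
have : Mv (fun k => v k (rt (cos t) (sin t) x)) = Mv (Rv (cos t) (sin t) (v^~ x)).
 by rewrite -e3 -(act_rmx (cos t) (sin t) x) -rotzE e1 e2 rotzE rmx_Mv.
by move=> /(congr1 (fun M => coords M k)); rewrite !coords_Mv.
Qed.

Lemma minimizer_S1 (lam : R) Q A : S1 A -> minimizer lam (Qmu 1 nu%:C%C) Q ->
 minimizer lam (Qmu 1 nu%:C%C) (fun x => A *m Q (act A^T x) *m A^T).
Proof.
move=> [t _ <-] mn; have cs := cos2sin2 t.
have := minimizer_rot Qmu_nrm bnu_nrm_unit mB_bnu_nrm mB_Qmu_nrm (fun C S x k => @bnu_rt R nu C S x k) cs mn.
rewrite rotzE (_ : (fun x => _ *m Q (rt _ _ x) *m _) = fun x => rmx (cos t) (sin t) *m Q (act (rmx (cos t) (sin t))^T x) *m (rmx (cos t) (sin t))^T)//.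
by apply/funext => x; rewrite rmx_tr act_rmx.
Qed.
End BoundaryValues.

Theorem corollary7p15 (R : realType) (lambda : R) (nu : nat -> R)
    (Q : nat -> R3 R -> 'M[R]_3)
    (lambda_gt0 : 0 < lambda)
    (nu_gt0 : forall j, 0 < nu j)
    (nu_noninc : nonincreasing_seq nu)
    (nu_cvg0 : nu j @[j --> \oo] --> 0)
    (Q_min : forall j, minimizer lambda (Qmu 1 (nu j)%:C) (Q j)) :
  \forall j \near \oo,
    [/\ (admissible (Qmu 1 (nu j)%:C) `\` admissible_sym (Qmu 1 (nu j)%:C))
          (Q j),
        forall A, S1 A ->
          minimizer lambda (Qmu 1 (nu j)%:C)
            (fun x => A *m Q j (act A^T x) *m A^T) &
        exists Q', minimizer lambda (Qmu 1 (nu j)%:C) Q' /\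
          ~ {ae vol R, forall x, B1 x -> Q' x = Q j x}].
Proof.
have [nu1 nu10 contra] := equivariant_contradiction lambda_gt0.
have small : \forall j \near \oo, nu j < nu1 by exact: (cvgr_lt _ nu_cvg0 _ nu10).
apply: filterS small => j nuj; have n0 := nu_gt0 j; have mn := Q_min j.
have neq : ~ equivariant (Q j).
 move=> eqQ; have [f [v [w [QE M]]]] := Min_of_minimizer n0 mn.
 apply: (contra (nu j) f v w _ M); first by rewrite n0.
 exact: equivariant_coords QE eqQ.
split.
- by split; [case: mn|case].
- by move=> A SA; exact: minimizer_S1.
(* Failure of equivariance singles out one rotation. The minimizer turned back by it cannot agree
   almost everywhere with the original one, which gives the second minimizer. *)
have [t nt] : exists t : R, ~ {ae vol R, forall x, B1 x -> Q j (act (rotz t) x) = rotz t *m Q j x *m (rotz t)^T}.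
 by apply: contrapT => h; apply: neq => _ [t _ <-]; apply: contrapT => nt; apply: h; exists t.
have cs := cos2sin2 t.
have tr : (rotz t)^T = rotz (- t) :> 'M[R]_3 by rewrite !rotzE rmx_tr cosN sinN.
have rr : rotz t *m (rotz t)^T = 1%:M :> 'M[R]_3 by rewrite rotzE rmx_tr rmx_mul.
have rr' : (rotz t)^T *m rotz t = 1%:M :> 'M[R]_3 by exact: mulmx1C.
have S1t : S1 (rotz t)^T by rewrite tr; exists (- t).
exists (fun x => (rotz t)^T *m Q j (act (rotz t)^T^T x) *m (rotz t)^T^T); split; first exact: minimizer_S1.
move=> h; apply: nt; apply: filterS h => x h Bx; rewrite -(h Bx) trmxK !mulmxA rr mul1mx -mulmxA rr mulmx1.
by [].
Qed.
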